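(* Let $H\in(\frac12,1)$, let $B=\{B_t,t\in[0,1]\}$ be a fractional Brownian motion with Hurst parameter $H$, and for $n\ge1$ let $Z_n=\delta(u_n)$, where $u_n(t)=n^Ht^nB_t$, $t\in[0,1]$, and $\delta$ is the Skorohod (divergence) integral with respect to $B$. Let $c_H=\sqrt{H\Gamma(2H)}$ and let $\zeta\sim N(0,1)$ be independent of $B$. Then for every $f\in C^3_b(\mathbb R)$, $$E[f(Z_n)]=E\big[f(c_H|B_1|\zeta)\big]+n^{H-1}E\big[c_H^2H\,B_1^2\,f^{(3)}(c_H|B_1|\zeta)\big]+o(n^{H-1})\qquad(n\to\infty).$$
   Context: $B$ is the centered Gaussian process with covariance $E[B_sB_t]=\frac12(t^{2H}+s^{2H}-|t-s|^{2H})$. $\mathfrak H$ is the Hilbert space obtained by completing step functions on $[0,1]$ under $\langle\mathbf 1_{[0,t]},\mathbf 1_{[0,s]}\rangle_{\mathfrak H}=E[B_sB_t]$; $B$ extends to an isonormal Gaussian process on $\mathfrak H$, and $\delta$ is the adjoint of its Malliavin derivative. $C_b^3(\mathbb R)$ is the space of functions with bounded continuous derivatives up to order 3. *)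

(* Defs.v *)
From HB Require Import structures.
From mathcomp Require Import all_boot all_order all_algebra sesquilinear.
From mathcomp Require Import all_classical all_reals all_analysis.

Set Implicit Arguments.
Unset Strict Implicit.
Unset Printing Implicit Defensive.

Import Order.TTheory GRing.Theory Num.Theory numFieldNormedType.Exports.

Local Open Scope classical_set_scope.
Local Open Scope ring_scope.

Definition Gamma {R : realType} (x : R) : R :=
  \int[lebesgue_measure]_(t in `]0%R, +oo[) (t `^ (x - 1) * expR (- t)).

(* Bounds are required of f', f'' and f''' only, so that both usual readings
   of C_b^3 (f itself bounded or not) are covered. *)
Definition Cb3 {R : realType} (f : R -> R) : Prop :=
  [/\ forall k x, (k < 3)%N -> derivable (derive1n k f) x 1,
      forall k, (k <= 3)%N -> continuous (derive1n k f)
    & forall k, (0 < k <= 3)%N ->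
        exists M : R, forall x, `|derive1n k f x| <= M].

Section gaussian.
Context {d} {T : measurableType d} {R : realType} (P : probability T R).

(* Degenerate laws have to be listed apart: normal_prob m 0 is not a Dirac mass
   (it is the uniform law on [0, 1]). *)
Definition gaussian (X : T -> R) : Prop :=
  (exists m s : R, s != 0 /\
     forall A, measurable A -> P (X @^-1` A) = normal_prob m s A) \/
  (exists m : R, {ae P, forall w, X w = m}).

Definition gaussian_family {I : Type} (D : set I) (X : I -> T -> R) : Prop :=
  forall (n : nat) (a : 'I_n -> R) (t : 'I_n -> I), (forall i, D (t i)) ->
    gaussian (fun w => \sum_(i < n) a i * X (t i) w).

Definition sigma_of {I : Type} (D : set I) (X : I -> T -> R) : set (set T) :=
  <<s [set C | exists i (A : set R),
         [/\ D i, measurable A & C = X i @^-1` A]] >>.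

Definition independent_of {I : Type} (D : set I) (X : I -> T -> R)
    (Y : T -> R) : Prop :=
  forall A C, measurable A -> sigma_of D X C ->
    P (Y @^-1` A `&` C) = (P (Y @^-1` A) * P C)%E.

End gaussian.

Definition fbm_cov {R : realType} (H s t : R) : R :=
  2^-1 * (t `^ (2 * H) + s `^ (2 * H) - `|t - s| `^ (2 * H)).

(* As usual, fractional Brownian motion is taken with continuous paths, so that
   t |-> n^H t^n B_t is pathwise an admissible integrand. *)
Definition fbm {d} {T : measurableType d} {R : realType}
    (P : probability T R) (H : R) (B : R -> {RV P >-> R}) : Prop :=
  [/\ gaussian_family P `[0%R, 1%R]%classic B,
      forall t : R, t \in `[0, 1] -> ('E_P[B t] = 0)%E,
      forall s t : R, s \in `[0, 1] -> t \in `[0, 1] ->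
        ('E_P[(fun w => B s w * B t w)%R] = (fbm_cov H s t)%:E)%E
    & forall w, {within `[0, 1], continuous (fun t => B t w)}].

Section step_completion.
Context {R : realType} (H : R).

(* A list of pairs (a, t) stands for the step function that is the sum of the
   a 1_[0, t]. *)
Definition step_on01 (s : seq (R * R)) : bool :=
  all (fun p => p.2 \in `[0, 1]) s.

Definition step_fun (s : seq (R * R)) (r : R) : R :=
  \sum_(p <- s) p.1 * \1_`[0, p.2] r.

Context {V : completeNormedModType R} (ip : {dot V for idfun}) (ind : R -> V).

Definition step_vec (s : seq (R * R)) : V := \sum_(p <- s) p.1 *: ind p.2.

(* V, with ind t the class of 1_[0, t], is a Hilbert completion of the step
   functions on [0, 1]; this determines (V, ind) up to a unique isometry. *)
Definition step_completion : Prop :=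
  [/\ forall v, ip v v = `|v| ^+ 2,
      forall s t : R, s \in `[0, 1] -> t \in `[0, 1] ->
        ip (ind s) (ind t) = fbm_cov H s t
    & closure [set step_vec s | s in [set s | step_on01 s]] = setT].

(* Square of the norm of the Banach space |V| of functions phi on [0, 1] such
   that H(2H-1) \int\int |phi r| |phi s| |r - s|^(2H-2) dr ds < oo. For H > 1/2,
   step functions are dense in |V|, and this norm dominates that of V. *)
Definition abs_norm2 (phi : R -> R) : \bar R :=
  ((H * (2 * H - 1))%:E *
   \int[lebesgue_measure]_(r in `[0%R, 1%R])
     \int[lebesgue_measure]_(s in `[0%R, 1%R])
       (`|phi r| * `|phi s| * `|r - s| `^ (2 * H - 2))%:E)%E.

(* The inclusion of |V| in V is the continuous extension of
   step_fun s |-> step_vec s. *)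
Definition is_class (phi : R -> R) (v : V) : Prop :=
  measurable_fun (`[0, 1]%classic : set R) phi /\
  exists s : nat -> seq (R * R),
    [/\ forall k, step_on01 (s k),
        abs_norm2 (phi \- step_fun (s k)) @[k --> \oo] --> 0%E
      & step_vec (s k) @[k --> \oo] --> v].

Definition class (phi : R -> R) : V := xget 0 (is_class phi).

End step_completion.

Section malliavin.
Context {d} {T : measurableType d} {R : realType} (P : probability T R).
Context {V : completeNormedModType R} (ip : {dot V for idfun}).
Context (W : V -> {RV P >-> R}).

Definition isonormal : Prop :=
  [/\ gaussian_family P setT W,
      forall h, ('E_P[W h] = 0)%E
    & forall g h, ('E_P[(fun w => W g w * W h w)%R] = (ip g h)%:E)%E].

(* D and its adjoint act on L^2(T, sigma(W), P) and L^2(T, sigma(W), P; V). The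
   sigma-algebra of T may be larger than sigma(W) (it may carry a variable
   independent of W), hence the explicit measurability conditions; for V-valued
   variables weak measurability is enough when V is separable. *)
Definition W_measurable (X : T -> R) : Prop :=
  forall A, measurable A -> sigma_of setT W (X @^-1` A).

Definition L2W (X : T -> R) : Prop := X \in Lfun P 2%:E /\ W_measurable X.

Definition L2WV (u : T -> V) : Prop :=
  (forall h, W_measurable (fun w => ip (u w) h)) /\
  (\int[P]_w (`|u w| ^+ 2)%:E < +oo)%E.

Definition partial {m} (i : 'I_m) (g : 'rV[R]_m -> R) : 'rV[R]_m -> R :=
  fun x => 'D_(delta_mx 0 i) g x.

Definition smooth_poly_growth {m} (g : 'rV[R]_m -> R) : Prop :=
  forall s : seq 'I_m, let dg := foldr partial g s in
    (forall x, differentiable dg x) /\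
    exists (C : R) (N : nat), forall x, `|dg x| <= C * (1 + `|x|) ^+ N.

Definition cylindrical_derivative (F : T -> R) (DF : T -> V) : Prop :=
  exists (m : nat) (h : 'I_m -> V) (g : 'rV[R]_m -> R),
    let X w : 'rV[R]_m := \row_i W (h i) w in
    [/\ smooth_poly_growth g, F = (fun w => g (X w))
      & DF = (fun w => \sum_(i < m) partial i g (X w) *: h i)].

(* F belongs to D^{1,2} and DF is its Malliavin derivative: closure in
   L^2 x L^2(V) of the derivative of cylindrical functionals. *)
Definition malliavin_derivative (F : T -> R) (DF : T -> V) : Prop :=
  [/\ L2W F, L2WV DF
    & exists (F_ : nat -> T -> R) (DF_ : nat -> T -> V),
      [/\ forall k, cylindrical_derivative (F_ k) (DF_ k),
          (\int[P]_w (`|F_ k w - F w| ^+ 2)%:E)%E @[k --> \oo] --> 0%E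
        & (\int[P]_w (`|DF_ k w - DF w| ^+ 2)%:E)%E @[k --> \oo] --> 0%E]].

(* u belongs to Dom(delta) iff such a Z exists; Z is then unique up to a.e.
   equality. *)
Definition is_divergence (u : T -> V) (Z : T -> R) : Prop :=
  [/\ L2WV u, L2W Z
    & forall F DF, malliavin_derivative F DF ->
        ('E_P[(fun w => F w * Z w)%R] = 'E_P[(fun w => ip (DF w) (u w))%R])%E].

(* A version of delta(u); the zero function outside Dom(delta). *)
Definition divergence (u : T -> V) : T -> R := xget (cst 0) (is_divergence u).

End malliavin.

(* Main.v *)
(** Write [phi t = n^H t^n] and [b = B_1], and let [v] be the class of [phi], so
    that [W v] is Gaussian. Summation by parts in the discretised divergence of
    [phi B] gives
      [Z_n = b * W v - <1_[0, 1], v> + R_n],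
    where [E|R_n|] is at most the integral of [(1 - t)^(2H)] with respect to [phi],
    which is [O(n^(-H)) = o(n^(H - 1))]. Let [rho] be the covariance of [b] and
    [W v], and split [W v = rho b + s eta] with [eta ~ N(0, 1)] independent of [b].
    Then [Z_n = s b eta + rho (b^2 - 1) + R_n], and Taylor's formula gives
      [E f(Z_n) = E f(s b eta) + rho E[(b^2 - 1) f'(s b eta)] + O(rho^2 + E|R_n|)].
    Two integrations by parts in [b] turn the second expectation into
    [s^2 E[eta^2 f'''(s b eta)]], in which [b] and [eta] may be exchanged.
    It remains to see that [rho ~ H n^(H - 1)] and [s^2 = c_H^2 + O(1/n + rho^2)]:
    the double integral in [|v|^2] reduces to a Beta integral by self-similarity,
    and [n^(2H)] times the latter tends to a value of Gamma at speed [1/n], because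
    [0 <= e^(-x) - (1 - x/n)^n <= e^(-x) x^2 / n]. That this [Z_n] is the divergence
    follows from Gaussian integration by parts for the Riemann sums, passage to the
    limit in L^2, and the fact that trigonometric cylindrical variables separate the
    integrable variables measurable with respect to W. *)

From HB Require Import structures.
Require Import Defs.
From mathcomp Require Import all_boot all_order all_algebra sesquilinear ring lra.
From mathcomp Require Import all_classical all_reals all_analysis.
From mathcomp Require Import measurable_realfun.

Import Order.TTheory GRing.Theory Num.Theory numFieldNormedType.Exports.

Set Implicit Arguments.
Unset Strict Implicit.
Unset Printing Implicit Defensive.

Local Open Scope classical_set_scope.
Local Open Scope ring_scope.

(** * Expectations of real random variables *)

(** The measure [d phi] concentrates at t = 1, so freezing B at b = B_1 costs little: (b - B) dB is,
    up to quadratic variation, minus half the differential of (b - B)^2, and R_n becomes, up to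
    sign, half the integral of (b - B_t)^2 - (1 - t)^(2H) against [phi]. Two obstacles shape the
    proof. [divergence] and [class] are choices among the solutions of a characterisation, so each
    needs existence with an explicit candidate and uniqueness; for the divergence the candidate is
    the pathwise limit [Zlim]. And V-valued variables are only weakly measurable, so the integral of
    a squared norm has to be treated as a lower integral. Integrals in time are limits of sums over
    uniform grids. The covariances of grid increments are nonnegative with total mass 1, hence act
    as probability weights; the kernel |r - s|^(2H - 2) serves only to identify [class]. Against the
    rate n^(H - 1), the errors n^(-H), n^(2H - 2) and 1/n are negligible because H > 1/2, H < 1 and
    H > 0 respectively. *)

Notation Ex P X := (Rintegral P setT X).

Section real_expectation.
Context {d} {T : measurableType d} {R : realType} (P : probability T R).
Implicit Types (X Y Z G : T -> R).

Definition itg X := P.-integrable setT (EFin \o X).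

Lemma itg_meas X : itg X -> measurable_fun setT X.
Proof. by move=> /measurable_int/measurable_EFinP. Qed.

Lemma itgD X Y : itg X -> itg Y -> itg (fun w => X w + Y w).
Proof. by move=> iX iY; have := @integrableD _ _ _ P setT measurableT _ _ iX iY. Qed.

Lemma itgZ (k : R) X : itg X -> itg (fun w => k * X w).
Proof. by move=> iX; have := @integrableZl _ _ _ P setT measurableT k _ iX. Qed.

Lemma itgN X : itg X -> itg (fun w => - X w).
Proof. by move=> iX; have := @integrableN _ _ _ P setT _ iX. Qed.

Lemma itgB X Y : itg X -> itg Y -> itg (fun w => X w - Y w).
Proof. by move=> iX iY; apply: itgD => //; exact: itgN. Qed.

Lemma itg_le X Y : measurable_fun setT X -> itg Y ->
  (forall w, `|X w| <= Y w) -> itg X.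
Proof.
move=> mX iY XY; apply: (@le_integrable _ _ _ P setT measurableT _ (EFin \o Y)) => //.
  exact/measurable_EFinP.
by move=> w _ /=; rewrite lee_fin (le_trans (XY w))// ler_norm.
Qed.

Lemma itg_norm X : itg X -> itg (fun w => `|X w|).
Proof. by move=> iX; have := @integrable_norm _ _ _ P setT _ iX. Qed.

Lemma itg_cst (k : R) : itg (fun=> k).
Proof. exact: finite_measure_integrable_cst. Qed.

Lemma itg_bounded X (M : R) : measurable_fun setT X ->
  (forall w, `|X w| <= M) -> itg X.
Proof. by move=> mX XM; apply: itg_le (itg_cst M) _. Qed.

Lemma itg_sum (I : Type) (s : seq I) (X : I -> T -> R) :
  (forall i, itg (X i)) -> itg (fun w => \sum_(i <- s) X i w).
Proof.
move=> iX; elim: s => [|i s IH].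
  by under eq_fun do rewrite big_nil; exact: itg_cst.
by under eq_fun do rewrite big_cons; apply: itgD.
Qed.

Lemma eqEx X Y : X =1 Y -> Ex P X = Ex P Y.
Proof. by move=> /funext ->. Qed.

Lemma ExD X Y : itg X -> itg Y -> Ex P (fun w => X w + Y w) = Ex P X + Ex P Y.
Proof. by move=> iX iY; rewrite RintegralD. Qed.

Lemma ExB X Y : itg X -> itg Y -> Ex P (fun w => X w - Y w) = Ex P X - Ex P Y.
Proof. by move=> iX iY; rewrite RintegralB. Qed.

Lemma ExZ (k : R) X : itg X -> Ex P (fun w => k * X w) = k * Ex P X.
Proof. by move=> iX; rewrite RintegralZl. Qed.

Lemma ExN X : itg X -> Ex P (fun w => - X w) = - Ex P X.
Proof.
by move=> iX; rewrite -mulN1r -ExZ//; apply: eqEx => w; rewrite mulN1r.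
Qed.

Lemma Ex_cst (k : R) : Ex P (fun=> k) = k.
Proof.
rewrite (@Rintegral_cst _ _ _ P setT measurableT k).
have -> : fine (P setT) = 1 by have /= -> := @probability_setT _ _ _ P.
by rewrite mulr1.
Qed.

Lemma Ex_sum (I : Type) (s : seq I) (X : I -> T -> R) :
  (forall i, itg (X i)) ->
  Ex P (fun w => \sum_(i <- s) X i w) = \sum_(i <- s) Ex P (X i).
Proof.
move=> iX; elim: s => [|i s IH].
  by rewrite big_nil -[RHS](Ex_cst 0); apply: eqEx => w; rewrite big_nil.
rewrite big_cons -IH -ExD//; last exact: itg_sum.
by apply: eqEx => w; rewrite big_cons.
Qed.

Lemma Ex_le X Y : itg X -> itg Y -> (forall w, X w <= Y w) -> Ex P X <= Ex P Y.
Proof. by move=> iX iY XY; apply: le_Rintegral. Qed.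

Lemma Ex_ge0 X : (forall w, 0 <= X w) -> 0 <= Ex P X.
Proof. by move=> X0; apply: Rintegral_ge0. Qed.

Lemma Ex_norm X : itg X -> `|Ex P X| <= Ex P (fun w => `|X w|).
Proof. by move=> iX; apply: le_normr_Rintegral. Qed.

Lemma EFin_Ex X : itg X -> (Ex P X)%:E = (\int[P]_w (X w)%:E)%E.
Proof. by move=> iX; rewrite fineK//; apply: integrable_fin_num. Qed.

Lemma ge0_itg X (M : R) : measurable_fun setT X -> (forall w, 0 <= X w) ->
  (\int[P]_w (X w)%:E <= M%:E)%E -> itg X /\ Ex P X <= M.
Proof.
move=> mX X0 XM.
have iX : itg X.
  apply/integrableP; split; first exact/measurable_EFinP.
  under eq_integral do rewrite /= ger0_norm//.
  by rewrite (le_lt_trans XM)// ltry.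
by split=> //; rewrite -lee_fin EFin_Ex.
Qed.

Lemma dct (X_ : nat -> T -> R) X G :
  (forall k, measurable_fun setT (X_ k)) -> itg G ->
  (forall k w, `|X_ k w| <= G w) ->
  (forall w, X_ ^~ w @ \oo --> X w) ->
  measurable_fun setT X /\ itg X /\ Ex P (X_ k) @[k --> \oo] --> Ex P X.
Proof.
move=> mX iG XG Xc.
have mXl : measurable_fun setT X.
  by apply: (measurable_fun_cvg mX) => w _; exact: Xc.
have XG' w : `|X w| <= G w.
  have c : `|X_ k w| @[k --> \oo] --> `|X w| by apply: cvg_norm; exact: Xc.
  rewrite -(cvg_lim (@Rhausdorff R) c); apply: limr_le; last by apply: nearW.
  by apply/cvg_ex; exists `|X w|.
have iX : itg X by apply: itg_le iG _.
split=> //; split=> //.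
have [|||||_ _ H] := @dominated_convergence _ _ _ P setT measurableT
  (fun k => EFin \o X_ k) (EFin \o X) (EFin \o G).
- by move=> k; exact/measurable_EFinP.
- exact/measurable_EFinP.
- by apply: aeW => w _; apply: cvg_EFin; [exact: nearW|exact: Xc].
- exact: iG.
- by apply: aeW => w k _ /=; rewrite lee_fin.
apply: fine_cvg.
rewrite [X in _ --> X]fineK; last exact: integrable_fin_num.
exact: H.
Qed.

Lemma fatou_Ex (X_ : nat -> T -> R) X (M : R) :
  (forall k, itg (X_ k)) -> (forall k w, 0 <= X_ k w) ->
  (forall w, X_ ^~ w @ \oo --> X w) ->
  (\forall k \near \oo, Ex P (X_ k) <= M) ->
  itg X /\ Ex P X <= M.
Proof.
move=> iX X0 Xc XM.
have mX k : measurable_fun setT (X_ k) by apply: itg_meas.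
have mXl : measurable_fun setT X.
  by apply: (measurable_fun_cvg mX) => w _; exact: Xc.
apply: ge0_itg => //.
  move=> w; rewrite -(cvg_lim (@Rhausdorff R) (Xc w)).
  by apply: limr_ge; [apply/cvg_ex; eexists; exact: Xc | apply: nearW].
have := @fatou _ _ _ P setT measurableT (fun k => EFin \o X_ k).
move=> /(_ (fun k => (proj2 (measurable_EFinP setT (X_ k))) (mX k))).
move=> /(_ _)/le_trans => H.
have -> : (\int[P]_w (X w)%:E = \int[P]_w limn_einf (fun k => (EFin \o X_ k) w))%E.
  apply: eq_integral => w _.
  have : ((X_ k w)%:E @[k --> \oo] --> (X w)%:E)%E.
    by apply: cvg_EFin; [exact: nearW|exact: Xc].
  by move=> /cvg_limn_einf_sup[->].
apply: H => [k w _|]; first by rewrite lee_fin.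
case: XM => N _ XM.
rewrite limn_einf_lim; apply: lime_le; first exact: is_cvg_einfs.
apply: nearW => k; rewrite /einfs.
(* The infimum over indices at least k is bounded by its term of index k + N, which lies in the
   range where the bound [M] holds. *)
apply: (@le_trans _ _ (\int[P]_w (X_ (k + N)%N w)%:E)%E).
  apply: ereal_inf_lbound => /=; exists (k + N)%N => //=.
  by rewrite leq_addr.
by rewrite -EFin_Ex// lee_fin; apply: XM; rewrite /= leq_addl.
Qed.

Definition L2 X := measurable_fun setT X /\ itg (fun w => X w ^+ 2).

Lemma L2_mul X Y : L2 X -> L2 Y -> itg (fun w => X w * Y w).
Proof.
move=> [mX iX] [mY iY].
apply: (itg_le (Y := fun w => X w ^+ 2 + Y w ^+ 2)).
- exact: measurable_funM.
- exact: itgD.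
move=> w; rewrite normrM.
have := sqr_ge0 (`|X w| - `|Y w|); have := sqr_ge0 (`|X w| + `|Y w|).
rewrite -(real_normK (num_real (X w))) -(real_normK (num_real (Y w))).
move: `|X w| `|Y w| => a b; nra.
Qed.

Lemma L2D X Y : L2 X -> L2 Y -> L2 (fun w => X w + Y w).
Proof.
move=> lX lY; split; first by apply: measurable_funD; [apply: lX.1|apply: lY.1].
have -> : (fun w => (X w + Y w) ^+ 2) =
    (fun w => (X w ^+ 2 + 2 * (X w * Y w)) + Y w ^+ 2).
  by apply/funext => w; ring.
by apply: itgD; [apply: itgD; [apply: lX.2|apply/itgZ/L2_mul]|apply: lY.2].
Qed.

Lemma L2Z (k : R) X : L2 X -> L2 (fun w => k * X w).
Proof.
move=> [mX iX]; split; first exact: measurable_funM.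
under eq_fun do rewrite exprMn.
exact: itgZ.
Qed.

Lemma L2B X Y : L2 X -> L2 Y -> L2 (fun w => X w - Y w).
Proof.
move=> lX lY; have := L2D lX (L2Z (-1) lY).
by congr L2; apply/funext => w; rewrite mulN1r.
Qed.

Lemma L2_bounded X (M : R) : measurable_fun setT X ->
  (forall w, `|X w| <= M) -> L2 X.
Proof.
move=> mX XM; split => //; apply: (@itg_bounded _ (M ^+ 2)).
  exact: measurable_funX.
by move=> w; rewrite normrX lerXn2r ?nnegrE// (le_trans _ (XM w)).
Qed.

Lemma L2_cst (k : R) : L2 (fun=> k).
Proof. by apply: (@L2_bounded _ `|k|). Qed.

Lemma L2_itg X : L2 X -> itg X.
Proof.
move=> lX; have := L2_mul lX (L2_cst 1).
by congr itg; apply/funext => w; rewrite mulr1.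
Qed.

Lemma L2_sum (I : Type) (s : seq I) (X : I -> T -> R) :
  (forall i, L2 (X i)) -> L2 (fun w => \sum_(i <- s) X i w).
Proof.
move=> iX; elim: s => [|i s IH].
  by under eq_fun do rewrite big_nil; exact: L2_cst.
by under eq_fun do rewrite big_cons; apply: L2D.
Qed.

Lemma L2_Lfun X : L2 X <-> X \in Lfun P 2%:E.
Proof.
split=> [[mX iX]|h].
  rewrite inE; apply/andP; split; first by rewrite inE /=.
  rewrite inE /= /finite_norm.
  rewrite unlock /=.
  have -> : (fun x : T => (`|(EFin \o X) x| `^ 2)%E) = (EFin \o (fun w => X w ^+ 2)).
    apply/funext => w /=; rewrite powR_mulrn//.
    by rewrite real_normK// num_real.
  by rewrite poweR_lty// -EFin_Ex// ltry.
split; first by move: h; rewrite inE => /andP[]; rewrite inE.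
exact: Lfun2_integrable_sqr.
Qed.

Lemma L2_CS X Y : L2 X -> L2 Y ->
  (Ex P (fun w => X w * Y w)) ^+ 2 <=
  Ex P (fun w => X w ^+ 2) * Ex P (fun w => Y w ^+ 2).
Proof.
move=> lX lY.
have key (t : R) : 0 <= Ex P (fun w => X w ^+ 2)
    + 2 * t * Ex P (fun w => X w * Y w) + t ^+ 2 * Ex P (fun w => Y w ^+ 2).
  have := Ex_ge0 (fun w => sqr_ge0 (X w + t * Y w)).
  congr (_ <= _).
  rewrite -ExZ; last exact: L2_mul.
  rewrite -(ExZ (t ^+ 2)); last exact: lY.2.
  rewrite -ExD; [|exact: lX.2|exact/itgZ/L2_mul].
  rewrite -ExD; last 2 first.
  - by apply: itgD; [exact: lX.2|exact/itgZ/L2_mul].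
  - by apply: itgZ; exact: lY.2.
  by apply: eqEx => w; ring.
move: key; set a := Ex P (fun w => X w ^+ 2); set b := Ex P (fun w => X w * Y w).
set c := Ex P _ => key.
have c0 : 0 <= c by apply: Ex_ge0 => w; exact: sqr_ge0.
have a0 : 0 <= a by apply: Ex_ge0 => w; exact: sqr_ge0.
have [c00|cn] := eqVneq c 0.
  rewrite c00 mulr0 in key *.
  have [->|bn] := eqVneq b 0; first by rewrite expr0n.
  have := key (- (a + 1) / (2 * b)).
  rewrite (_ : _ + _ + _ = - 1); last by field; rewrite bn.
  by rewrite ler0N1.
have cp : 0 < c by rewrite lt_def cn.
have := key (- b / c).
rewrite (_ : _ + _ + _ = a - b ^+ 2 / c); last by field.
by rewrite subr_ge0 ler_pdivrMr.
Qed.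

Lemma L2_Ex_norm X : L2 X -> (Ex P (fun w => `|X w|)) ^+ 2 <= Ex P (fun w => X w ^+ 2).
Proof.
move=> [mX iX].
have l : L2 (fun w => `|X w|).
  split; first exact: measurableT_comp.
  have -> : (fun w => `|X w| ^+ 2) = (fun w => X w ^+ 2); last by [].
  by apply/funext => w; rewrite real_normK ?num_real.
have := L2_CS l (L2_cst 1).
rewrite Ex_cst expr1n mulr1.
by under eqEx do rewrite mulr1; under [in leRHS]eqEx do rewrite real_normK ?num_real//.
Qed.

Lemma L2_add_le X Y : L2 X -> L2 Y ->
  Ex P (fun w => (X w + Y w) ^+ 2) <=
  2 * Ex P (fun w => X w ^+ 2) + 2 * Ex P (fun w => Y w ^+ 2).
Proof.
move=> lX lY.
rewrite -ExZ ?(proj2 lX)// -ExZ ?(proj2 lY)// -ExD; last 2 first.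
- exact/itgZ/lX.2.
- exact/itgZ/lY.2.
apply: Ex_le; first exact: (L2D lX lY).2.
  by apply: itgD; apply: itgZ; [exact: lX.2|exact: lY.2].
by move=> w; have := sqr_ge0 (X w - Y w); nra.
Qed.

Lemma L2_cvg_mul (X_ : nat -> T -> R) X Y :
  (forall k, L2 (X_ k)) -> L2 X -> L2 Y ->
  Ex P (fun w => (X_ k w - X w) ^+ 2) @[k --> \oo] --> 0 ->
  Ex P (fun w => Y w * X_ k w) @[k --> \oo] --> Ex P (fun w => Y w * X w).
Proof.
move=> lX_ lX lY c.
apply/subr_cvg0.
pose M := Ex P (fun w => Y w ^+ 2).
have key k : `|Ex P (fun w => Y w * X_ k w) - Ex P (fun w => Y w * X w)| <=
    Num.sqrt (M * Ex P (fun w => (X_ k w - X w) ^+ 2)).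
  rewrite -ExB; [|exact: L2_mul..].
  under eqEx do rewrite -mulrBr.
  rewrite -sqrtr_sqr ler_wsqrtr// L2_CS//.
  exact: L2B.
apply: norm_cvg0.
apply: (squeeze_cvgr (f := cst 0) (h := fun k =>
   Num.sqrt (M * Ex P (fun w => (X_ k w - X w) ^+ 2)))).
- by apply: nearW => k; rewrite normr_ge0 key.
- exact: cvg_cst.
- rewrite -[X in _ --> X]sqrtr0 -[X in Num.sqrt X](mulr0 M).
  apply: (cvg_comp _ Num.sqrt); last exact: sqrt_continuous.
  by apply: cvgMr.
Qed.

(** Fatou's lemma in the second index of the Cauchy bound: it identifies the L^2 limit with the
    pointwise one without extracting a subsequence. *)
Lemma L2_cvg_fatou (X_ : nat -> T -> R) X (e : R) (N : nat) :
  (forall k, L2 (X_ k)) -> (forall w, X_ ^~ w @ \oo --> X w) ->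
  (forall k l, (N <= k)%N -> (N <= l)%N ->
    Ex P (fun w => (X_ k w - X_ l w) ^+ 2) <= e) ->
  L2 X /\ forall k, (N <= k)%N -> Ex P (fun w => (X_ k w - X w) ^+ 2) <= e.
Proof.
move=> lX c H.
have mX : measurable_fun setT X.
  by apply: (measurable_fun_cvg (fun k => (lX k).1)) => w _; exact: c.
have key k : (N <= k)%N -> L2 (fun w => X_ k w - X w) /\
    Ex P (fun w => (X_ k w - X w) ^+ 2) <= e.
  move=> Nk.
  have [] := @fatou_Ex (fun l w => (X_ k w - X_ l w) ^+ 2)
    (fun w => (X_ k w - X w) ^+ 2) e.
  - by move=> l; exact: (L2B (lX k) (lX l)).2.
  - by move=> l w; exact: sqr_ge0.
  - move=> w; rewrite expr2; under eq_fun do rewrite expr2.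
    by apply: cvgM; apply: cvgB => //; exact: cvg_cst.
  - by exists N => // l /= Nl; apply: H.
  move=> i1 i2; split => //; split=> //.
  by apply: measurable_funB => //; exact: (lX k).1.
split; last by move=> k /key[].
have := L2B (lX N) (key N (leqnn N)).1.
by congr L2; apply/funext => w; rewrite subKr.
Qed.

End real_expectation.

(** * Derivatives of real functions *)

Section real_derivatives.
Context {R : realType}.
Implicit Types f g : R -> R.
Local Notation isd x f df := (is_derive (x : R) (1 : R) f df).

Lemma isd_cst (x c : R) : isd x (fun=> c) 0.
Proof. exact: is_derive_cst. Qed.

Lemma isd_id (x : R) : isd x (fun y => y) 1.
Proof. exact: is_derive_id. Qed.

Lemma isdD x f g df dg : isd x f df -> isd x g dg ->
  isd x (fun y => f y + g y) (df + dg).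
Proof. exact: is_deriveD. Qed.

Lemma isdN x f df : isd x f df -> isd x (fun y => - f y) (- df).
Proof. exact: is_deriveN. Qed.

Lemma isdB x f g df dg : isd x f df -> isd x g dg ->
  isd x (fun y => f y - g y) (df - dg).
Proof. by move=> h1 h2; exact: isdD h1 (isdN h2). Qed.

Lemma isdZ x (k : R) f df : isd x f df -> isd x (fun y => k * f y) (k * df).
Proof. exact: is_deriveZ. Qed.

Lemma isdM x f g df dg : isd x f df -> isd x g dg ->
  isd x (fun y => f y * g y) (df * g x + f x * dg).
Proof.
move=> h1 h2; have := @is_deriveM _ _ _ _ _ _ _ _ h1 h2.
by rewrite /GRing.scale /= addrC (mulrC (g x)).
Qed.

Lemma isd_eq x f df df' : isd x f df -> df = df' -> isd x f df'.
Proof. by move=> h <-. Qed.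

Lemma isdX x n f df : isd x f df ->
  isd x (fun y => f y ^+ n) (n%:R * f x ^+ n.-1 * df).
Proof.
move=> h; elim: n => [|n IH].
  under eq_fun do rewrite expr0.
  by rewrite /= !mul0r; exact: isd_cst.
under eq_fun do rewrite exprS.
apply: (isd_eq (isdM h IH)); case: n {IH} => [|n] /=; first by rewrite !expr0; ring.
by rewrite -[in RHS]nat1r exprS; ring.
Qed.

Lemma isd_comp x f g df dg : isd (f x) g dg -> isd x f df ->
  isd x (fun y => g (f y)) (df * dg).
Proof. by move=> h1 h2; have := @is_derive1_comp _ _ _ _ _ _ h1 h2; rewrite mulrC. Qed.

Lemma isd_derive1 x f df : isd x f df -> derive1 f x = df.
Proof. by move=> h; rewrite derive1E; exact: derive_val. Qed.

Lemma isd_derivable x f df : isd x f df -> derivable f x 1.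
Proof. by case. Qed.

Lemma derivable_isd x f : derivable f x 1 -> isd x f (derive1 f x).
Proof. by move=> h; rewrite derive1E; exact: derivableP. Qed.

Lemma isd_continuous x f df : isd x f df -> {for x, continuous f}.
Proof.
by move=> [h _]; apply: differentiable_continuous; exact/derivable1_diffP.
Qed.

Lemma FTC_isd (a b : R) f F : a <= b ->
  {within `[a, b], continuous f} -> {within `[a, b], continuous F} ->
  (forall x, a < x < b -> isd x F (f x)) ->
  \int[lebesgue_measure]_(x in `[a, b]) f x = F b - F a.
Proof.
rewrite le_eqVlt => /predU1P[->|ab] cf cF dF.
  by rewrite set_itv1 Rintegral_set1 subrr.
rewrite /Rintegral (@continuous_FTC2 _ f F a b)//.
- have [_ ca cb] := (continuous_within_itvP F ab).1 cF.
  split => //.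
  by move=> x; rewrite in_itv/= => /dF/isd_derivable.
- by move=> x; rewrite in_itv/= => /dF/isd_derive1.
Qed.

Lemma within_itgb (a b : R) f : {within `[a, b], continuous f} ->
  lebesgue_measure.-integrable `[a, b] (EFin \o f).
Proof. by move=> cf; apply: continuous_compact_integrable => //; exact: segment_compact. Qed.

Lemma continuous_isd0 f : (forall x, isd x f 0) -> forall x y, f x = f y.
Proof. by move=> h x y; apply: is_derive_0_is_cst. Qed.

End real_derivatives.

(** * The normal law *)

Definition pg {R : realType} (f : R -> R) :=
  exists (C : R) (N : nat), forall x, `|f x| <= C * (1 + `|x|) ^+ N.

Section poly_growth.
Context {R : realType}.
Implicit Types f g : R -> R.

Lemma one_le1D (x : R) N : 1 <= (1 + `|x|) ^+ N.
Proof. by apply: exprn_ege1; rewrite lerDl. Qed.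

Lemma pg_ge0 f : pg f -> exists (C : R) (N : nat),
  0 <= C /\ forall x, `|f x| <= C * (1 + `|x|) ^+ N.
Proof.
move=> [C [N H]]; exists `|C|, N; split=> // x.
by rewrite (le_trans (H x))// ler_wpM2r ?ler_norm.
Qed.

Lemma pg_bounded f (M : R) : (forall x, `|f x| <= M) -> pg f.
Proof. by move=> H; exists M, 0%N => x; rewrite expr0 mulr1. Qed.

Lemma pg_id : pg (fun x : R => x).
Proof. by exists 1, 1%N => x; rewrite mul1r expr1 lerDr. Qed.

Lemma pg_mul f g : pg f -> pg g -> pg (fun x => f x * g x).
Proof.
move=> /pg_ge0[C [N [C0 H]]] /pg_ge0[D [M [D0 K]]]; exists (C * D), (N + M)%N => x.
by rewrite normrM exprD mulrACA ler_pM.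
Qed.

Lemma pg_add f g : pg f -> pg g -> pg (fun x => f x + g x).
Proof.
move=> /pg_ge0[C [N [C0 H]]] /pg_ge0[D [M [D0 K]]]; exists (C + D), (N + M)%N => x.
rewrite (le_trans (ler_normD _ _))// mulrDl lerD//.
  by rewrite (le_trans (H x))// ler_wpM2l// exprD ler_peMr ?one_le1D.
by rewrite (le_trans (K x))// ler_wpM2l// exprD ler_peMl ?one_le1D.
Qed.

Lemma pg_exp f n : pg f -> pg (fun x => f x ^+ n).
Proof.
move=> pf; elim: n => [|n IH].
  by apply: (@pg_bounded _ 1) => x; rewrite expr0 normr1.
by under eq_fun do rewrite exprS; exact: pg_mul.
Qed.

Lemma pg_affine f (a b : R) : pg f -> pg (fun x => f (a * x + b)).
Proof.
move=> /pg_ge0[C [N [C0 H]]]; exists (C * (1 + `|a| + `|b|) ^+ N), N => x.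
rewrite (le_trans (H _))// -mulrA -exprMn ler_wpM2l//.
rewrite lerXn2r ?nnegrE ?addr_ge0 ?mulr_ge0 ?addr_ge0//.
have := ler_normD (a * x) b; rewrite normrM.
have := normr_ge0 a; have := normr_ge0 b; have := normr_ge0 x.
move: `|a| `|b| `|x| `|a * x + b| => p q r s; nra.
Qed.

(** For a positive exponent M, exp(y^2) is the M-th power of exp(y^2 / M), which is at least 1 + y^2
    / M; it is then enough to compare the bases. *)
Lemma poly_le_expR (N : nat) (y : R) :
  (1 + `|y|) ^+ N <= (N.+2)%:R ^+ N * expR (y ^+ 2).
Proof.
case: N => [|N].
  by rewrite !expr0 mul1r (le_trans _ (expR_ge1Dx _))// lerDl sqr_ge0.
have -> : expR (y ^+ 2) = expR (y ^+ 2 / N.+1%:R) ^+ N.+1.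
  by rewrite -expRM_natl mulrCA divff ?mulr1// pnatr_eq0.
rewrite -exprMn lerXn2r ?nnegrE ?addr_ge0 ?mulr_ge0 ?expR_ge0//.
apply: (@le_trans _ _ (N.+3%:R * (1 + y ^+ 2 / N.+1%:R))); last first.
  by rewrite ler_wpM2l// expR_ge1Dx.
have n0 : (0 : R) < N.+1%:R by rewrite ltr0n.
rewrite -addn2 natrD mulrDr mulr1.
have : `|y| <= 1 + y ^+ 2.
  rewrite -(real_normK (num_real y)); have := sqr_ge0 (`|y| - 1); nra.
have : y ^+ 2 <= (N.+1%:R + 2%:R) * (y ^+ 2 / N.+1%:R).
  rewrite mulrCA ler_peMr ?sqr_ge0// ler_pdivlMr// mul1r lerDl//.
have : (1 : R) <= N.+1%:R by rewrite ler1n.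
by move: (N.+1%:R : R) (y ^+ 2) => n z; lra.
Qed.

End poly_growth.

Section normal_law.
Context {R : realType} (m s : R) (s0 : s != 0).
Local Notation isd x f df := (is_derive (x : R) (1 : R) f df).
Local Notation N := (normal_prob m s).
Local Notation lam := (@lebesgue_measure R).
Local Notation p := (normal_pdf m s).

(** The Radon-Nikodym derivative is known only through its integrals over measurable sets, which
    determine it almost everywhere; this identifies it with [normal_pdf]. *)
Lemma integral_normal_prob (f : R -> \bar R) :
  N.-integrable setT f ->
  (\int[N]_x f x = \int[lam]_x (f x * (p x)%:E))%E.
Proof.
move=> fi; have mf := measurable_int _ fi.
rewrite -(Radon_Nikodym_change_of_variables (normal_prob_dominates m s))//=.
apply: ae_eq_integral => //.
- apply: emeasurable_funM => //; apply: (measurable_int lam).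
  by apply: Radon_Nikodym_integrable; exact: normal_prob_dominates.
- apply: emeasurable_funM => //; apply/measurable_EFinP.
  exact: measurable_normal_pdf.
apply: ae_eqe_mul2l => /=.
rewrite Radon_NikodymE//=; first exact: normal_prob_dominates.
move=> dom; case: cid => /= h [h1 h2 h3].
apply: integral_ae_eq => //=.
- by apply/measurable_EFinP; exact: measurable_normal_pdf.
- by move=> E _ mE; rewrite -h3.
Qed.

Let s' := s * Num.sqrt 2.

(** Doubling the variance absorbs any polynomial: with y = (x - m)/(2s) the two exponents are -2y^2
    and -y^2, so a factor exp(-y^2) is left to beat the power of 1 + |x|. *)
Lemma pg_normal_pdf (n : nat) : exists K : R, 0 <= K /\
  forall x, (1 + `|x|) ^+ n * p x <= K * normal_pdf m s' x.
Proof.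
have sq2 : Num.sqrt (2 : R) ^+ 2 = 2 by rewrite sqr_sqrtr.
have s'0 : s' != 0.
  by rewrite mulf_neq0// gt_eqF// sqrtr_gt0.
pose A := 1 + `|m| + 2 * `|s|.
pose K := A ^+ n * n.+2%:R ^+ n * (normal_peak s / normal_peak s').
have peak0 := normal_peak_gt0 s0; have peak0' := normal_peak_gt0 s'0.
have A0 : 0 <= A by rewrite /A !addr_ge0// mulr_ge0.
exists K; split.
  rewrite /K mulr_ge0//; last by rewrite divr_ge0// ltW.
  by rewrite mulr_ge0// exprn_ge0.
move=> x; rewrite !normal_pdfE// /normal_fun.
pose y := (x - m) / (2 * s).
have e1 : - (x - m) ^+ 2 / (s ^+ 2 *+ 2) = - (2 * y ^+ 2).
  by rewrite /y -mulr_natr; field.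
have e2 : - (x - m) ^+ 2 / (s' ^+ 2 *+ 2) = - (y ^+ 2).
  by rewrite /y /s' exprMn sq2 -mulr_natr; field.
rewrite e1 e2.
have h1 : (1 + `|x|) ^+ n <= A ^+ n * (1 + `|y|) ^+ n.
  rewrite -exprMn lerXn2r ?nnegrE ?addr_ge0 ?mulr_ge0 ?addr_ge0 ?mulr_ge0//.
  have : `|x| <= `|m| + 2 * `|s| * `|y|.
    have -> : x = m + (2 * s) * y by rewrite /y; field.
    by rewrite (le_trans (ler_normD _ _))// !normrM normr_nat.
  rewrite /A; have := normr_ge0 m; have := normr_ge0 s; have := normr_ge0 y.
  move: `|m| `|s| `|y| `|x| => a b c d; nra.
have h2 := poly_le_expR n y.
have -> : expR (- (2 * y ^+ 2)) = expR (- y ^+ 2) * expR (- y ^+ 2).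
  by rewrite -expRD; congr expR; ring.
have h3 : (1 + `|x|) ^+ n * expR (- y ^+ 2) <= A ^+ n * n.+2%:R ^+ n.
  rewrite expRN ler_pdivrMr ?expR_gt0// (le_trans h1)// -mulrA ler_wpM2l//.
  by rewrite exprn_ge0// !addr_ge0// mulr_ge0.
rewrite /K.
rewrite [X in _ <= X](_ : _ = A ^+ n * n.+2%:R ^+ n * (normal_peak s * expR (- y ^+ 2))); last first.
  by field; rewrite gt_eqF.
rewrite [X in X <= _](_ : _ = (1 + `|x|) ^+ n * expR (- y ^+ 2) * (normal_peak s * expR (- y ^+ 2))); last by ring.
by rewrite ler_wpM2r// mulr_ge0 ?expR_ge0// ltW.
Qed.

Lemma itg_normal_pg (f : R -> R) : measurable_fun setT f -> pg f -> itg N f.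
Proof.
move=> mf [C [n H]].
suff i n' : itg N (fun x => (1 + `|x|) ^+ n').
  by apply: (@itg_le _ _ _ N f (fun x => C * (1 + `|x|) ^+ n)) => //; exact: itgZ.
have [K [K0 HK]] := pg_normal_pdf n'.
have mg : measurable_fun setT (fun x : R => (1 + `|x|) ^+ n').
  by apply: measurable_funX; apply: measurable_funD => //; exact: measurableT_comp.
(* Truncation makes each term integrable, as [integral_normal_prob] requires; Fatou's lemma then
   removes it. *)
pose X_ (k : nat) (x : R) := Num.min ((1 + `|x|) ^+ n') k%:R.
have X0 k x : 0 <= X_ k x by rewrite /X_ le_min exprn_ge0 ?addr_ge0//=.
have iX k : itg N (X_ k).
  apply: (@itg_bounded _ _ _ _ _ k%:R); first exact: measurable_minr.
  by move=> x; rewrite ger0_norm// /X_ ge_min lexx orbT.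
have [||//] := @fatou_Ex _ _ _ N X_ (fun x => (1 + `|x|) ^+ n') K iX X0.
- move=> x; apply: cvg_near_cst.
  exists (Num.truncn ((1 + `|x|) ^+ n')).+1 => // k /= hk.
  rewrite /X_; apply/min_idPl.
  rewrite (le_trans (ltW (truncnS_gt _)))// ler_nat//.
- apply: nearW => k.
  rewrite -lee_fin EFin_Ex// integral_normal_prob//; last exact: iX.
  apply: (@le_trans _ _ (\int[lam]_x (K%:E * (normal_pdf m s' x)%:E))%E).
    apply: ge0_le_integral => //=.
    - by move=> x _; rewrite lee_fin mulr_ge0// normal_pdf_ge0.
    - apply/measurable_EFinP/measurable_funM; first exact: itg_meas (iX k).
      exact: measurable_normal_pdf.
    - by apply/measurable_EFinP/measurable_funM => //; exact: measurable_normal_pdf.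
    move=> x _; rewrite lee_fin (le_trans _ (HK x))//.
    by rewrite ler_wpM2r ?normal_pdf_ge0// /X_ ge_min lexx.
  rewrite ge0_integralZl//=.
  - by rewrite integral_normal_pdf mule1.
  - by apply/measurable_EFinP; exact: measurable_normal_pdf.
  - by move=> x _; rewrite lee_fin normal_pdf_ge0.
Qed.

Lemma isd_normal_pdf x : isd x p (- (x - m) / s ^+ 2 * p x).
Proof.
rewrite normal_pdfE// /normal_fun.
have h0 := isdM (isdN (isdX 2 (isdB (isd_id x) (isd_cst x m)))) (isd_cst x (s ^+ 2 *+ 2)^-1).
have h := isdZ (normal_peak s) (@isd_comp _ x _ expR _ _ (is_derive_expR _) h0).
apply: (isd_eq h).
by rewrite -[X in X^-1]mulr_natr; field.
Qed.

(** One power of 1 + |x| more than the growth of f is absorbed, which leaves a decay like 1/(1 +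
    |x|). Integer points are enough, since they are the ends of integration in [normal_ibp]. *)
Lemma pdf_cvg0 (f : R -> R) : pg f ->
  f n%:R * p n%:R @[n --> \oo] --> 0 /\ f (- n%:R) * p (- n%:R) @[n --> \oo] --> 0.
Proof.
move=> /pg_ge0[C [n [C0 H]]]; have [K [K0 HK]] := pg_normal_pdf n.+1.
have s'0 : s' != 0 by rewrite mulf_neq0// gt_eqF// sqrtr_gt0.
pose M := C * (K * normal_peak s').
have key x : `|f x * p x| <= M / (1 + `|x|).
  have x0 : 0 < 1 + `|x| by rewrite ltr_pwDl.
  rewrite ler_pdivlMr// normrM (ger0_norm (normal_pdf_ge0 _ _ _)).
  apply: (@le_trans _ _ (C * ((1 + `|x|) ^+ n.+1 * p x))).
    have := ler_wpM2r (mulr_ge0 (normal_pdf_ge0 m s x) (ltW x0)) (H x).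
    by rewrite exprSr; congr (_ <= _); ring.
  rewrite /M ler_wpM2l// (le_trans (HK x))// ler_wpM2l//.
  exact: normal_pdf_ub.
have M0 : M / (1 + n%:R) @[n --> \oo] --> (0 : R).
  rewrite -[X in _ --> X](mulr0 M); apply: cvgMr.
  apply/gtr0_cvgV0; first by apply: nearW => k; rewrite ltr_pwDl.
  apply: (@ger_cvgy _ _ _ _ (fun n : nat => n%:R)); last exact: cvgr_idn.
  by apply: nearW => k; rewrite lerDr.
split; apply: norm_cvg0; apply: (squeeze_cvgr (f := cst 0) (h := fun k : nat => M / (1 + k%:R))) => //; try exact: cvg_cst; apply: nearW => k; rewrite normr_ge0 (le_trans (key _))// ?normrN ger0_norm//.
Qed.

(** Stein's identity. Since p' = -(x - m) p / s^2, the product of [psi] and the density is the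
    derivative of f p, so its integral over [-n, n] is a boundary term that tends to 0. *)
Lemma normal_ibp (f f' : R -> R) : (forall x, isd x f (f' x)) ->
  continuous f' -> pg f -> pg f' ->
  Ex N (fun x => (x - m) * f x) = s ^+ 2 * Ex N f'.
Proof.
move=> df cf' pf pf'.
have cf : continuous f by move=> x; exact: isd_continuous (df x).
have mf : measurable_fun setT f by apply: continuous_measurable_fun.
have mf' : measurable_fun setT f' by apply: continuous_measurable_fun.
pose psi x := f' x - s ^- 2 * ((x - m) * f x).
have pxm : pg (fun x : R => x - m).
  by apply: pg_add; [exact: pg_id|apply: (@pg_bounded _ _ `|m|) => x; rewrite normrN].
have mxm : measurable_fun setT (fun x : R => (x - m) * f x).
  by apply: measurable_funM => //; exact: measurable_funB.
have i1 : itg N f' by apply: itg_normal_pg.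
have i2 : itg N (fun x => (x - m) * f x).
  by apply: itg_normal_pg => //; exact: pg_mul.
have ipsi : itg N psi by apply: itgB => //; exact: itgZ.
suff : Ex N psi = 0.
  rewrite ExB//; last exact: itgZ.
  rewrite ExZ// => /subr0_eq ->.
  by rewrite mulrA divff ?mul1r// expf_neq0.
have mI (n : nat) : measurable (`[- n%:R, n%:R]%classic : set R) by [].
have c1 : Ex N (fun x => psi x * \1_(`[- n%:R, n%:R]) x) @[n --> \oo] --> Ex N psi.
  apply: (@dct _ _ _ N (fun n x => psi x * \1_(`[- n%:R, n%:R]) x) psi
    (fun x => `|psi x|) _ (itg_norm ipsi) _ _).2.2.
  - by move=> n; apply: measurable_funM; [exact: itg_meas ipsi|exact: measurable_indic].
  - by move=> n x; rewrite normrM ler_piMr// indicE; case: (_ \in _); rewrite ?normr1 ?normr0.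
  move=> x; apply: cvg_near_cst.
  exists (Num.truncn `|x|).+1 => // k /= hk.
  rewrite indicE mem_set ?mulr1//= in_itv/= -ler_norml.
  by rewrite (le_trans (ltW (truncnS_gt _)))// ler_nat//.
have [t1 t2] := pdf_cvg0 pf.
have c2 : Ex N (fun x => psi x * \1_(`[- n%:R, n%:R]) x) @[n --> \oo] --> 0 - 0.
  rewrite (_ : (fun n => _) = (fun n : nat => f n%:R * p n%:R - f (- n%:R) * p (- n%:R))).
    exact: cvgB t1 t2.
  apply/funext => n.
  have in1 : itg N (fun x => psi x * \1_(`[- n%:R, n%:R]) x).
    apply: (itg_le _ (itg_norm ipsi)).
      by apply: measurable_funM; [exact: itg_meas ipsi|exact: measurable_indic].
    by move=> x; rewrite normrM ler_piMr// indicE; case: (_ \in _); rewrite ?normr1 ?normr0.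
  transitivity (\int[lam]_(x in `[- n%:R, n%:R]) (psi x * p x)).
    rewrite /Rintegral; congr fine; rewrite integral_normal_prob// [RHS]integral_mkcond.
    apply: eq_integral => x _; rewrite patchE indicE.
    by case: ifP => _; rewrite ?mulr1 ?mulr0 ?mul0e.
  apply: (@FTC_isd _ _ _ (fun x => psi x * p x) (fun x => f x * p x)).
  - by rewrite (@le_trans _ _ 0)// oppr_le0.
  - apply: continuous_subspaceT => x; apply: cvgM; last exact: continuous_normal_pdf.
    apply: cvgB; first exact: cf'.
    apply: cvgMr; apply: cvgM; last exact: cf.
    by apply: cvgB; [exact: cvg_id|exact: cvg_cst].
  - apply: continuous_subspaceT => x; apply: cvgM; last exact: continuous_normal_pdf.
    exact: cf.
  - move=> x _; apply: (isd_eq (isdM (df x) (isd_normal_pdf x))).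
    by rewrite /psi; field.
by rewrite -(cvg_lim (@Rhausdorff R) c1) (cvg_lim (@Rhausdorff R) c2) subr0.
Qed.

Lemma normal_mean : Ex N (fun x => x) = m.
Proof.
have b1 (k : R) : pg (fun=> k) by apply: (@pg_bounded _ _ `|k|).
have : Ex N (fun x => (x - m) * 1) = s ^+ 2 * Ex N (fun=> 0).
  apply: (@normal_ibp (fun=> 1) (fun=> 0)).
  - by move=> x; exact: cvg_cst.
  - exact: b1.
  - exact: b1.
rewrite Ex_cst mulr0; under eqEx do rewrite mulr1.
have i : itg N (fun x => x) by apply: itg_normal_pg => //; exact: pg_id.
rewrite ExB ?Ex_cst//; first by move=> /eqP; rewrite subr_eq0 => /eqP.
exact: itg_cst.
Qed.

End normal_law.

(** * Cosine moments of the centered normal law *)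

Section normal_char.
Context {R : realType} (s theta : R) (s0 : s != 0).
Local Notation isd x f df := (is_derive (x : R) (1 : R) f df).
Local Notation N := (normal_prob 0 s).

Let cosf (mu x : R) := cos (mu * x + theta).

Let mcosf mu : measurable_fun setT (cosf mu).
Proof.
apply: continuous_measurable_fun => x; apply: (cvg_comp _ cos); last exact: continuous_cos.
by apply: cvgD; [apply: cvgMr; exact: cvg_id|exact: cvg_cst].
Qed.

Let isd_arg (mu x : R) : isd x (fun y => mu * y + theta) mu.
Proof. by apply: (isd_eq (isdD (isdZ mu (isd_id x)) (isd_cst x theta))); ring. Qed.

Let F mu := Ex N (cosf mu).

Let itg_cosf mu : itg N (cosf mu).
Proof. by apply: (@itg_bounded _ _ _ N _ 1); [exact: mcosf|move=> x; exact: cos_max]. Qed.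

Let itg_xsin mu : itg N (fun x => x * sin (mu * x + theta)).
Proof.
apply: itg_normal_pg => //; last first.
  apply: pg_mul; [exact: pg_id|apply: (@pg_bounded _ _ 1) => x; exact: sin_max].
apply: measurable_funM => //.
apply: continuous_measurable_fun => x; apply: (cvg_comp _ sin); last exact: continuous_sin.
by apply: cvgD; [apply: cvgMr; exact: cvg_id|exact: cvg_cst].
Qed.

Let xsin_cos mu : Ex N (fun x => x * sin (mu * x + theta)) = s ^+ 2 * mu * F mu.
Proof.
have -> : Ex N (fun x => x * sin (mu * x + theta)) = Ex N (fun x => (x - 0) * sin (mu * x + theta)).
  by apply: eqEx => x; rewrite subr0.
transitivity (s ^+ 2 * Ex N (fun x => mu * cosf mu x)); last by rewrite ExZ// mulrA.
apply: (@normal_ibp _ _ _ s0 (fun x => sin (mu * x + theta)) (fun x => mu * cosf mu x)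
  (fun x => isd_comp (is_derive_sin _) (isd_arg mu x))).
- move=> x; apply: cvgMr; apply: (cvg_comp _ cos); last exact: continuous_cos.
  by apply: cvgD; [apply: cvgMr; exact: cvg_id|exact: cvg_cst].
- by apply: (@pg_bounded _ _ 1) => x; exact: sin_max.
- by apply: (@pg_bounded _ _ `|mu|) => x; rewrite normrM ler_piMr// cos_max.
Qed.

Let isdF mu : isd mu F (- (s ^+ 2 * mu * F mu)).
Proof.
have d1 (y x : R) : isd x (cosf ^~ y) (y * - sin (x * y + theta)).
  apply: (@isd_comp _ x (fun z => z * y + theta) cos y _ (is_derive_cos _)).
  by apply: (isd_eq (isdD (isdM (isd_id x) (isd_cst x y)) (isd_cst x theta))); ring.
have ig : N.-integrable setT (EFin \o (fun y : R => `|y|)).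
  by apply: itg_norm; apply: itg_normal_pg => //; exact: pg_id.
have Imu : `]mu - 1, mu + 1[%classic mu by rewrite /= in_itv/= ltrBlDr ltrDl ltr01.
have gub x y : `]mu - 1, mu + 1[%classic x -> [set: R] y -> `|partial1of2 cosf x y| <= `|y|.
  move=> _ _; rewrite /partial1of2 (isd_derive1 (d1 y x)).
  by rewrite normrM normrN ler_piMr// sin_max.
have h1 x : `]mu - 1, mu + 1[%classic x -> N.-integrable setT (EFin \o cosf x).
  by move=> _; exact: itg_cosf.
have h2 x y : `]mu - 1, mu + 1[%classic x -> setT y -> derivable (cosf ^~ y) x 1.
  by move=> _ _; exact: isd_derivable (d1 y x).
have h3 (y : R) : 0 <= `|y| by [].
have der := derivable_under_integral measurableT Imu h1 h2 h3 ig gub.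
have dF := differentiation_under_integral measurableT Imu h1 h2 h3 ig gub.
apply: (isd_eq (derivable_isd der)); rewrite dF.
rewrite -xsin_cos -ExN//; apply: eqEx => y.
by rewrite /partial1of2 (isd_derive1 (d1 y mu)) mulrN.
Qed.

(** Stein's identity gives F' = -s^2 mu F, so F(mu) exp(mu^2 s^2 / 2) is constant. The phase theta
    covers sines too, which keeps everything real-valued. *)
Lemma normal_char (mu : R) :
  Ex N (fun x => cos (mu * x + theta)) = expR (- (mu ^+ 2 * s ^+ 2 / 2)) * cos theta.
Proof.
pose G t := F t * expR (t ^+ 2 * s ^+ 2 / 2).
have dG t : isd t G 0.
  have h0 : isd t (fun t => t ^+ 2 * s ^+ 2 / 2) (t * s ^+ 2).
    apply: (isd_eq (isdM (isdM (isdX 2 (isd_id t)) (isd_cst t (s ^+ 2))) (isd_cst t 2^-1))).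
    by field.
  apply: (isd_eq (isdM (isdF t) (@isd_comp _ t _ expR _ _ (is_derive_expR _) h0))).
  by ring.
have := continuous_isd0 dG mu 0.
rewrite /G expr0n/= !mul0r expR0 mulr1 => h.
have F0 : F 0 = cos theta.
  by rewrite /F -[RHS](Ex_cst N); apply: eqEx => x; rewrite /cosf mul0r add0r.
by rewrite expRN -F0 -h -/(F mu) mulrC mulfK// gt_eqF// expR_gt0.
Qed.

End normal_char.

(** * Gaussian variables on a probability space, degenerate laws included *)

Section gaussian_variable.
Context {d} {T : measurableType d} {R : realType} (P : probability T R).
Local Notation isd x f df := (is_derive (x : R) (1 : R) f df).

Section law.
Variables (X : T -> R) (m s : R).
Hypothesis mX : measurable_fun setT X.
Hypothesis lawX : forall A, measurable A -> P (X @^-1` A) = normal_prob m s A.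

Lemma law_ge0 (g : R -> \bar R) : measurable_fun setT g -> (forall x, 0 <= g x)%E ->
  (\int[P]_w g (X w) = \int[normal_prob m s]_x g x)%E.
Proof.
move=> mg g0.
transitivity (\int[pushforward P (X : T -> measurableTypeR R)]_x g x)%E.
  by rewrite ge0_integral_pushforward.
by apply: eq_measure_integral => A mA _; exact: lawX.
Qed.

Lemma law_itg (g : R -> R) : measurable_fun setT g -> itg (normal_prob m s) g ->
  itg P (fun w => g (X w)).
Proof.
move=> mg /integrableP[_ ig]; apply/integrableP; split.
  by apply/measurable_EFinP; exact: measurableT_comp.
rewrite (law_ge0 (g := fun x => `|(g x)%:E|%E))//.
by apply/measurableT_comp => //; exact/measurable_EFinP.
Qed.

Lemma law_Ex (g : R -> R) : measurable_fun setT g -> itg (normal_prob m s) g ->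
  Ex P (fun w => g (X w)) = Ex (normal_prob m s) g.
Proof.
move=> mg ig; rewrite /Rintegral [in LHS]integralE [in RHS]integralE.
congr (fine (_ - _)%E).
  rewrite -(law_ge0 (g := (EFin \o g)^\+%E))//.
    by apply: eq_integral => w _; rewrite unlock.
  by apply: measurable_funepos; exact/measurable_EFinP.
rewrite -(law_ge0 (g := (EFin \o g)^\-%E))//.
  by apply: eq_integral => w _; rewrite unlock.
by apply: measurable_funeneg; exact/measurable_EFinP.
Qed.

End law.

Variable X : T -> R.
Hypothesis mX : measurable_fun setT X.

Lemma ae_cst_itg (m : R) (g : R -> R) : measurable_fun setT g ->
  {ae P, forall w, X w = m} -> itg P (fun w => g (X w)) /\ Ex P (fun w => g (X w)) = g m.
Proof.
move=> mg h.
have mgX : measurable_fun setT (fun w => g (X w)) by exact: measurableT_comp.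
split.
  apply/integrableP; split; first exact/measurable_EFinP.
  rewrite (ae_eq_integral (cst `|g m|%:E)) //=.
  - by rewrite integral_cst//= probability_setT mule1 ltry.
  - by apply/measurable_EFinP; exact: measurableT_comp.
  - by apply: filterS h => w -> _.
rewrite /Rintegral (ae_eq_integral (cst (g m)%:E)) //=.
- by rewrite integral_cst//= probability_setT mule1.
- exact/measurable_EFinP.
- by apply: filterS h => w -> _.
Qed.

Hypothesis gX : gaussian P X.

Lemma gaussian_itg (g : R -> R) : measurable_fun setT g -> pg g ->
  itg P (fun w => g (X w)).
Proof.
move=> mg pgg; case: gX => [[m [s [s0 lawX]]]|[m h]].
  by apply: (law_itg mX lawX) => //; exact: itg_normal_pg.
by have [] := ae_cst_itg mg h.
Qed.

Lemma gaussian_L2 : L2 P X.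
Proof.
split => //; apply: (gaussian_itg (g := fun x => x ^+ 2)).
  exact: measurable_funX.
by apply: pg_exp; exact: pg_id.
Qed.

Hypothesis X0 : Ex P X = 0.

(** Mean zero forces m = 0 in both alternatives of [gaussian]; in the first one the variance is s^2
    by Stein's identity for f(x) = x. *)
Lemma gaussian_centered :
  (exists s : R, [/\ s != 0, s ^+ 2 = Ex P (fun w => X w ^+ 2) &
     forall A, measurable A -> P (X @^-1` A) = normal_prob 0 s A]) \/
  (Ex P (fun w => X w ^+ 2) = 0 /\ {ae P, forall w, X w = 0}).
Proof.
case: gX => [[m [s [s0 lawX]]]|[m h]]; last first.
  right; have [_] := ae_cst_itg (@measurable_id _ _ setT) h.
  rewrite X0 => m0; have [_ ->] := ae_cst_itg (measurable_funX 2 (@measurable_id _ _ setT)) h.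
  by rewrite -m0 expr0n in h *.
left; exists s.
have i1 : itg (normal_prob m s) (fun x => x) by apply: itg_normal_pg => //; exact: pg_id.
have m0 : m = 0 by rewrite -(normal_mean m s0) -(law_Ex mX lawX)//.
rewrite m0 in lawX; split => //.
have p2 : pg (fun x : R => x ^+ 2) by apply: pg_exp; exact: pg_id.
have i2 : itg (normal_prob 0 s) (fun x => x ^+ 2).
  by apply: itg_normal_pg => //; exact: measurable_funX.
have m2 : measurable_fun setT (fun x : R => x ^+ 2) by exact: measurable_funX.
have -> := law_Ex mX lawX m2 i2.
have : Ex (normal_prob 0 s) (fun x => (x - 0) * x) = s ^+ 2 * Ex (normal_prob 0 s) (fun=> 1).
  apply: (@normal_ibp _ _ _ s0 (fun x => x) (fun=> 1)).
  - by move=> x; exact: cvg_cst.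
  - exact: pg_id.
  - by apply: (@pg_bounded _ _ 1) => x; rewrite normr1.
by rewrite Ex_cst mulr1 => <-; apply: eqEx => x; rewrite subr0 expr2.
Qed.

Lemma gaussian_ibp (f f' : R -> R) : (forall x, isd x f (f' x)) ->
  continuous f' -> pg f -> pg f' ->
  Ex P (fun w => X w * f (X w)) = Ex P (fun w => X w ^+ 2) * Ex P (fun w => f' (X w)).
Proof.
move=> df cf' pf pf'.
have mf : measurable_fun setT f.
  by apply: continuous_measurable_fun => x; exact: isd_continuous (df x).
have mf' : measurable_fun setT f' by exact: continuous_measurable_fun.
have mxf : measurable_fun setT (fun x : R => x * f x) by exact: measurable_funM.
have pxf : pg (fun x => x * f x) by apply: pg_mul => //; exact: pg_id.
case: gaussian_centered => [[s [s0 sv lawX]]|[v0 h]]; last first.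
  have [_ ->] := ae_cst_itg mxf h.
  by rewrite v0 !mul0r.
rewrite -sv (law_Ex (g := fun x => x * f x) mX lawX)//; last exact: itg_normal_pg.
rewrite (law_Ex (g := f') mX lawX)//; last exact: itg_normal_pg.
by rewrite -normal_ibp//; apply: eqEx => x; rewrite subr0.
Qed.

Lemma gaussian_char (mu theta : R) : Ex P (fun w => cos (mu * X w + theta)) =
  expR (- (mu ^+ 2 * Ex P (fun w => X w ^+ 2) / 2)) * cos theta.
Proof.
have mc : measurable_fun setT (fun x : R => cos (mu * x + theta)).
  apply: continuous_measurable_fun => x; apply: (cvg_comp _ cos); last exact: continuous_cos.
  by apply: cvgD; [apply: cvgMr; exact: cvg_id|exact: cvg_cst].
case: gaussian_centered => [[s [s0 sv lawX]]|[v0 h]]; last first.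
  have [_ ->] := ae_cst_itg mc h.
  by rewrite v0 !mulr0 mul0r oppr0 expR0 mul1r add0r.
rewrite -sv (law_Ex (g := fun x => cos (mu * x + theta)) mX lawX)//; last first.
  by apply: (@itg_bounded _ _ _ _ _ 1) => // x; exact: cos_max.
exact: normal_char.
Qed.

(** Stein's identity for f(x) = x^3. *)
Lemma gaussian_moment4 : Ex P (fun w => X w ^+ 4) = 3 * (Ex P (fun w => X w ^+ 2)) ^+ 2.
Proof.
have pid := @pg_id R.
have h : Ex P (fun w => X w * X w ^+ 3) =
    Ex P (fun w => X w ^+ 2) * Ex P (fun w => 3 * X w ^+ 2).
  apply: (@gaussian_ibp (fun x => x ^+ 3) (fun x => 3 * x ^+ 2)).
  - by move=> x; apply: (isd_eq (isdX 3 (isd_id x))); rewrite mulr1.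
  - by move=> x; apply: cvgMr; exact: sqr_continuous.
  - exact: pg_exp.
  - apply: pg_mul; last exact: pg_exp.
    by apply: (@pg_bounded _ _ 3) => x; rewrite normr_nat.
under eqEx do rewrite exprS.
rewrite h ExZ; first by ring.
apply: (gaussian_itg (g := fun x => x ^+ 2)); first exact: measurable_funX.
exact: pg_exp.
Qed.

End gaussian_variable.

(** * Trigonometric moments determine a sigma-algebra *)

Section trigonometric_approximation.
Context {R : realType}.
Implicit Types f g : R -> R.

(** Phases make sines and constants special cases, and [cosM] turns products into sums; hence
    polynomials in a trigonometric polynomial stay in the class. *)
Inductive trigpoly : (R -> R) -> Prop :=
| trig_cos l t : trigpoly (fun x => cos (l * x + t))
| trig_add f g : trigpoly f -> trigpoly g -> trigpoly (fun x => f x + g x)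
| trig_scale c f : trigpoly f -> trigpoly (fun x => c * f x).

Lemma cosM (a b : R) : cos a * cos b = 2^-1 * (cos (a + b) + cos (a - b)).
Proof. by rewrite cosD cosB; field. Qed.

Lemma trig_mul f g : trigpoly f -> trigpoly g -> trigpoly (fun x => f x * g x).
Proof.
move=> tf tg; elim: tf => [l t|f1 f2 _ h1 _ h2|c f1 _ h1].
- elim: tg => [l' t'|g1 g2 _ h1 _ h2|c g1 _ h1].
  + have -> : (fun x => cos (l * x + t) * cos (l' * x + t')) =
      (fun x => 2^-1 * (cos ((l + l') * x + (t + t')) + cos ((l - l') * x + (t - t')))).
      by apply/funext => x; rewrite cosM; congr (_ * (cos _ + cos _)); ring.
    by apply/trig_scale/trig_add; exact: trig_cos.
  + by under eq_fun do rewrite mulrDr; exact: trig_add.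
  + by under eq_fun do rewrite mulrCA; exact: trig_scale.
- by under eq_fun do rewrite mulrDl; exact: trig_add.
- by under eq_fun do rewrite -mulrA; exact: trig_scale.
Qed.

Lemma trig_cst c : trigpoly (fun=> c).
Proof.
have := trig_scale c (trig_cos 0 0).
by under eq_fun do rewrite mul0r addr0 cos0 mulr1.
Qed.

Lemma trig_exp n f : trigpoly f -> trigpoly (fun x => f x ^+ n).
Proof.
move=> tf; elim: n => [|n IH]; first exact: trig_cst.
by under eq_fun do rewrite exprS; exact: trig_mul.
Qed.

Lemma trig_bounded f : trigpoly f -> exists M : R, forall x, `|f x| <= M.
Proof.
elim=> [l t|f1 f2 _ [M1 h1] _ [M2 h2]|c f1 _ [M h]].
- by exists 1 => x; exact: cos_max.
- by exists (M1 + M2) => x; rewrite (le_trans (ler_normD _ _))// lerD.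
- by exists (`|c| * M) => x; rewrite normrM ler_wpM2l.
Qed.

Lemma trig_continuous f : trigpoly f -> continuous f.
Proof.
elim=> [l t|f1 f2 _ h1 _ h2|c f1 _ h] x.
- apply: (cvg_comp _ cos); last exact: continuous_cos.
  by apply: cvgD; [apply: cvgMr; exact: cvg_id|exact: cvg_cst].
- by apply: cvgD; [exact: h1|exact: h2].
- by apply: cvgMr; exact: h.
Qed.

Lemma bernoulli_ge (z : R) n : 0 <= z <= 1 -> 1 - n%:R * z <= (1 - z) ^+ n.
Proof.
move=> /andP[z0 z1]; elim: n => [|n IH]; first by rewrite mul0r subr0.
rewrite exprS -nat1r.
have h : (1 - z) * (1 - n%:R * z) <= (1 - z) * (1 - z) ^+ n by rewrite ler_wpM2l ?subr_ge0.
apply: le_trans h; have : 0 <= n%:R * z * z by rewrite !mulr_ge0.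
by move: (n%:R : R) => m; nra.
Qed.

(** The geometric sum of q^i for i < k has k terms, each at least q^k. Applied to the square root r
    of q it bounds k r^k, and the other factor r^k of q^k still tends to 0. *)
Lemma natmul_expr_le (q : R) k : 0 <= q < 1 -> (1 - q) * (k%:R * q ^+ k) <= 1 - q ^+ k.
Proof.
move=> /andP[q0 q1]; elim: k => [|k IH]; first by rewrite mul0r mulr0 expr0 subrr.
have qk0 : 0 <= q ^+ k by rewrite exprn_ge0.
have qk1 : q ^+ k <= 1 by rewrite exprn_ile1// ltW.
rewrite exprS -nat1r.
have -> : (1 - q) * ((1 + k%:R) * (q * q ^+ k)) =
  (1 - q) * (q * q ^+ k) + q * ((1 - q) * (k%:R * q ^+ k)) by ring.
have := ler_wpM2l q0 IH; move: ((1 - q) * (k%:R * q ^+ k)) (q ^+ k) qk0 qk1 => a b b0 b1.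
have : 0 <= (1 - q) * (1 - q * b) by rewrite mulr_ge0 ?subr_ge0 ?(ltW q1)//; nra.
nra.
Qed.

Lemma cvg_natmul_expr (q : R) : 0 <= q < 1 -> k%:R * q ^+ k @[k --> \oo] --> 0.
Proof.
move=> /andP[q0 q1]; pose r := Num.sqrt q.
have r2 : r ^+ 2 = q by rewrite sqr_sqrtr.
have r0 : 0 <= r by exact: sqrtr_ge0.
have r1 : r < 1 by rewrite -[ltRHS]sqrtr1 ltr_sqrt.
apply: (squeeze_cvgr (f := cst 0) (h := fun k => (1 - r)^-1 * r ^+ k)).
- apply: nearW => k; rewrite mulr_ge0 ?exprn_ge0//= -r2 -exprM mul2n -addnn exprD mulrA.
  rewrite ler_wpM2r ?exprn_ge0// -[leRHS]mul1r ler_pdivlMr ?subr_gt0// mulrC.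
  rewrite (le_trans (natmul_expr_le k _))//; first by rewrite r0 r1.
  by rewrite lerBlDr lerDl exprn_ge0.
- exact: cvg_cst.
- rewrite -[X in _ --> X](mulr0 (1 - r)^-1); apply: cvgMr.
  by apply: cvg_expr; rewrite ger0_norm.
Qed.

(* Threshold polynomials: they converge boundedly to the indicator of [0, 1/2). *)
Lemma threshold_cvg (y : R) : 0 <= y <= 1 ->
  (1 - y ^+ k) ^+ (k * 2 ^ k) @[k --> \oo] --> ((y < 2^-1)%R%:R : R).
Proof.
move=> /andP[y0 y1].
have yk k : 0 <= y ^+ k <= 1 by rewrite exprn_ge0//= exprn_ile1.
have [ylt|yge] := ltP y 2^-1.
  have q01 : 0 <= 2 * y < 1 by rewrite mulr_ge0//= -ltr_pdivlMl// mulr1.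
  apply: (squeeze_cvgr (f := fun k => 1 - k%:R * (2 * y) ^+ k) (h := cst 1)).
  - apply: nearW => k; apply/andP; split; last first.
      by rewrite exprn_ile1// ?subr_ge0 ?lerBlDr ?lerDl; have /andP[] := yk k.
    apply: le_trans (bernoulli_ge _ (yk k)).
    by rewrite natrM natrX exprMn mulrA.
  - rewrite -[X in _ --> X]subr0; apply: cvgB; first exact: cvg_cst.
    exact: cvg_natmul_expr.
  - exact: cvg_cst.
apply: (squeeze_cvgr (f := cst 0) (h := fun k => (expR (-1)) ^+ k)).
- apply: nearW => k; rewrite exprn_ge0 ?subr_ge0 ?(andP (yk k)).2//=.
  rewrite mulnC exprM lerXn2r ?nnegrE ?exprn_ge0 ?expR_ge0 ?subr_ge0 ?(andP (yk k)).2//.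
  have -> : expR (-1) = expR (- 2^-1 ^+ k) ^+ (2 ^ k) :> R.
    rewrite -expRM_natl natrX mulrN -exprMn divff//.
    by rewrite expr1n.
  rewrite lerXn2r ?nnegrE ?expR_ge0 ?subr_ge0 ?(andP (yk k)).2//.
  apply: le_trans (expR_ge1Dx _); rewrite lerD2l lerN2 lerXn2r ?nnegrE//.
- exact: cvg_cst.
- by apply: cvg_expr; rewrite ger0_norm ?expR_ge0// -[ltRHS]expR0 ltr_expR oppr_lt0.
Qed.

(** Thresholding (1 + sin(l(x - a)))/2 at 1/2 gives the indicator of sin(l(x - a)) < 0 as a bounded
    limit of trigonometric polynomials. For l = 1/(k+1) the sine has the sign of x - a as long as |x
    - a| < (k+1) pi, so letting k grow yields the ray. *)
Lemma trig_closure_ray (H : (R -> R) -> Prop) (a : R) :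
  (forall f, trigpoly f -> H f) ->
  (forall (f_ : nat -> R -> R) f (M : R), (forall k, H (f_ k)) ->
     (forall k x, `|f_ k x| <= M) -> (forall x, f_ ^~ x @ \oo --> f x) -> H f) ->
  H (fun x => (x < a)%R%:R).
Proof.
move=> H1 H2.
have sin_bd (x : R) : 0 <= (1 + sin x) / 2 <= 1.
  have := sin_max x; rewrite ler_norml => /andP[h1 h2].
  by apply/andP; split; lra.
have b01 (b : bool) : `|b%:R : R| <= 1 by case: b; rewrite ?normr1 ?normr0.
have S (l : R) : H (fun x => (sin (l * (x - a)) < 0)%R%:R).
  apply: (H2 (fun k x => (1 - ((1 + sin (l * (x - a))) / 2) ^+ k) ^+ (k * 2 ^ k)) _ 1).
  - move=> k; apply: H1.
    have -> : (fun x => (1 - ((1 + sin (l * (x - a))) / 2) ^+ k) ^+ (k * 2 ^ k)) =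
      (fun x => (1 + -1 * (2^-1 * (1 + cos (l * x + (- (l * a) - pi / 2)))) ^+ k) ^+ (k * 2 ^ k)).
      apply/funext => x; rewrite mulN1r; congr ((1 - _ ^+ k) ^+ _).
      rewrite mulrC -cosBpihalf; congr (_ * (_ + cos _)); ring.
    apply: trig_exp; apply: trig_add; first exact: trig_cst.
    apply: trig_scale; apply: trig_exp; apply: trig_scale.
    by apply: trig_add; [exact: trig_cst|exact: trig_cos].
  - move=> k x; have /andP[h0 h1] := sin_bd (l * (x - a)).
    have h2 : 0 <= 1 - ((1 + sin (l * (x - a))) / 2) ^+ k by rewrite subr_ge0 exprn_ile1.
    by rewrite ger0_norm ?exprn_ge0// exprn_ile1// lerBlDr lerDl exprn_ge0.
  - move=> x; have := threshold_cvg (sin_bd (l * (x - a))).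
    have -> // : ((1 + sin (l * (x - a))) / 2 < 2^-1) = (sin (l * (x - a)) < 0).
    by apply/idP/idP; lra.
apply: (H2 (fun k x => (sin (k.+1%:R^-1 * (x - a)) < 0)%R%:R) _ 1) => //.
move=> x; apply: cvg_near_cst.
exists (Num.truncn `|x - a|).+1 => // k /= hk.
have k0 : (0 : R) < k.+1%:R by rewrite ltr0n.
have hx : `|x - a| < k.+1%:R.
  by rewrite (lt_le_trans (truncnS_gt _))// ler_nat (leq_trans hk).
have pi1 : (1 : R) < pi by have := pihalf_ge1 R; lra.
have hs : `|k.+1%:R^-1 * (x - a)| < pi.
  rewrite normrM ger0_norm ?invr_ge0// mulrC ltr_pdivrMr// (lt_le_trans hx)//.
  by rewrite ler_peMl ?(ltW k0)// ltW.
congr (nat_of_bool _)%:R.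
have sgn (t : R) : 0 < t -> `|t| < pi -> 0 < sin t.
  by move=> t0; rewrite ger0_norm ?(ltW t0)// => tp; apply: sin_gt0_pi; rewrite t0.
have [xa|xa|->] := ltgtP x a.
- have : 0 < sin (- (k.+1%:R^-1 * (x - a))).
    apply: sgn; last by rewrite normrN.
    by rewrite -mulrN mulr_gt0 ?invr_gt0// opprB subr_gt0.
  by rewrite sinN oppr_gt0 => ->.
- have : 0 < sin (k.+1%:R^-1 * (x - a)).
    by apply: sgn => //; rewrite mulr_gt0 ?invr_gt0// subr_gt0.
  by move=> h; rewrite ltNge (ltW h).
- by rewrite subrr mulr0 sin0 ltxx.
Qed.

End trigonometric_approximation.

(** * From vanishing cosine moments to vanishing integrals over a sigma-algebra *)

Section uniqueness.
Context {d} {T : measurableType d} {R : realType} (P : probability T R).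
Context {I : Type} (D : set I) (X : I -> T -> R).
Hypothesis mX : forall i, D i -> measurable_fun setT (X i).
Variable A : T -> R.
Hypothesis iA : itg P A.

Definition lincomb (s : seq (R * I)) (w : T) : R := \sum_(p <- s) p.1 * X p.2 w.

(** Stated through [nth] because equality on I need not be decidable, so that boolean membership in
    a list is not at hand. *)
Definition indices_in (J : Type) (s : seq (J * I)) := forall k, (k < size s)%N ->
  forall x0, D (nth x0 s k).2.

Lemma indices_in_cons (J : Type) (p : J * I) s :
  indices_in (p :: s) <-> D p.2 /\ indices_in s.
Proof.
split=> [h|[h1 h2] [|k] //= hk x0]; last exact: h2.
by split=> [|k hk x0]; [exact: (h 0%N isT p)|exact: (h k.+1 hk x0)].
Qed.

Lemma measurable_lincomb s : indices_in s -> measurable_fun setT (lincomb s).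
Proof.
elim: s => [|p s IH] h.
  by rewrite /lincomb; under eq_fun do rewrite big_nil; exact: measurable_cst.
have [h1 h2] := (indices_in_cons _ _).1 h.
rewrite /lincomb; under eq_fun do rewrite big_cons.
by apply: measurable_funD; [apply: measurable_funM => //; exact: mX|exact: IH].
Qed.

Hypothesis char0 : forall s (theta : R), indices_in s ->
  Ex P (fun w => A w * cos (lincomb s w + theta)) = 0.

Definition below (l : seq (R * I)) (w : T) : R := \prod_(q <- l) (X q.2 w < q.1)%R%:R.

Lemma below01 l w : 0 <= below l w <= 1.
Proof.
rewrite /below; elim: l => [|q l /andP[h0 h1]]; first by rewrite big_nil ler01 lexx.
rewrite big_cons mulr_ge0//=.
by case: (_ < _); rewrite ?mul1r ?mul0r ?ler01.
Qed.

Lemma measurable_lt_cst i (a : R) : D i -> measurable_fun setT (fun w => (X i w < a)%R%:R : R).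
Proof.
move=> Di.
have -> : (fun w => (X i w < a)%R%:R : R) = \1_(X i @^-1` `]-oo, a[%classic).
  by apply/funext => w; rewrite indicE; congr ((nat_of_bool _)%:R); apply/idP/idP;
    rewrite inE /= in_itv.
by apply: measurable_indic; rewrite -[X in measurable X]setTI; exact: mX.
Qed.

Lemma measurable_below l : indices_in l -> measurable_fun setT (below l).
Proof.
elim: l => [|p s IH] h.
  by rewrite /below; under eq_fun do rewrite big_nil; exact: measurable_cst.
have [h1 h2] := (indices_in_cons _ _).1 h.
rewrite /below; under eq_fun do rewrite big_cons.
by apply: measurable_funM; [exact: measurable_lt_cst|exact: IH].
Qed.

(** One threshold factor is added at a time: for a cosine in place of the threshold, [cosM] merges
    it into the cosine of the linear combination, and [trig_closure_ray] passes from cosines to the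
    ray. The merge changes s and theta, so the induction keeps them general. *)
Lemma Ex_below_cos l : indices_in l -> forall s (theta : R), indices_in s ->
  Ex P (fun w => A w * below l w * cos (lincomb s w + theta)) = 0.
Proof.
elim: l => [_ s theta hs|q l IH hl s theta hs].
  by rewrite -[RHS](char0 theta hs); apply: eqEx => w; rewrite /below big_nil mulr1.
have [Dq Dl] := (indices_in_cons _ _).1 hl.
have mA := itg_meas iA.
have mcos r (u : R) : indices_in r -> measurable_fun setT (fun w => cos (lincomb r w + u)).
  move=> hr; apply: (measurableT_comp (f := cos)); last first.
    by apply: measurable_funD => //; exact: measurable_lincomb.
  by apply: continuous_measurable_fun; exact: continuous_cos.
have base (f : T -> R) : measurable_fun setT f -> (exists M : R, forall w, `|f w| <= M) ->
    itg P (fun w => A w * below l w * f w).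
  move=> mf [M fM]; apply: (itg_le (Y := fun w => M * `|A w|)).
  - by apply: measurable_funM => //; apply: measurable_funM => //; exact: measurable_below.
  - by apply: itgZ; exact: itg_norm.
  move=> w; rewrite !normrM mulrC ler_pM ?mulr_ge0//.
  by rewrite ler_piMr// ger0_norm; have /andP[] := below01 l w.
pose H (f : R -> R) := [/\ measurable_fun setT f, (exists M : R, forall x, `|f x| <= M) &
  forall s theta, indices_in s ->
  Ex P (fun w => A w * below l w * (f (X q.2 w) * cos (lincomb s w + theta))) = 0].
have : H (fun x => (x < q.1)%R%:R).
  apply: trig_closure_ray => [f tf|f_ f M Hf fM fc].
    split; first by apply: continuous_measurable_fun; exact: trig_continuous.
      exact: trig_bounded.
    move=> {s hs theta}.
    elim: tf => [c t|f1 f2 t1 h1 t2 h2|c f1 t1 h1] s theta hs.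
    - have p1 : indices_in ((c, q.2) :: s) by apply/indices_in_cons.
      have p2 : indices_in ((- c, q.2) :: s) by apply/indices_in_cons.
      transitivity (Ex P (fun w => 2^-1 *
          (A w * below l w * cos (lincomb ((c, q.2) :: s) w + (theta + t)) +
           A w * below l w * cos (lincomb ((- c, q.2) :: s) w + (theta - t))))).
        apply: eqEx => w; rewrite /lincomb !big_cons /= [cos _ * _]mulrC cosM.
        rewrite -mulrDr mulrCA; congr (_ * (_ * (cos _ + cos _))); ring.
      have cb r (u : R) : exists M : R, forall w, `|cos (lincomb r w + u)| <= M.
        by exists 1 => w; exact: cos_max.
      have i1 := base _ (mcos _ (theta + t) p1) (cb _ _).
      have i2 := base _ (mcos _ (theta - t) p2) (cb _ _).
      by rewrite ExZ ?ExD// ?IH// ?addr0 ?mulr0//; exact: itgD.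
    - have bb g : trigpoly g ->
          itg P (fun w => A w * below l w * (g (X q.2 w) * cos (lincomb s w + theta))).
        move=> tg; apply: base.
          apply: measurable_funM; last exact: mcos.
          apply: (measurableT_comp (f := g)); last exact: mX.
          by apply: continuous_measurable_fun; exact: trig_continuous.
        have [M hM] := trig_bounded tg; exists M => w.
        by rewrite normrM (le_trans _ (hM (X q.2 w)))// ler_piMr// cos_max.
      under eqEx do rewrite mulrDl mulrDr.
      by rewrite ExD ?h1 ?h2 ?addr0//; exact: bb.
    - have tg := t1.
      transitivity (Ex P (fun w => c * (A w * below l w * (f1 (X q.2 w) * cos (lincomb s w + theta))))).
        by apply: eqEx => w; ring.
      rewrite ExZ ?h1 ?mulr0//; apply: base.
        apply: measurable_funM; last exact: mcos.
        apply: (measurableT_comp (f := f1)); last exact: mX.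
        by apply: continuous_measurable_fun; exact: trig_continuous.
      have [M hM] := trig_bounded tg; exists M => w.
      by rewrite normrM (le_trans _ (hM (X q.2 w)))// ler_piMr// cos_max.
  have mf_ k : measurable_fun setT (f_ k) by case: (Hf k).
  split.
  - by apply: (measurable_fun_cvg mf_) => x _; exact: fc.
  - exists M => x; have c : `|f_ k x| @[k --> \oo] --> `|f x| by apply: cvg_norm; exact: fc.
    rewrite -(cvg_lim (@Rhausdorff R) c); apply: limr_le; last exact: nearW.
    by apply/cvg_ex; eexists; exact: c.
  move=> r t hr.
  have [||||_ [_ c]] := @dct _ _ _ P
    (fun k w => A w * below l w * (f_ k (X q.2 w) * cos (lincomb r w + t)))
    (fun w => A w * below l w * (f (X q.2 w) * cos (lincomb r w + t)))
    (fun w => M * `|A w|).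
  - move=> k; apply: measurable_funM.
      by apply: measurable_funM => //; exact: measurable_below.
    apply: measurable_funM; last exact: mcos.
    by apply: (measurableT_comp (f := f_ k)); [exact: mf_|exact: mX].
  - by apply: itgZ; exact: itg_norm.
  - move=> k w; rewrite normrM mulrC ler_pM//.
      by rewrite normrM (le_trans _ (fM k (X q.2 w)))// ler_piMr// cos_max.
    by rewrite normrM ler_piMr// ger0_norm; have /andP[] := below01 l w.
  - move=> w; apply: cvgMr; apply: cvgMl; exact: fc.
  have e : (fun k => Ex P (fun w => A w * below l w * (f_ k (X q.2 w) * cos (lincomb r w + t))))
     = fun=> 0 by apply/funext => k; have [_ _ ->] := Hf k.
  rewrite e in c; exact: (cvg_unique (@Rhausdorff R) c (cvg_cst _)).
move=> [_ _ /(_ s theta hs) <-]; apply: eqEx => w.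
by rewrite /below big_cons; ring.
Qed.

(** A pi-lambda argument: the sets where [below l] is 1 are the finite intersections of events X_i <
    a, they generate the sigma-algebra, and the events over which A integrates to 0 form a Dynkin
    class. The empty list supplies E A = 0, needed for complements. *)
Lemma Ex_sigma C : sigma_of D X C -> Ex P (fun w => A w * \1_C w) = 0.
Proof.
pose G : set (set T) := [set C | exists l, indices_in l /\
  C = [set w | below l w = 1]].
have GI : setI_closed G.
  move=> _ _ [l [hl ->]] [m [hm ->]]; exists (l ++ m); split.
    move=> k; rewrite size_cat => hk x0; rewrite nth_cat; case: ifP => h; first exact: hl.
    by apply: hm; rewrite ltn_subLR// leqNgt h.
  apply/seteqP; split => w /=; rewrite /below big_cat/=.
    by move=> [-> ->]; rewrite mulr1.
  move=> h; have /andP[a0 a1] := below01 l w; have /andP[b0 b1] := below01 m w.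
  by rewrite /below in a0 a1 b0 b1; move: h; split; nra.
have mG C0 : G C0 -> measurable C0.
  move=> [l [hl ->]]; rewrite -[X in measurable X]setTI.
  exact: (measurable_below hl measurableT (measurable_set1 1)).
pose K : set (set T) := [set C | measurable C /\ Ex P (fun w => A w * \1_C w) = 0].
have mind C0 : measurable C0 -> itg P (fun w => A w * \1_C0 w).
  move=> mC; apply: (itg_le (Y := fun w => `|A w|)).
  - by apply: measurable_funM; [exact: itg_meas iA|exact: measurable_indic].
  - exact: itg_norm.
  - by move=> w; rewrite normrM ler_piMr// indicE; case: (_ \in _); rewrite ?normr1 ?normr0.
have nil_in : indices_in (J := R) [::] by move=> k.
have GK : G `<=` K.
  move=> C0 GC; split; first exact: mG.
  case: GC => l [hl ->].
  rewrite -[RHS](Ex_below_cos hl 0 nil_in); apply: eqEx => w.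
  rewrite /lincomb big_nil addr0 cos0 mulr1; congr (_ * _).
  rewrite indicE; case: (boolP (w \in _)); first by rewrite inE /= => ->.
  rewrite notin_setE /= /below; elim: l {hl} => [|p l IH]; first by rewrite big_nil.
  rewrite big_cons; case: (_ < _); first by rewrite mul1r => /IH.
  by rewrite mul0r.
have A0 : Ex P A = 0.
  have [_] : K [set w | below [::] w = 1] by apply: GK; exists [::].
  move=> <-; apply: eqEx => w; rewrite indicE mem_set ?mulr1//=.
  by rewrite /below big_nil.
have Kd : dynkin K.
  split.
  - split=> //; rewrite -[RHS]A0; apply: eqEx => w.
    by rewrite indicE mem_set ?mulr1.
  - move=> C0 [mC hC]; split; first exact: measurableC.
    transitivity (Ex P (fun w => A w - A w * \1_C0 w)).
      apply: eqEx => w; rewrite !indicE in_setC.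
      by case: (_ \in _); rewrite /= ?mulr1 ?mulr0 ?subrr ?subr0.
    by rewrite ExB ?A0 ?hC ?subr0//; exact: mind.
  - move=> F tF KF.
    have mF k : measurable (F k) by case: (KF k).
    have mU : measurable (\bigcup_k F k) by exact: bigcup_measurable.
    split=> //.
    pose U n := \big[setU/set0]_(k < n) F k.
    have mUn n : measurable (U n) by apply: bigsetU_measurable.
    have z n : Ex P (fun w => A w * \1_(U n) w) = 0.
      elim: n => [|n IH].
        rewrite -[RHS](Ex_cst P 0); apply: eqEx => w.
        by rewrite /U big_ord0 indic0 mulr0.
      transitivity (Ex P (fun w => A w * \1_(U n) w + A w * \1_(F n) w)); last first.
        by rewrite ExD ?IH ?(KF n).2 ?addr0//; exact: mind.
      apply: eqEx => w; rewrite -mulrDr; congr (_ * _).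
      rewrite /U big_ord_recr /= !indicE in_setU.
      case: (boolP (w \in F n)) => wF; last by rewrite orbF addr0.
      case: (boolP (w \in \big[setU/set0]_(k < n) F k)) => [/set_mem|_]; last by rewrite add0r.
      rewrite -bigcup_mkord => -[k /= kn Fkw].
      move/set_mem: wF => Fnw; have /trivIsetP := tF.
      move=> /(_ k n Logic.I Logic.I); rewrite ltn_eqF// => /(_ isT)/seteqP[+ _].
      by move=> /(_ w (conj Fkw Fnw)).
    have [||||_ [_ c]] := @dct _ _ _ P (fun n w => A w * \1_(U n) w)
       (fun w => A w * \1_(\bigcup_k F k) w) (fun w => `|A w|).
    - by move=> k; apply: itg_meas; exact: mind.
    - exact: itg_norm.
    - by move=> k w; rewrite normrM ler_piMr// indicE; case: (_ \in _); rewrite ?normr1 ?normr0.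
    - move=> w; apply: cvgMr; apply: cvg_near_cst.
      have [[k _ Fkw]|h] := pselect ((\bigcup_k F k) w).
        exists k.+1 => // n /= kn; rewrite !indicE !mem_set//; first by exists k.
        by rewrite /U -bigcup_mkord; exists k.
      apply: nearW => n; rewrite !indicE !memNset// /U -bigcup_mkord => -[k /= kn Fkw].
      by apply: h; exists k.
    rewrite (_ : (fun n => _) = fun=> 0) in c; last by apply/funext.
    exact: (cvg_unique (@Rhausdorff R) c (cvg_cst _)).
have sK : <<s G >> `<=` K.
  rewrite -setI_closed_g_dynkin_g_sigma_algebra//.
  exact: smallest_sub.
move=> sC; have [] // : K C.
apply: sK; move: C sC; apply: smallest_sub; first exact: smallest_sigma_algebra.
move=> _ [i [B [Di mB ->]]].
have := @measurability _ _ (g_sigma_algebraType G) R setT (X i) _ (RGenInftyO.measurableE R).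
move=> /(_ _ measurableT _ mB); rewrite setTI; apply.
move=> _ [_ [a ->] <-]; rewrite setTI; apply: sub_sigma_algebra.
exists [:: (a, i)]; split; first by apply/indices_in_cons.
apply/seteqP; split=> w /=; rewrite in_itv/= /below big_seq1/=; first by move=> ->.
by case: (_ < _) => // /eqP; rewrite eq_sym oner_eq0.
Qed.

End uniqueness.

(** * Gaussian independence and integration by parts *)

Section indicators.
Context {d} {T : measurableType d} {R : realType} (P : probability T R).

Lemma itg_indic (C : set T) : measurable C -> itg P (\1_C : T -> R).
Proof.
move=> mC; apply: (@itg_bounded _ _ _ _ _ 1) => [|w]; first exact: measurable_indic.
by rewrite indicE; case: (_ \in _); rewrite ?normr1 ?normr0.
Qed.

Lemma EFin_P (C : set T) : measurable C -> (Ex P \1_C)%:E = P C.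
Proof. by move=> mC; rewrite EFin_Ex ?integral_indic ?setIT//; exact: itg_indic. Qed.

Lemma sigma_of_measurable (I : Type) (D : set I) (X : I -> T -> R) :
  (forall i, D i -> measurable_fun setT (X i)) ->
  sigma_of D X `<=` measurable.
Proof.
move=> mX; apply: smallest_sub; first exact: sigma_algebra_measurable.
move=> _ [i [A [Di mA ->]]]; rewrite -[X in measurable X]setTI; exact: mX.
Qed.

End indicators.

(** * Uncorrelated jointly Gaussian families are independent *)

Section independence.
Context {d} {T : measurableType d} {R : realType} (P : probability T R).
Context {I : Type} (D : set I) (X : I -> T -> R) (Y : T -> R).
Hypothesis mX : forall i, D i -> measurable_fun setT (X i).
Hypothesis mY : measurable_fun setT Y.
Hypothesis gXY : forall s (mu : R), indices_in D s ->
  gaussian P (fun w => lincomb X s w + mu * Y w).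
Hypothesis X0 : forall i, D i -> Ex P (X i) = 0.
Hypothesis Y0 : Ex P Y = 0.
Hypothesis XY0 : forall i, D i -> Ex P (fun w => X i w * Y w) = 0.

Let gX s : indices_in D s -> gaussian P (lincomb X s).
Proof.
move=> hs; have := gXY 0 hs.
by under eq_fun do rewrite mul0r addr0.
Qed.

Let nil_in : indices_in D ([::] : seq (R * I)).
Proof. by move=> k. Qed.

Let gY : gaussian P Y.
Proof.
have := gXY 1 nil_in.
by under eq_fun do rewrite /lincomb big_nil add0r mul1r.
Qed.

Let L2X s : indices_in D s -> L2 P (lincomb X s).
Proof. by move=> hs; apply: gaussian_L2; [exact: (measurable_lincomb mX)|exact: gX]. Qed.

Let L2Xi i : D i -> L2 P (X i).
Proof.
move=> Di; have : indices_in D [:: (1 : R, i)] by apply/indices_in_cons.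
move=> /L2X; congr L2; apply/funext => w.
by rewrite /lincomb big_seq1 mul1r.
Qed.

Let L2Y : L2 P Y.
Proof. exact: gaussian_L2. Qed.

Let lin0 s : indices_in D s ->
  Ex P (lincomb X s) = 0 /\ Ex P (fun w => lincomb X s w * Y w) = 0.
Proof.
elim: s => [|p s IH] hs.
  rewrite /lincomb; split; rewrite -[RHS](Ex_cst P); apply: eqEx => w; rewrite big_nil//.
  by rewrite mul0r.
have [h1 h2] := (indices_in_cons _ _ _).1 hs; have [IH1 IH2] := IH h2.
have e w : lincomb X (p :: s) w = p.1 * X p.2 w + lincomb X s w by rewrite /lincomb big_cons.
split.
  under eqEx do rewrite e.
  rewrite ExD ?ExZ ?IH1 ?X0 ?mulr0 ?addr0//; first exact/L2_itg/L2Xi.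
    exact/itgZ/L2_itg/L2Xi.
  exact/L2_itg/L2X.
under eqEx do rewrite e mulrDl -mulrA.
rewrite ExD ?ExZ ?IH2 ?XY0 ?mulr0 ?addr0//; first by apply: L2_mul => //; exact: L2Xi.
  by apply: itgZ; apply: L2_mul => //; exact: L2Xi.
by apply: L2_mul => //; exact: L2X.
Qed.

Let vY := Ex P (fun w => Y w ^+ 2).
Let vX s := Ex P (fun w => lincomb X s w ^+ 2).

Let charXY s (mu theta : R) : indices_in D s ->
  Ex P (fun w => cos (lincomb X s w + mu * Y w + theta)) =
  expR (- (vX s / 2)) * expR (- (mu ^+ 2 * vY / 2)) * cos theta.
Proof.
move=> hs; have [l0 lY0] := lin0 hs.
have m1 : measurable_fun setT (fun w => lincomb X s w + mu * Y w).
  by apply: measurable_funD; [exact: (measurable_lincomb mX)|exact: measurable_funM].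
have z : Ex P (fun w => lincomb X s w + mu * Y w) = 0.
  rewrite ExD ?ExZ ?l0 ?Y0 ?mulr0 ?addr0//; first exact: L2_itg.
    exact/L2_itg/L2X.
  exact/itgZ/L2_itg.
have := gaussian_char m1 (gXY mu hs) z 1 theta.
under eqEx do rewrite mul1r.
move=> ->; rewrite -expRD; congr (expR _ * _).
have -> : Ex P (fun w => (lincomb X s w + mu * Y w) ^+ 2) = vX s + mu ^+ 2 * vY.
  transitivity (Ex P (fun w => lincomb X s w ^+ 2 + (2 * mu) * (lincomb X s w * Y w) + mu ^+ 2 * Y w ^+ 2)).
    by apply: eqEx => w; ring.
  have i1 := L2_mul (L2X hs) L2Y.
  have i2 := (L2X hs).2; have i3 := L2Y.2.
  rewrite ExD; [|by apply: itgD => //; exact: itgZ|exact: itgZ].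
  rewrite ExD//; last exact: itgZ.
  by rewrite !ExZ// lY0 mulr0 addr0.
by rewrite expr1n; field.
Qed.

(** [Ex_sigma] is used twice: over sigma(X) for cos(mu Y + t) minus its mean, whose cosine moments
    vanish because the variances add up, and then over sigma(Y) for the indicator of C minus its
    probability. *)
Lemma gaussian_independent : independent_of P D X Y.
Proof.
have mcos (f : T -> R) : measurable_fun setT f -> measurable_fun setT (fun w => cos (f w)).
  move=> mf; apply: (measurableT_comp (f := cos)) => //.
  by apply: continuous_measurable_fun; exact: continuous_cos.
have icos (f : T -> R) : measurable_fun setT f -> itg P (fun w => cos (f w)).
  by move=> /mcos mf; apply: (@itg_bounded _ _ _ _ _ 1) => // w; exact: cos_max.
have mYt mu t : measurable_fun setT (fun w => mu * Y w + t).
  by apply: measurable_funD => //; exact: measurable_funM.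
have char1 mu t : Ex P (fun w => cos (mu * Y w + t)) = expR (- (mu ^+ 2 * vY / 2)) * cos t.
  exact: gaussian_char.
have step1 mu t C : sigma_of D X C -> measurable C ->
    Ex P (fun w => \1_C w * cos (mu * Y w + t)) = Ex P \1_C * Ex P (fun w => cos (mu * Y w + t)).
  move=> sC mC; pose k := Ex P (fun w => cos (mu * Y w + t)).
  have iA : itg P (fun w => cos (mu * Y w + t) - k).
    by apply: itgB; [exact: icos|exact: itg_cst].
  have i1 : itg P (\1_C : T -> R).
    apply: (@itg_bounded _ _ _ _ _ 1) => [|w]; first exact: measurable_indic.
    by rewrite indicE; case: (_ \in _); rewrite ?normr1 ?normr0.
  have i2 : itg P (fun w => \1_C w * cos (mu * Y w + t)).
    apply: (@itg_bounded _ _ _ _ _ 1) => [|w].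
      by apply: measurable_funM; [exact: measurable_indic|exact: mcos].
    by rewrite normrM mulr_ile1 ?cos_max// indicE; case: (_ \in _); rewrite ?normr1 ?normr0.
  have : Ex P (fun w => (cos (mu * Y w + t) - k) * \1_C w) = 0.
    apply: (@Ex_sigma _ _ _ P I D X mX _ iA) => // s theta hs.
    have ms := measurable_lincomb mX hs.
    have j1 : itg P (fun w => cos (lincomb X s w + mu * Y w + (theta + t))).
      by apply: icos; apply: measurable_funD => //; apply: measurable_funD => //; exact: measurable_funM.
    have j2 : itg P (fun w => cos (lincomb X s w + (- mu) * Y w + (theta - t))).
      by apply: icos; apply: measurable_funD => //; apply: measurable_funD => //; exact: measurable_funM.
    have j3 : itg P (fun w => cos (lincomb X s w + theta)).
      by apply: icos; apply: measurable_funD.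
    transitivity (Ex P (fun w => 2^-1 * (cos (lincomb X s w + mu * Y w + (theta + t)) +
       cos (lincomb X s w + (- mu) * Y w + (theta - t))) - k * cos (lincomb X s w + theta))).
      apply: eqEx => w; rewrite mulrBl [cos _ * cos _]mulrC cosM.
      by congr (_ * (cos _ + cos _) - _); ring.
    rewrite ExB; [|by apply: itgZ; exact: itgD|exact: itgZ].
    rewrite !ExZ//; last exact: itgD.
    rewrite ExD// !charXY// /k char1 sqrrN.
    have -> : Ex P (fun w => cos (lincomb X s w + theta)) = expR (- (vX s / 2)) * cos theta.
      have := charXY 0 theta hs; rewrite expr0n/= !mul0r oppr0 expR0 mulr1 => <-.
      by apply: eqEx => w; rewrite mul0r addr0.
    by rewrite cosD cosB; field.
  have -> : Ex P (fun w => (cos (mu * Y w + t) - k) * \1_C w) =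
      Ex P (fun w => \1_C w * cos (mu * Y w + t)) - k * Ex P \1_C.
    rewrite -ExZ// -ExB//; last exact: itgZ.
    by apply: eqEx => w; ring.
  by move=> /eqP; rewrite subr_eq0 mulrC => /eqP.
move=> B C mB sC; have mC := sigma_of_measurable mX sC.
have mYB : measurable (Y @^-1` B) by rewrite -[X in measurable X]setTI; exact: mY.
pose c := Ex P \1_C.
have i1 : itg P (\1_C : T -> R) by exact: itg_indic.
have iA : itg P (fun w => \1_C w - c) by apply: itgB => //; exact: itg_cst.
have mYu : forall i : unit, setT i -> measurable_fun setT (fun w => Y w) by [].
have : Ex P (fun w => (\1_C w - c) * \1_(Y @^-1` B) w) = 0.
  (* A family indexed by [unit] has the sigma-algebra of Y alone. *)
  apply: (@Ex_sigma _ _ _ P unit setT (fun _ => Y) mYu _ iA); last first.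
    by apply: sub_sigma_algebra; exists tt, B.
  move=> s theta _.
  have -> : lincomb (fun=> Y) s = (fun w => (\sum_(p <- s) p.1) * Y w).
    by apply/funext => w; rewrite /lincomb mulr_suml.
  set mu := \sum_(p <- s) _.
  transitivity (Ex P (fun w => \1_C w * cos (mu * Y w + theta) - c * cos (mu * Y w + theta))).
    by apply: eqEx => w; ring.
  rewrite ExB; last 2 first.
  - apply: (@itg_bounded _ _ _ _ _ 1) => [|w].
      by apply: measurable_funM; [exact: measurable_indic|exact: mcos].
    by rewrite normrM mulr_ile1 ?cos_max// indicE; case: (_ \in _); rewrite ?normr1 ?normr0.
  - by apply: itgZ; exact: icos.
  by rewrite ExZ ?step1 ?subrr//; exact: icos.
have -> : Ex P (fun w => (\1_C w - c) * \1_(Y @^-1` B) w) =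
    Ex P \1_(Y @^-1` B `&` C) - c * Ex P \1_(Y @^-1` B).
  rewrite -ExZ; last exact: itg_indic.
  rewrite -ExB; [|apply: itg_indic; exact: measurableI|apply: itgZ; exact: itg_indic].
  by apply: eqEx => w; rewrite indicI /=; ring.
move=> /eqP; rewrite subr_eq0 => /eqP e.
rewrite -(@EFin_P _ _ _ P (Y @^-1` B `&` C)) -?(@EFin_P _ _ _ P (Y @^-1` B)) -?(@EFin_P _ _ _ P C)//; last exact: measurableI.
by rewrite e -EFinM mulrC.
Qed.

End independence.

(** * Integrating out an independent variable *)

Section product_law.
Context {d d1 d2} {T : measurableType d} {T1 : measurableType d1} {T2 : measurableType d2}.
Context {R : realType} (P : probability T R) (N : probability T2 R).
Context (f : {mfun T >-> T1}) (g : {mfun T >-> T2}).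
Hypothesis fg : forall A B, measurable A -> measurable B ->
  P (f @^-1` A `&` g @^-1` B) = (P (f @^-1` A) * N B)%E.

Definition pair_fun (w : T) : T1 * T2 := (f w, g w).

Lemma measurable_pair_fun : measurable_fun setT pair_fun.
Proof. exact: measurable_fun_pair. Qed.

HB.instance Definition _ := isMeasurableFun.Build _ _ _ _ pair_fun measurable_pair_fun.

Lemma product_lawE (A : set (T1 * T2)) : measurable A ->
  (distribution P f \x N)%E A = distribution P pair_fun A.
Proof.
move: A; apply: product_measure_unique => A B mA mB.
by rewrite /distribution /pushforward -fg.
Qed.

Lemma product_law_integral (Phi : T1 * T2 -> R) : measurable_fun setT Phi ->
  itg P (fun w => Phi (f w, g w)) ->
  itg P (fun w => Ex N (fun y => Phi (f w, y))) /\
  Ex P (fun w => Phi (f w, g w)) = Ex P (fun w => Ex N (fun y => Phi (f w, y))).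
Proof.
move=> mPhi iPhi.
have mPhiE : measurable_fun setT (EFin \o Phi) by exact/measurable_EFinP.
have iQ : (distribution P pair_fun).-integrable setT (EFin \o Phi).
  exact: integrable_pushforward.
have iQ' : (distribution P f \x N)%E.-integrable setT (EFin \o Phi).
  move/integrableP : iQ => [_ iQ]; apply/integrableP; split => //.
  apply: le_lt_trans iQ; rewrite le_eqVlt; apply/orP; left; apply/eqP.
  by apply: eq_measure_integral => A mA _; exact: product_lawE.
have iF := integrable_fubini_F iQ'; have mF := measurable_int _ iF.
have iFf : P.-integrable setT (fubini_F N (EFin \o Phi) \o f).
  move/integrableP : (iF) => [_ iF']; apply/integrableP; split.
    exact: measurableT_comp.
  have := @ge0_integral_distribution _ _ _ _ _ P f (abse \o fubini_F N (EFin \o Phi)).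
  move=> /(_ _ _)/esym; rewrite /comp => -> //.
  exact: measurableT_comp.
have mfine : measurable_fun setT (EFin \o (fun w => Ex N (fun y => Phi (f w, y)))).
  apply/measurable_EFinP; apply: measurableT_comp; first exact: fine_measurable.
  exact: measurable_int iFf.
split.
  (* [fine] sends an infinite inner integral to 0, so the real-valued version is dominated by
     [fubini_F]. *)
  apply: (le_integrable measurableT mfine _ iFf) => w _ /=.
  rewrite /Rintegral /fubini_F /=.
  case: (\int[N]_y (Phi (f w, y))%:E)%E => [r||] /=; first exact: lexx.
  - by rewrite normr0 leey.
  - by rewrite normr0 leey.
transitivity (fine (\int[distribution P pair_fun]_z (Phi z)%:E)).
  rewrite integral_distribution//.
have -> : (\int[distribution P pair_fun]_z (Phi z)%:E =
    \int[distribution P f]_x \int[N]_y (Phi (x, y))%:E)%E.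
  have := integral12_prod_meas1 iQ'; rewrite /fubini_F /= => ->.
  by apply/esym/eq_measure_integral => A mA _; exact: product_lawE.
rewrite (integral_distribution (f := fubini_F N (EFin \o Phi)))//.
congr fine; apply: ae_eq_integral => //.
- exact: measurable_int iFf.
- have := integrable_ae measurableT iFf; apply: filterS => w /= h _.
  by rewrite /Rintegral fineK//; exact: h.
Qed.

End product_law.

Section fubini.
Context {d} {T : measurableType d} {R : realType} (P : probability T R).
Context {I : Type} (D : set I) (X : I -> T -> R) (Y : T -> R) (m s : R).
Hypothesis mX : forall i, D i -> measurable_fun setT (X i).
Hypothesis mY : measurable_fun setT Y.
Hypothesis lawY : forall A, measurable A -> P (Y @^-1` A) = normal_prob m s A.
Hypothesis indXY : independent_of P D X Y.

Definition sigma_gen : set (set T) := [set C | exists i (A : set R),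
         [/\ D i, measurable A & C = X i @^-1` A]].

(** The first factor is T itself with the sigma-algebra generated by X, reached by the identity map;
    thus Phi may depend on the whole family X, however large D is. *)
Lemma independent_integral
    (Phi : g_sigma_algebraType sigma_gen * measurableTypeR R -> R) :
  measurable_fun setT Phi -> itg P (fun w => Phi (w, Y w)) ->
  itg P (fun w => Ex (normal_prob m s) (fun y => Phi (w, y))) /\
  Ex P (fun w => Phi (w, Y w)) =
  Ex P (fun w => Ex (normal_prob m s) (fun y => Phi (w, y))).
Proof.
move=> mPhi iPhi.
have mid : measurable_fun setT (fun w : T => w : g_sigma_algebraType sigma_gen).
  by move=> _ B mB; rewrite setTI; exact: (sigma_of_measurable mX mB).
pose f : {mfun T >-> g_sigma_algebraType sigma_gen} :=
  HB.pack (fun w : T => w : g_sigma_algebraType sigma_gen) (isMeasurableFun.Build _ _ _ _ _ mid).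
pose g : {mfun T >-> measurableTypeR R} :=
  HB.pack (Y : T -> measurableTypeR R)
   (isMeasurableFun.Build _ _ T (measurableTypeR R) (Y : T -> measurableTypeR R) mY).
apply: (@product_law_integral _ _ _ _ _ _ R P (normal_prob m s) f g) => // A B mA mB.
rewrite setIC; apply: (eq_trans (indXY mB mA)).
by rewrite muleC; congr (_ * _)%E; exact: lawY.
Qed.

Lemma measurable_sigma_gen i : D i ->
  measurable_fun setT (fun w : g_sigma_algebraType sigma_gen => X i w).
Proof. by move=> Di _ B mB; rewrite setTI; apply: sub_sigma_algebra; exists i, B. Qed.

End fubini.

(** * Variables with moments of all orders *)

Section moments.
Context {d} {T : measurableType d} {R : realType} (P : probability T R).
Implicit Types X Y : T -> R.

(** Unlike [L2], this class is stable under products, so integrability of the polynomial expressions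
    in Gaussian variables below is automatic. *)
Definition Lall X := measurable_fun setT X /\ forall n, itg P (fun w => `|X w| ^+ n).

Lemma Lall_meas X : Lall X -> measurable_fun setT X. Proof. by case. Qed.

Lemma Lall_itg X : Lall X -> itg P X.
Proof. by move=> [mX /(_ 1%N) iX]; apply: itg_le iX _ => // w; rewrite expr1. Qed.

Lemma Lall_L2 X : Lall X -> L2 P X.
Proof.
move=> [mX /(_ 2) iX]; split => //.
have -> // : (fun w => X w ^+ 2) = (fun w => `|X w| ^+ 2).
by apply/funext => w; rewrite real_normK ?num_real.
Qed.

Lemma measurable_normX X n : measurable_fun setT X -> measurable_fun setT (fun w => `|X w| ^+ n).
Proof. by move=> mX; apply: measurable_funX; exact: measurableT_comp. Qed.

Lemma Lall_le X Y : measurable_fun setT X -> Lall Y -> (forall w, `|X w| <= `|Y w|) -> Lall X.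
Proof.
move=> mX [mY iY] XY; split=> // n; apply: itg_le (iY n) _; first exact: measurable_normX.
by move=> w; rewrite ger0_norm ?exprn_ge0// lerXn2r ?nnegrE.
Qed.

Lemma Lall_cst k : Lall (fun=> k).
Proof. by split=> // n; exact: itg_cst. Qed.

Lemma Lall_norm X : Lall X -> Lall (fun w => `|X w|).
Proof.
move=> [mX iX]; split; first exact: measurableT_comp.
by move=> n; have := iX n; under [X in _ -> itg P X]eq_fun do rewrite normr_id.
Qed.

Lemma Lall_mul X Y : Lall X -> Lall Y -> Lall (fun w => X w * Y w).
Proof.
move=> [mX iX] [mY iY]; split; first exact: measurable_funM.
move=> n; apply: (itg_le (Y := fun w => `|X w| ^+ (n * 2) + `|Y w| ^+ (n * 2))).
- by apply: measurable_normX; exact: measurable_funM.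
- exact: itgD.
move=> w; rewrite ger0_norm ?exprn_ge0// normrM exprMn !exprM.
have := sqr_ge0 (`|X w| ^+ n - `|Y w| ^+ n); have := exprn_ge0 n (normr_ge0 (X w)).
have := exprn_ge0 n (normr_ge0 (Y w)).
by move: (`|X w| ^+ n) (`|Y w| ^+ n) => a b; nra.
Qed.

Lemma Lall_add X Y : Lall X -> Lall Y -> Lall (fun w => X w + Y w).
Proof.
move=> [mX iX] [mY iY]; split; first exact: measurable_funD.
move=> n; apply: (itg_le (Y := fun w => 2 ^+ n * (`|X w| ^+ n + `|Y w| ^+ n))).
- by apply: measurable_normX; exact: measurable_funD.
- by apply: itgZ; exact: itgD.
move=> w; rewrite ger0_norm ?exprn_ge0//.
wlog h : X Y {mX iX mY iY} / `|X w| <= `|Y w|.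
  move=> H; have [|/ltW] := leP `|X w| `|Y w|; first exact: H.
  by move=> /H; rewrite addrC [X in _ * X]addrC.
apply: (@le_trans _ _ ((2 * `|Y w|) ^+ n)).
  by rewrite lerXn2r ?nnegrE ?mulr_ge0// (le_trans (ler_normD _ _))// mulr_natl mulr2n lerD2r.
by rewrite exprMn ler_wpM2l ?exprn_ge0// lerDr exprn_ge0.
Qed.

Lemma Lall_exp X n : Lall X -> Lall (fun w => X w ^+ n).
Proof.
move=> lX; elim: n => [|n IH]; first exact: Lall_cst.
by under eq_fun do rewrite exprS; exact: Lall_mul.
Qed.

Lemma Lall_sum (J : Type) (s : seq J) (X : J -> T -> R) :
  (forall i, Lall (X i)) -> Lall (fun w => \sum_(i <- s) X i w).
Proof.
move=> iX; elim: s => [|i s IH].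
  by under eq_fun do rewrite big_nil; exact: Lall_cst.
by under eq_fun do rewrite big_cons; exact: Lall_add.
Qed.

Lemma gaussian_Lall X : measurable_fun setT X -> gaussian P X -> Lall X.
Proof.
move=> mX gX; split=> // n.
apply: (gaussian_itg mX gX (g := fun x => `|x| ^+ n)).
  apply: measurable_funX; exact: normr_measurable.
by apply: pg_exp; exists 1, 1%N => x; rewrite normr_id mul1r expr1 lerDr.
Qed.

End moments.

(** * Functions of finitely many real variables *)

Section row_functions.
Context {R : realType} {m : nat}.
Local Notation isd x f df := (is_derive (x : R) (1 : R) f df).

Lemma row_norm_le (v : 'rV[R]_m) (M : R) : 0 <= M -> (forall i, `|v 0 i| <= M) -> `|v| <= M.
Proof.
move=> M0 h; rewrite [`|v|]mx_normrE.
by apply: bigmax_le => // -[i j] _ /=; rewrite (ord1 i).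
Qed.

Lemma row_norm_sum (x : 'I_m -> R) : `|\row_i x i| <= \sum_i `|x i|.
Proof.
apply: row_norm_le; first by apply: sumr_ge0.
by move=> i; rewrite mxE (bigD1 i)//= lerDl sumr_ge0.
Qed.

(** Rounding each coordinate down to a multiple of 1/(k+1) leaves countably many values, so the
    rounded function is measurable by countable unions; continuity of g gives the limit. *)
Lemma measurable_row d (T : measurableType d) (x : 'I_m -> T -> R) (g : 'rV[R]_m -> R) :
  continuous g -> (forall i, measurable_fun setT (x i)) ->
  measurable_fun setT (fun w => g (\row_i x i w)).
Proof.
move=> cg mx.
pose q (k : nat) (w : T) : 'rV[int]_m := \row_i Num.floor (k.+1%:R * x i w).
pose e (k : nat) (v : 'rV[int]_m) : 'rV[R]_m := \row_i ((v 0 i)%:~R / k.+1%:R).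
have mg k : measurable_fun setT (fun w => g (e k (q k w))).
  move=> _ B mB; rewrite setTI.
  have -> : (fun w => g (e k (q k w))) @^-1` B =
      \bigcup_v (if `[< B (g (e k v)) >] then q k @^-1` [set v] else set0).
    apply/seteqP; split=> w /=.
      by move=> h; exists (q k w) => //; case: asboolP.
    by move=> [v _]; case: asboolP => // h /= ->.
  apply: countable_bigcupT_measurable => [|v]; first exact: countableP.
  case: ifP => // _.
  have -> : q k @^-1` [set v] =
      \bigcap_i ((fun w => Num.floor (k.+1%:R * x i w)) @^-1` [set v 0 i]).
    apply/seteqP; split=> w /=; first by move=> qv i _ /=; rewrite -qv mxE.
    by move=> h; apply/rowP => i; rewrite mxE; exact: h.
  apply: fin_bigcap_measurable => [|i _]; first exact: finite_finset.
  have -> : (fun w => Num.floor (k.+1%:R * x i w)) @^-1` [set v 0 i] =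
     (fun w => k.+1%:R * x i w) @^-1` `[(v 0 i)%:~R, (v 0 i + 1)%:~R[%classic.
    apply/seteqP; split=> w /=; rewrite in_itv/=.
      by move=> <-; rewrite floor_le_tmp floorD1_gt.
    by move=> h; apply/eqP; rewrite floor_eq.
  rewrite -[X in measurable X]setTI.
  by apply: (measurable_funM (measurable_cst _) (mx i)).
apply: (measurable_fun_cvg mg) => w _.
apply: (cvg_comp _ g); last exact: cg.
apply/cvgrPdist_le => /= eps eps0.
exists (Num.truncn eps^-1) => // k /= hk.
have k0 : (0 : R) < k.+1%:R by rewrite ltr0n.
apply: row_norm_le; first exact: ltW.
move=> i; rewrite !mxE.
have /andP[h1 h2] : (Num.floor (k.+1%:R * x i w))%:~R <= k.+1%:R * x i w < (Num.floor (k.+1%:R * x i w) + 1)%:~R.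
  by rewrite floor_le_tmp floorD1_gt.
rewrite intrD in h2.
have -> : x i w - (Num.floor (k.+1%:R * x i w))%:~R / k.+1%:R =
    (k.+1%:R * x i w - (Num.floor (k.+1%:R * x i w))%:~R) / k.+1%:R.
  by field; rewrite gt_eqF.
rewrite normrM (ger0_norm (_ : 0 <= k.+1%:R^-1)) ?invr_ge0 ?ltW//.
rewrite ltr_pdivrMr// ger0_norm ?subr_ge0//.
apply: (@lt_le_trans _ _ 1); first by rewrite ltrBlDl.
rewrite -ler_pdivrMl// mulr1.
by rewrite (le_trans (ltW (truncnS_gt _)))// ler_nat.
Qed.

Lemma isd_row (g : 'rV[R]_m -> R) (c x : 'I_m -> R) (y : R) :
  (forall p, differentiable g p) ->
  isd y (fun y => g (\row_i (c i * y + x i)))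
    (\sum_i c i * partial i g (\row_i (c i * y + x i))).
Proof.
move=> dg.
pose l (y : R) : 'rV[R]_m := y *: (\row_i c i) + \row_i x i.
have el z : \row_i (c i * z + x i) = l z.
  by apply/rowP => i; rewrite !mxE mulrC.
have -> : (fun y => g (\row_i (c i * y + x i))) = g \o l.
  by apply/funext => z; rewrite el.
have dl : is_diff y l (fun z => z *: (\row_i c i)).
  apply: is_diff_eq.
  by apply/funext => z /=; rewrite addr0.
have dlc : differentiable l y by case: dl.
have dgl := differentiable_comp dlc (dg (l y)).
apply: DeriveDef; first exact/diff_derivable.
have dv : 'd l y = (fun z => z *: (\row_i c i)) :> (R -> 'rV[R]_m) by exact: diff_val.
rewrite deriveE// diff_comp//= dv /= scale1r.
rewrite [X in 'd g _ X](row_sum_delta) linear_sum /=; apply: eq_bigr => i _.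
rewrite mxE.
have -> : 'd g (l y) (c i *: 'e_i) = c i * 'd g (l y) 'e_i by exact: linearZ.
congr (_ * _).
rewrite /partial el.
rewrite deriveE//.
Qed.

Lemma row_affine_norm (c x : 'I_m -> R) : exists A : R, 0 <= A /\
  forall y, 1 + `|\row_i (c i * y + x i)| <= A * (1 + `|y|).
Proof.
exists (1 + \sum_i (`|c i| + `|x i|)).
have s0 : 0 <= \sum_i (`|c i| + `|x i|) by apply: sumr_ge0 => i _; rewrite addr_ge0.
split; first by rewrite addr_ge0.
move=> y; have : `|\row_i (c i * y + x i)| <= (\sum_i (`|c i| + `|x i|)) * (1 + `|y|).
  apply: (le_trans (row_norm_sum _)); rewrite mulr_suml; apply: ler_sum => i _.
  rewrite (le_trans (ler_normD _ _))// normrM.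
  have := normr_ge0 (c i); have := normr_ge0 (x i); have := normr_ge0 y.
  by move: `|c i| `|x i| `|y| => p q r; nra.
by have := normr_ge0 y; move: `|y| `|\row_i _| (\sum_i _) s0 => p q r; nra.
Qed.

End row_functions.

(** * Gaussian integration by parts in several variables *)

Section gaussian_integration_by_parts.
Context {d} {T : measurableType d} {R : realType} (P : probability T R).
Local Notation isd x f df := (is_derive (x : R) (1 : R) f df).

Lemma gaussian_family_lincomb (I : Type) (D : set I) (X : I -> T -> R) s :
  gaussian_family P D X -> indices_in D s -> gaussian P (lincomb X s).
Proof.
move=> gX hs.
have := gX (size s) (fun i => (tnth (in_tuple s) i).1) (fun i => (tnth (in_tuple s) i).2).
have -> : (fun w => \sum_(i < size s) (tnth (in_tuple s) i).1 * X (tnth (in_tuple s) i).2 w) = lincomb X s.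
  by apply/funext => w; rewrite /lincomb [RHS]big_tnth.
by apply=> i; rewrite (tnth_nth (tnth (in_tuple s) i)); apply: hs => /=.
Qed.

Lemma ae0_Ex (Z Y : T -> R) : measurable_fun setT Z -> measurable_fun setT Y ->
  {ae P, forall w, Y w = 0} -> Ex P (fun w => Z w * Y w) = 0.
Proof.
move=> mZ mY h; rewrite /Rintegral (ae_eq_integral (cst 0%E)) //=.
- by rewrite integral0.
- by apply/measurable_EFinP; exact: measurable_funM.
- by apply: filterS h => w -> _; rewrite mulr0.
Qed.

(** The indices [Some i] carry the arguments of g and [None] an additional linear factor, the B_t in
    the integrand phi B; a single family lets all of them be decorrelated from Y at once. *)
Variables (m : nat) (X : option 'I_m -> T -> R) (Y : T -> R) (g : 'rV[R]_m -> R).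
Hypothesis mX : forall i, measurable_fun setT (X i).
Hypothesis mY : measurable_fun setT Y.
Hypothesis gXY : forall s (mu : R), gaussian P (fun w => lincomb X s w + mu * Y w).
Hypothesis X0 : forall i, Ex P (X i) = 0.
Hypothesis Y0 : Ex P Y = 0.
Hypothesis sg : smooth_poly_growth g.

Lemma smooth_growth0 : (forall p, differentiable g p) /\ exists (C : R) (N : nat),
  0 <= C /\ forall x, `|g x| <= C * (1 + `|x|) ^+ N.
Proof.
have [dg [C [N h]]] := sg [::]; split=> //; exists `|C|, N; split=> // x.
by rewrite (le_trans (h x))// ler_wpM2r ?ler_norm// exprn_ge0// addr_ge0.
Qed.

Lemma smooth_growth_partial i : smooth_poly_growth (partial i g).
Proof.
by move=> s; have := sg (rcons s i); rewrite foldr_rcons.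
Qed.

Lemma gaussian_Xi i : gaussian P (X i).
Proof.
have := gXY [:: (1, i)] 0; congr gaussian; apply/funext => w.
by rewrite /lincomb big_seq1 mul1r mul0r addr0.
Qed.

Lemma gaussian_Y : gaussian P Y.
Proof.
have := gXY [::] 1; congr gaussian; apply/funext => w.
by rewrite /lincomb big_nil add0r mul1r.
Qed.

Lemma Lall_row (h : 'rV[R]_m -> R) : smooth_poly_growth h -> Lall P (fun w => h (\row_i X (Some i) w)).
Proof.
move=> sh; have [dh [C [N hb]]] := sh [::].
have lX i : Lall P (X i) by apply: gaussian_Lall; [exact: mX|exact: gaussian_Xi].
have lS : Lall P (fun w => C * (1 + \sum_i `|X (Some i) w|) ^+ N).
  apply: Lall_mul; first exact: Lall_cst.
  apply: Lall_exp; apply: Lall_add; first exact: Lall_cst.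
  by apply: Lall_sum => i; exact: Lall_norm.
apply: (Lall_le _ lS).
  by apply: measurable_row => // p; apply: differentiable_continuous; exact: dh.
move=> w; rewrite (le_trans (hb _))// normrM.
have a0 : 0 <= 1 + `|\row_i X (Some i) w| by rewrite addr_ge0.
apply: (@le_trans _ _ (`|C| * (1 + `|\row_i X (Some i) w|) ^+ N)).
  by rewrite ler_wpM2r ?ler_norm// exprn_ge0.
rewrite ler_wpM2l// (le_trans _ (ler_norm _))// lerXn2r ?nnegrE ?addr_ge0 ?sumr_ge0//.
by rewrite lerD2l row_norm_sum.
Qed.

Lemma pg_row (h : 'rV[R]_m -> R) (c x : 'I_m -> R) : smooth_poly_growth h ->
  pg (fun y => h (\row_i (c i * y + x i))).
Proof.
move=> sh; have [dh [C [N hb]]] := sh [::].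
have [A [A0 hA]] := row_affine_norm c x.
exists (`|C| * A ^+ N), N => y; rewrite (le_trans (hb _))// -mulrA -exprMn.
apply: (@le_trans _ _ (`|C| * (1 + `|\row_i (c i * y + x i)|) ^+ N)).
  by rewrite ler_wpM2r ?ler_norm// exprn_ge0// addr_ge0.
rewrite ler_wpM2l// lerXn2r ?nnegrE ?addr_ge0//.
by rewrite mulr_ge0// addr_ge0.
Qed.

(* The X_i are split as c_i Y + (part independent of Y); conditionally on the
   latter this is one-dimensional integration by parts. *)
Lemma gaussian_ibp_row :
  Ex P (fun w => g (\row_i X (Some i) w) * X None w * Y w) =
  \sum_i Ex P (fun w => X (Some i) w * Y w) *
         Ex P (fun w => partial i g (\row_j X (Some j) w) * X None w) +
  Ex P (fun w => X None w * Y w) * Ex P (fun w => g (\row_i X (Some i) w)).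
Proof.
have lX i : Lall P (X i) by apply: gaussian_Lall; [exact: mX|exact: gaussian_Xi].
have lY : Lall P Y by apply: gaussian_Lall => //; exact: gaussian_Y.
have lg := Lall_row sg.
have lpg i := Lall_row (smooth_growth_partial i).
case: (gaussian_centered mY gaussian_Y Y0) => [[s [s0 sv lawY]]|[v0 h]]; last first.
  rewrite (@ae0_Ex (fun w => g (\row_i X (Some i) w) * X None w))//; last first.
    exact: Lall_meas (Lall_mul lg (lX None)).
  rewrite big1 => [|i _]; by rewrite (ae0_Ex (mX _) mY h) mul0r ?addr0.
pose c i := Ex P (fun w => X i w * Y w) / s ^+ 2.
pose Xp i w := X i w - c i * Y w.
have mXp i : measurable_fun setT (Xp i).
  by apply: measurable_funB => //; exact: measurable_funM.
have s20 : s ^+ 2 != 0 by rewrite expf_neq0.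
have ind : independent_of P setT Xp Y.
  apply: gaussian_independent => //.
  - move=> r mu _; have := gXY r (mu - \sum_(p <- r) p.1 * c p.2).
    congr gaussian; apply/funext => w; rewrite /lincomb.
    have -> : \sum_(p <- r) p.1 * Xp p.2 w =
        \sum_(p <- r) p.1 * X p.2 w - (\sum_(p <- r) p.1 * c p.2) * Y w.
      by rewrite mulr_suml -sumrB; apply: eq_bigr => p _; rewrite /Xp; ring.
    by ring.
  - move=> i _; rewrite ExB ?X0 ?ExZ ?Y0 ?mulr0 ?subr0//; first exact: Lall_itg.
      exact: Lall_itg.
    by apply: itgZ; exact: Lall_itg.
  - move=> i _; have i1 : itg P (fun w => X i w * Y w) by apply/Lall_itg/Lall_mul.
    have i2 : itg P (fun w => Y w ^+ 2) by apply/Lall_itg/Lall_exp.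
    transitivity (Ex P (fun w => X i w * Y w - c i * Y w ^+ 2)).
      by apply: eqEx => w; rewrite /Xp; ring.
    by rewrite ExB// ?ExZ// -?sv ?/c ?divfK ?subrr//; exact: itgZ.
have rowE w : \row_i X (Some i) w = \row_i (c (Some i) * Y w + Xp (Some i) w).
  by apply/rowP => i; rewrite !mxE /Xp; ring.
have NoneE w : X None w = c None * Y w + Xp None w by rewrite /Xp; ring.
pose S := (g_sigma_algebraType (sigma_gen setT Xp) * measurableTypeR R)%type.
pose K (z : S) := c None * z.2 + Xp None z.1.
pose Phi (h : 'rV[R]_m -> R) (z : S) := h (\row_i (c (Some i) * z.2 + Xp (Some i) z.1)).
have maff i : measurable_fun setT (fun z : S => c i * z.2 + Xp i z.1).
  apply: measurable_funD.
    by apply: measurable_funM; [exact: measurable_cst|exact: measurable_snd].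
  apply: (measurableT_comp (f := fun w : g_sigma_algebraType (sigma_gen setT Xp) => Xp i w)).
    exact: measurable_sigma_gen.
  exact: measurable_fst.
have mPhi h : smooth_poly_growth h -> measurable_fun setT (Phi h).
  move=> sh; apply: (measurable_row (x := fun i (z : S) => c (Some i) * z.2 + Xp (Some i) z.1)).
    by move=> p; apply: differentiable_continuous; exact: (sh [::]).1.
  by move=> i; exact: maff.
have mK : measurable_fun setT K by exact: maff.
have e1 := @independent_integral _ _ _ P _ setT Xp Y 0 s (fun i _ => mXp i) mY lawY ind
   (fun z => Phi g z * K z * z.2).
have e2 i := @independent_integral _ _ _ P _ setT Xp Y 0 s (fun i _ => mXp i) mY lawY ind
   (fun z => Phi (partial i g) z * K z).
have e3 := @independent_integral _ _ _ P _ setT Xp Y 0 s (fun i _ => mXp i) mY lawY ind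
   (Phi g).
rewrite (eqEx P (Y := fun w => Phi g (w, Y w) * K (w, Y w) * Y w)); last first.
  by move=> w; rewrite rowE NoneE.
rewrite (e1 _ _).2; last 2 first.
- by apply: measurable_funM; [apply: measurable_funM => //; exact: mPhi|exact: measurable_snd].
- have : itg P (fun w => g (\row_i X (Some i) w) * X None w * Y w).
    by apply: Lall_itg; do 2 apply: Lall_mul => //.
  by congr itg; apply/funext => w; rewrite rowE NoneE.
have iPhi i : itg P (fun w => Phi (partial i g) (w, Y w) * K (w, Y w)).
  have := Lall_itg (Lall_mul (lpg i) (lX None)).
  by congr itg; apply/funext => w; rewrite rowE NoneE.
have iPg : itg P (fun w => Phi g (w, Y w)).
  by have := Lall_itg lg; congr itg; apply/funext => w; rewrite rowE.
have mrow h w : smooth_poly_growth h ->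
    measurable_fun setT (fun y : R => h (\row_j (c (Some j) * y + Xp (Some j) w))).
  move=> sh; apply: (measurable_row (x := fun i y => c (Some i) * y + Xp (Some i) w)) => [p|j].
    by apply: differentiable_continuous; exact: (sh [::]).1.
  by apply: measurable_funD => //; exact: measurable_funM.
have mKw w : measurable_fun setT (fun y : R => c None * y + Xp None w).
  by apply: measurable_funD => //; exact: measurable_funM.
have pK w : pg (fun y : R => c None * y + Xp None w).
  apply: pg_add; last exact: (@pg_bounded _ _ `|Xp None w|).
  by apply: pg_mul; [exact: (@pg_bounded _ _ `|c None|)|exact: pg_id].
have iN w i : itg (normal_prob 0 s) (fun y => Phi (partial i g) (w, y) * K (w, y)).
  apply: (@itg_normal_pg _ 0 s s0 (fun y => partial i g (\row_j (c (Some j) * y + Xp (Some j) w)) *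
    (c None * y + Xp None w))).
    by apply: measurable_funM => //; apply: mrow; exact: smooth_growth_partial.
  by apply: pg_mul => //; apply: pg_row; exact: smooth_growth_partial.
have iNg w : itg (normal_prob 0 s) (fun y => Phi g (w, y)).
  apply: (@itg_normal_pg _ 0 s s0 (fun y => g (\row_j (c (Some j) * y + Xp (Some j) w)))).
    exact: mrow.
  exact: pg_row.
transitivity (Ex P (fun w =>
    \sum_i (c (Some i) * s ^+ 2) * Ex (normal_prob 0 s) (fun y => Phi (partial i g) (w, y) * K (w, y)) +
    (c None * s ^+ 2) * Ex (normal_prob 0 s) (fun y => Phi g (w, y)))).
  apply: eqEx => w.
  pose gw (y : R) := g (\row_i (c (Some i) * y + Xp (Some i) w)).
  pose gw' (y : R) := \sum_i c (Some i) * partial i g (\row_i (c (Some i) * y + Xp (Some i) w)).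
  pose kw (y : R) := c None * y + Xp None w.
  have dgw y : isd y gw (gw' y) by exact: isd_row smooth_growth0.1.
  have dkw y : isd y kw (c None).
    by apply: isd_eq (isdD (isdZ (c None) (isd_id y)) (isd_cst y (Xp None w))) _; ring.
  have cgw' : continuous gw'.
    rewrite /gw' => y; elim: (index_enum 'I_m) => [|i r IH].
      by under eq_fun do rewrite big_nil; exact: cvg_cst.
    under eq_fun do rewrite big_cons; apply: cvgD; last exact: IH.
    apply: cvgMr.
    exact: isd_continuous (isd_row (c \o Some) (fun i => Xp (Some i) w) y (smooth_growth_partial i [::]).1).
  have pgw' : pg gw'.
    rewrite /gw'; elim: (index_enum 'I_m) => [|i r IH].
      by apply: (@pg_bounded _ _ 0) => y; rewrite big_nil normr0.
    under eq_fun do rewrite big_cons; apply: pg_add => //; apply: pg_mul.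
      by apply: (@pg_bounded _ _ `|c (Some i)|).
    by apply: pg_row; exact: smooth_growth_partial.
  have pgw : pg gw by exact: pg_row.
  have := @normal_ibp _ 0 s s0 (fun y => gw y * kw y) (fun y => gw' y * kw y + gw y * c None)
    (fun y => isdM (dgw y) (dkw y)).
  have h1 : continuous (fun y => gw' y * kw y + gw y * c None).
    move=> y; apply: cvgD; first by apply: cvgM; [exact: cgw'|exact: isd_continuous (dkw y)].
    by apply: cvgMl; exact: isd_continuous (dgw y).
  have h2 : pg (fun y => gw' y * kw y + gw y * c None).
    apply: pg_add; first exact: pg_mul pgw' (pK w).
    by apply: pg_mul => //; exact: (@pg_bounded _ _ `|c None|).
  move=> /(_ h1 (pg_mul pgw (pK w)) h2) E.
  transitivity (Ex (normal_prob 0 s) (fun y => (y - 0) * (gw y * kw y))).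
    by apply: eqEx => y; rewrite subr0 [RHS]mulrC.
  have iS i : itg (normal_prob 0 s) (fun y => c (Some i) * (Phi (partial i g) (w, y) * K (w, y))).
    by apply: itgZ; exact: iN.
  rewrite E; transitivity (s ^+ 2 * Ex (normal_prob 0 s) (fun y =>
      \sum_i c (Some i) * (Phi (partial i g) (w, y) * K (w, y)) + c None * Phi g (w, y))).
    congr (_ * _); apply: eqEx => y; congr (_ + _); last by rewrite mulrC.
    by rewrite mulr_suml; apply: eq_bigr => i _; rewrite mulrA.
  rewrite ExD; [|by apply: itg_sum|by apply: itgZ; exact: iNg].
  rewrite Ex_sum// mulrDr mulr_sumr; congr (_ + _).
    apply: eq_bigr => i _; rewrite ExZ; last exact: iN.
    by rewrite mulrCA mulrA.
  by rewrite ExZ; [rewrite mulrCA mulrA|exact: iNg].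
have {}e2 i := e2 i (measurable_funM (mPhi _ (smooth_growth_partial i)) mK) (iPhi i).
have {}e3 := e3 (mPhi _ sg) iPg.
rewrite ExD; last 2 first.
- by apply: itg_sum => i; apply: itgZ; exact: (e2 i).1.
- by apply: itgZ; exact: e3.1.
rewrite Ex_sum => [|i]; last by apply: itgZ; exact: (e2 i).1.
congr (_ + _).
  apply: eq_bigr => i _; rewrite ExZ; last exact: (e2 i).1.
  rewrite /c divfK//; congr (_ * _).
  by rewrite -(e2 i).2; apply: eqEx => w; rewrite rowE NoneE.
rewrite ExZ; last exact: e3.1.
rewrite /c divfK//; congr (_ * _).
by rewrite -e3.2; apply: eqEx => w; rewrite rowE.
Qed.

End gaussian_integration_by_parts.

(** * The covariance of fractional Brownian motion and Riemann sums *)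

Section dot_product.
Context {R : realType} {V : completeNormedModType R} (ip : {dot V for idfun}).
Hypothesis ipE : forall v, ip v v = `|v| ^+ 2.

Lemma ipC u v : ip u v = ip v u.
Proof. by rewrite (hermC ip) expr0 mul1r. Qed.

Lemma ipDl u v w : ip (u + v) w = ip u w + ip v w.
Proof. exact: linearDl. Qed.

Lemma ipDr u v w : ip u (v + w) = ip u v + ip u w.
Proof. exact: linearDr. Qed.

Lemma ipBl u v w : ip (u - v) w = ip u w - ip v w.
Proof. exact: linearBl. Qed.

Lemma ipBr u v w : ip u (v - w) = ip u v - ip u w.
Proof. exact: linearBr. Qed.

Lemma ipZl a u w : ip (a *: u) w = a * ip u w.
Proof. exact: linearZl_LR. Qed.

Lemma ipZr a u w : ip u (a *: w) = a * ip u w.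
Proof. by rewrite ipC ipZl ipC. Qed.

Lemma ip0l w : ip 0 w = 0.
Proof. exact: linear0l. Qed.

Lemma ip_suml (I : Type) (s : seq I) (P : pred I) (f : I -> V) w :
  ip (\sum_(i <- s | P i) f i) w = \sum_(i <- s | P i) ip (f i) w.
Proof.
elim: s => [|i s IH]; first by rewrite !big_nil ip0l.
by rewrite !big_cons; case: ifP => // _; rewrite ipDl IH.
Qed.

Lemma ip_sumr (I : Type) (s : seq I) (P : pred I) (f : I -> V) w :
  ip w (\sum_(i <- s | P i) f i) = \sum_(i <- s | P i) ip w (f i).
Proof. by rewrite ipC ip_suml; apply: eq_bigr => i _; rewrite ipC. Qed.

Lemma ip_le (u v : V) : `|ip u v| <= `|u| * `|v|.
Proof.
have [->|v0] := eqVneq v 0; first by rewrite ipC ip0l !normr0 mulr0.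
have n0 : 0 < `|v| by rewrite normr_gt0.
have := sqr_ge0 `|u - (ip u v / `|v| ^+ 2) *: v|.
rewrite -ipE ipBl !ipBr !ipZl !ipZr (ipC v u) !ipE.
set c := ip u v.
have -> : `|u| ^+ 2 - c / `|v| ^+ 2 * c - (c / `|v| ^+ 2 * c - c / `|v| ^+ 2 * (c / `|v| ^+ 2 * `|v| ^+ 2)) =
  `|u| ^+ 2 - c ^+ 2 / `|v| ^+ 2 by field; rewrite gt_eqF.
rewrite subr_ge0 ler_pdivrMr ?exprn_gt0// -exprMn => h.
by rewrite -(@ler_pXn2r _ 2) ?nnegrE ?mulr_ge0// real_normK ?num_real.
Qed.

Lemma ip_cvgl (v_ : nat -> V) v w : v_ k @[k --> \oo] --> v ->
  ip (v_ k) w @[k --> \oo] --> ip v w.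
Proof.
move=> c; apply/subr_cvg0; apply: norm_cvg0.
apply: (squeeze_cvgr (f := cst 0) (h := fun k => `|v_ k - v| * `|w|)).
- by apply: nearW => k; rewrite normr_ge0/= -ipBl ip_le.
- exact: cvg_cst.
- rewrite -[X in _ --> X](mul0r `|w|); apply: cvgMl.
  rewrite -(normr0 V); apply: cvg_norm; rewrite -(subrr v).
  by apply: cvgB => //; exact: cvg_cst.
Qed.

End dot_product.

Section covariance.
Context {R : realType} (H : R).
Hypothesis hH : 2^-1 < H < 1.
Local Notation p := (2 * H).

Lemma p_bounds : 1 < p < 2.
Proof. by move/andP: hH => [h1 h2]; apply/andP; split; lra. Qed.

(** The inner points are convex combinations of the outer ones with exchanged weights; the two
    convexity inequalities add up to the claim. *)
Lemma powR_convex4 (x0 x1 x2 x3 : R) : 0 <= x0 -> x0 <= x1 -> x0 <= x2 ->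
  x1 + x2 = x0 + x3 -> x1 `^ p + x2 `^ p <= x0 `^ p + x3 `^ p.
Proof.
move=> h0 h1 h2 e; have [x30|x30] := eqVneq x3 x0.
  have -> : x1 = x0 by lra.
  by have -> : x2 = x3 by lra.
have d0 : 0 < x3 - x0 by rewrite lt_def subr_eq0 x30 /=; lra.
have l0 : 0 <= (x3 - x1) / (x3 - x0) by rewrite divr_ge0 ?(ltW d0)//; lra.
have l1 : (x3 - x1) / (x3 - x0) <= 1 by rewrite ler_pdivrMr// mul1r; lra.
have p1 : 1 <= p by have /andP[/ltW] := p_bounds.
have key (l : R) (l0' : 0 <= l) (l1' : l <= 1) :
    x0 \in (`[0, +oo[%classic : set R) -> x3 \in (`[0, +oo[%classic : set R) ->
    (l * x0 + (1 - l) * x3) `^ p <= l * x0 `^ p + (1 - l) * x3 `^ p.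
  by move=> a b; exact: (@convex_powR R p p1 (Itv01 l0' l1') x0 x3 a b).
have x3m : (x3 : R) \in (`[0, +oo[%classic : set R) by rewrite inE /= in_itv/= andbT; lra.
have x0m : (x0 : R) \in (`[0, +oo[%classic : set R) by rewrite inE /= in_itv/= andbT; lra.
have := key _ l0 l1 x0m x3m.
have l0' : 0 <= 1 - (x3 - x1) / (x3 - x0) by rewrite subr_ge0.
have l1' : 1 - (x3 - x1) / (x3 - x0) <= 1 by rewrite lerBlDr lerDl.
have := key _ l0' l1' x0m x3m.
set l := (x3 - x1) / (x3 - x0) in l0 l1 l0' l1' *.
have le : l * (x3 - x0) = x3 - x1 by rewrite /l divfK// gt_eqF.
have e1 : l * x0 + (1 - l) * x3 = x1 by lra.
have e2 : (1 - l) * x0 + (1 - (1 - l)) * x3 = x2 by lra.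
rewrite e1 e2; set A := x0 `^ p; set C := x3 `^ p; set D1 := x1 `^ p; set D2 := x2 `^ p.
nra.
Qed.

Lemma fbm_covC s t : fbm_cov H s t = fbm_cov H t s.
Proof. by rewrite /fbm_cov distrC [t `^ _ + _]addrC. Qed.

Lemma fbm_cov0 t : 0 <= t -> fbm_cov H 0 t = 0.
Proof.
move=> t0; rewrite /fbm_cov powR0 ?subr0; last by have /andP[] := p_bounds; lra.
by rewrite addr0 (ger0_norm t0) subrr mulr0.
Qed.

Lemma fbm_cov11 : fbm_cov H 1 1 = 1.
Proof.
rewrite /fbm_cov subrr normr0 powR0; last by have /andP[] := p_bounds; lra.
by rewrite powR1; field.
Qed.

(** The covariance of the increments B_b - B_a and B_d - B_c. *)
Definition cov_incr (a b c d : R) :=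
  fbm_cov H b d - fbm_cov H b c - (fbm_cov H a d - fbm_cov H a c).

Lemma cov_incrE a b c d : cov_incr a b c d = 2^-1 *
  (`|d - a| `^ p + `|c - b| `^ p - `|c - a| `^ p - `|d - b| `^ p).
Proof. by rewrite /cov_incr /fbm_cov; ring. Qed.

Lemma cov_incr_ge0 a b c d : a <= b -> b <= c -> c <= d -> 0 <= cov_incr a b c d.
Proof.
move=> ab bc cd; rewrite cov_incrE.
rewrite !ger0_norm; [|lra..].
have : (c - a) `^ p + (d - b) `^ p <= (c - b) `^ p + (d - a) `^ p.
  by apply: powR_convex4; lra.
lra.
Qed.

Lemma cov_incr_self a b : a <= b -> cov_incr a b a b = (b - a) `^ p.
Proof.
move=> ab; rewrite cov_incrE !subrr normr0 powR0; last by have /andP[] := p_bounds; lra.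
by rewrite (distrC a b) (ger0_norm (_ : 0 <= b - a)) ?subr_ge0//; field.
Qed.

Lemma cov_incrC a b c d : cov_incr a b c d = cov_incr c d a b.
Proof. by rewrite /cov_incr !(fbm_covC c) !(fbm_covC d); ring. Qed.

End covariance.

(** * Uniform grids and their common refinements *)

Section grid.
Context {R : realType}.

Definition grid (N j : nat) : R := j%:R / N%:R.

Lemma grid_ge0 N j : 0 <= grid N j.
Proof. by rewrite divr_ge0. Qed.

Lemma grid_le N i j : (i <= j)%N -> grid N i <= grid N j.
Proof. by move=> ij; rewrite ler_wpM2r ?invr_ge0// ler_nat. Qed.

Lemma grid0 N : grid N 0 = 0.
Proof. by rewrite /grid mul0r. Qed.

Lemma gridN N : (0 < N)%N -> grid N N = 1.
Proof. by move=> N0; rewrite /grid divff// pnatr_eq0 -lt0n. Qed.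

Lemma grid_mem N j : (0 < N)%N -> (j <= N)%N -> grid N j \in `[0, 1].
Proof. by move=> N0 jN; rewrite in_itv/= grid_ge0/= -(gridN N0) grid_le. Qed.

Lemma gridS N j : grid N j.+1 - grid N j = N%:R^-1.
Proof. by rewrite /grid -nat1r; ring. Qed.

Lemma grid_mull k l i : (0 < l)%N -> grid (k * l) (i * l) = grid k i.
Proof.
move=> l0; rewrite /grid !natrM -mulf_div divff ?mulr1// pnatr_eq0 -lt0n//.
Qed.

Lemma grid_near k l j : (0 < k)%N -> (0 < l)%N ->
  `|grid k (j %/ l) - grid (k * l) j| <= k%:R^-1.
Proof.
move=> k0 l0.
have kR : (0 : R) < k%:R by rewrite ltr0n.
have lR : (0 : R) < l%:R by rewrite ltr0n.
rewrite -(grid_mull k (j %/ l) l0) distrC ger0_norm; last first.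
  by rewrite subr_ge0 grid_le// leq_trunc_div.
rewrite -mulrBl -natrB ?leq_trunc_div// ler_pdivrMr ?ltr0n ?muln_gt0 ?k0//.
rewrite natrM mulrA mulVf ?gt_eqF// mul1r ler_nat.
rewrite {1}(divn_eq j l) addKn ltnW// ltn_mod//.
Qed.

(** Expressing sums of meshes 1/k and 1/l on the common grid of mesh 1/(kl) lets them be subtracted
    term by term, which is how all Cauchy properties are obtained. *)
Lemma riemann_refine (E : lmodType R) (y : nat -> R) (X : R -> E) k l : (0 < l)%N ->
  \sum_(0 <= i < k) y i *: (X (grid k i.+1) - X (grid k i)) =
  \sum_(0 <= j < k * l) y (j %/ l)%N *: (X (grid (k * l) j.+1) - X (grid (k * l) j)).
Proof.
move=> l0; rewrite big_nat_mul; apply: eq_big_nat => i /andP[_ ik].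
transitivity (\sum_(i * l <= j < i.+1 * l) y i *: (X (grid (k * l) j.+1) - X (grid (k * l) j))).
  rewrite -scaler_sumr telescope_sumr ?leq_mul2r ?leqnSn ?orbT//.
  by rewrite !grid_mull.
apply: eq_big_nat => j /andP[h1 h2]; congr (y _ *: _).
by apply/eqP; rewrite eqn_leq leq_divRL// h1 -ltnS ltn_divLR.
Qed.

End grid.

Section integral_monotonicity.
Local Open Scope ereal_scope.
Context {d} {T : measurableType d} {R : realType} (mu : {measure set T -> \bar R}).

(* The integral of a nonnegative function, measurable or not, is the supremum of
   the integrals of the simple functions below it. *)
Lemma le_lower_integral (D : set T) (f g : T -> \bar R) :
  (forall x, D x -> 0 <= f x) -> (forall x, D x -> f x <= g x) ->
  \int[mu]_(x in D) f x <= \int[mu]_(x in D) g x.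
Proof.
move=> f0 fg; rewrite integral_mkcond [leRHS]integral_mkcond.
have h0 x : 0 <= (f \_ D) x by rewrite patchE; case: ifPn => // /set_mem/f0.
have h1 x : (f \_ D) x <= (g \_ D) x.
  by rewrite !patchE; case: ifPn => // /set_mem/fg.
rewrite !ge0_integralTE//; last by move=> x; exact: le_trans (h1 x).
apply: ub_ereal_sup => _ [h hf <-]; apply: ereal_sup_ubound; exists h => // x.
exact: le_trans (hf x) (h1 x).
Qed.

End integral_monotonicity.

Section uniform_continuity.
Context {R : realType}.

Lemma within_near (y : R -> R) (x : R) : {within `[0, 1], continuous y} -> x \in `[0, 1] ->
  forall e, 0 < e -> exists2 d, 0 < d & forall s, s \in `[0, 1] -> `|x - s| < d ->
    `|y x - y s| <= e.
Proof.
move=> cy x01 e e0.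
have x01' : (`[0, 1]%classic : set R) x by [].
have /(_ x x01') := (subspace_continuousP _ (y : R -> R)).1 cy.
move=> /cvgrPdist_le /(_ e e0).
rewrite /prop_near1 /within /= => /nbhs_ballP [d /= d0 h].
by exists d => // s s01 xs; exact: (h s).
Qed.

(** Heine's theorem, from the near-covering form of compactness with the filter of radii tending to
    0 from the right. *)
Lemma within_unif_cont (y : R -> R) : {within `[0, 1], continuous y} ->
  forall e, 0 < e -> exists2 d, 0 < d & forall s t, s \in `[0, 1] -> t \in `[0, 1] ->
    `|s - t| <= d -> `|y s - y t| <= e.
Proof.
move=> cy e e0.
have := (compact_near_coveringP (`[0, 1]%classic : set R)).1 (@segment_compact R 0 1).
move=> /(_ R (0^'+) (fun d s => s \in `[0, 1] -> forall t, t \in `[0, 1] ->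
  `|s - t| <= d -> `|y s - y t| <= e) _).
have e20 : 0 < e / 2 by rewrite divr_gt0.
move=> h; have /h : forall x : R, `[0, 1]%classic x -> \forall x' \near x & i \near 0^'+,
    (x' \in `[0, 1] -> forall t, t \in `[0, 1] -> `|x' - t| <= i -> `|y x' - y t| <= e).
  move=> x x01; have [d d0 hd] := within_near cy x01 e20.
  exists (ball x (d / 2), [set i | i < d / 2]) => /=.
    split; first by apply: nbhsx_ballx; rewrite divr_gt0.
    by apply: nbhs_right_lt; rewrite divr_gt0.
  move=> [x' i] /= [xx' di] x'01 t t01 x't.
  have h1 : `|x - x'| < d / 2 by [].
  have h3 : `|x - t| < d.
    by rewrite (_ : x - t = (x - x') + (x' - t)); [apply: le_lt_trans (ler_normD _ _) _; lra|ring].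
  have h4 : `|x - x'| < d by lra.
  have := hd _ t01 h3; have := hd _ x'01 h4.
  rewrite (_ : y x' - y t = (y x - y t) - (y x - y x')); last by ring.
  by move=> h5 h6; apply: le_trans (ler_normB _ _) _; lra.
move=> hn; have : \forall d \near 0^'+, (0 < d) /\ (`[0, 1]%classic `<=` (fun s : R => s \in `[0, 1] -> forall t, t \in `[0, 1] ->
  `|s - t| <= d -> `|y s - y t| <= e)).
  by near=> d; split; near: d; [exact: nbhs_right_gt|exact: hn].
by move=> /filter_ex [d [d0 hd]]; exists d => // s t s01 t01; exact: hd.
Unshelve. all: by end_near. Qed.

End uniform_continuity.

Section riemann_sums.
Context {R : realType}.

Definition riem (E : lmodType R) (X : R -> E) (y : R -> R) (N : nat) : E :=
  \sum_(0 <= j < N) y (grid N j) *: (X (grid N j.+1) - X (grid N j)).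

Lemma riem_sub (E : lmodType R) (X : R -> E) y k l : (0 < k)%N -> (0 < l)%N ->
  riem X y k - riem X y l = \sum_(0 <= j < k * l)
    (y (grid k (j %/ l)) - y (grid l (j %/ k))) *:
      (X (grid (k * l) j.+1) - X (grid (k * l) j)).
Proof.
move=> k0 l0; rewrite /riem (riemann_refine (fun i => y (grid k i)) X k l0).
rewrite (riemann_refine (fun i => y (grid l i)) X l k0) mulnC -sumrB.
by apply: eq_bigr => j _; rewrite scalerBl mulnC.
Qed.

Lemma grid_near2 k l j : (0 < k)%N -> (0 < l)%N ->
  `|grid k (j %/ l) - grid l (j %/ k)| <= k%:R^-1 + l%:R^-1 :> R.
Proof.
move=> k0 l0; have h1 := grid_near j k0 l0 : _ <= _ :> R; have h2 := grid_near j l0 k0 : _ <= _ :> R.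
rewrite mulnC in h2; rewrite (_ : _ - _ = (grid k (j %/ l) - grid (k * l) j) -
  (grid l (j %/ k) - grid (k * l) j)); last by ring.
by apply: le_trans (ler_normB _ _) _; exact: lerD.
Qed.

Lemma grid_mem2 k l j : (j < k * l)%N -> grid k (j %/ l) \in (`[0, 1] : interval R).
Proof.
move=> jkl; have k0 : (0 < k)%N by case: k jkl.
have l0 : (0 < l)%N by case: l jkl; rewrite ?muln0.
by rewrite grid_mem// ltnW// ltn_divLR.
Qed.

Lemma unif_cont_grid (y : R -> R) : {within `[0, 1], continuous y} -> forall e : R, 0 < e ->
  exists2 K, (0 < K)%N & forall k l j, (K <= k)%N -> (K <= l)%N -> (j < k * l)%N ->
    `|y (grid k (j %/ l)) - y (grid l (j %/ k))| <= e.
Proof.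
move=> cy e e0; have [d d0 hd] := within_unif_cont cy e0.
have [K K0] : exists2 K : nat, (0 < K)%N & K%:R^-1 <= d / 2.
  exists (Num.truncn (2 / d)).+1 => //.
  rewrite -[leRHS]invrK lef_pV2 ?posrE ?invr_gt0 ?divr_gt0//.
  by rewrite invf_div ltW// truncnS_gt.
move=> Kd; exists K => // k l j kK lK jkl; apply: hd.
- exact: grid_mem2 jkl.
- by apply: (@grid_mem2 l k j); rewrite mulnC.
- have k0 : (0 < k)%N by apply: leq_trans kK.
  have l0 : (0 < l)%N by apply: leq_trans lK.
  apply: le_trans (grid_near2 j k0 l0) _.
  have h m : (K <= m)%N -> m%:R^-1 <= K%:R^-1 :> R.
    by move=> Km; rewrite lef_pV2 ?posrE ?ltr0n ?ler_nat// (leq_trans K0).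
  have := h _ kK; have := h _ lK; lra.
Qed.

End riemann_sums.

(** * Covariances of grid increments as probability weights *)

Section increments.
Context {R : realType} (H : R) (hH : 2^-1 < H < 1).
Local Notation c N i j := (cov_incr H (grid N i) (grid N i.+1) (grid N j) (grid N j.+1)).

Lemma cov_grid_ge0 N i j : 0 <= c N i j.
Proof.
wlog ij : i j / (i <= j)%N.
  by move=> h; have [/h//|/ltnW/h] := leqP i j; rewrite cov_incrC.
move: ij; rewrite leq_eqVlt => /orP[/eqP ->|ij].
  by rewrite cov_incr_self ?powR_ge0 ?grid_le.
by apply: cov_incr_ge0; rewrite ?grid_le.
Qed.

Lemma cov_incr_sum a b (x : nat -> R) N :
  \sum_(0 <= j < N) cov_incr H a b (x j) (x j.+1) = cov_incr H a b (x 0%N) (x N).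
Proof.
pose F j := fbm_cov H b (x j) - fbm_cov H a (x j).
transitivity (\sum_(0 <= j < N) (F j.+1 - F j)).
  by apply: eq_bigr => j _; rewrite /F /cov_incr; ring.
by rewrite telescope_sumr// /F /cov_incr; ring.
Qed.

Lemma cov_grid_sum N : (0 < N)%N -> \sum_(0 <= i < N) \sum_(0 <= j < N) c N i j = 1.
Proof.
move=> N0; under eq_bigr do rewrite cov_incr_sum cov_incrC.
by rewrite cov_incr_sum grid0 gridN// cov_incr_self// subr0 powR1.
Qed.

(** The weights are nonnegative because H > 1/2, and their total is the variance of B_1, namely 1. A
    uniform bound on coefficients thus bounds a norm in V, whatever the mesh. *)
Lemma cov_grid_le N (b : nat -> nat -> R) M : (0 < N)%N ->
  (forall i j, (i < N)%N -> (j < N)%N -> b i j <= M) ->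
  \sum_(0 <= i < N) \sum_(0 <= j < N) b i j * c N i j <= M.
Proof.
move=> N0 bM; rewrite -[leRHS]mulr1 -(cov_grid_sum N0) mulr_sumr.
rewrite [leLHS]big_nat [leRHS]big_nat; apply: ler_sum => i /= iN.
rewrite mulr_sumr [leLHS]big_nat [leRHS]big_nat; apply: ler_sum => j /= jN.
by rewrite ler_wpM2r ?cov_grid_ge0 ?bM.
Qed.

Context (V : completeNormedModType R) (ip : {dot V for idfun}) (ind : R -> V).
Hypothesis ipE : forall v, ip v v = `|v| ^+ 2.
Hypothesis ip_ind : forall s t : R, s \in `[0, 1] -> t \in `[0, 1] ->
  ip (ind s) (ind t) = fbm_cov H s t.

Lemma ind0 : ind 0 = 0.
Proof.
apply/eqP; rewrite -normr_eq0 -sqrf_eq0 -ipE ip_ind ?bound_itvE//.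
by rewrite fbm_cov0.
Qed.

Lemma ip_incr N i j : (i < N)%N -> (j < N)%N ->
  ip (ind (grid N i.+1) - ind (grid N i)) (ind (grid N j.+1) - ind (grid N j)) = c N i j.
Proof.
move=> iN jN; rewrite ipBl !ipBr !ip_ind ?grid_mem// ?(leq_ltn_trans _ iN)// ?(ltnW iN)// ?(ltnW jN)//.

Qed.

Lemma norm_incr_sum N (b : nat -> R) :
  `|\sum_(0 <= j < N) b j *: (ind (grid N j.+1) - ind (grid N j))| ^+ 2 =
  \sum_(0 <= i < N) \sum_(0 <= j < N) b i * b j * c N i j.
Proof.
rewrite -ipE ip_suml; apply: eq_big_nat => i /= iN.
rewrite ip_sumr; apply: eq_big_nat => j /= jN.
by rewrite ipZl ipZr ip_incr// mulrA.
Qed.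

Lemma norm_incr_le N (b : nat -> R) M : (0 < N)%N -> 0 <= M ->
  (forall j, (j < N)%N -> `|b j| <= M) ->
  `|\sum_(0 <= j < N) b j *: (ind (grid N j.+1) - ind (grid N j))| <= M.
Proof.
move=> N0 M0 bM; rewrite -(@ler_pXn2r _ 2) ?nnegrE// norm_incr_sum.
apply: cov_grid_le => // i j iN jN; apply: le_trans (ler_norm _) _.
by rewrite normrM expr2 ler_pM// bM.
Qed.

Lemma riem_cvg (y : R -> R) : {within `[0, 1], continuous y} ->
  cvg (riem ind y k @[k --> \oo]).
Proof.
move=> cy; apply: cauchy_cvg; apply: cauchy_exP => e e0.
have e20 : 0 < e / 2 by rewrite divr_gt0.
have [K K0 hK] := unif_cont_grid cy e20.
exists (riem ind y K); suff : \forall k \near \oo, ball (riem ind y K) e (riem ind y k) by [].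
near=> k; have Kk : (K <= k)%N by near: k; exact: nbhs_infty_ge.
rewrite -ball_normE /= riem_sub//; last exact: leq_trans Kk.
apply: (@le_lt_trans _ _ (e / 2)); last by lra.
apply: norm_incr_le => [||j jk]; [|exact: ltW|exact: hK].
by rewrite muln_gt0 K0 (leq_trans K0).
Unshelve. all: by end_near. Qed.

End increments.

(** * Classes of continuous functions *)

Section abs_power.
Context {R : realType}.
Local Notation isd x f df := (is_derive (x : R) (1 : R) f df).

Definition apow (a x : R) : R := `|x| `^ a.

(* sgn(x) |x|^a, written so that its continuity is that of [apow a]. *)
Definition spow (a x : R) : R := apow a ((`|x| + x) / 2) - apow a ((`|x| - x) / 2).

Lemma apow_ge0 a x : 0 <= apow a x. Proof. exact: powR_ge0. Qed.

Lemma apow0 a : a != 0 -> apow a 0 = 0.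
Proof. by move=> a0; rewrite /apow normr0 powR0. Qed.

Lemma apow_pos a x : 0 <= x -> apow a x = x `^ a.
Proof. by move=> x0; rewrite /apow ger0_norm. Qed.

Lemma spow_pos a x : a != 0 -> 0 <= x -> spow a x = x `^ a.
Proof.
move=> a0 x0; rewrite /spow ger0_norm// subrr mul0r apow0// subr0.
by rewrite -mulr2n -[x *+ 2]mulr_natr mulfK ?pnatr_eq0// apow_pos.
Qed.

Lemma spow_neg a x : a != 0 -> x <= 0 -> spow a x = - (- x) `^ a.
Proof.
move=> a0 x0; rewrite /spow ler0_norm// addNr mul0r apow0// sub0r.
by rewrite -mulr2n -[_ *+ 2]mulr_natr mulfK ?pnatr_eq0// apow_pos// oppr_ge0.
Qed.

Lemma spow_le1 a x : 0 < a -> `|x| <= 1 -> `|spow a x| <= 1.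
Proof.
move=> a0 x1; have h y : 0 <= y -> y <= 1 -> y `^ a <= 1.
  by move=> y0 y1; have := @ge0_ler_powR R a (ltW a0) y 1; rewrite powR1; apply; rewrite ?nnegrE.
have [x0|/ltW x0] := leP 0 x.
  by rewrite spow_pos ?gt_eqF// ger0_norm ?powR_ge0// h//; move: x1; rewrite ger0_norm.
rewrite spow_neg ?gt_eqF// normrN ger0_norm ?powR_ge0// h ?oppr_ge0//.
by move: x1; rewrite ler0_norm.
Qed.

Lemma isd_apow_pos (a x : R) : 0 < x -> isd x (apow a) (a * x `^ (a - 1)).
Proof.
move=> x0; apply: (@near_eq_is_derive _ _ _ (fun y : R => y `^ a)).
  by near=> y; rewrite apow_pos// ltW//; near: y; exact: lt_nbhsr.
exact: is_derive1_powR.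
Unshelve. all: by end_near. Qed.

Lemma isd_apow_neg (a x : R) : x < 0 -> isd x (apow a) (- (a * (- x) `^ (a - 1))).
Proof.
move=> x0; have -> : apow a = (fun y => apow a (- y)).
  by apply/funext => y; rewrite /apow normrN.
apply: (@isd_eq _ _ _ (- 1 * (a * (- x) `^ (a - 1)))); last by rewrite mulN1r.
apply: (@isd_comp _ x (fun y : R => - y) (apow a)).
  by apply: isd_apow_pos; rewrite oppr_gt0.

Qed.

Lemma apow_cvg0 (a : R) : 0 < a -> apow a x @[x --> (0 : R)] --> (0 : R).
Proof.
move=> a0; apply/cvgrPdist_le => e e0; near=> x.
rewrite sub0r normrN ger0_norm ?apow_ge0//.
have : `|x| <= e `^ a^-1.
  rewrite -normrN -[- x]sub0r; near: x; apply: cvgr_dist_le; first exact: cvg_id.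
  by rewrite powR_gt0.
move=> h; apply: le_trans (_ : (e `^ a^-1) `^ a <= _).
  by rewrite ge0_ler_powR ?nnegrE ?powR_ge0// ltW.
by rewrite -powRrM mulVf ?gt_eqF// powRr1// ltW.
Unshelve. all: by end_near. Qed.

Lemma apow_continuous (a : R) : 0 < a -> continuous (apow a : R -> R).
Proof.
move=> a0 x; have [x0|x0|->] := ltgtP x 0.
- exact: isd_continuous (isd_apow_neg a x0).
- exact: isd_continuous (isd_apow_pos a x0).
- rewrite /continuous_at apow0 ?gt_eqF//; exact: apow_cvg0.
Qed.

Lemma spow_continuous (a : R) : 0 < a -> continuous (spow a : R -> R).
Proof.
move=> a0 x; apply: cvgB.
- apply: (@continuous_comp _ _ _ (fun x : R => (`|x| + x) / 2) (apow a)); last exact: apow_continuous.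
  by apply: cvgMl; apply: cvgD; [exact: norm_continuous|exact: cvg_id].
- apply: (@continuous_comp _ _ _ (fun x : R => (`|x| - x) / 2) (apow a)); last exact: apow_continuous.
  by apply: cvgMl; apply: cvgB; [exact: norm_continuous|exact: cvg_id].
Qed.

(** At 0 the difference quotient has absolute value |h|^(p-1), which tends to 0 as p > 1. *)
Lemma isd_apow (p x : R) : 1 < p -> isd x (apow p) (p * spow (p - 1) x).
Proof.
move=> p1; have p0 : 0 < p - 1 by rewrite subr_gt0.
have [x0|x0|->] := ltgtP x 0.
- apply: (isd_eq (isd_apow_neg p x0)).
  by rewrite spow_neg ?(ltW x0) ?gt_eqF// mulrN.
- by apply: (isd_eq (isd_apow_pos p x0)); rewrite spow_pos ?(ltW x0) ?gt_eqF.
- rewrite spow_pos ?gt_eqF// powR0 ?gt_eqF// mulr0.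
  have c0 : h^-1 *: (apow p (h *: 1 + 0) - apow p 0) @[h --> (0 : R)^'] --> (0 : R).
    rewrite apow0 ?gt_eqF ?(lt_trans ltr01)//.
    apply: norm_cvg0; apply: (squeeze_cvgr (f := cst 0) (h := fun h : R => apow (p - 1) h)).
    + near=> h; rewrite normr_ge0 /= subr0 addr0 [h *: 1]mulr1 normrM normfV.
      rewrite (ger0_norm (apow_ge0 _ _)) /apow.
      have h0 : 0 < `|h| by rewrite normr_gt0; near: h; exact: nbhs_dnbhs_neq.
      by rewrite -(mulr_powRB1 (ltW h0)) ?(lt_trans ltr01)// mulrA mulVf ?gt_eqF// mul1r.
    + exact: cvg_cst.
    + apply: cvg_trans (apow_cvg0 p0); apply: cvg_app; exact: nbhs_dnbhs.
  split; first by apply/cvg_ex; exists 0.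
  exact: cvg_lim c0.
Unshelve. all: by end_near. Qed.

End abs_power.

Section open_interval.
Context {R : realType}.
Local Notation isd x f df := (is_derive (x : R) (1 : R) f df).

Lemma integral_itvoo_le (a b : R) (f F : R -> R) (C : R) : a < b ->
  (forall x, a < x < b -> 0 <= f x) ->
  (forall x, a < x < b -> {for x, continuous f}) ->
  (forall x, a < x < b -> isd x F (f x)) ->
  (forall x y, a < x < b -> a < y < b -> F y - F x <= C) ->
  (\int[lebesgue_measure]_(x in `]a, b[) (f x)%:E <= C%:E)%E.
Proof.
move=> ab f0 cf dF FC.
(* The denominator n + 2 keeps [h n] at most half the length, so every closed interval [A n] is
   nonempty; together they exhaust the open interval, at whose ends f may be singular. *)
pose h (n : nat) : R := (b - a) / n.+2%:R.
have ba : 0 < b - a by rewrite subr_gt0.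
have h0 n : 0 < h n by rewrite divr_gt0// ltr0n.
have h2 n : h n <= (b - a) / 2.
  by rewrite ler_pM2l// lef_pV2 ?posrE// ler_nat.
pose A n : set R := `[a + h n, b - h n]%classic.
have sub n x : A n x -> a < x < b.
  rewrite /A /= in_itv/= => /andP[h1 h3]; apply/andP; split.
    by apply: lt_le_trans h1; rewrite ltrDl.
  by apply: le_lt_trans h3 _; rewrite ltrBlDr ltrDl.
have Ae : `]a, b[%classic = \bigcup_n A n.
  apply/seteqP; split => [x|x [n _ /sub]]; last by rewrite /= in_itv.
  rewrite /= in_itv/= => /andP[ax xb].
  have : h n @[n --> \oo] --> 0.
    rewrite -[X in _ --> X](mulr0 (b - a)); apply: cvgMr.
    have := @cvg_harmonic R; rewrite -(cvg_shiftn 1)/=.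
    by under eq_fun do rewrite addn1.
  move=> /cvgrPdist_le /(_ (Order.min (x - a) (b - x))).
  rewrite lt_min !subr_gt0 ax xb => /(_ isT) /filter_ex [n].
  rewrite sub0r normrN ger0_norm ?(ltW (h0 n))// le_min => /andP[h1 h3].
  by exists n => //; rewrite /A /= in_itv/=; apply/andP; split; lra.
rewrite Ae.
suff [h1 h3 h4 h5] : [/\ nondecreasing_seq A, (forall i, measurable (A i : set (measurableTypeR R))),
    measurable_fun (\bigcup_i A i : set (measurableTypeR R)) (EFin \o f)
  & forall x, (\bigcup_i A i) x -> (0 <= (f x)%:E)%E].
  have cv := @ge0_nondecreasing_set_cvg_integral _ (measurableTypeR R) R A (EFin \o f)
    lebesgue_measure h1 h3 (fun n => measurable_funS (bigcupT_measurable _ h3)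
      (bigcup_sup Logic.I) h4) (fun n x xn => h5 x (ex_intro2 _ _ n Logic.I xn)).
  refine (cvge_le _ cv).
  apply: nearW => n; have cfn : {within A n, continuous f}.
    apply: continuous_in_subspaceT => x; rewrite inE => /sub; exact: cf.
  have := within_itgb cfn => itf.
  have hn := h2 n; have hn0 := h0 n.
  rewrite /= -(fineK (integrable_fin_num _ itf))// lee_fin.
  apply: (@le_trans _ _ (F (b - h n) - F (a + h n))); last first.
    by apply: FC; apply: (sub n); rewrite /A /= in_itv/=; apply/andP; split; lra.
  rewrite le_eqVlt; apply/orP; left; apply/eqP; apply: FTC_isd => //.
  + lra.
  + apply: continuous_in_subspaceT => x; rewrite inE => /sub /dF; exact: isd_continuous.
  + move=> x /andP[h6 h7]; apply: dF; apply: (sub n).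
    by rewrite /A /= in_itv/= !ltW.
split.
- move=> m n mn; apply/subsetPset => x; rewrite /A /= !in_itv/= => /andP[h1 h3].
  have : h n <= h m by rewrite ler_pM2l// lef_pV2 ?posrE ?ltr0n// ler_nat.
  by move=> h4; apply/andP; split; lra.
- by move=> i; exact: measurable_itv.
- rewrite -Ae; apply/measurable_EFinP.
  apply: open_continuous_measurable_fun; first exact: itv_open.
  by move=> x; rewrite inE /= in_itv/=; exact: cf.
- by move=> x [n _ /sub ?]; rewrite lee_fin f0.
Qed.

End open_interval.

(** * The singular kernel |r - s|^(2H - 2) *)

Section kernel.
Context {R : realType} (H : R) (hH : 2^-1 < H < 1).
Local Notation mu := (@lebesgue_measure R).

(** The primitive |r - s|^(2H-1)/(2H-1) is bounded near r because 2H > 1. Length 2 on either side of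
    r is enough to cover [0, 1] for every r in it, with a constant free of r. *)
Lemma kernel_itvoo_le : exists C : R, forall r : R,
  (\int[mu]_(s in `]r, (r + 2)%R[) (`|r - s| `^ (2 * H - 2))%:E <= C%:E)%E /\
  (\int[mu]_(s in `](r - 2)%R, r[) (`|r - s| `^ (2 * H - 2))%:E <= C%:E)%E.
Proof.
have /andP[H1 H2] := hH.
have a0 : 0 < 2 * H - 1 by lra.
have g0 (z : R) : 0 < z < 2 -> 0 <= z `^ (2 * H - 1) / (2 * H - 1) <= 2 `^ (2 * H - 1) / (2 * H - 1).
  move=> /andP[z0 z2]; rewrite divr_ge0 ?powR_ge0 ?(ltW a0)//= ler_pM2r ?invr_gt0//.
  by rewrite ge0_ler_powR ?nnegrE ?ltW.
exists (2 `^ (2 * H - 1) / (2 * H - 1)) => r; split.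
- apply: (integral_itvoo_le (F := fun s => (s - r) `^ (2 * H - 1) / (2 * H - 1))).
  + lra.
  + by move=> x _; exact: powR_ge0.
  + move=> x /andP[rx _]; apply: (@continuous_comp _ _ _ (fun x : R => r - x) (apow (2 * H - 2))).
      by apply: cvgB; [exact: cvg_cst|exact: cvg_id].
    by apply: isd_continuous (isd_apow_neg _ _); lra.
  + move=> x /andP[rx _]; rewrite distrC ger0_norm; last by lra.
    have := @isd_comp _ x (fun s : R => s - r) (fun z => z `^ (2 * H - 1)) _ _
      (@is_derive1_powR _ (2 * H - 1) (x - r) _) (isdB (isd_id x) (isd_cst x r)).
    rewrite subr_gt0 rx => /(_ isT) /(isdZ (2 * H - 1)^-1).
    under eq_fun do rewrite mulrC.
    move=> /isd_eq; apply; rewrite subr0 mul1r mulrA mulVf ?gt_eqF// mul1r.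
    by congr (_ `^ _); ring.
  + move=> x y xr yr; have := g0 (x - r) _; have := g0 (y - r) _.
    move=> /(_ _)/andP[|_ h1]; first by lra.
    move=> /(_ _)/andP[|h2 _]; first by lra.
    lra.
- apply: (integral_itvoo_le (F := fun s => - ((r - s) `^ (2 * H - 1) / (2 * H - 1)))).
  + lra.
  + by move=> x _; exact: powR_ge0.
  + move=> x /andP[_ rx]; apply: (@continuous_comp _ _ _ (fun x : R => r - x) (apow (2 * H - 2))).
      by apply: cvgB; [exact: cvg_cst|exact: cvg_id].
    by apply: isd_continuous (isd_apow_pos _ _); lra.
  + move=> x /andP[_ rx]; rewrite ger0_norm; last by lra.
    have := @isd_comp _ x (fun s : R => r - s) (fun z => z `^ (2 * H - 1)) _ _
      (@is_derive1_powR _ (2 * H - 1) (r - x) _) (isdB (isd_cst x r) (isd_id x)).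
    rewrite subr_gt0 rx => /(_ isT) /(isdZ (- (2 * H - 1)^-1)).
    under eq_fun do rewrite mulNr mulrC.
    move=> /isd_eq; apply; rewrite sub0r mulrA mulrNN mulr1 mulrA mulVf ?gt_eqF// mul1r.
    by congr (_ `^ _); ring.
  + move=> x y xr yr; have := g0 (r - x) _; have := g0 (r - y) _.
    move=> /(_ _)/andP[|h2 _]; first by lra.
    move=> /(_ _)/andP[|_ h1]; first by lra.
    lra.
Qed.

Lemma measurable_cov_kernel (r : R) (D : set (measurableTypeR R)) : measurable D ->
  measurable_fun D (fun s : R => (`|r - s| `^ (2 * H - 2))%:E).
Proof.
move=> mD; apply/measurable_EFinP; apply: (measurableT_comp (measurable_powR _)).
by apply: measurableT_comp => //; apply: measurable_funB => //; exact: measurable_cst.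
Qed.

Lemma kernel_le : exists C : R, forall r : R, r \in `[0, 1] ->
  (\int[mu]_(s in `[0%R, 1%R]) (`|r - s| `^ (2 * H - 2))%:E <= C%:E)%E.
Proof.
have [C hC] := kernel_itvoo_le; exists (C + C) => r r01.
have [h1 h2] := hC r.
have k0 x : (0 <= (`|r - x| `^ (2 * H - 2))%:E)%E by rewrite lee_fin powR_ge0.
apply: (@le_trans _ _ (\int[mu]_(s in (`](r - 2)%R, r[ `|` `]r, (r + 2)%R[)%classic) (`|r - s| `^ (2 * H - 2))%:E)%E).
  rewrite integral_mkcond [leRHS]integral_mkcond; apply: le_lower_integral => x _.
    by rewrite patchE; case: ifPn.
  rewrite !patchE; case: ifPn => [xi|]; last by case: ifPn.
  (* The singular point is left out of the union, which is harmless: a power of 0 with nonzero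
     exponent is 0 by convention. *)
  have [->|xr] := eqVneq x r.
    rewrite subrr normr0 powR0; first by case: ifPn.
    by have /andP[_ ?] := hH; rewrite lt_eqF//; lra.
  rewrite ifT// inE /=; move: xi r01 xr; rewrite inE/= !in_itv/= neq_lt.
  move=> /andP[x0 x1] /andP[r0 r1] /orP[xr|xr]; [left|right]; lra.
rewrite ge0_integral_setU//; last 2 first.
- by apply: measurable_cov_kernel; apply: measurableU.
- apply/disj_setPLR => x; rewrite /= !in_itv/= => /andP[_ xr] /andP[rx _].
  by have := lt_trans xr rx; rewrite ltxx.
by rewrite EFinD; exact: leeD.
Qed.

End kernel.

(** * Uniform approximation by step functions *)

Section step_approximation.
Context {R : realType}.

(** The step function with value y(j/N) on ]j/N, (j+1)/N], each such indicator being a difference of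
    two indicators of intervals [0, t]. The pair (y 0, 0) supplies the value at the point 0. *)
Definition steps (y : R -> R) (N : nat) : seq (R * R) :=
  (y 0, 0) :: [seq (y (grid N j), grid N j.+1) | j <- index_iota 0 N] ++
              [seq (- y (grid N j), grid N j) | j <- index_iota 0 N].

Lemma steps_on01 y N : (0 < N)%N -> step_on01 (steps y N).
Proof.
move=> N0; rewrite /step_on01 /= all_cat !all_map bound_itvE ler01 /=.
apply/andP; split; apply/allP => j; rewrite mem_index_iota /= => jN; rewrite grid_mem//.
exact: ltnW.
Qed.

Lemma big_steps (E : zmodType) (F : R * R -> E) y N :
  \sum_(p <- steps y N) F p = F (y 0, 0) +
    \sum_(0 <= j < N) (F (y (grid N j), grid N j.+1) + F (- y (grid N j), grid N j)).
Proof. by rewrite /steps big_cons big_cat !big_map big_split. Qed.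

Lemma step_approx (y : R -> R) N e : (0 < N)%N ->
  (forall s t, s \in `[0, 1] -> t \in `[0, 1] -> `|s - t| <= N%:R^-1 -> `|y s - y t| <= e) ->
  forall r, r \in `[0, 1] -> `|y r - step_fun (steps y N) r| <= e.
Proof.
move=> N0 hy r r01; pose J (t : R) : R := \1_`[0, t] r.
have JE t : J t = (r <= t)%R%:R.
  by rewrite /J indicE mem_setE in_itv/=; move: r01; rewrite in_itv/= => /andP[->].
have e0 : 0 <= e by have := hy r r r01 r01; rewrite !subrr normr0; apply; rewrite invr_ge0.
have tele : \sum_(0 <= j < N) (J (grid N j.+1) - J (grid N j)) = 1 - J 0.
  rewrite telescope_sumr// gridN// grid0 (JE 1).
  by move: r01; rewrite in_itv/= => /andP[_ ->].
have -> : y r - step_fun (steps y N) r = (y r - y 0) * J 0 +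
    \sum_(0 <= j < N) (y r - y (grid N j)) * (J (grid N j.+1) - J (grid N j)).
  rewrite /step_fun big_steps/= -/(J 0).
  transitivity (y r * (J 0 + \sum_(0 <= j < N) (J (grid N j.+1) - J (grid N j))) -
    (y 0 * J 0 + \sum_(0 <= j < N) y (grid N j) * (J (grid N j.+1) - J (grid N j)))).
    rewrite tele [J 0 + _]addrC subrK mulr1; congr (_ - (_ + _)).
    by apply: eq_bigr => j _; rewrite -/(J _) -/(J _); ring.
  rewrite mulrDr mulr_sumr opprD addrACA -mulrBl -sumrB; congr (_ + _).
  by apply: eq_bigr => j _; rewrite -mulrBl.
have -> : (y r - y 0) * J 0 = 0.
  rewrite JE; case: (leP r 0) => h; last by rewrite mulr0.
  have -> : r = 0 by apply/eqP; rewrite eq_le h; move: r01; rewrite in_itv/= => /andP[].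
  by rewrite subrr mul0r.
rewrite add0r; apply: le_trans (_ : \sum_(0 <= j < N) e * (J (grid N j.+1) - J (grid N j)) <= _).
  apply: le_trans (ler_norm_sum _ _ _) _.
  rewrite big_nat [leRHS]big_nat; apply: ler_sum => j /= jN.
  rewrite !JE; have [h1|h1] := leP r (grid N j).
    by rewrite (le_trans h1) ?grid_le// subrr !mulr0 normr0.
  have [h2|h2] := leP r (grid N j.+1); last by rewrite subrr !mulr0 normr0.
  rewrite subr0 !mulr1; apply: hy => //; first by rewrite grid_mem// ltnW.
  by rewrite ger0_norm ?subr_ge0 ?(ltW h1)// -(gridS N j) lerD2r.
rewrite -mulr_sumr tele -[leRHS]mulr1 ler_wpM2l// JE.
by case: (r <= 0); rewrite ?subrr ?subr0 ?ler01.
Qed.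

Lemma step_fun_cat (s s' : seq (R * R)) r :
  step_fun (s ++ s') r = step_fun s r + step_fun s' r.
Proof. by rewrite /step_fun big_cat. Qed.

Lemma measurable_step_fun (s : seq (R * R)) (D : set (measurableTypeR R)) :
  measurable_fun D (step_fun s).
Proof.
elim: s => [|p s IH].
  rewrite (_ : step_fun _ = cst 0)//.
  by apply/funext => r; rewrite /step_fun big_nil.
rewrite (_ : step_fun _ = (fun r => p.1 * \1_`[0, p.2] r + step_fun s r)).
  apply: measurable_funD => //; apply: measurable_funM => //.
by apply/funext => r; rewrite /step_fun big_cons.
Qed.

Lemma step_fun_bounded (s : seq (R * R)) : exists M, forall r, `|step_fun s r| <= M.
Proof.
exists (\sum_(p <- s) `|p.1|) => r; apply: le_trans (ler_norm_sum _ _ _) _.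
apply: ler_sum => p _; rewrite normrM -[leRHS]mulr1 ler_wpM2l// indicE.
by case: (_ \in _); rewrite ?normr0 ?normr1.
Qed.

End step_approximation.

Lemma EFin_norm_ge0 (R : realType) (x : R) : (0 <= (`|x|)%:E)%E.
Proof. by rewrite lee_fin. Qed.

Section abs_norm.
Context {R : realType} (H : R) (hH : 2^-1 < H < 1).
Local Notation mu := (@lebesgue_measure R).

Let kc : 0 < H * (2 * H - 1).
Proof. by have /andP[h1 h2] := hH; rewrite mulr_gt0//; lra. Qed.

Lemma lebesgue_measure01 : mu `[0%R, 1%R] = 1%E.
Proof. by rewrite lebesgue_measure_itv/= lte_fin ltr01 -EFinD subr0. Qed.

Lemma abs_norm2_le : exists C : R, forall psi e, 0 <= e ->
  (forall r, r \in `[0, 1] -> `|psi r| <= e) -> (abs_norm2 H psi <= (C * e ^+ 2)%:E)%E.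
Proof.
have [C hC] := kernel_le hH; exists (H * (2 * H - 1) * C) => psi e e0 he.
rewrite -mulrA EFinM; apply: lee_wpmul2l; first by rewrite lee_fin ltW.
have h1 r s : (0 <= (`|psi r| * `|psi s| * `|r - s| `^ (2 * H - 2))%:E)%E.
  by rewrite lee_fin mulr_ge0 ?powR_ge0 ?mulr_ge0.
apply: (@le_trans _ _ (\int[mu]_(r in `[0%R, 1%R]) (C * e ^+ 2)%:E)%E).
  apply: le_lower_integral => r r01; first by apply: integral_ge0.
  apply: (@le_trans _ _ (\int[mu]_(s in `[0%R, 1%R]) ((e ^+ 2)%:E * (`|r - s| `^ (2 * H - 2))%:E))%E).
    apply: le_lower_integral => s s01 //.
    by rewrite -EFinM lee_fin ler_wpM2r ?powR_ge0// expr2 ler_pM// he.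
  have mk : measurable_fun (`[0, 1]%classic : set (measurableTypeR R))
      (fun s : R => (`|r - s| `^ (2 * H - 2))%:E).
    exact: (measurable_cov_kernel H r (measurable_itv _)).
  rewrite ge0_integralZl_EFin ?exprn_ge0//.
  rewrite [C * _]mulrC [(_ * C)%:E]EFinM; apply: lee_wpmul2l; first by rewrite lee_fin exprn_ge0.
  exact: hC.
by rewrite integral_cst//= lebesgue_measure01 mule1.
Qed.

(** The exponent 2H - 2 is negative and |r - s| <= 1, so the kernel is at least 1 off the diagonal,
    which is negligible for each r. Convergence in this norm therefore implies convergence in
    L^1. *)
Lemma abs_norm2_ge (psi : R -> R) : measurable_fun (`[0, 1]%classic : set (measurableTypeR R)) psi ->
  ((H * (2 * H - 1))%:E * ((\int[mu]_(r in `[0%R, 1%R]) (`|psi r|)%:E) *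
     (\int[mu]_(r in `[0%R, 1%R]) (`|psi r|)%:E)) <= abs_norm2 H psi)%E.
Proof.
move=> mpsi; apply: lee_wpmul2l; first by rewrite lee_fin ltW.
set I := (\int[mu]_(r in _) _)%E.
have mn : measurable_fun (`[0, 1]%classic : set (measurableTypeR R)) (fun r => (`|psi r|)%:E).
  by apply/measurable_EFinP; apply: measurableT_comp.
have I0 : (0 <= I)%E by apply: integral_ge0 => r _; rewrite lee_fin.
rewrite {1}/I -ge0_integralZr//.
apply: le_lower_integral => r r01; first by rewrite mule_ge0 ?lee_fin.
rewrite /I -ge0_integralZl_EFin//.
have k0 s : (0 <= (`|psi r| * `|psi s| * `|r - s| `^ (2 * H - 2))%:E)%E.
  by rewrite lee_fin mulr_ge0 ?powR_ge0 ?mulr_ge0.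
apply: ae_ge0_le_integral => //.
- exact: measurable_funeM.
- apply/measurable_EFinP; apply: measurable_funM.
    by apply: measurable_funM => //; exact: measurableT_comp.
  by apply/measurable_EFinP; exact: measurable_cov_kernel.
- exists [set r]; split => //; first exact: lebesgue_measure_set1.
  move=> s /= /not_implyP [s01 h]; apply: contrapT => sr; apply: h.
  rewrite -EFinM lee_fin -[leLHS]mulr1 ler_wpM2l ?mulr_ge0//.
  move: r01 s01; rewrite /= !in_itv/= => /andP[r0 r1] /andP[s0 s1].
  rewrite -[leLHS](powRr0 `|r - s|) ger_powR//.
    rewrite normr_gt0 subr_eq0; apply/andP; split; first by apply/eqP => h; apply: sr; rewrite /= h.
    by rewrite ler_norml; apply/andP; split; lra.
  by have /andP[? ?] := hH; lra.
Qed.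

Lemma abs_norm2_L1 (psi : nat -> R -> R) :
  (forall k, measurable_fun (`[0, 1]%classic : set (measurableTypeR R)) (psi k)) ->
  abs_norm2 H (psi k) @[k --> \oo] --> 0%E ->
  forall e : R, 0 < e -> \forall k \near \oo, (\int[mu]_(r in `[0%R, 1%R]) `|psi k r|%:E <= e%:E)%E.
Proof.
move=> mpsi c e e0.
have e1 : 0 < H * (2 * H - 1) * (e * e) by rewrite (mulr_gt0 kc)// mulr_gt0.
have : \forall k \near \oo, (abs_norm2 H (psi k) < (H * (2 * H - 1) * (e * e))%:E)%E.
  have [c1 /cvgrPdist_lt/(_ _ e1) c2] := (fine_cvgP _ _).1 c.
  apply: filterS2 c1 c2 => k /fineK <- /=; rewrite sub0r normrN lte_fin => h.
  exact: le_lt_trans (ler_norm _) h.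
apply: filterS => k /(le_lt_trans (abs_norm2_ge (mpsi k))).
rewrite [(_ * (e * e))%:E]EFinM lte_pmul2l ?lte_fin// => h; rewrite leNgt; apply/negP => h2.
move: h; apply/negP; rewrite -leNgt EFinM.
by apply: lee_pmul; rewrite ?lee_fin ?ltW.
Qed.

End abs_norm.

Section step_integrals.
Context {R : realType}.
Local Notation mu := (@lebesgue_measure R).

Lemma bounded_integrable01 (f : R -> R) M :
  measurable_fun (`[0, 1]%classic : set (measurableTypeR R)) f ->
  (forall r, r \in `[0, 1] -> `|f r| <= M) -> mu.-integrable `[0, 1] (EFin \o f).
Proof.
move=> mf fM; apply: measurable_bounded_integrable => //.
  by rewrite /= lebesgue_measure_itv/= lte_fin ltr01 ltry.
exists M; split; first exact: num_real.
by move=> x Mx r r01 /=; apply: le_trans (ltW Mx); exact: fM.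
Qed.

Lemma integral_step_fun (k : R -> R) M s : continuous k ->
  (forall r, r \in `[0, 1] -> `|k r| <= M) -> step_on01 s ->
  mu.-integrable `[0, 1] (EFin \o (fun r => step_fun s r * k r)) /\
  ((\sum_(p <- s) p.1 * \int[mu]_(r in `[0, p.2]) k r)%:E =
   \int[mu]_(r in `[0%R, 1%R]) (step_fun s r * k r)%:E)%E.
Proof.
move=> ck kM.
have mk (D : set (measurableTypeR R)) : measurable_fun D k.
  by apply: (measurable_funS measurableT) => //; exact: continuous_measurable_fun.
have iS l : mu.-integrable `[0, 1] (EFin \o (fun r => step_fun l r * k r)).
  have [M' hM'] := step_fun_bounded l.
  apply: (@bounded_integrable01 _ (M' * M)).
    by apply: measurable_funM => //; exact: measurable_step_fun.
  by move=> r r01; rewrite normrM ler_pM ?kM.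
move=> s01; split => //; elim: s s01 => [_|p s IH /= /andP[p01 s01]].
  rewrite big_nil integral0_eq// => r _.
  by rewrite /step_fun big_nil mul0r.
rewrite big_cons EFinD IH//.
have mI : measurable_fun (`[0, 1]%classic : set (measurableTypeR R))
    (fun r => \1_`[0, p.2] r * k r).
  by apply: measurable_funM => //; exact: measurable_indic.
have bI r : r \in `[0, 1] -> `|\1_`[0, p.2] r * k r| <= M.
  move=> r01; rewrite normrM -[leRHS]mul1r ler_pM ?kM//.
  by rewrite indicE; case: (_ \in _); rewrite ?normr0 ?normr1.
have iI := bounded_integrable01 mI bI.
have -> : (p.1 * \int[mu]_(r in `[0, p.2]) k r)%:E =
    (\int[mu]_(r in `[0%R, 1%R]) (p.1%:E * (\1_`[0, p.2] r * k r)%:E))%E.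
  rewrite integralZl// EFinM; congr (_ * _)%E.
  rewrite /Rintegral fineK.
    have IE : `[0, p.2]%classic = (`[0, 1] `&` `[0, p.2])%classic :> set R.
      rewrite setIidr// => x; move: p01; rewrite /= !in_itv/= => /andP[_ p1] /andP[-> h].
      exact: le_trans p1.
    rewrite [in LHS]IE integral_mkcondr epatch_indic; apply: eq_integral => r _ /=.
    by rewrite mulrC -EFinM.
  apply: integrable_fin_num => //; apply: within_itgb.
  exact: continuous_subspaceT.
rewrite -integralD//; [|exact: integrableZl|exact: iS].
apply: eq_integral => r _; rewrite -EFinM -EFinD /step_fun big_cons; congr EFin; ring.
Qed.

End step_integrals.

(** * Uniqueness and identification of [class] *)

Section class_uniqueness.
Context {R : realType} (H : R) (hH : 2^-1 < H < 1).
Local Notation isd x f df := (is_derive (x : R) (1 : R) f df).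
Local Notation mu := (@lebesgue_measure R).

(* The derivative in s of the covariance of B_s and B_t. *)
Definition covK (t r : R) : R := H * (spow (2 * H - 1) r + spow (2 * H - 1) (t - r)).

Let q0 : 0 < 2 * H - 1. Proof. by have /andP[? ?] := hH; lra. Qed.

Lemma covK_continuous t : continuous (covK t).
Proof.
move=> x; apply: cvgMr; apply: cvgD; first exact: spow_continuous.
apply: (@continuous_comp _ _ _ (fun x : R => t - x) (spow (2 * H - 1))); last exact: spow_continuous.
by apply: cvgB; [exact: cvg_cst|exact: cvg_id].
Qed.

Lemma covK_le t r : t \in `[0, 1] -> r \in `[0, 1] -> `|covK t r| <= 2.
Proof.
rewrite !in_itv/= => /andP[t0 t1] /andP[r0 r1].
have /andP[h1 h2] := hH.
have h3 : `|spow (2 * H - 1) r| <= 1 by apply: spow_le1 => //; rewrite ger0_norm.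
have h4 : `|spow (2 * H - 1) (t - r)| <= 1.
  by apply: spow_le1 => //; rewrite ler_norml; apply/andP; split; lra.
have H0 : 0 <= H by lra.
rewrite normrM (ger0_norm H0); set a := spow _ _ in h3 *; set b := spow _ _ in h4 *.
by have := ler_normD a b; nra.
Qed.

Lemma fbm_cov_integral u t : u \in `[0, 1] -> t \in `[0, 1] ->
  \int[mu]_(r in `[0, u]) covK t r = fbm_cov H u t.
Proof.
rewrite !in_itv/= => /andP[u0 u1] /andP[t0 t1].
pose F (s : R) : R := 2^-1 * (t `^ (2 * H) + apow (2 * H) s - apow (2 * H) (t - s)).
have p1 : 1 < 2 * H by have /andP[? ?] := hH; lra.
have dF s : isd s F (covK t s).
  have := @isd_comp _ s (fun s : R => t - s) (apow (2 * H)) _ _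
      (isd_apow (t - s) p1) (isdB (isd_cst s t) (isd_id s)).
  move=> /(isdB (isdD (isd_cst s (t `^ (2 * H))) (isd_apow s p1))) /(isdZ 2^-1) /isd_eq; apply.
  by rewrite /covK; field.
have -> : fbm_cov H u t = F u - F 0.
  rewrite /F /fbm_cov subr0 apow0 ?gt_eqF ?(lt_trans _ p1)//.
  by rewrite (apow_pos _ t0) (apow_pos _ u0) /apow; ring.
apply: FTC_isd => //.
- by apply: continuous_subspaceT; exact: covK_continuous.
- by apply: continuous_subspaceT => s; exact: isd_continuous (dF s).
Qed.

Context (V : completeNormedModType R) (ip : {dot V for idfun}) (ind : R -> V).
Hypothesis hV : step_completion H ip ind.

Let ipE : forall v, ip v v = `|v| ^+ 2. Proof. by case: hV. Qed.

Lemma measurable_covK t (D : set (measurableTypeR R)) : measurable_fun D (covK t).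
Proof.
apply: (measurable_funS measurableT) => //.
by apply: continuous_measurable_fun; exact: covK_continuous.
Qed.

Lemma ip_step_vec s t : step_on01 s -> t \in `[0, 1] ->
  ((ip (step_vec ind s) (ind t))%:E = \int[mu]_(r in `[0%R, 1%R]) (step_fun s r * covK t r)%:E)%E.
Proof.
move=> s01 t01; have [_ ip_ind _] := hV.
have ck : continuous (covK t) by exact: covK_continuous.
have [_ <-] := integral_step_fun ck (fun r => covK_le t01) s01.
rewrite /step_vec ip_suml; congr EFin; move/allP: s01 => s01.
rewrite big_seq [RHS]big_seq; apply: eq_bigr => p /s01 p01.
by rewrite ipZl ip_ind// fbm_cov_integral.
Qed.

Lemma ip_step_vec_le s t : step_on01 s -> t \in `[0, 1] ->
  (`|ip (step_vec ind s) (ind t)|%:E <= 2%:E * \int[mu]_(r in `[0%R, 1%R]) `|step_fun s r|%:E)%E.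
Proof.
move=> s01 t01; have ms : measurable_fun (`[0, 1]%classic : set (measurableTypeR R))
    (fun r => `|step_fun s r|%:E).
  by apply/measurable_EFinP; apply: measurableT_comp => //; exact: measurable_step_fun.
rewrite -ge0_integralZl_EFin//.
rewrite -abse_EFin ip_step_vec//.
apply: le_trans (le_abse_integral _ _ _) _ => //.
  apply/measurable_EFinP; apply: measurable_funM; [exact: measurable_step_fun|exact: measurable_covK].
apply: le_lower_integral => r r01; first exact: abse_ge0.
by rewrite -EFinM lee_fin normrM mulrC ler_wpM2r ?covK_le.
Qed.

Lemma ip_ind_dense v : (forall t, t \in `[0, 1] -> ip v (ind t) = 0) -> v = 0.
Proof.
move=> v0; have [_ _ dense] := hV.
have step0 s : step_on01 s -> ip v (step_vec ind s) = 0.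
  rewrite /step_vec ip_sumr => /allP s01; rewrite big_seq big1// => p /s01 p01.
  by rewrite ipZr v0 ?mulr0.
apply/eqP; rewrite -normr_le0; apply/ler_addgt0Pl => e e0; rewrite addr0.
have : closure [set step_vec ind s | s in [set s | step_on01 s]] v by rewrite dense.
move=> /(_ (ball v e) (nbhsx_ballx v e e0)) [_ [[s s01 <-]]].
rewrite -ball_normE /= => h.
have : ip v v = ip v (v - step_vec ind s) by rewrite ipBr step0// subr0.
have := ip_le ipE v (v - step_vec ind s); rewrite ipE => h1 h2.
rewrite leNgt; apply/negP => h3.
have : `|v| ^+ 2 <= `|v| * `|v - step_vec ind s|.
  by rewrite h2; apply: le_trans h1; exact: ler_norm.
have v1 : 0 < `|v| by apply: lt_trans h3.
by rewrite expr2 ler_pM2l// leNgt (lt_trans h h3).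
Qed.

(** The inner product of a step vector with [ind t] is the integral of the step function against
    [covK t], which is bounded. The L^1 distance of the two approximating sequences tends to 0, so v
    and v' have equal inner products with the total family [ind t]. *)
Lemma is_class_unique phi v v' : is_class H ind phi v -> is_class H ind phi v' -> v = v'.
Proof.
move=> [mphi [s [s01 sa sv]]] [_ [s' [s01' sa' sv']]].
apply/eqP; rewrite -subr_eq0; apply/eqP; apply: ip_ind_dense => t t01.
pose ns := fun k => [seq (- p.1, p.2) | p : R * R <- s' k].
have nsF k r : step_fun (ns k) r = - step_fun (s' k) r.
  by rewrite /step_fun big_map -sumrN; apply: eq_bigr => p _; rewrite mulNr.
have nsV k : step_vec ind (ns k) = - step_vec ind (s' k).
  by rewrite /step_vec big_map -sumrN; apply: eq_bigr => p _; rewrite scaleNr.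
have catV k : step_vec ind (s k ++ ns k) = step_vec ind (s k) - step_vec ind (s' k).
  by rewrite -nsV /step_vec big_cat.
have cat01 k : step_on01 (s k ++ ns k).
  by rewrite /step_on01 all_cat; apply/andP; split; [exact: s01|rewrite all_map; exact: s01'].
have m1 k : measurable_fun (`[0, 1]%classic : set (measurableTypeR R)) (phi \- step_fun (s k)).
  by apply: measurable_funB => //; exact: measurable_step_fun.
have m2 k : measurable_fun (`[0, 1]%classic : set (measurableTypeR R)) (phi \- step_fun (s' k)).
  by apply: measurable_funB => //; exact: measurable_step_fun.
have cv : ip (step_vec ind (s k ++ ns k)) (ind t) @[k --> \oo] --> ip (v - v') (ind t).
  by under eq_fun do rewrite catV; apply: ip_cvgl => //; exact: cvgB.
have mE (f : R -> R) : measurable_fun (`[0, 1]%classic : set (measurableTypeR R)) f ->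
    measurable_fun (`[0, 1]%classic : set (measurableTypeR R)) (fun r => `|f r|%:E).
  by move=> mf; apply/measurable_EFinP; apply: measurableT_comp.
apply/eqP; rewrite -normr_le0; apply/ler_addgt0Pl => e e0; rewrite addr0.
have intD k := @ge0_integralD _ _ R mu _ (measurable_itv _) _ _
  (fun r _ => EFin_norm_ge0 (phi r - step_fun (s k) r)) (mE _ (m1 k))
  (fun r _ => EFin_norm_ge0 (phi r - step_fun (s' k) r)) (mE _ (m2 k)).
have e4 : 0 < e / 4 by rewrite divr_gt0.
apply: (cvgr_to_le (cvg_norm cv)).
  near=> k; rewrite /= -lee_fin; apply: le_trans (ip_step_vec_le (cat01 k) t01) _.
  have -> : e%:E = (2%:E * (e / 4 + e / 4)%:E)%E by rewrite -EFinM; congr EFin; field.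
  apply: lee_wpmul2l; first by rewrite lee_fin.
  apply: (@le_trans _ _ (\int[mu]_(r in `[0%R, 1%R]) ((`|phi r - step_fun (s k) r|)%:E +
    (`|phi r - step_fun (s' k) r|)%:E))%E).
    apply: le_lower_integral => r _; first by rewrite lee_fin.
    rewrite -EFinD lee_fin step_fun_cat nsF /=.
    rewrite (_ : step_fun (s k) r - step_fun (s' k) r = - (phi r - step_fun (s k) r) + (phi r - step_fun (s' k) r)); last by ring.
    by apply: le_trans (ler_normD _ _) _; rewrite normrN.
  rewrite intD EFinD; apply: leeD; near: k; [exact: (abs_norm2_L1 hH m1 sa e4)|exact: (abs_norm2_L1 hH m2 sa' e4)].
Unshelve. all: by end_near. Qed.

Lemma squeeze_ereal0 (a : nat -> \bar R) : (forall k, (0 <= a k)%E) ->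
  (forall e : R, 0 < e -> \forall k \near \oo, (a k <= e%:E)%E) -> a k @[k --> \oo] --> 0%E.
Proof.
move=> a0 ha; apply/fine_cvgP; split.
  have := ha 1 ltr01; apply: filterS => k ak.
  by rewrite ge0_fin_numE// (le_lt_trans ak)// ltry.
apply/cvgrPdist_le => e e0; have := ha e e0; apply: filterS => k ak /=.
have fk : a k \is a fin_num by rewrite ge0_fin_numE// (le_lt_trans ak)// ltry.
by rewrite sub0r normrN ger0_norm ?fine_ge0// -lee_fin fineK.
Qed.

Lemma riem_is_class (y : R -> R) v : {within `[0, 1], continuous y} ->
  riem ind y N @[N --> \oo] --> v -> is_class H ind y v.
Proof.
move=> cy cv; split.
  by apply: subspace_continuous_measurable_fun => //.
exists (fun k => steps y k.+1); split.
- by move=> k; exact: steps_on01.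
- have [C hC] := abs_norm2_le hH.
  apply: squeeze_ereal0 => [k|e e0].
    rewrite mule_ge0//; first by have /andP[? ?] := hH; rewrite lee_fin mulr_ge0//; lra.
    apply: integral_ge0 => r _; apply: integral_ge0 => t _.
    by rewrite lee_fin !mulr_ge0 ?powR_ge0.
  have e1 : 0 < Num.sqrt (e / (`|C| + 1)) by rewrite sqrtr_gt0 divr_gt0// ltr_wpDl.
  have [d d0 hd] := within_unif_cont cy e1.
  near=> k; have kd : k.+1%:R^-1 <= d.
    near: k; have := near_infty_natSinv_lt (PosNum d0).
    by apply: filterS => k /ltW.
  apply: le_trans (hC _ _ (ltW e1) _) _.
    apply: step_approx => // s t s01 t01 st; apply: hd => //; exact: le_trans kd.
  rewrite lee_fin sqr_sqrtr; last by rewrite divr_ge0 ?(ltW e0)// addr_ge0.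
  rewrite mulrCA -[leRHS]mulr1 ler_pM2l// ler_pdivrMr ?ltr_wpDl// mul1r.
  by apply: le_trans (ler_norm _) _; rewrite lerDl.
- rewrite [X in X @ _ --> _](_ : _ = (fun k => riem ind y k.+1)); last first.
    apply/funext => k; rewrite /step_vec big_steps/= /riem.
    have [_ ip_ind _] := hV; rewrite (ind0 hH ipE ip_ind) scaler0 add0r.
    by apply: eq_bigr => j _; rewrite scaleNr scalerBr.
  by rewrite (cvg_shiftS (riem ind y)).
Unshelve. all: by end_near. Qed.

(** The Riemann sums converge to some vector by [riem_cvg]; that vector is a class of y, and
    uniqueness shows that the choice made by [xget] is the same one. *)
Lemma class_riem (y : R -> R) : {within `[0, 1], continuous y} ->
  riem ind y N @[N --> \oo] --> class H ind y.
Proof.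
move=> cy; have [_ ip_ind _] := hV.
have /cvg_ex [v cv] := riem_cvg hH ipE ip_ind cy.
have hv := riem_is_class cy cv.
rewrite /class; case: xgetP => [v' _ hv'|h]; last by have := h v.
by rewrite (is_class_unique hv' hv).
Qed.

End class_uniqueness.

(** * Linear and quadratic functionals of W *)

Section L2_sums.
Context {d} {T : measurableType d} {R : realType} (P : probability T R).

Lemma sqr_sum_le (I : Type) (s : seq I) (a x : I -> R) :
  (\sum_(i <- s) a i * x i) ^+ 2 <= (\sum_(i <- s) `|a i|) * \sum_(i <- s) `|a i| * x i ^+ 2.
Proof.
elim: s => [|i s IH]; first by rewrite !big_nil expr0n mul0r.
rewrite !big_cons.
set A := \sum_(_ <- _) a _ * x _ in IH *; set S := \sum_(_ <- _) `|a _| in IH *.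
set Q := \sum_(_ <- _) _ * _ ^+ 2 in IH *.
have S0 : 0 <= S by apply: sumr_ge0.
have Q0 : 0 <= Q by apply: sumr_ge0 => j _; rewrite mulr_ge0// sqr_ge0.
have key : `|2 * (A * x i)| <= S * x i ^+ 2 + Q.
  have q0 : 0 <= S * x i ^+ 2 + Q by rewrite addr_ge0// mulr_ge0// sqr_ge0.
  rewrite -(@ler_pXn2r _ 2) ?nnegrE//.
  rewrite real_normK ?num_real//.
  have := sqr_ge0 (S * x i ^+ 2 - Q); have := sqr_ge0 (x i).
  move: IH; move: A S Q {S0 Q0 q0} (x i) => A S Q y h1 h2 h3; nra.
have a2 : a i ^+ 2 = `|a i| ^+ 2 by rewrite real_normK ?num_real.
have h : 2 * (a i * x i) * A <= `|a i| * (S * x i ^+ 2 + Q).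
  apply: le_trans (ler_norm _) _.
  rewrite (_ : 2 * (a i * x i) * A = a i * (2 * (A * x i))); last by ring.
  by rewrite normrM ler_wpM2l ?key.
rewrite sqrrD exprMn a2; move: h IH; move: (`|a i|) => b h IH; nra.
Qed.

(** Cauchy-Schwarz with weights |a_i|. When the a_i are increments of the monotone [phi], the sum of
    the weights telescopes and the bound does not depend on the mesh. *)
Lemma L2_sum_le (I : eqType) (s : seq I) (a : I -> R) (X : I -> T -> R) (M : R) :
  (forall i, L2 P (X i)) -> (forall i, i \in s -> Ex P (fun w => X i w ^+ 2) <= M) ->
  L2 P (fun w => \sum_(i <- s) a i * X i w) /\
  Ex P (fun w => (\sum_(i <- s) a i * X i w) ^+ 2) <= (\sum_(i <- s) `|a i|) ^+ 2 * M.
Proof.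
move=> lX XM; have l : L2 P (fun w => \sum_(i <- s) a i * X i w).
  by apply: L2_sum => i; exact: L2Z.
have iX i : itg P (fun w => `|a i| * X i w ^+ 2) by apply: itgZ; exact: (lX i).2.
split => //.
apply: le_trans (Ex_le l.2 _ (fun w => sqr_sum_le s a (X ^~ w))) _.
  by apply: itgZ; exact: itg_sum.
rewrite ExZ; last exact: itg_sum.
rewrite expr2 -mulrA ler_wpM2l ?sumr_ge0// Ex_sum// mulr_suml big_seq [leRHS]big_seq.
apply: ler_sum => i si; rewrite ExZ; last exact: (lX i).2.
by rewrite ler_wpM2l// XM.
Qed.

Lemma Ex_mul_le X Y (M : R) : L2 P X -> L2 P Y -> Ex P (fun w => X w ^+ 2) <= M ->
  Ex P (fun w => Y w ^+ 2) <= M -> Ex P (fun w => X w * Y w) <= M.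
Proof.
move=> lX lY hX hY; have i1 := lX.2; have i2 := lY.2.
apply: (@le_trans _ _ (Ex P (fun w => 2^-1 * (X w ^+ 2 + Y w ^+ 2)))).
  apply: Ex_le; [exact: L2_mul|by apply: itgZ; exact: itgD|move=> w].
  by have := sqr_ge0 (X w - Y w); lra.
by rewrite ExZ ?ExD//; [lra|exact: itgD].
Qed.

End L2_sums.

Section isonormal.
Context {d} {T : measurableType d} {R : realType} (P : probability T R).
Context {V : completeNormedModType R} (ip : {dot V for idfun}).
Hypothesis ipE : forall v, ip v v = `|v| ^+ 2.
Context (W : V -> {RV P >-> R}).
Hypothesis hW : isonormal ip W.
Local Notation Wf := (fun (h : V) (w : T) => W h w).

Lemma W_meas h : measurable_fun setT (W h : T -> R).
Proof. exact: measurable_funPT. Qed.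

Lemma lincomb_gaussian s : gaussian P (lincomb Wf s).
Proof.
have [gW _ _] := hW.
by apply: (@gaussian_family_lincomb _ _ _ P _ setT Wf).
Qed.

Lemma lincomb_meas s : measurable_fun setT (lincomb Wf s).
Proof. by apply: (@measurable_lincomb _ _ _ _ setT) => // i _; exact: W_meas. Qed.

Lemma lincomb_Lall s : Lall P (lincomb Wf s).
Proof. by apply: gaussian_Lall; [exact: lincomb_meas|exact: lincomb_gaussian]. Qed.

Lemma lincomb1 h : lincomb Wf [:: (1, h)] = W h.
Proof. by apply/funext => w; rewrite /lincomb big_seq1 mul1r. Qed.

Lemma W_Lall h : Lall P (W h).
Proof. by rewrite -lincomb1; exact: lincomb_Lall. Qed.

Lemma W_mean h : Ex P (W h) = 0.
Proof. by have [_ + _] := hW => /(_ h); rewrite unlock /Rintegral => ->. Qed.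

Lemma W_cov g h : Ex P (fun w => W g w * W h w) = ip g h.
Proof. by have [_ _ +] := hW => /(_ g h); rewrite unlock /Rintegral => ->. Qed.

Definition lin_vec (s : seq (R * V)) : V := \sum_(p <- s) p.1 *: p.2.

Lemma lincomb_mean s : Ex P (lincomb Wf s) = 0.
Proof.
rewrite /lincomb Ex_sum; last by move=> p; apply: itgZ; exact: Lall_itg (W_Lall _).
rewrite big1// => p _; rewrite ExZ ?W_mean ?mulr0//; exact: Lall_itg (W_Lall _).
Qed.

Lemma lincomb_cov s s' :
  Ex P (fun w => lincomb Wf s w * lincomb Wf s' w) = ip (lin_vec s) (lin_vec s').
Proof.
have iWW g h : itg P (fun w => W g w * W h w).
  exact: Lall_itg (Lall_mul (W_Lall g) (W_Lall h)).
transitivity (Ex P (fun w => \sum_(p <- s) \sum_(q <- s') p.1 * (q.1 * (W p.2 w * W q.2 w)))).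
  apply: eqEx => w; rewrite /lincomb mulr_suml; apply: eq_bigr => p _.
  by rewrite mulr_sumr; apply: eq_bigr => q _; ring.
have i1 p q : itg P (fun w => p.1 * (q.1 * (W p.2 w * W q.2 w))).
  by do 2 apply: itgZ.
rewrite Ex_sum => [|p]; last by apply: itg_sum => q.
rewrite /lin_vec ip_suml; apply: eq_bigr => p _.
rewrite Ex_sum// ip_sumr; apply: eq_bigr => q _.
by rewrite ExZ; [rewrite ExZ// W_cov ipZl ipZr|exact: itgZ].
Qed.

Lemma lincomb_var s : Ex P (fun w => lincomb Wf s w ^+ 2) = `|lin_vec s| ^+ 2.
Proof. by rewrite -ipE -lincomb_cov; apply: eqEx => w; rewrite expr2. Qed.

Lemma lincomb_moment4 s : Ex P (fun w => lincomb Wf s w ^+ 4) = 3 * `|lin_vec s| ^+ 4.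
Proof.
rewrite (gaussian_moment4 (lincomb_meas s) (lincomb_gaussian s) (lincomb_mean s)).
by rewrite lincomb_var -exprM.
Qed.

Lemma WB_lincomb g h : (fun w => W g w - W h w) = lincomb Wf [:: (1, g); (-1, h)].
Proof. by apply/funext => w; rewrite /lincomb !big_cons big_nil /=; ring. Qed.

Lemma WD_lincomb g h : (fun w => W g w + W h w) = lincomb Wf [:: (1, g); (1, h)].
Proof. by apply/funext => w; rewrite /lincomb !big_cons big_nil /=; ring. Qed.

Lemma WB_var g h : Ex P (fun w => (W g w - W h w) ^+ 2) = `|g - h| ^+ 2.
Proof.
have -> : g - h = lin_vec [:: (1, g); (-1, h)].
  by rewrite /lin_vec !big_cons big_nil scale1r scaleN1r addr0.
by rewrite -lincomb_var -WB_lincomb.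
Qed.

Lemma WB_moment4 g h : Ex P (fun w => (W g w - W h w) ^+ 4) = 3 * `|g - h| ^+ 4.
Proof.
have -> : g - h = lin_vec [:: (1, g); (-1, h)].
  by rewrite /lin_vec !big_cons big_nil scale1r scaleN1r addr0.
by rewrite -lincomb_moment4 -WB_lincomb.
Qed.

Lemma WD_moment4 g h : Ex P (fun w => (W g w + W h w) ^+ 4) = 3 * `|g + h| ^+ 4.
Proof.
have -> : g + h = lin_vec [:: (1, g); (1, h)].
  by rewrite /lin_vec !big_cons big_nil !scale1r addr0.
by rewrite -lincomb_moment4 -WD_lincomb.
Qed.

Lemma W_var h : Ex P (fun w => W h w ^+ 2) = `|h| ^+ 2.
Proof. by rewrite -ipE -W_cov; apply: eqEx => w; rewrite expr2. Qed.

Lemma WB_Lall g h : Lall P (fun w => W g w - W h w).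
Proof. by rewrite WB_lincomb; exact: lincomb_Lall. Qed.

Lemma WD_Lall g h : Lall P (fun w => W g w + W h w).
Proof. by rewrite WD_lincomb; exact: lincomb_Lall. Qed.

(** The Wick square of W h, that is, the double Wiener integral of h tensor h. *)
Definition Wsq (h : V) (w : T) : R := W h w ^+ 2 - `|h| ^+ 2.

Lemma Wsq_Lall h : Lall P (Wsq h).
Proof.
apply: Lall_add; first by apply: Lall_exp; exact: W_Lall.
exact: Lall_cst.
Qed.

(** The difference is the product (W g - W h)(W g + W h) minus its mean. Its variance is at most the
    second moment of the product, which Cauchy-Schwarz reduces to two Gaussian fourth moments. *)
Lemma WsqB_le g h : Ex P (fun w => (Wsq g w - Wsq h w) ^+ 2) <=
  3 * (`|g - h| * `|g + h|) ^+ 2.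
Proof.
pose X w := (W g w - W h w) * (W g w + W h w).
have lX : Lall P X by apply: Lall_mul; [exact: WB_Lall|exact: WD_Lall].
have eX : Ex P X = `|g| ^+ 2 - `|h| ^+ 2.
  rewrite -!W_var -ExB; [|exact: Lall_itg (Lall_exp 2 (W_Lall g))|exact: Lall_itg (Lall_exp 2 (W_Lall h))].
  by apply: eqEx => w; rewrite /X; ring.
have -> : Ex P (fun w => (Wsq g w - Wsq h w) ^+ 2) =
    Ex P (fun w => X w ^+ 2 - 2 * Ex P X * X w + Ex P X ^+ 2).
  by apply: eqEx => w; rewrite /Wsq eX /X; ring.
have i1 := Lall_itg (Lall_exp 2 lX); have i2 := Lall_itg lX.
have i3 : itg P (fun w => 2 * Ex P X * X w) by exact: itgZ.
rewrite ExD; [|exact: itgB|exact: itg_cst].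
rewrite ExB// ExZ// Ex_cst.
apply: (@le_trans _ _ (Ex P (fun w => X w ^+ 2))).
  by have := sqr_ge0 (Ex P X); lra.
have lB : L2 P (fun w => (W g w - W h w) ^+ 2).
  exact: Lall_L2 (Lall_exp 2 (WB_Lall g h)).
have lD : L2 P (fun w => (W g w + W h w) ^+ 2).
  exact: Lall_L2 (Lall_exp 2 (WD_Lall g h)).
have := L2_CS lB lD.
under [X in X ^+ 2 <= _]eqEx do rewrite -exprMn -/(X _).
under [X in _ <= X * _]eqEx do rewrite -exprM.
under [X in _ <= _ * X]eqEx do rewrite -exprM.
rewrite WB_moment4 WD_moment4 => hh.
rewrite -(@ler_pXn2r _ 2) ?nnegrE ?mulr_ge0 ?sqr_ge0//.
  by apply: le_trans hh _; rewrite le_eqVlt; apply/orP; left; apply/eqP; ring.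
by apply: Ex_ge0 => w; rewrite sqr_ge0.
Qed.

End isonormal.

(** * Stieltjes sums against a monotone integrator *)

Section stieltjes_sums.
Context {R : realType} (phi : R -> R).
Hypothesis phi_nd : forall s t : R, 0 <= s -> s <= t -> t <= 1 -> phi s <= phi t.

Definition riemS (f y : R -> R) (N : nat) : R :=
  \sum_(0 <= j < N) y (grid N j) * (f (grid N j.+1) - f (grid N j)).

Lemma riemS_sub (f y : R -> R) k l : (0 < k)%N -> (0 < l)%N ->
  riemS f y k - riemS f y l = \sum_(0 <= j < k * l)
    (y (grid k (j %/ l)) - y (grid l (j %/ k))) *
      (f (grid (k * l) j.+1) - f (grid (k * l) j)).
Proof. exact: (@riem_sub _ R^o f y k l). Qed.

Lemma grid_le1 N j : (j <= N)%N -> grid N j <= 1 :> R.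
Proof.
case: N => [|N jN]; first by rewrite /grid invr0 mulr0.
by rewrite -(@gridN R N.+1)// grid_le.
Qed.

Lemma dphi_ge0 N j : (j < N)%N -> 0 <= phi (grid N j.+1) - phi (grid N j).
Proof. by move=> jN; rewrite subr_ge0 phi_nd ?grid_ge0 ?grid_le ?grid_le1. Qed.

Lemma sum_norm_dphi N : (0 < N)%N ->
  \sum_(0 <= j < N) `|phi (grid N j.+1) - phi (grid N j)| = phi 1 - phi 0.
Proof.
move=> N0; transitivity (\sum_(0 <= j < N) (phi (grid N j.+1) - phi (grid N j))).
  by apply: eq_big_nat => j /= jN; rewrite ger0_norm ?dphi_ge0.
by rewrite telescope_sumr// gridN// grid0.
Qed.

Lemma sum_dphi_le N (b : nat -> R) M : (0 < N)%N ->
  (forall j, (j < N)%N -> `|b j| <= M) ->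
  `|\sum_(0 <= j < N) b j * (phi (grid N j.+1) - phi (grid N j))| <= M * (phi 1 - phi 0).
Proof.
move=> N0 bM; apply: le_trans (ler_norm_sum _ _ _) _.
rewrite -(sum_norm_dphi N0) mulr_sumr big_nat [leRHS]big_nat; apply: ler_sum => j /= jN.
by rewrite normrM ler_wpM2r ?bM.
Qed.

Lemma riemS_cvg (y : R -> R) : {within `[0, 1], continuous y} -> cvg (riemS phi y N @[N --> \oo]).
Proof.
move=> cy; apply: cauchy_cvg; apply: cauchy_exP => e e0.
have d0 : 0 <= phi 1 - phi 0 by rewrite subr_ge0 phi_nd.
have e1 : 0 < e / (phi 1 - phi 0 + 1) / 2 by rewrite !divr_gt0// ltr_wpDl.
have [K K0 hK] := unif_cont_grid cy e1.
exists (riemS phi y K); suff : \forall k \near \oo, ball (riemS phi y K) e (riemS phi y k) by [].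
near=> k; have Kk : (K <= k)%N by near: k; exact: nbhs_infty_ge.
have k0 := leq_trans K0 Kk.
rewrite -ball_normE /= riemS_sub//.
apply: le_lt_trans (sum_dphi_le (M := e / (phi 1 - phi 0 + 1) / 2) _ _) _.
- by rewrite muln_gt0 K0.
- by move=> j jk; apply: hK.
- rewrite mulrAC ltr_pdivrMr// mulrAC ltr_pdivrMr ?ltr_wpDl//.
  by rewrite -mulrA ltr_pM2l//; lra.
Unshelve. all: by end_near. Qed.

(** The last sum is the discrete covariation of f and g, by which summation by parts differs from
    integration by parts. *)
Lemma abel_grid (f g : R -> R) N : (0 < N)%N ->
  riemS g f N = f 1 * g 1 - f 0 * g 0 - riemS f g N -
    \sum_(0 <= j < N) (f (grid N j.+1) - f (grid N j)) * (g (grid N j.+1) - g (grid N j)).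
Proof.
move=> N0; have : f 1 * g 1 - f 0 * g 0 =
    \sum_(0 <= j < N) (f (grid N j.+1) * g (grid N j.+1) - f (grid N j) * g (grid N j)).
  by rewrite (telescope_sumr (fun j => f (grid N j) * g (grid N j)))// gridN// grid0.
move=> ->; rewrite /riemS -!sumrB.
by apply: eq_bigr => j _; ring.
Qed.

End stieltjes_sums.

(** * Moments of the increments of B along a grid *)

Section increments_of_W.
Context {d} {T : measurableType d} {R : realType} (P : probability T R).
Context (H : R) (hH : 2^-1 < H < 1).
Context (V : completeNormedModType R) (ip : {dot V for idfun}) (ind : R -> V).
Hypothesis hV : step_completion H ip ind.
Context (W : V -> {RV P >-> R}).
Hypothesis hW : isonormal ip W.

Lemma stepE v : ip v v = `|v| ^+ 2. Proof. by case: hV. Qed.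

Lemma step_ip s t : s \in `[0, 1] -> t \in `[0, 1] -> ip (ind s) (ind t) = fbm_cov H s t.
Proof. by case: hV => _ + _; apply. Qed.

Lemma ind_var t : t \in `[0, 1] -> `|ind t| ^+ 2 = t `^ (2 * H).
Proof.
move=> t01; rewrite -stepE step_ip// /fbm_cov subrr normr0 powR0; first by field.
by have /andP[h _] := p_bounds hH; rewrite gt_eqF// (lt_trans ltr01).
Qed.

Lemma ind_le1 t : t \in `[0, 1] -> `|ind t| <= 1.
Proof.
move=> t01; rewrite -(@ler_pXn2r _ 2) ?nnegrE// ind_var// expr1n.
move: t01; rewrite in_itv/= => /andP[t0 t1]; have /andP[h _] := p_bounds hH.
have := @ge0_ler_powR R (2 * H) _ t 1; rewrite powR1; apply; rewrite ?nnegrE//.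
by rewrite (le_trans ler01)// ltW.
Qed.

Lemma indB_var s t : s \in `[0, 1] -> t \in `[0, 1] ->
  `|ind s - ind t| ^+ 2 = `|s - t| `^ (2 * H).
Proof.
move=> s01 t01; rewrite -stepE ipBl !ipBr !stepE !ind_var// !step_ip//.
by rewrite fbm_covC /fbm_cov; field.
Qed.

Lemma indB_le s t : s \in `[0, 1] -> t \in `[0, 1] -> `|ind s - ind t| ^+ 2 <= `|s - t|.
Proof.
move=> s01 t01; rewrite indB_var//; have /andP[h _] := p_bounds hH.
have [->|st] := eqVneq (s - t) 0; first by rewrite normr0 powR0// gt_eqF// (lt_trans ltr01).
apply: ge1r_powR; last exact: ltW.
rewrite normr_gt0 st; move: s01 t01; rewrite !in_itv/= => /andP[? ?] /andP[? ?].
by rewrite ler_norml; apply/andP; split; lra.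
Qed.

(** The constant is 3 from [WsqB_le] times 4, which bounds |ind s + ind t|^2; moreover |s - t|^(2H)
    <= |s - t| on [0, 1]. *)
Lemma Wsq_ind_le s t : s \in `[0, 1] -> t \in `[0, 1] ->
  Ex P (fun w => (Wsq W (ind s) w - Wsq W (ind t) w) ^+ 2) <= 12 * `|s - t|.
Proof.
move=> s01 t01; apply: le_trans (WsqB_le stepE hW _ _) _; rewrite exprMn mulrA.
have h1 := indB_le s01 t01.
have h2 : `|ind s + ind t| ^+ 2 <= 4.
  have : `|ind s + ind t| <= 2.
    by apply: le_trans (ler_normD _ _) _; have := ind_le1 s01; have := ind_le1 t01; lra.
  by have := normr_ge0 (ind s + ind t); nra.
have h3 := sqr_ge0 `|ind s - ind t|; have h4 := sqr_ge0 `|ind s + ind t|.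
move: h1 h2 h3 h4; move: (_ ^+ 2) (_ ^+ 2) => a b h1 h2 h3 h4; nra.
Qed.

Definition dind N j : V := ind (grid N j.+1) - ind (grid N j).

Definition dB N j (w : T) : R := W (ind (grid N j.+1)) w - W (ind (grid N j)) w.

Lemma dind_var N j : (j < N)%N -> `|dind N j| ^+ 2 = N%:R^-1 `^ (2 * H).
Proof.
move=> jN; have N0 : (0 < N)%N by case: N jN.
by rewrite indB_var ?grid_mem// ?(ltnW jN)// gridS ger0_norm.
Qed.

Lemma dB_Lall N j : Lall P (dB N j). Proof. exact: (WB_Lall hW). Qed.

Lemma dB_var N j : Ex P (fun w => dB N j w ^+ 2) = `|dind N j| ^+ 2.
Proof. exact: (WB_var stepE hW). Qed.

(* The quadratic variation of B vanishes since 2H > 1. *)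
Lemma dBsq_le N j : (j < N)%N ->
  Ex P (fun w => (dB N j w ^+ 2 - `|dind N j| ^+ 2) ^+ 2) <= 3 * N%:R^-1 `^ (2 * H) ^+ 2.
Proof.
move=> jN; have l2 : Lall P (fun w => dB N j w ^+ 2) := Lall_exp 2 (dB_Lall N j).
have l4 := Lall_exp 4 (dB_Lall N j).
have i1 := Lall_itg l2; have i2 := Lall_itg l4.
have i3 : itg P (fun w => 2 * `|dind N j| ^+ 2 * dB N j w ^+ 2) by exact: itgZ.
have -> : Ex P (fun w => (dB N j w ^+ 2 - `|dind N j| ^+ 2) ^+ 2) =
    Ex P (fun w => dB N j w ^+ 4 - 2 * `|dind N j| ^+ 2 * dB N j w ^+ 2 + `|dind N j| ^+ 4).
  by apply: eqEx => w; ring.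
rewrite ExD; [|exact: itgB|exact: itg_cst].
rewrite ExB// ExZ// Ex_cst dB_var (WB_moment4 stepE hW) -/(dind N j) -(dind_var jN).
by have := sqr_ge0 (`|dind N j| ^+ 2); move: (`|dind N j|) => x; nra.
Qed.

(** The counterpart of [norm_incr_le] for random coefficients. Expanding the squared norm into a
    double sum of real products also settles its measurability. *)
Lemma Ex_norm_incr_le N (b : nat -> T -> R) M : (0 < N)%N ->
  (forall j, L2 P (b j)) -> (forall j, (j < N)%N -> Ex P (fun w => b j w ^+ 2) <= M) ->
  itg P (fun w => `|\sum_(0 <= j < N) b j w *: dind N j| ^+ 2) /\
  Ex P (fun w => `|\sum_(0 <= j < N) b j w *: dind N j| ^+ 2) <= M.
Proof.
move=> N0 lb bM.
have E w : `|\sum_(0 <= j < N) b j w *: dind N j| ^+ 2 =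
    \sum_(0 <= i < N) \sum_(0 <= j < N)
      cov_incr H (grid N i) (grid N i.+1) (grid N j) (grid N j.+1) * (b i w * b j w).
  rewrite (norm_incr_sum stepE step_ip); apply: eq_bigr => i _; apply: eq_bigr => j _.
  by rewrite mulrC.
under eq_fun do rewrite E.
have i1 i j : itg P (fun w => cov_incr H (grid N i) (grid N i.+1) (grid N j) (grid N j.+1) *
    (b i w * b j w)) by apply: itgZ; exact: L2_mul.
have i2 i : itg P (fun w => \sum_(0 <= j < N)
      cov_incr H (grid N i) (grid N i.+1) (grid N j) (grid N j.+1) * (b i w * b j w)).
  exact: itg_sum.
split; first exact: itg_sum.
rewrite Ex_sum//.
apply: le_trans (cov_grid_le (b := fun i j => Ex P (fun w => b i w * b j w)) hH N0 _).
  rewrite le_eqVlt; apply/orP; left; apply/eqP; apply: eq_bigr => i _.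
  rewrite Ex_sum//; apply: eq_bigr => j _; rewrite ExZ; last exact: L2_mul.
  by rewrite mulrC.
by move=> i j iN jN; apply: Ex_mul_le; rewrite ?bM.
Qed.

End increments_of_W.

(** * The divergence of phi B *)

Section divergence_limit.
Context {d} {T : measurableType d} {R : realType} (P : probability T R).
Context (H : R) (hH : 2^-1 < H < 1).
Context (V : completeNormedModType R) (ip : {dot V for idfun}) (ind : R -> V).
Hypothesis hV : step_completion H ip ind.
Context (W : V -> {RV P >-> R}).
Hypothesis hW : isonormal ip W.
Hypothesis cW : forall w, {within `[0, 1], continuous (fun t => W (ind t) w)}.
Context (phi : R -> R).
Hypothesis phi_nd : forall s t : R, 0 <= s -> s <= t -> t <= 1 -> phi s <= phi t.
Hypothesis phi_c : {within `[0, 1], continuous phi}.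
Hypothesis phi0 : phi 0 = 0.
Local Notation dBw := (dB ind W).
Local Notation dindw := (dind ind).
Local Notation Wsqw := (Wsq W).

Let ipE v : ip v v = `|v| ^+ 2. Proof. exact: stepE hV v. Qed.

Lemma phi_ge0 t : t \in `[0, 1] -> 0 <= phi t.
Proof. by rewrite in_itv/= => /andP[t0 t1]; rewrite -phi0 phi_nd. Qed.

Lemma phi_le t : t \in `[0, 1] -> phi t <= phi 1.
Proof. by rewrite in_itv/= => /andP[t0 t1]; rewrite phi_nd. Qed.

(* ZN is the divergence of the discretised integrand uN. Summation by parts turns
   it, up to quadratic variation, into ZA, whose limit exists pathwise. *)
Definition uN N (w : T) : V :=
  \sum_(0 <= j < N) (phi (grid N j) * W (ind (grid N j)) w) *: dindw N j.

Definition ZN N (w : T) : R := \sum_(0 <= j < N)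
  phi (grid N j) * (W (ind (grid N j)) w * dBw N j w - ip (ind (grid N j)) (dindw N j)).

Definition ZA N (w : T) : R :=
  2^-1 * (phi 1 * Wsqw (ind 1) w - riemS phi (fun t => Wsqw (ind t) w) N).

(** Half of phi(1) Wsq(ind 1) minus the pathwise Stieltjes integral of Wsq(ind t) with respect to
    phi. Being a limit for every outcome, it inherits W-measurability from [ZA]. *)
Definition Zlim (w : T) : R := lim (ZA N w @[N --> \oo]).

Lemma phiB_le s t : s \in `[0, 1] -> t \in `[0, 1] ->
  Ex P (fun w => (phi s * W (ind s) w - phi t * W (ind t) w) ^+ 2) <=
  2 * (phi 1 ^+ 2 * `|s - t|) + 2 * (phi s - phi t) ^+ 2.
Proof.
move=> s01 t01.
have lB := Lall_L2 (WB_Lall hW (ind s) (ind t)).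
have lt := Lall_L2 (W_Lall hW (ind t)).
have -> : Ex P (fun w => (phi s * W (ind s) w - phi t * W (ind t) w) ^+ 2) =
   Ex P (fun w => (phi s * (W (ind s) w - W (ind t) w) + (phi s - phi t) * W (ind t) w) ^+ 2).
  by apply: eqEx => w; ring.
apply: le_trans (L2_add_le (L2Z _ lB) (L2Z _ lt)) _; apply: lerD.
  rewrite ler_pM2l//; under eqEx do rewrite exprMn.
  rewrite ExZ; last exact: lB.2.
  rewrite (WB_var ipE hW); apply: ler_pM; rewrite ?sqr_ge0// ?(indB_le hH hV)//.
  by rewrite lerXn2r ?nnegrE ?phi_ge0 ?phi_le ?bound_itvE.
rewrite ler_pM2l//; under eqEx do rewrite exprMn.
rewrite ExZ; last exact: lt.2.
rewrite (W_var ipE hW) -[leRHS]mulr1 ler_wpM2l ?sqr_ge0// -[leRHS](expr1n _ 2).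
by rewrite lerXn2r ?nnegrE// (ind_le1 hH hV).
Qed.

Lemma grid_small (e : R) : 0 < e -> exists2 K, (0 < K)%N & forall k l j, (K <= k)%N -> (K <= l)%N ->
  (j < k * l)%N -> [/\ grid k (j %/ l) \in (`[0, 1] : interval R), grid l (j %/ k) \in (`[0, 1] : interval R),
    `|grid k (j %/ l) - grid l (j %/ k)| <= e & `|phi (grid k (j %/ l)) - phi (grid l (j %/ k))| <= e].
Proof.
move=> e0; have [K1 K10 h1] := unif_cont_grid phi_c e0.
have cid : {within `[0, 1], continuous (fun x : R => x)}.
  by apply: continuous_subspaceT => x; exact: cvg_id.
have [K2 K20 h2] := unif_cont_grid cid e0.
exists (maxn K1 K2); first by rewrite leq_max K10.
move=> k l j; rewrite !geq_max => /andP[k1 k2] /andP[l1 l2] jkl; split.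
- exact: grid_mem2 jkl.
- by apply: (@grid_mem2 _ l k j); rewrite mulnC.
- exact: h2.
- exact: h1.
Qed.

Lemma uN_sub k l w : (0 < k)%N -> (0 < l)%N ->
  uN k w - uN l w = \sum_(0 <= j < k * l)
    (phi (grid k (j %/ l)) * W (ind (grid k (j %/ l))) w -
     phi (grid l (j %/ k)) * W (ind (grid l (j %/ k))) w) *: dindw (k * l) j.
Proof. exact: (riem_sub ind (fun t => phi t * W (ind t) w)). Qed.

Lemma phiW_L2 t : L2 P (fun w => phi t * W (ind t) w).
Proof. by apply: L2Z; exact: Lall_L2 (W_Lall hW _). Qed.

Lemma uN_cauchy (e : R) : 0 < e -> exists2 K, (0 < K)%N & forall k l, (K <= k)%N -> (K <= l)%N ->
  itg P (fun w => `|uN k w - uN l w| ^+ 2) /\ Ex P (fun w => `|uN k w - uN l w| ^+ 2) <= e.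
Proof.
(* The cap by 1 gives e1^2 <= e1 for the squared increment of phi; the denominator is the sum of the
   two coefficients in [phiB_le]. *)
move=> e0; pose e1 := Num.min 1 (e / (2 * phi 1 ^+ 2 + 2)).
have D0 : 0 < 2 * phi 1 ^+ 2 + 2 by rewrite ltr_wpDl// mulr_ge0// sqr_ge0.
have e10 : 0 < e1 by rewrite lt_min ltr01 divr_gt0.
have [K K0 hK] := grid_small e10; exists K => // k l kK lK.
have k0 := leq_trans K0 kK; have l0 := leq_trans K0 lK.
have E w := uN_sub w k0 l0.
under [fun w => `|uN k w - uN l w| ^+ 2]eq_fun do rewrite E.
apply: (Ex_norm_incr_le hH hV (b := fun j w => phi (grid k (j %/ l)) * W (ind (grid k (j %/ l))) w -
     phi (grid l (j %/ k)) * W (ind (grid l (j %/ k))) w)).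
- by rewrite muln_gt0 k0.
- by move=> j; apply: L2B; exact: phiW_L2.
- move=> j /(hK _ _ _ kK lK)[m1 m2 h1 h2].
  apply: le_trans (phiB_le m1 m2) _.
  have h3 : (phi (grid k (j %/ l)) - phi (grid l (j %/ k))) ^+ 2 <= e1.
    rewrite -real_normK ?num_real//; apply: le_trans (_ : e1 ^+ 2 <= _).
      by rewrite lerXn2r ?nnegrE// ltW.
    by rewrite expr2 -[leRHS]mulr1 ler_wpM2l ?(ltW e10)// ge_min lexx.
  have h4 : e1 * (2 * phi 1 ^+ 2 + 2) <= e by rewrite -ler_pdivlMr// ge_min lexx orbT.
  by have := sqr_ge0 (phi 1); move: h1 h3 h4; set a := (`|_ - _|); nra.
Qed.

Context (u : T -> V).
Hypothesis hu : forall w, uN N w @[N --> \oo] --> u w.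

Lemma uN_cvg_L2 (e : R) : 0 < e -> exists2 K, (0 < K)%N & forall k, (K <= k)%N ->
  itg P (fun w => `|uN k w - u w| ^+ 2) /\ Ex P (fun w => `|uN k w - u w| ^+ 2) <= e.
Proof.
move=> e0; have [K K0 hK] := uN_cauchy e0; exists K => // k kK.
apply: (fatou_Ex (X_ := fun l w => `|uN k w - uN (l + K) w| ^+ 2)).
- by move=> l; apply: (hK k (l + K)%N _ _).1 => //; exact: leq_addl.
- by move=> l w; exact: sqr_ge0.
- move=> w; have c : uN (l + K) w @[l --> \oo] --> u w by rewrite (cvg_shiftn K (uN ^~ w)).
  have c2 : `|uN k w - uN (l + K) w| @[l --> \oo] --> `|uN k w - u w|.
    by apply: cvg_norm; apply: cvgB => //; exact: cvg_cst.
  by under eq_fun do rewrite expr2; apply: cvgM.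
- by apply: nearW => l; apply: (hK k (l + K)%N _ _).2 => //; exact: leq_addl.
Qed.

Lemma uN_itg N : (0 < N)%N -> itg P (fun w => `|uN N w| ^+ 2).
Proof.
move=> N0; pose b j w := phi (grid N j) * W (ind (grid N j)) w.
have h j : (j < N)%N -> Ex P (fun w => b j w ^+ 2) <= \sum_(0 <= j < N) Ex P (fun w => b j w ^+ 2).
  move=> jN; rewrite (bigD1_seq j) ?mem_index_iota ?iota_uniq//= lerDl.
  by apply: sumr_ge0 => i _; apply: Ex_ge0 => w; exact: sqr_ge0.
exact: (Ex_norm_incr_le hH hV N0 (fun j => phiW_L2 (grid N j)) h).1.
Qed.

Lemma norm_itg (a b : T -> V) : measurable_fun setT (fun w => `|a w + b w| ^+ 2) ->
  itg P (fun w => `|a w| ^+ 2) -> itg P (fun w => `|b w| ^+ 2) ->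
  itg P (fun w => `|a w + b w| ^+ 2).
Proof.
move=> m ia ib; apply: (itg_le (Y := fun w => 2 * (`|a w| ^+ 2 + `|b w| ^+ 2))) => //.
  by apply: itgZ; exact: itgD.
move=> w; rewrite ger0_norm ?sqr_ge0//.
have : `|a w + b w| ^+ 2 <= (`|a w| + `|b w|) ^+ 2 by rewrite lerXn2r ?nnegrE ?addr_ge0 ?ler_normD.
by have := sqr_ge0 (`|a w| - `|b w|); lra.
Qed.

(** Measurability of the squared norm comes from its being a pointwise limit of the squared norms of
    [uN], which are explicit quadratic expressions in W. *)
Lemma u_itg : itg P (fun w => `|u w| ^+ 2).
Proof.
have [K K0 hK] := uN_cvg_L2 ltr01.
have [i _] := hK K (leqnn K).
have e w : u w = uN K w + (u w - uN K w) by rewrite addrC subrK.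
have m : measurable_fun setT (fun w => `|u w| ^+ 2).
  apply: (measurable_fun_cvg (D := setT) (h := fun N w => `|uN N.+1 w| ^+ 2)) => //.
    by move=> N; exact: itg_meas (uN_itg (ltn0Sn N)).
  move=> w _; have c : uN N.+1 w @[N --> \oo] --> u w by rewrite (cvg_shiftS (uN ^~ w)).
  by under eq_fun do rewrite expr2; apply: cvgM; exact: cvg_norm.
under eq_fun do rewrite e; apply: norm_itg.
- by under eq_fun do rewrite -e.
- exact: uN_itg.
- by under eq_fun do rewrite distrC.
Qed.

Lemma ZA_cauchy (e : R) : 0 < e -> exists2 K, (0 < K)%N & forall k l, (K <= k)%N -> (K <= l)%N ->
  Ex P (fun w => (ZA k w - ZA l w) ^+ 2) <= e.
Proof.
move=> e0; pose M := 12 * (phi 1 ^+ 2 + 1).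
have M0 : 0 < M by rewrite mulr_gt0// ltr_wpDl ?sqr_ge0.
have e1 : 0 < e / M by rewrite divr_gt0.
have [K K0 hK] := grid_small e1; exists K => // k l kK lK.
have k0 := leq_trans K0 kK; have l0 := leq_trans K0 lK.
pose a j := phi (grid (k * l) j.+1) - phi (grid (k * l) j).
pose X j w := 2^-1 * (Wsqw (ind (grid l (j %/ k))) w - Wsqw (ind (grid k (j %/ l))) w).
have E w : ZA k w - ZA l w = \sum_(j <- index_iota 0 (k * l)) a j * X j w.
  transitivity (2^-1 * (riemS phi (fun t => Wsqw (ind t) w) l - riemS phi (fun t => Wsqw (ind t) w) k)).
    by rewrite /ZA; ring.
  rewrite riemS_sub// mulnC mulr_sumr; apply: eq_bigr => j _.
  by rewrite /a /X; ring.
under eqEx do rewrite E.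
have lX j : L2 P (X j).
  by apply: L2Z; apply: L2B; exact: Lall_L2 (Wsq_Lall hW _).
have [|_] := @L2_sum_le _ _ _ P _ (index_iota 0 (k * l)) a X (3 * (e / M)) lX.
  move=> j; rewrite mem_index_iota /= => jkl.
  have [m1 m2 h1 _] := hK _ _ _ kK lK jkl.
  rewrite /X; under eqEx do rewrite exprMn.
  rewrite ExZ; last by apply: (L2B _ _).2; exact: Lall_L2 (Wsq_Lall hW _).
  have := Wsq_ind_le hH hV hW m2 m1; rewrite distrC => h2.
  by move: h1 h2; set z := (`|_ - _|); set y := Ex P _; lra.
move=> h; apply: le_trans h _.
rewrite sum_norm_dphi// ?muln_gt0 ?k0// phi0 subr0.
apply: (@le_trans _ _ (e / M * M)); last by rewrite divfK ?gt_eqF.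
move: e1; set y := e / M => y0; rewrite /M.
by have := sqr_ge0 (phi 1); nra.
Qed.

Lemma ZA_L2 N : L2 P (ZA N).
Proof.
apply: L2Z; apply: L2B; first by apply: L2Z; exact: Lall_L2 (Wsq_Lall hW _).
apply: L2_sum => j; under eq_fun do rewrite mulrC.
by apply: L2Z; exact: Lall_L2 (Wsq_Lall hW _).
Qed.

Lemma Wsq_continuous w : {within `[0, 1], continuous (fun t => Wsqw (ind t) w)}.
Proof.
have c1 : {within `[0, 1], continuous (fun t => W (ind t) w)} by exact: cW.
have c2 : {within `[0, 1], continuous (fun t => `|ind t| ^+ 2)}.
  apply: (@subspace_eq_continuous _ _ _ (fun t : R => apow (2 * H) t)).
    move=> t; rewrite inE /= => t01; rewrite /from_subspace/= (ind_var hH hV)// apow_pos//.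
    by move: t01; rewrite in_itv/= => /andP[].
  apply: continuous_subspaceT; apply: apow_continuous.
  by have /andP[h _] := p_bounds hH; rewrite (lt_trans ltr01).
rewrite (_ : (fun t => _) = (fun t => W (ind t) w * W (ind t) w - `|ind t| ^+ 2)).
  by move=> t; apply: cvgB; [apply: cvgM; exact: c1|exact: c2].
by apply/funext => t; rewrite /Wsq expr2.
Qed.

Lemma ZA_cvg w : ZA N w @[N --> \oo] --> Zlim w.
Proof.
suff : cvg (ZA N w @[N --> \oo]) by [].
apply: is_cvgMr; apply: is_cvgB; first exact: is_cvg_cst.
by apply: riemS_cvg => //; exact: Wsq_continuous.
Qed.

Lemma Zlim_L2 : L2 P Zlim.
Proof.
have [K K0 hK] := ZA_cauchy ltr01.
exact: (L2_cvg_fatou ZA_L2 ZA_cvg hK).1.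
Qed.

Lemma ZA_Zlim : Ex P (fun w => (ZA N w - Zlim w) ^+ 2) @[N --> \oo] --> 0.
Proof.
apply/cvgrPdist_le => e e0; have [K K0 hK] := ZA_cauchy e0.
have [_ h] := L2_cvg_fatou ZA_L2 ZA_cvg hK.
near=> N; rewrite sub0r normrN ger0_norm; last by apply: Ex_ge0 => w; exact: sqr_ge0.
by apply: h; near: N; exact: nbhs_infty_ge.
Unshelve. all: by end_near. Qed.

Lemma ip_ind_dind N j : ip (ind (grid N j)) (dindw N j) =
  2^-1 * (`|ind (grid N j.+1)| ^+ 2 - `|ind (grid N j)| ^+ 2 - `|dindw N j| ^+ 2).
Proof. by rewrite /dind -!ipE !ipBl !ipBr (ipC ip (ind (grid N j.+1))); field. Qed.

Lemma ZN_L2 N : L2 P (ZN N).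
Proof.
apply: L2_sum => j; apply: L2Z; apply: L2B; last exact: L2_cst.
by apply: Lall_L2; apply: Lall_mul; [exact: (W_Lall hW)|exact: (dB_Lall _ hW)].
Qed.

Lemma quad_var_L2 N : L2 P (fun w => \sum_(0 <= j < N) phi (grid N j) * (dBw N j w ^+ 2 - `|dindw N j| ^+ 2)).
Proof.
apply: L2_sum => j; apply: L2Z; apply: L2B; last exact: L2_cst.
by apply: Lall_L2; apply: Lall_exp; exact: (dB_Lall _ hW).
Qed.

(** Each of the N terms has L^2 norm of order N^(-2H), so the sum has order N^(1 - 2H), which tends
    to 0 exactly because H > 1/2. *)
Lemma quad_var_le N : (0 < N)%N ->
  Ex P (fun w => (\sum_(0 <= j < N) phi (grid N j) * (dBw N j w ^+ 2 - `|dindw N j| ^+ 2)) ^+ 2) <=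
  phi 1 ^+ 2 * (3 * (N%:R^-1 `^ (2 * H - 1)) ^+ 2).
Proof.
move=> N0; pose Q j w := dBw N j w ^+ 2 - `|dindw N j| ^+ 2.
have lQ j : L2 P (Q j).
  apply: L2B; last exact: L2_cst.
  by apply: Lall_L2; apply: Lall_exp; exact: (dB_Lall _ hW).
have hQ j : j \in index_iota 0 N -> Ex P (fun w => Q j w ^+ 2) <= 3 * N%:R^-1 `^ (2 * H) ^+ 2.
  by rewrite mem_index_iota /= => jN; exact: (dBsq_le hH hV hW).
have [_ hB] := L2_sum_le (phi \o grid N) lQ hQ.
apply: le_trans hB _.
have p1 : 0 <= phi 1 by rewrite phi_ge0// bound_itvE.
have s1 : \sum_(j <- index_iota 0 N) `|(phi \o grid N) j| <= N%:R * phi 1.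
  rewrite big_nat; apply: le_trans (_ : \sum_(0 <= j < N) phi 1 <= _).
    rewrite [leRHS]big_nat; apply: ler_sum => j /= jN.
    have m := @grid_mem R N j N0 (ltnW jN).
    by rewrite ger0_norm ?phi_ge0// phi_le.
  by rewrite sumr_const_nat subn0 mulr_natl.
have NR : (0 : R) < N%:R by rewrite ltr0n.
have e1 : N%:R^-1 `^ (2 * H) = N%:R^-1 * N%:R^-1 `^ (2 * H - 1) :> R.
  by rewrite mulr_powRB1 ?invr_ge0//; have /andP[? _] := p_bounds hH; rewrite (lt_trans ltr01).
rewrite e1; set y := _ `^ _.
apply: (@le_trans _ _ ((N%:R * phi 1) ^+ 2 * (3 * (N%:R^-1 * y) ^+ 2))).
  apply: ler_wpM2r; first by rewrite mulr_ge0// sqr_ge0.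
  by rewrite lerXn2r ?nnegrE ?mulr_ge0 ?sumr_ge0.
by rewrite le_eqVlt; apply/orP; left; apply/eqP; field; rewrite gt_eqF.
Qed.

(** Since B dB = (d(B^2) - (dB)^2)/2, [ZN] is half a Stieltjes sum of phi against [Wsq], up to
    quadratic variation. Summation by parts turns the former into [ZA] plus the covariation of phi
    and [Wsq], of order N^(-1/2) in L^2. *)
Lemma ZN_ZA_le N : (0 < N)%N -> Ex P (fun w => (ZN N w - ZA N w) ^+ 2) <=
  phi 1 ^+ 2 * (6 * N%:R^-1 + 3 / 2 * (N%:R^-1 `^ (2 * H - 1)) ^+ 2).
Proof.
move=> N0; pose a j := phi (grid N j.+1) - phi (grid N j).
pose X j w := Wsqw (ind (grid N j.+1)) w - Wsqw (ind (grid N j)) w.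
pose Q j w := dBw N j w ^+ 2 - `|dindw N j| ^+ 2.
have E w : ZN N w - ZA N w = - 2^-1 * (\sum_(j <- index_iota 0 N) a j * X j w +
    \sum_(j <- index_iota 0 N) phi (grid N j) * Q j w).
  have -> : ZN N w = 2^-1 * (riemS (fun t => Wsqw (ind t) w) phi N - \sum_(0 <= j < N) phi (grid N j) * Q j w).
    rewrite /ZN /riemS -sumrB mulr_sumr; apply: eq_bigr => j _.
    by rewrite ip_ind_dind /Q /dB /Wsq; field.
  by rewrite (abel_grid _ _ N0) phi0 mul0r subr0 /ZA /X /a; ring.
under eqEx do rewrite E exprMn.
have lX j : L2 P (X j) by apply: L2B; exact: Lall_L2 (Wsq_Lall hW _).
have hX j : j \in index_iota 0 N -> Ex P (fun w => X j w ^+ 2) <= 12 * N%:R^-1.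
  rewrite mem_index_iota /= => jN.
  have m1 := @grid_mem R N j N0 (ltnW jN); have m2 := @grid_mem R N j.+1 N0 jN.
  apply: le_trans (Wsq_ind_le hH hV hW m2 m1) _.
  by rewrite gridS ger0_norm.
have [lA hA] := L2_sum_le a lX hX.
have lB := quad_var_L2 N; have hB := quad_var_le N0.
rewrite ExZ; last exact: (L2D lA lB).2.
have h := L2_add_le lA lB.
have {}hA : Ex P (fun w => (\sum_(j <- index_iota 0 N) a j * X j w) ^+ 2) <= phi 1 ^+ 2 * (12 * N%:R^-1).
  apply: le_trans hA _.
  by rewrite sum_norm_dphi// phi0 subr0.
move: h hA hB.
set x1 := Ex P _; set x2 := Ex P _; set x3 := Ex P _; move=> h1 h2 h3.
by rewrite sqrrN expr2; lra.
Qed.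

Lemma ZN_Zlim : Ex P (fun w => (ZN N w - Zlim w) ^+ 2) @[N --> \oo] --> 0.
Proof.
have q0 : 0 < 2 * H - 1 by have /andP[? _] := p_bounds hH; rewrite subr_gt0.
have c1 : (N.+1%:R^-1 : R) @[N --> \oo] --> 0 by exact: cvg_harmonic.
have c2 : (N.+1%:R^-1 `^ (2 * H - 1) : R) @[N --> \oo] --> 0.
  apply: cvg_trans (_ : apow (2 * H - 1) N.+1%:R^-1 @[N --> \oo] --> 0).
    by apply: near_eq_cvg; apply: nearW => N; rewrite apow_pos// invr_ge0.
  by apply: (@cvg_comp _ _ _ (fun N : nat => N.+1%:R^-1 : R) (apow (2 * H - 1)) _ _ _ c1); exact: apow_cvg0.
rewrite -(cvg_shiftS (fun N => Ex P (fun w => (ZN N w - Zlim w) ^+ 2))).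
have c3 := ZA_Zlim; rewrite -(cvg_shiftS (fun N => Ex P (fun w => (ZA N w - Zlim w) ^+ 2))) in c3.
apply: (squeeze_cvgr (f := cst 0) (h := fun N =>
  2 * (phi 1 ^+ 2 * (6 * N.+1%:R^-1 + 3 / 2 * (N.+1%:R^-1 `^ (2 * H - 1)) ^+ 2)) +
  2 * Ex P (fun w => (ZA N.+1 w - Zlim w) ^+ 2))).
- apply: nearW => N; apply/andP; split; first by apply: Ex_ge0 => w; exact: sqr_ge0.
  have l1 := L2B (ZN_L2 N.+1) (ZA_L2 N.+1); have l2 := L2B (ZA_L2 N.+1) Zlim_L2.
  rewrite [leLHS](_ : _ = Ex P (fun w => ((ZN N.+1 w - ZA N.+1 w) + (ZA N.+1 w - Zlim w)) ^+ 2)); last first.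
    by apply: eqEx => w; congr (_ ^+ 2); ring.
  apply: le_trans (L2_add_le l1 l2) _; apply: lerD => //.
  by rewrite ler_pM2l// ZN_ZA_le.
- exact: cvg_cst.
- rewrite [X in _ --> X](_ : 0 = 2 * (phi 1 ^+ 2 * (6 * 0 + 3 / 2 * (0 * 0))) + 2 * 0); last by ring.
  apply: cvgD; last exact: cvgMr.
  apply: cvgMr; apply: cvgMr; apply: cvgD; first exact: cvgMr.
  by apply: cvgMr; under eq_fun do rewrite expr2; exact: cvgM.
Qed.

End divergence_limit.

Section trigonometric_functionals.
Context {R : realType} {m : nat} (lam : 'I_m -> R).

Let L (x : 'rV[R]_m) : R := \sum_i lam i * x 0 i.

Let lincos (p : R * R) (x : 'rV[R]_m) : R := p.1 * cos (L x + p.2).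

Let partial_lincos i p : partial i (lincos p) = lincos (p.1 * lam i, p.2 + pi / 2).
Proof.
apply/funext => x; pose F (t : R) : R := p.1 * cos (L x + t * lam i + p.2).
have dF : is_derive (0 : R) (1 : R) F (p.1 * (lam i * - sin (L x + 0 * lam i + p.2))).
  apply: isdZ; apply: (@isd_comp _ 0 (fun t : R => L x + t * lam i + p.2) cos).
  apply: (isd_eq (isdD (isdD (isd_cst 0 (L x)) (isdM (isd_id 0) (isd_cst 0 (lam i))))
    (isd_cst 0 p.2))); ring.
have -> : partial i (lincos p) x = 'D_1 F 0.
  have E : (fun h : R => h^-1 *: ((lincos p \o shift x) (h *: (delta_mx 0 i : 'rV[R]_m)) - lincos p x)) =
      (fun h : R => h^-1 *: ((F \o shift 0) (h *: (1 : R)) - F 0)).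
    apply/funext => h; congr (_ *: (_ - _)); last by rewrite /lincos /F mul0r addr0.
    rewrite /lincos /F /=; congr (_ * cos (_ + _)).
    rewrite addr0 [h *: 1]mulr1 /L (bigD1 i)//= [in RHS](bigD1 i)//=.
    rewrite !mxE !eqxx mulr1 mulrDr (eq_bigr (fun j => lam j * x 0 j)); first by ring.
    by move=> j ji; rewrite !mxE eqxx (negbTE ji) /= mulr0 add0r.
  by rewrite /partial /derive E.
rewrite (derive_val (is_derive := dF)) /lincos mul0r addr0 /= addrA cosDpihalf; ring.
Qed.

(** The functions c cos(L x + theta) are closed under partial derivatives, because minus the sine is
    the cosine shifted by pi/2; hence all iterated partials are bounded and differentiable. *)
Lemma lincos_smooth (theta : R) :
  smooth_poly_growth (fun x : 'rV[R]_m => cos (\sum_i lam i * x 0 i + theta)).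
Proof.
move=> s; rewrite /=.
have [p ->] : exists p, foldr partial (fun x : 'rV[R]_m => cos (L x + theta)) s = lincos p.
  elim: s => [|i s [p IH]] /=; last by rewrite IH partial_lincos; eexists.
  by exists (1, theta); apply/funext => x; rewrite /lincos mul1r.
split; last first.
  by exists `|p.1|, 0%N => x; rewrite expr0 mulr1 /lincos normrM ler_piMr// cos_max.
move=> x; apply: (@differentiable_comp _ _ _ _ L (fun y : R => p.1 * cos (y + p.2))).
  have -> : L = \sum_(i < m) (fun y : 'rV[R]_m => lam i * y 0 i).
    by apply/funext => y; rewrite fct_sumE.
  apply: differentiable_sum => i; apply: differentiableM => //.
  exact: differentiable_coord.
by apply/derivable1_diffP; apply: ex_derive.
Qed.

End trigonometric_functionals.

Section weak_measurability.
Context {d} {T : measurableType d} {R : realType} (P : probability T R).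
Context {V : completeNormedModType R}.
Context (W : V -> {RV P >-> R}).
Local Notation TW := (g_sigma_algebraType (sigma_gen setT (fun (h : V) (w : T) => W h w))).

Lemma W_measurableP (X : T -> R) : W_measurable W X <-> measurable_fun setT (X : TW -> R).
Proof.
split=> [h _ B mB|h A mA]; first by rewrite setTI; exact: h.
by have := h measurableT A mA; rewrite setTI.
Qed.

Lemma W_measurable_measurable (X : T -> R) : W_measurable W X -> measurable_fun setT X.
Proof.
move=> hX _ B mB; rewrite setTI.
by apply: (@sigma_of_measurable _ _ _ _ setT (fun h w => W h w)) => [h _|]; [exact: W_meas|exact: hX].
Qed.

Lemma W_measurable_W h : W_measurable W (W h).
Proof. by move=> A mA; apply: sub_sigma_algebra; exists h, A. Qed.

Lemma W_measurable_lim (X_ : nat -> T -> R) (X : T -> R) :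
  (forall n, W_measurable W (X_ n)) -> (forall w, X_ ^~ w @ \oo --> X w) -> W_measurable W X.
Proof.
move=> mX cX; apply/W_measurableP.
have mX' n : measurable_fun setT (X_ n : TW -> R) by apply/W_measurableP.
by apply: (measurable_fun_cvg mX') => w _; exact: cX.
Qed.

Lemma W_measurable_sum (I : Type) (s : seq I) (X : I -> T -> R) :
  (forall i, W_measurable W (X i)) -> W_measurable W (fun w => \sum_(i <- s) X i w).
Proof.
move=> mX; apply/W_measurableP; by apply: measurable_sum => i; apply/W_measurableP.
Qed.

Lemma W_measurable_mul (X Y : T -> R) : W_measurable W X -> W_measurable W Y ->
  W_measurable W (fun w => X w * Y w).
Proof.
move=> /W_measurableP mX /W_measurableP mY; apply/W_measurableP; exact: measurable_funM.
Qed.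

Lemma W_measurable_sub (X Y : T -> R) : W_measurable W X -> W_measurable W Y ->
  W_measurable W (fun w => X w - Y w).
Proof.
move=> /W_measurableP mX /W_measurableP mY; apply/W_measurableP; exact: measurable_funB.
Qed.

Lemma W_measurable_cst (c : R) : W_measurable W (fun=> c).
Proof. by apply/W_measurableP; exact: measurable_cst. Qed.

Lemma W_measurable_row m (h : 'I_m -> V) (g : 'rV[R]_m -> R) : continuous g ->
  W_measurable W (fun w => g (\row_i W (h i) w)).
Proof.
move=> cg; apply/W_measurableP.
apply: (@measurable_row _ _ _ _ (fun i (w : TW) => W (h i) w)) => // i.
by move=> mT B mB; rewrite setTI; apply: sub_sigma_algebra; exists (h i), B.
Qed.

End weak_measurability.

(** * Cylindrical functionals and their derivatives *)

Section cylindrical.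
Context {d} {T : measurableType d} {R : realType} (P : probability T R).
Context {V : completeNormedModType R} (ip : {dot V for idfun}).
Hypothesis ipE : forall v, ip v v = `|v| ^+ 2.
Context (W : V -> {RV P >-> R}).
Hypothesis hW : isonormal ip W.

(* A Cauchy-Schwarz inequality for which |a|^2 need not be measurable. *)
Lemma ip_small (a v : T -> V) (M e : R) : measurable_fun setT (fun w => ip (a w) (v w)) ->
  itg P (fun w => `|v w| ^+ 2) -> (\int[P]_w (`|a w| ^+ 2)%:E <= M%:E)%E -> 0 < e ->
  itg P (fun w => ip (a w) (v w)) /\
  Ex P (fun w => `|ip (a w) (v w)|) <= (2 * e)^-1 * M + e / 2 * Ex P (fun w => `|v w| ^+ 2).
Proof.
move=> mi iv aM e0.
(* A measurable minorant of |a|^2, from 2xy <= x^2 + y^2 with x = |a| and y = e |v|; its integral is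
   at most the lower integral of |a|^2. *)
pose f w := Num.max 0 (2 * e * `|ip (a w) (v w)| - e ^+ 2 * `|v w| ^+ 2).
have f0 w : 0 <= f w by rewrite le_max lexx.
have fa w : f w <= `|a w| ^+ 2.
  rewrite ge_max sqr_ge0 /= lerBlDr; have := ip_le ipE (a w) (v w) => h.
  have := sqr_ge0 (`|a w| - e * `|v w|) => h2.
  apply: (@le_trans _ _ (2 * e * (`|a w| * `|v w|))); first by rewrite ler_pM2l// mulr_gt0.
  by move: h2; move: (`|a w|) (`|v w|) => x y; nra.
have mf : measurable_fun setT f.
  apply: measurable_maxr; first exact: measurable_cst.
  apply: measurable_funB; apply: measurable_funM => //; first exact: measurableT_comp.
  exact: (itg_meas iv).
have [|itf fM] := @ge0_itg _ _ _ P f M mf f0.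
  by apply: le_trans aM; apply: le_lower_integral => w _; rewrite lee_fin.
have le w : `|ip (a w) (v w)| <= (2 * e)^-1 * f w + e / 2 * `|v w| ^+ 2.
  have : 2 * e * `|ip (a w) (v w)| - e ^+ 2 * `|v w| ^+ 2 <= f w by rewrite le_max lexx orbT.
  have e2 : 0 < 2 * e by rewrite mulr_gt0.
  move=> h; rewrite -(ler_pM2l e2).
  have -> : 2 * e * ((2 * e)^-1 * f w + e / 2 * `|v w| ^+ 2) = f w + e ^+ 2 * `|v w| ^+ 2.
    by field; rewrite gt_eqF.
  by rewrite -lerBlDr.
have i1 : itg P (fun w => (2 * e)^-1 * f w) by exact: itgZ.
have i2 : itg P (fun w => e / 2 * `|v w| ^+ 2) by exact: itgZ.
have ii : itg P (fun w => ip (a w) (v w)) by apply: (itg_le mi (itgD i1 i2)).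
split => //; apply: le_trans (Ex_le (itg_norm ii) (itgD i1 i2) le) _.
by rewrite ExD// !ExZ// lerD2r ler_pM2l// invr_gt0 mulr_gt0.
Qed.

Context (m : nat) (h : 'I_m -> V) (g : 'rV[R]_m -> R).
Hypothesis sg : smooth_poly_growth g.
Local Notation X w := (\row_i W (h i) w).
Let DF (w : T) : V := \sum_(i < m) partial i g (X w) *: h i.

Let oh (k : V) (i : option 'I_m) : V := if i is Some i then h i else k.

Lemma row_family_gaussian k a b s (mu : R) :
  gaussian P (fun w => lincomb (fun i w => W (oh k i) w) s w + mu * (W a w - W b w)).
Proof.
have := lincomb_gaussian hW ([seq (p.1, oh k p.2) | p <- s] ++ [:: (mu, a); (- mu, b)]).
congr gaussian; apply/funext => w.
rewrite /lincomb big_cat big_map !big_cons big_nil /=; ring.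
Qed.

Lemma row_Lall (f : 'rV[R]_m -> R) : smooth_poly_growth f -> Lall P (fun w => f (X w)).
Proof.
move=> sf; apply: (@Lall_row _ _ _ P m (fun i w => W (oh 0 i) w) (fun w => W 0 w - W 0 w) _ _ f sf).
  by move=> i; exact: W_meas.
by move=> s mu; exact: row_family_gaussian.
Qed.

Lemma partial_smooth i : smooth_poly_growth (partial i g).
Proof. exact: smooth_growth_partial. Qed.

Lemma cylindrical_ibp k a b :
  Ex P (fun w => g (X w) * W k w * (W a w - W b w)) =
  \sum_i ip (h i) (a - b) * Ex P (fun w => partial i g (X w) * W k w) +
  ip k (a - b) * Ex P (fun w => g (X w)).
Proof.
have iW u v := Lall_itg (Lall_mul (W_Lall hW u) (W_Lall hW v)).
have cov u : Ex P (fun w => W u w * (W a w - W b w)) = ip u (a - b).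
  rewrite ipBr -!(W_cov hW) -ExB//; apply: eqEx => w; ring.
have := @gaussian_ibp_row _ _ _ P m (fun i w => W (oh k i) w) (fun w => W a w - W b w) g.
move=> /(_ (fun i => W_meas W (oh k i)) (measurable_funB (W_meas W a) (W_meas W b))
  (row_family_gaussian k a b)) /= -> //.
- by rewrite cov; congr (_ + _); apply: eq_bigr => i _; rewrite cov.
- by move=> i; exact: (W_mean hW).
- by rewrite ExB ?(W_mean hW) ?subrr//; exact: Lall_itg (W_Lall hW _).
Qed.

Lemma cyl_weak_measurable v : W_measurable W (fun w => ip (DF w) v).
Proof.
have -> : (fun w => ip (DF w) v) = (fun w => \sum_(i <- index_enum 'I_m) partial i g (X w) * ip (h i) v).
  by apply/funext => w; rewrite /DF ip_suml; apply: eq_bigr => i _; rewrite ipZl.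
apply: W_measurable_sum => i; apply: W_measurable_mul; last exact: W_measurable_cst.
by apply: W_measurable_row => x; apply: differentiable_continuous; exact: (partial_smooth i [::]).1.
Qed.

Lemma cyl_norm_itg : itg P (fun w => `|DF w| ^+ 2).
Proof.
have -> : (fun w => `|DF w| ^+ 2) = (fun w => \sum_(i <- index_enum 'I_m) \sum_(j <- index_enum 'I_m)
    ip (h i) (h j) * (partial i g (X w) * partial j g (X w))).
  apply/funext => w; rewrite -ipE /DF ip_suml; apply: eq_bigr => i _.
  by rewrite ip_sumr; apply: eq_bigr => j _; rewrite ipZl ipZr; ring.
apply: itg_sum => i; apply: itg_sum => j; apply: itgZ; apply: Lall_itg.
by apply: Lall_mul; apply: row_Lall; exact: partial_smooth.
Qed.

Lemma cylindrical_malliavin : malliavin_derivative ip W (fun w => g (X w)) DF.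
Proof.
have z0 : (\int[P]_w (`|(0 : R)| ^+ 2)%:E)%E = 0%E.
  by apply: integral0_eq => w _; rewrite normr0 expr0n.
split.
- split; first by apply/L2_Lfun; apply: Lall_L2; exact: row_Lall.
  by apply: W_measurable_row => x; apply: differentiable_continuous; exact: (sg [::]).1.
- split; first exact: cyl_weak_measurable.
  by rewrite -EFin_Ex ?ltry//; exact: cyl_norm_itg.
- exists (fun _ w => g (X w)), (fun _ => DF); split => [_||].
  + by exists m, h, g.
  + rewrite [Z in Z @ _](_ : _ = cst 0%E); first exact: cvg_cst.
    by apply/funext => k /=; apply: integral0_eq => w _; rewrite subrr normr0 expr0n.
  + rewrite [Z in Z @ _](_ : _ = cst 0%E); first exact: cvg_cst.
    by apply/funext => k /=; apply: integral0_eq => w _; rewrite subrr normr0 expr0n.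
Qed.

End cylindrical.

(** * Duality with the Malliavin derivative and uniqueness of the divergence *)

Section duality.
Context {d} {T : measurableType d} {R : realType} (P : probability T R).
Context (H : R) (hH : 2^-1 < H < 1).
Context (V : completeNormedModType R) (ip : {dot V for idfun}) (ind : R -> V).
Hypothesis hV : step_completion H ip ind.
Context (W : V -> {RV P >-> R}).
Hypothesis hW : isonormal ip W.
Hypothesis cW : forall w, {within `[0, 1], continuous (fun t => W (ind t) w)}.
Context (phi : R -> R).
Hypothesis phi_nd : forall s t : R, 0 <= s -> s <= t -> t <= 1 -> phi s <= phi t.
Hypothesis phi_c : {within `[0, 1], continuous phi}.
Hypothesis phi0 : phi 0 = 0.
Context (u : T -> V).
Local Notation dBw := (dB ind W).
Local Notation dindw := (dind ind).
Local Notation uNw := (uN ind W phi).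
Local Notation ZNw := (ZN ip ind W phi).
Local Notation ZA := (ZA ind W phi).
Local Notation Zlim := (Zlim ind W phi).
Hypothesis hu : forall w, uNw N w @[N --> \oo] --> u w.

Let ipE v : ip v v = `|v| ^+ 2. Proof. exact: stepE hV v. Qed.

(** [cylindrical_ibp] is applied to each increment with the additional factor W(ind(j/N)); the term
    in which that factor is differentiated cancels the inner product subtracted in [ZN]. *)
Lemma discrete_duality m (h : 'I_m -> V) (g : 'rV[R]_m -> R) N : smooth_poly_growth g ->
  Ex P (fun w => g (\row_i W (h i) w) * ZNw N w) =
  Ex P (fun w => ip (\sum_(i < m) partial i g (\row_i W (h i) w) *: h i) (uNw N w)).
Proof.
move=> sg; pose X w : 'rV[R]_m := \row_i W (h i) w.
have lg : Lall P (fun w => g (X w)) by exact: (row_Lall hW h sg).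
have lp i : Lall P (fun w => partial i g (X w)).
  by apply: (row_Lall hW h); exact: partial_smooth.
have i1 j : itg P (fun w => phi (grid N j) * (g (X w) * W (ind (grid N j)) w * dBw N j w -
    ip (ind (grid N j)) (dindw N j) * g (X w))).
  apply: itgZ; apply: itgB; last by apply: itgZ; exact: Lall_itg.
  apply: Lall_itg; apply: Lall_mul; last exact: (dB_Lall _ hW).
  by apply: Lall_mul => //; exact: (W_Lall hW).
transitivity (Ex P (fun w => \sum_(0 <= j < N) phi (grid N j) *
    (g (X w) * W (ind (grid N j)) w * dBw N j w - ip (ind (grid N j)) (dindw N j) * g (X w)))).
  by apply: eqEx => w; rewrite /ZN mulr_sumr; apply: eq_bigr => j _; rewrite -/(X w); ring.
rewrite Ex_sum//.
have i2 i j : itg P (fun w => phi (grid N j) * ip (h i) (dindw N j) *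
    (partial i g (X w) * W (ind (grid N j)) w)).
  by apply: itgZ; apply: Lall_itg; apply: Lall_mul => //; exact: (W_Lall hW).
transitivity (Ex P (fun w => \sum_(0 <= j < N) \sum_i phi (grid N j) * ip (h i) (dindw N j) *
    (partial i g (X w) * W (ind (grid N j)) w))); last first.
  apply: eqEx => w; rewrite /uN ip_sumr; apply: eq_bigr => j _.
  by rewrite ip_suml; apply: eq_bigr => i _; rewrite ipZl ipZr -/(X w); ring.
rewrite Ex_sum => [|j]; last by apply: itg_sum => i.
apply: eq_bigr => j _; rewrite Ex_sum//.
have l1 : itg P (fun w => g (X w) * W (ind (grid N j)) w * dBw N j w).
  apply: Lall_itg; apply: Lall_mul; last exact: (dB_Lall _ hW).
  by apply: Lall_mul => //; exact: (W_Lall hW).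
have l2 : itg P (fun w => ip (ind (grid N j)) (dindw N j) * g (X w)).
  by apply: itgZ; exact: Lall_itg.
rewrite ExZ; last exact: itgB.
rewrite ExB// (cylindrical_ibp hW h sg) ExZ ?addrK; last exact: Lall_itg.
rewrite mulr_sumr; apply: eq_bigr => i _; rewrite ExZ ?mulrA//.
by apply: Lall_itg; apply: Lall_mul => //; exact: (W_Lall hW).
Qed.

Lemma ip_uN a N w : ip (a w) (uNw N w) =
  \sum_(0 <= j < N) phi (grid N j) * W (ind (grid N j)) w * ip (a w) (dindw N j).
Proof. by rewrite /uN ip_sumr; apply: eq_bigr => j _; rewrite ipZr. Qed.

Lemma ip_uN_cvg (a : T -> V) w : ip (a w) (uNw N w) @[N --> \oo] --> ip (a w) (u w).
Proof.
rewrite ipC; under eq_fun do rewrite ipC.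
by apply: ip_cvgl => //; exact: hu.
Qed.

Lemma measurable_ip_uN (a : T -> V) N : (forall v, measurable_fun setT (fun w => ip (a w) v)) ->
  measurable_fun setT (fun w => ip (a w) (uNw N w)).
Proof.
move=> ma; under eq_fun do rewrite ip_uN.
apply: measurable_sum => j; apply: measurable_funM => //.
by apply: measurable_funM => //; exact: W_meas.
Qed.

Lemma measurable_ip_u (a : T -> V) : (forall v, measurable_fun setT (fun w => ip (a w) v)) ->
  measurable_fun setT (fun w => ip (a w) (u w)).
Proof.
move=> ma; apply: (measurable_fun_cvg (fun N => measurable_ip_uN N ma)) => w _.
exact: ip_uN_cvg.
Qed.

Lemma W_measurable_ip_u v : W_measurable W (fun w => ip (u w) v).
Proof.
under eq_fun do rewrite ipC.
apply: (@W_measurable_lim _ _ _ _ _ _ (fun N w => ip v (uNw N w))) => [N|w]; last first.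
  exact: (@ip_uN_cvg (fun=> v) w).
under eq_fun do rewrite (ip_uN (fun=> v)).
apply: W_measurable_sum => j; apply: W_measurable_mul; last exact: W_measurable_cst.
by apply: W_measurable_mul; [exact: W_measurable_cst|exact: W_measurable_W].
Qed.

Lemma W_measurable_Zlim : W_measurable W Zlim.
Proof.
refine (W_measurable_lim (X_ := ZA) _ _) => [N|w]; last exact: (ZA_cvg hH hV cW phi_nd).
have mq v : W_measurable W (Wsq W v).
  apply: W_measurable_sub; last exact: W_measurable_cst.
  have -> : (fun w => W v w ^+ 2) = (fun w => W v w * W v w) by apply/funext => w; rewrite expr2.
  by apply: W_measurable_mul; exact: W_measurable_W.
apply: W_measurable_mul; first exact: W_measurable_cst.
apply: W_measurable_sub; first by apply: W_measurable_mul => //; exact: W_measurable_cst.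
by apply: W_measurable_sum => j; apply: W_measurable_mul => //; exact: W_measurable_cst.
Qed.

Let Ui := u_itg hH hV hW phi_nd phi_c phi0 hu.

Lemma weak_meas (a : T -> V) v : (forall v, W_measurable W (fun w => ip (a w) v)) ->
  measurable_fun setT (fun w => ip (a w) v).
Proof. by move=> ha; apply: (@W_measurable_measurable _ _ _ _ _ W). Qed.

Lemma duality_cylindrical m (h : 'I_m -> V) (g : 'rV[R]_m -> R) : smooth_poly_growth g ->
  let DF w := \sum_(i < m) partial i g (\row_i W (h i) w) *: h i in
  itg P (fun w => ip (DF w) (u w)) /\
  Ex P (fun w => g (\row_i W (h i) w) * Zlim w) = Ex P (fun w => ip (DF w) (u w)).
Proof.
move=> sg DF.
have mDF v : measurable_fun setT (fun w => ip (DF w) v).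
  by apply: weak_meas => v'; exact: cyl_weak_measurable.
have iDF : itg P (fun w => `|DF w| ^+ 2) by exact: (cyl_norm_itg ipE hW h sg).
set M := Ex P (fun w => `|DF w| ^+ 2).
have M0 : 0 <= M by apply: Ex_ge0 => w; exact: sqr_ge0.
have DFM : (\int[P]_w (`|DF w| ^+ 2)%:E <= M%:E)%E by rewrite -EFin_Ex.
have [iu _] := ip_small ipE (measurable_ip_u mDF) Ui DFM ltr01.
split => //.
have lg : L2 P (fun w => g (\row_i W (h i) w)) by apply: Lall_L2; exact: (row_Lall hW h sg).
have c1 := L2_cvg_mul (ZN_L2 ind hW phi) (Zlim_L2 hH hV hW cW phi_nd phi_c phi0) lg (ZN_Zlim hH hV hW cW phi_nd phi_c phi0).
apply: (@cvg_unique _ (@Rhausdorff R) _ _ _ _ c1).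
have E N := discrete_duality h N sg.
rewrite /=; under eq_fun do rewrite E.
apply/cvgrPdist_le => e e0.
have M1 : 0 < M + 1 by rewrite ltr_wpDl.
(* The weight balances the two terms of [ip_small]: M/(2e') <= e/2, while the second is at most e/2
   once E|uN - u|^2 <= e/e'. *)
pose e' := (M + 1) / e; have e'0 : 0 < e' by rewrite divr_gt0.
have d0 : 0 < e / e' by rewrite divr_gt0.
have [K K0 hK] := uN_cvg_L2 hH hV hW phi_nd phi_c phi0 hu d0.
near=> N; have KN : (K <= N)%N by near: N; exact: nbhs_infty_ge.
have [iN hN] := hK N KN.
have miN : measurable_fun setT (fun w => ip (DF w) (uNw N w - u w)).
  under eq_fun do rewrite ipBr.
  by apply: measurable_funB; [exact: measurable_ip_uN|exact: measurable_ip_u].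
have [iv hv] := ip_small ipE miN iN DFM e'0.
have iuN : itg P (fun w => ip (DF w) (uNw N w)).
  have := itgD iv iu; congr itg; apply/funext => w; rewrite ipBr; ring.
rewrite distrC -ExB// (eqEx P (Y := fun w => ip (DF w) (uNw N w - u w))); last by move=> w; rewrite ipBr.
apply: le_trans (Ex_norm iv) _; apply: le_trans hv _.
have h1 : (2 * e')^-1 * M <= e / 2.
  rewrite invfM -mulrA [e / 2]mulrC ler_pM2l// ler_pdivrMl// /e' divfK ?gt_eqF//.
  by rewrite lerDl.
have h2 : e' / 2 * Ex P (fun w => `|uNw N w - u w| ^+ 2) <= e / 2.
  apply: (@le_trans _ _ (e' / 2 * (e / e'))); first by rewrite ler_pM2l ?divr_gt0.
  by rewrite le_eqVlt; apply/orP; left; apply/eqP; field; rewrite gt_eqF.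
lra.
Unshelve. all: by end_near. Qed.

Lemma duality F DF : malliavin_derivative ip W F DF ->
  itg P (fun w => ip (DF w) (u w)) /\ Ex P (fun w => F w * Zlim w) = Ex P (fun w => ip (DF w) (u w)).
Proof.
move=> [[/L2_Lfun lF _] [mDF DFoo] [F_ [DF_ [cyl cF cDF]]]].
have mD v : measurable_fun setT (fun w => ip (DF w) v) by apply: weak_meas => v'; exact: mDF.
have [M DFM] : exists M : R, (\int[P]_w (`|DF w| ^+ 2)%:E <= M%:E)%E.
  exists (fine (\int[P]_w (`|DF w| ^+ 2)%:E)); rewrite fineK// ge0_fin_numE//.
  by apply: integral_ge0 => w _; rewrite lee_fin sqr_ge0.
have [iu _] := ip_small ipE (measurable_ip_u mD) Ui DFM ltr01.
split => //.
have cylE k : [/\ L2 P (F_ k), forall v, measurable_fun setT (fun w => ip (DF_ k w) v),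
    itg P (fun w => ip (DF_ k w) (u w)) &
    Ex P (fun w => F_ k w * Zlim w) = Ex P (fun w => ip (DF_ k w) (u w))].
  have [m [h [g [sg -> ->]]]] := cyl k; split.
  - by apply: Lall_L2; exact: (row_Lall hW h sg).
  - by move=> v; apply: weak_meas => v'; exact: cyl_weak_measurable.
  - exact: (duality_cylindrical h sg).1.
  - exact: (duality_cylindrical h sg).2.
have lF_ k : L2 P (F_ k) by case: (cylE k).
have lZ := Zlim_L2 hH hV hW cW phi_nd phi_c phi0.
have cF' : Ex P (fun w => (F_ k w - F w) ^+ 2) @[k --> \oo] --> 0.
  apply: cvg_trans (fine_cvg cF); apply: near_eq_cvg; apply: nearW => k /=.
  by apply: eqEx => w; rewrite real_normK ?num_real.
have := L2_cvg_mul lF_ lF lZ cF'.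
have -> : (fun k => Ex P (fun w => Zlim w * F_ k w)) = (fun k => Ex P (fun w => ip (DF_ k w) (u w))).
  apply/funext => k; have [_ _ _ <-] := cylE k; apply: eqEx => w; exact: mulrC.
rewrite (eqEx P (Y := fun w => F w * Zlim w)); last by move=> w; rewrite mulrC.
move=> c1; apply: (@cvg_unique _ (@Rhausdorff R) _ _ _ _ c1).
apply/cvgrPdist_le => e e0.
set U := Ex P (fun w => `|u w| ^+ 2).
have U0 : 0 <= U by apply: Ex_ge0 => w; exact: sqr_ge0.
have U1 : 0 < U + 1 by rewrite ltr_wpDl.
(* Now u is fixed and the derivatives vary, so the weight is small: e'U/2 <= e/2, and a derivative
   error of at most e' e contributes e/2. *)
pose e' := e / (U + 1); have e'0 : 0 < e' by rewrite divr_gt0.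
have d0 : 0 < e' * e by rewrite mulr_gt0.
have [c2 /cvgrPdist_le/(_ _ d0) c3] := (fine_cvgP _ _).1 cDF.
near=> k.
have DM : (\int[P]_w (`|DF_ k w - DF w| ^+ 2)%:E <= (e' * e)%:E)%E.
  rewrite -[leLHS]fineK; last by near: k.
  rewrite lee_fin; apply: le_trans (ler_norm _) _.
  by rewrite -[X in `|X|]subr0 distrC; near: k.
have [_ mk ik _] := cylE k.
have mi : measurable_fun setT (fun w => ip (DF_ k w - DF w) (u w)).
  under eq_fun do rewrite ipBl.
  by apply: measurable_funB; exact: measurable_ip_u.
have [iv hv] := ip_small ipE mi Ui DM e'0.
rewrite distrC -ExB// (eqEx P (Y := fun w => ip (DF_ k w - DF w) (u w))); last by move=> w; rewrite ipBl.
apply: le_trans (Ex_norm iv) _; apply: le_trans hv _; rewrite -/U.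
have h1 : (2 * e')^-1 * (e' * e) = e / 2 by field; rewrite gt_eqF.
have h2 : e' / 2 * U <= e / 2.
  rewrite mulrAC ler_pM2r ?invr_gt0// /e' mulrAC ler_pdivrMr// ler_pM2l//.
  by rewrite lerDl.
lra.
Unshelve. all: by end_near. Qed.

Lemma is_divergence_Zlim : is_divergence ip W u Zlim.
Proof.
have lZ := Zlim_L2 hH hV hW cW phi_nd phi_c phi0.
split.
- split; first exact: W_measurable_ip_u.
  by rewrite -EFin_Ex ?ltry//; exact: Ui.
- by split; [exact/L2_Lfun|exact: W_measurable_Zlim].
- move=> F DF hF; have [iu E] := duality hF.
  have [[/L2_Lfun lF _] _ _] := hF.
  by rewrite unlock -!EFin_Ex ?E//; exact: L2_mul.
Qed.

(* Exponentials of W are replaced by cosines, which are cylindrical; they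
   separate sigma(W)-measurable integrable variables. *)
Lemma divergence_unique Z : is_divergence ip W u Z -> {ae P, forall w, Z w = Zlim w}.
Proof.
move=> [_ [/L2_Lfun lZ mZ] dualZ].
have lZ' := Zlim_L2 hH hV hW cW phi_nd phi_c phi0.
pose A w := Z w - Zlim w.
have lA : L2 P A by exact: L2B.
have iA : itg P A by exact: L2_itg.
have A0 s theta : Ex P (fun w => A w * cos (lincomb (fun h w => W h w) s w + theta)) = 0.
  pose g (x : 'rV[R]_(size s)) := cos (\sum_i (tnth (in_tuple s) i).1 * x 0 i + theta).
  pose h i := (tnth (in_tuple s) i).2.
  have sg : smooth_poly_growth g by exact: lincos_smooth.
  have gE w : g (\row_i W (h i) w) = cos (lincomb (fun h w => W h w) s w + theta).
    rewrite /g /lincomb [in RHS]big_tnth; congr (cos (_ + _)).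
    by apply: eq_bigr => i _; rewrite mxE.
  have hF := cylindrical_malliavin ipE hW h sg.
  have lg : L2 P (fun w => g (\row_i W (h i) w)) by apply: Lall_L2; exact: (row_Lall hW h sg).
  have := dualZ _ _ hF; have [iu E] := duality hF.
  rewrite unlock -!EFin_Ex//; last exact: L2_mul.
  move=> [E2].
  transitivity (Ex P (fun w => g (\row_i W (h i) w) * Z w - g (\row_i W (h i) w) * Zlim w)).
    by apply: eqEx => w; rewrite gE /A; ring.
  by rewrite ExB ?E2 ?E ?subrr//; exact: L2_mul.
have mA : W_measurable W A by apply: W_measurable_sub => //; exact: W_measurable_Zlim.
have key C : sigma_of setT (fun h w => W h w) C -> Ex P (fun w => A w * \1_C w) = 0.
  by apply: Ex_sigma => // h _; exact: W_meas.
have mpos : measurable (`]0, +oo[%classic : set R) by [].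
have mneg : measurable (`]-oo, 0[%classic : set R) by [].
(* The events A > 0 and A < 0 belong to sigma(W), so testing against them gives E|A| = 0. *)
have k1 := key _ (mA _ mpos); have k2 := key _ (mA _ mneg).
have iAC C : measurable C -> itg P (fun w => A w * \1_C w).
  move=> mC; apply: (itg_le (Y := fun w => `|A w|)); last first.
  - by move=> w; rewrite normrM ler_piMr// indicE; case: (_ \in _); rewrite ?normr0 ?normr1.
  - exact: itg_norm.
  - by apply: measurable_funM; [exact: lA.1|exact: measurable_indic].
have m1 : measurable (A @^-1` `]0, +oo[%classic) by rewrite -[X in measurable X]setTI; exact: lA.1.
have m2 : measurable (A @^-1` `]-oo, 0[%classic) by rewrite -[X in measurable X]setTI; exact: lA.1.
have E : Ex P (fun w => `|A w|) = 0.
  transitivity (Ex P (fun w => A w * \1_(A @^-1` `]0, +oo[%classic) w - A w * \1_(A @^-1` `]-oo, 0[%classic) w)).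
    apply: eqEx => w; rewrite !indicE.
    have -> : (w \in A @^-1` `]0, +oo[%classic) = (0 < A w).
      by apply/idP/idP; rewrite inE /= in_itv/= andbT.
    have -> : (w \in A @^-1` `]-oo, 0[%classic) = (A w < 0).
      by apply/idP/idP; rewrite inE /= in_itv/=.
    case: (ltgtP (A w) 0) => [h|h|->] /=.
    - by rewrite ltr0_norm// mulr1 mulr0 sub0r.
    - by rewrite gtr0_norm// mulr1 mulr0 subr0.
    - by rewrite normr0 !mulr0 subr0.
  by rewrite ExB ?k1 ?k2 ?subrr//; exact: iAC.
have mEA : measurable_fun setT (EFin \o A) by apply/measurable_EFinP; exact: lA.1.
have := (ae_eq_integral_abs P measurableT mEA).1.
have -> : (\int[P]_x `|(EFin \o A) x| = 0)%E by have := EFin_Ex (itg_norm iA); rewrite E => <-.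
move=> /(_ erefl); apply: filterS => w /(_ Logic.I) [h].
by apply/eqP; rewrite -subr_eq0; apply/eqP.
Qed.

Lemma divergence_ae : {ae P, forall w, divergence ip W u w = Zlim w}.
Proof.
rewrite /divergence; case: xgetP => [Z _ hZ|h]; first exact: divergence_unique.
by have := h _ is_divergence_Zlim.
Qed.

End duality.

(** * The remainder *)

Section decomposition.
Context {d} {T : measurableType d} {R : realType} (P : probability T R).
Context (H : R) (hH : 2^-1 < H < 1).
Context (V : completeNormedModType R) (ip : {dot V for idfun}) (ind : R -> V).
Hypothesis hV : step_completion H ip ind.
Context (W : V -> {RV P >-> R}).
Hypothesis hW : isonormal ip W.
Hypothesis cW : forall w, {within `[0, 1], continuous (fun t => W (ind t) w)}.
Context (phi : R -> R).
Hypothesis phi_nd : forall s t : R, 0 <= s -> s <= t -> t <= 1 -> phi s <= phi t.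
Hypothesis phi_c : {within `[0, 1], continuous phi}.
Hypothesis phi0 : phi 0 = 0.
Context (v : V).
Hypothesis hv : riem ind phi N @[N --> \oo] --> v.
Local Notation dBw := (dB ind W).
Local Notation dindw := (dind ind).
Local Notation Zl := (Zlim ind W phi).

Let ipE h : ip h h = `|h| ^+ 2. Proof. exact: stepE hV h. Qed.

Let SN N (w : T) : R := \sum_(0 <= j < N) phi (grid N j) * dBw N j w.

Let D (t : R) : V := ind 1 - ind t.

Let qt (t : R) (w : T) : R := (W (ind 1) w - W (ind t) w) ^+ 2 - `|D t| ^+ 2.

Definition RN N (w : T) : R :=
  ZN ip ind W phi N w - (W (ind 1) w * SN N w - ip (ind 1) (riem ind phi N)).

(** With Y = b - B one has dB = -dY, so Y_j dB_j is half of Y_j^2 - Y_{j+1}^2 + (dB_j)^2. Summing by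
    parts leaves no boundary term, since phi(0) = 0 and Y vanishes at time 1; the inner products
    provide the centering of each square. *)
Lemma RNE N w : (0 < N)%N -> RN N w = - 2^-1 *
  (\sum_(0 <= j < N) (phi (grid N j.+1) - phi (grid N j)) * qt (grid N j.+1) w +
   \sum_(0 <= j < N) phi (grid N j) * (dBw N j w ^+ 2 - `|dindw N j| ^+ 2)).
Proof.
move=> N0.
have ->: \sum_(0 <= j < N) (phi (grid N j.+1) - phi (grid N j)) * qt (grid N j.+1) w =
    - riemS (fun t => qt t w) phi N.
  rewrite (abel_grid _ _ N0) phi0 /qt /D !subrr normr0 !expr0n subrr !mul0r mulr0 subrr sub0r.
  rewrite opprB opprK -big_split/=; apply: eq_bigr => j _; rewrite /D; ring.
rewrite /RN /ZN /SN /riem /riemS mulr_sumr ip_sumr -!sumrB -!sumrN -big_split/= mulr_sumr.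
apply: eq_bigr => j _; rewrite ipZr /qt /D /dB /dind -!ipE !ipBl !ipBr.
by rewrite !(ipC ip _ (ind 1)) (ipC ip (ind (grid N j.+1)) (ind (grid N j))); field.
Qed.

Lemma qt_Lall t : Lall P (qt t).
Proof. by apply: Lall_add; [apply: Lall_exp; exact: (WB_Lall hW)|exact: Lall_cst]. Qed.

Lemma qt_le t : t \in `[0, 1] -> Ex P (fun w => `|qt t w|) <= 2 * (1 - t) `^ (2 * H).
Proof.
move=> t01; have l := Lall_exp 2 (WB_Lall hW (ind 1) (ind t)).
have i := Lall_itg l; have lq := Lall_itg (qt_Lall t).
apply: (@le_trans _ _ (Ex P (fun w => (W (ind 1) w - W (ind t) w) ^+ 2 + `|D t| ^+ 2))).
  apply: Ex_le; [exact: itg_norm|by apply: itgD => //; exact: itg_cst|move=> w].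
  by apply: le_trans (ler_normB _ _) _; rewrite !ger0_norm ?sqr_ge0.
rewrite ExD//; last exact: itg_cst.
rewrite Ex_cst (WB_var ipE hW) (indB_var hH hV) ?bound_itvE//.
rewrite ger0_norm; last by move: t01; rewrite in_itv/= subr_ge0 => /andP[].
lra.
Qed.

Lemma RN_le N : (0 < N)%N -> Ex P (fun w => `|RN N w|) <=
  \sum_(0 <= j < N) (phi (grid N j.+1) - phi (grid N j)) * (1 - grid N j.+1) `^ (2 * H) +
  Num.sqrt (phi 1 ^+ 2 * (3 * (N%:R^-1 `^ (2 * H - 1)) ^+ 2)).
Proof.
move=> N0; pose a j := phi (grid N j.+1) - phi (grid N j).
pose Q w := \sum_(0 <= j < N) phi (grid N j) * (dBw N j w ^+ 2 - `|dindw N j| ^+ 2).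
have lQ : L2 P Q := quad_var_L2 ind hW phi N.
have iq j : itg P (fun w => `|qt (grid N j.+1) w|) by exact: itg_norm (Lall_itg (qt_Lall _)).
have i1 : itg P (fun w => \sum_(0 <= j < N) `|a j| * `|qt (grid N j.+1) w|).
  by apply: itg_sum => j; exact: itgZ.
have iQ : itg P (fun w => `|Q w|) by exact: itg_norm (L2_itg lQ).
have iR : itg P (RN N).
  have : itg P (fun w => - 2^-1 * (\sum_(0 <= j < N) a j * qt (grid N j.+1) w + Q w)).
    apply: itgZ; apply: itgD; last exact: L2_itg.
    by apply: itg_sum => j; apply: itgZ; exact: Lall_itg (qt_Lall _).
  by congr itg; apply/funext => w; rewrite RNE.
have le w : `|RN N w| <= 2^-1 * (\sum_(0 <= j < N) `|a j| * `|qt (grid N j.+1) w| + `|Q w|).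
  have n2 : `|- (2^-1 : R)| = 2^-1 by rewrite normrN ger0_norm ?invr_ge0.
  rewrite RNE// normrM n2 ler_pM2l ?invr_gt0//.
  apply: le_trans (ler_normD _ _) _; rewrite lerD2r.
  apply: le_trans (ler_norm_sum _ _ _) _; apply: ler_sum => j _.
  by rewrite normrM.
have iS : itg P (fun w => 2^-1 * (\sum_(0 <= j < N) `|a j| * `|qt (grid N j.+1) w| + `|Q w|)).
  by apply: itgZ; exact: itgD.
apply: le_trans (Ex_le (itg_norm iR) iS le) _.
rewrite ExZ ?ExD//; last exact: itgD.
have h1 : Ex P (fun w => \sum_(0 <= j < N) `|a j| * `|qt (grid N j.+1) w|) <=
    2 * \sum_(0 <= j < N) a j * (1 - grid N j.+1) `^ (2 * H).
  rewrite Ex_sum => [|j]; last exact: itgZ.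
  rewrite mulr_sumr big_nat [leRHS]big_nat; apply: ler_sum => j /= jN.
  have a0 : 0 <= a j := dphi_ge0 phi_nd jN.
  rewrite ExZ// ger0_norm// mulrCA; apply: ler_wpM2l => //.
  by apply: qt_le; rewrite grid_mem.
have h2 : Ex P (fun w => `|Q w|) <= Num.sqrt (phi 1 ^+ 2 * (3 * (N%:R^-1 `^ (2 * H - 1)) ^+ 2)).
  rewrite -[leLHS]ger0_norm; last by apply: Ex_ge0.
  rewrite -sqrtr_sqr ler_wsqrtr//; apply: le_trans (L2_Ex_norm lQ) _.
  exact: (quad_var_le hH hV hW phi_nd phi0 N0).
have h3 := sqrtr_ge0 (phi 1 ^+ 2 * (3 * (N%:R^-1 `^ (2 * H - 1)) ^+ 2)).
by move: h1 h2 h3; set s := \sum_(_ <= _ < _) a _ * _; lra.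
Qed.

Definition Rem (w : T) : R := Zl w - (W (ind 1) w * W v w - ip (ind 1) v).

Let lZ : L2 P Zl := Zlim_L2 hH hV hW cW phi_nd phi_c phi0.

Lemma Rem_itg : itg P Rem.
Proof.
apply: itgB; first exact: L2_itg.
apply: itgB; last exact: itg_cst.
exact: Lall_itg (Lall_mul (W_Lall hW _) (W_Lall hW _)).
Qed.

Lemma SN_L2 N : L2 P (fun w => W v w - SN N w) /\
  Ex P (fun w => (W v w - SN N w) ^+ 2) = `|v - riem ind phi N| ^+ 2.
Proof.
pose s := (1, v) :: flatten [seq [:: (- phi (grid N j), ind (grid N j.+1)); (phi (grid N j), ind (grid N j))] |
  j <- index_iota 0 N].
have E w : W v w - SN N w = lincomb (fun h w => W h w) s w.
  rewrite /lincomb /s big_cons big_flatten big_map /= mul1r /SN -sumrN; congr (_ + _).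
  by apply: eq_bigr => j _; rewrite !big_cons big_nil /= /dB; ring.
have EV : v - riem ind phi N = lin_vec s.
  rewrite /lin_vec /s big_cons big_flatten big_map /= scale1r /riem -sumrN; congr (_ + _).
  by apply: eq_bigr => j _; rewrite !big_cons big_nil /= scalerBr addr0 scaleNr opprB addrC.
split; first by under eq_fun do rewrite E; apply: Lall_L2; exact: (lincomb_Lall hW).
by under eqEx do rewrite E; rewrite (lincomb_var ipE hW) EV.
Qed.

(** [Rem] differs from [RN] by the L^2 errors of [ZN], of the sums [SN] for W v and of the vectors
    [riem]; [del] collects these with the quadratic variation, and all of it vanishes in the
    limit. *)
Lemma Rem_le (l : R) :
  riemS phi (fun t => (1 - t) `^ (2 * H)) N @[N --> \oo] --> l ->
  Ex P (fun w => `|Rem w|) <= l.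
Proof.
move=> hl; have q0 : 0 < 2 * H - 1 by have /andP[? _] := p_bounds hH; rewrite subr_gt0.
pose del N := Num.sqrt (phi 1 ^+ 2 * (3 * (N.+1%:R^-1 `^ (2 * H - 1)) ^+ 2)) +
  Num.sqrt (Ex P (fun w => (ZN ip ind W phi N.+1 w - Zl w) ^+ 2)) + 2 * `|v - riem ind phi N.+1|.
have hb N : Ex P (fun w => `|Rem w|) <= riemS phi (fun t => (1 - t) `^ (2 * H)) N.+1 + del N.
  have [lS hS] := SN_L2 N.+1.
  have lzn := ZN_L2 ind hW phi N.+1.
  have lzz := L2B lzn lZ.
  have iW : itg P (fun w => W (ind 1) w * (W v w - SN N.+1 w)).
    by apply: L2_mul => //; exact: Lall_L2 (W_Lall hW _).
  pose k : R := ip (ind 1) (v - riem ind phi N.+1).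
  have E w : Rem w = RN N.+1 w - (ZN ip ind W phi N.+1 w - Zl w) - W (ind 1) w * (W v w - SN N.+1 w) + k.
    by rewrite /Rem /RN /k ipBr; ring.
  have le w : `|Rem w| <= `|RN N.+1 w| + `|ZN ip ind W phi N.+1 w - Zl w| +
      `|W (ind 1) w * (W v w - SN N.+1 w)| + `|k|.
    rewrite E; apply: le_trans (ler_normD _ _) _; rewrite lerD2r.
    by apply: le_trans (ler_normB _ _) _; rewrite lerD2r; exact: ler_normB.
  have iR : itg P (RN N.+1).
    have := itgB (itgD (itgD Rem_itg (L2_itg lzz)) iW) (itg_cst P k).
    by congr itg; apply/funext => w; rewrite E; ring.
  have i1 := itg_norm iR; have i2 := itg_norm (L2_itg lzz); have i3 := itg_norm iW.
  have i4 := itg_cst P `|k|.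
  apply: le_trans (Ex_le (itg_norm Rem_itg) (itgD (itgD (itgD i1 i2) i3) i4) le) _.
  rewrite ExD//; last by apply: itgD => //; exact: itgD.
  rewrite ExD//; last exact: itgD.
  rewrite ExD// Ex_cst.
  have h1 := RN_le (ltn0Sn N).
  have h2 : Ex P (fun w => `|ZN ip ind W phi N.+1 w - Zl w|) <=
      Num.sqrt (Ex P (fun w => (ZN ip ind W phi N.+1 w - Zl w) ^+ 2)).
    rewrite -[leLHS]ger0_norm; last by apply: Ex_ge0.
    by rewrite -sqrtr_sqr ler_wsqrtr// L2_Ex_norm.
  have n1 : `|ind 1| <= 1 by rewrite (ind_le1 hH hV) ?bound_itvE.
  have h3 : Ex P (fun w => `|W (ind 1) w * (W v w - SN N.+1 w)|) <= `|v - riem ind phi N.+1|.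
    have la : L2 P (fun w => `|W (ind 1) w|).
      by apply: Lall_L2; apply: Lall_norm; exact: (W_Lall hW).
    have sqn (x : R) : `|x| ^+ 2 = x ^+ 2 by rewrite real_normK ?num_real.
    have lb : L2 P (fun w => `|W v w - SN N.+1 w|).
      have [m i] := lS; split; first exact: measurableT_comp.
      by under eq_fun do rewrite sqn.
    have := L2_CS la lb; under eqEx do rewrite -normrM.
    under [X in _ <= X * _]eqEx do rewrite sqn.
    under [X in _ <= _ * X]eqEx do rewrite sqn.
    rewrite (W_var ipE hW) hS => h.
    rewrite -(@ler_pXn2r _ 2) ?nnegrE//; last by apply: Ex_ge0.
    apply: le_trans h _; rewrite -[leRHS]mul1r ler_wpM2r ?sqr_ge0//.
    by rewrite expr_le1.
  have h4 : `|k| <= `|v - riem ind phi N.+1|.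
    apply: le_trans (ip_le ipE _ _) _; rewrite -[leRHS]mul1r.
    by rewrite ler_wpM2r.
  (* [RN_le] samples at right ends; (1 - t)^(2H) decreases, so sampling at left ends only enlarges
     the sum. *)
  have h5 : \sum_(0 <= j < N.+1) (phi (grid N.+1 j.+1) - phi (grid N.+1 j)) * (1 - grid N.+1 j.+1) `^ (2 * H) <=
      riemS phi (fun t => (1 - t) `^ (2 * H)) N.+1.
    rewrite /riemS big_nat [leRHS]big_nat; apply: ler_sum => j /= jN.
    rewrite mulrC; apply: ler_wpM2r; first exact: (dphi_ge0 phi_nd jN).
    have g1 : grid N.+1 j.+1 <= 1 :> R by apply: grid_le1.
    have g2 : grid N.+1 j <= grid N.+1 j.+1 :> R by apply: grid_le.
    by rewrite ge0_ler_powR ?nnegrE ?subr_ge0 ?(le_trans g2)//; lra.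
  rewrite /del; lra.
suff c : riemS phi (fun t => (1 - t) `^ (2 * H)) N.+1 + del N @[N --> \oo] --> l.
  by apply: (cvgr_to_ge c); exact: nearW.
have sqrt0 (a : nat -> R) : a N @[N --> \oo] --> 0 -> Num.sqrt (a N) @[N --> \oo] --> 0.
  move=> ha; rewrite -[X in _ --> X]sqrtr0.
  by apply: (@cvg_comp _ _ _ a Num.sqrt _ _ _ ha); exact: sqrt_continuous.
rewrite -[X in _ --> X]addr0; apply: cvgD; first by rewrite (cvg_shiftS (riemS phi _)).
rewrite -[X in _ --> X](_ : 0 + 0 + 2 * 0 = 0); last by rewrite mulr0 !addr0.
apply: cvgD; first apply: cvgD.
- apply: sqrt0.
  have c1 : (N.+1%:R^-1 : R) @[N --> \oo] --> 0 by exact: cvg_harmonic.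
  have c2 : (N.+1%:R^-1 `^ (2 * H - 1) : R) @[N --> \oo] --> 0.
    apply: cvg_trans (_ : apow (2 * H - 1) N.+1%:R^-1 @[N --> \oo] --> 0).
      by apply: near_eq_cvg; apply: nearW => N; rewrite apow_pos// invr_ge0.
    by apply: (@cvg_comp _ _ _ (fun N : nat => N.+1%:R^-1 : R) (apow (2 * H - 1)) _ _ _ c1); exact: apow_cvg0.
  rewrite -[X in _ --> X](_ : phi 1 ^+ 2 * (3 * (0 * 0)) = 0); last by ring.
  by apply: cvgMr; apply: cvgMr; under eq_fun do rewrite expr2; exact: cvgM.
- apply: sqrt0; have := ZN_Zlim hH hV hW cW phi_nd phi_c phi0.
  by rewrite -(cvg_shiftS (fun N => Ex P (fun w => (ZN ip ind W phi N w - Zl w) ^+ 2))).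
- apply: cvgMr; rewrite -[X in _ --> X](normr0 V) -(subrr v); apply: cvg_norm.
  by apply: cvgB; [exact: cvg_cst|rewrite (cvg_shiftS (riem ind phi))].
Qed.

End decomposition.

(** * The class of a power *)

Section stieltjes_integral.
Context {R : realType}.
Local Notation isd x f df := (is_derive (x : R) (1 : R) f df).
Local Notation mu := (@lebesgue_measure R).

Lemma near_invn_le (d : R) : 0 < d -> \forall N \near \oo, N%:R^-1 <= d.
Proof.
move=> d0; near=> N; have N0 : (0 < N)%N by near: N; exact: nbhs_infty_gt.
rewrite invf_ple ?posrE ?ltr0n//; near: N; exact: nbhs_infty_ger.
Unshelve. all: by end_near. Qed.

Variables (phi k : R -> R) (M : R).
Hypothesis dphi : forall x, isd x phi (k x).
Hypothesis ck : continuous k.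
Hypothesis kM : forall r, r \in `[0, 1] -> `|k r| <= M.

Lemma riemS_steps y N : (0 < N)%N ->
  riemS phi y N = \int[mu]_(r in `[0, 1]) (step_fun (steps y N) r * k r).
Proof.
move=> N0; have Ik u : u \in `[0, 1] -> \int[mu]_(r in `[0, u]) k r = phi u - phi 0.
  rewrite in_itv/= => /andP[u0 u1]; apply: FTC_isd => //.
  - exact: continuous_subspaceT.
  - by apply: continuous_subspaceT => x; exact: isd_continuous (dphi x).
have [_ E] := integral_step_fun ck kM (steps_on01 y N0).
rewrite /Rintegral -E /= big_steps/= Ik ?bound_itvE// subrr mulr0 add0r.
rewrite /riemS [LHS]big_nat [RHS]big_nat; apply: eq_bigr => j /= jN.
by rewrite !Ik ?grid_mem ?(ltnW jN)//; ring.
Qed.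

Lemma riemS_integral (y : R -> R) : {within `[0, 1], continuous y} ->
  riemS phi y N @[N --> \oo] --> \int[mu]_(r in `[0, 1]) (y r * k r).
Proof.
move=> cy; have M0 : 0 <= M by apply: le_trans (kM (_ : 0 \in `[0, 1])); rewrite ?bound_itvE.
apply/cvgrPdist_le => e e0.
have e1 : 0 < e / (M + 1) by rewrite divr_gt0// ltr_wpDl.
have [d d0 hd] := within_unif_cont cy e1.
near=> N; have N0 : (0 < N)%N by near: N; exact: nbhs_infty_gt.
have Nd : N%:R^-1 <= d by near: N; exact: near_invn_le.
have ap : forall r, r \in `[0, 1] -> `|y r - step_fun (steps y N) r| <= e / (M + 1).
  by apply: step_approx => // s t s0 t0 st; apply: hd => //; exact: le_trans st Nd.
have [i1 _] := integral_step_fun ck kM (steps_on01 y N0).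
have i2 : mu.-integrable `[0, 1] (EFin \o (fun r => y r * k r)).
  apply: within_itgb => x; apply: cvgM; first exact: cy.
  exact: (continuous_subspaceT ck).
rewrite riemS_steps// -RintegralB//=.
have i3 : mu.-integrable `[0, 1] (EFin \o (fun r => y r * k r - step_fun (steps y N) r * k r)).
  by apply: eq_integrable (integrableB _ i2 i1) => //.
apply: le_trans (le_normr_Rintegral _ i3) _ => //.
apply: (@le_trans _ _ (\int[mu]_(r in `[0, 1]) (cst (e / (M + 1) * M) r))).
  apply: le_Rintegral => //=.
  - exact: integrable_norm.
  - by apply: within_itgb; apply: continuous_subspaceT => x; exact: cvg_cst.
  - move=> r r01; rewrite -mulrBl normrM ler_pM ?kM ?ap// inE.
rewrite /Rintegral (eq_integral (cst (e / (M + 1) * M)%:E)) => [|r _]; last by [].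
rewrite integral_cst//= lebesgue_measure01 mule1/=.
rewrite mulrAC ler_pdivrMr ?ltr_wpDl//; nra.
Unshelve. all: by end_near. Qed.

End stieltjes_integral.

Section within_eq.
Context {R : realType}.

Lemma within_eq (f g : R -> R) : (forall t, t \in `[0, 1] -> f t = g t) ->
  continuous g -> {within `[0, 1], continuous f}.
Proof.
move=> fg cg; apply: (@subspace_eq_continuous _ _ _ g); last exact: continuous_subspaceT.
by move=> t /set_mem t01; rewrite /from_subspace fg.
Qed.

Lemma within_powR (q : R) : 0 < q -> {within `[0, 1], continuous (fun t : R => t `^ q)}.
Proof.
move=> q0; apply: (within_eq (g := apow q)); last exact: apow_continuous.
by move=> t; rewrite in_itv/= => /andP[t0 _]; rewrite apow_pos.
Qed.

Lemma within_powR_rev (q : R) : 0 < q -> {within `[0, 1], continuous (fun t : R => (1 - t) `^ q)}.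
Proof.
move=> q0; apply: (within_eq (g := fun t => apow q (1 - t))).
  by move=> t; rewrite in_itv/= => /andP[_ t1]; rewrite apow_pos ?subr_ge0.
move=> x; apply: (@continuous_comp _ _ _ (fun x : R => 1 - x) (apow q)); last exact: apow_continuous.
by apply: cvgB; [exact: cvg_cst|exact: cvg_id].
Qed.

Lemma gt0_powRD (x q r : R) : 0 < x -> x `^ (q + r) = x `^ q * x `^ r.
Proof. by move=> x0; rewrite powRD// (gt_eqF x0) implybT. Qed.

End within_eq.

(** * Sums with respect to a multiple of t^m *)

Section power_weight.
Context {R : realType}.
Local Notation isd x f df := (is_derive (x : R) (1 : R) f df).
Local Notation mu := (@lebesgue_measure R).
Variables (a : R) (m : nat).
Hypotheses (a0 : 0 <= a) (m0 : (0 < m)%N).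
Local Notation phi := (fun t : R => a * t ^+ m).

Lemma phi_pow_nd (s t : R) : 0 <= s -> s <= t -> t <= 1 -> phi s <= phi t.
Proof. by move=> s0 st _; rewrite ler_wpM2l// lerXn2r ?nnegrE// (le_trans s0). Qed.

Lemma phi_pow0 : phi 0 = 0 :> R.
Proof. by rewrite /= expr0n gtn_eqF// mulr0. Qed.

Lemma phi_pow_continuous : continuous (phi : R -> R).
Proof. by move=> x; apply: cvgMr; exact: exprn_continuous. Qed.

Lemma riemS_pow (y : R -> R) : {within `[0, 1], continuous y} ->
  riemS phi y N @[N --> \oo] --> \int[mu]_(r in `[0, 1]) (y r * (a * (m%:R * r ^+ m.-1))).
Proof.
apply: (@riemS_integral _ phi _ (a * m%:R)).
- by move=> x; apply: isdZ; apply: isd_eq (isdX m (isd_id x)) _; rewrite mulr1.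
- by move=> x; apply: cvgMr; apply: cvgMr; exact: exprn_continuous.
- move=> r; rewrite in_itv/= => /andP[r0 r1].
  rewrite ger0_norm ?mulr_ge0 ?exprn_ge0// ler_wpM2l// -[leRHS]mulr1 ler_wpM2l//.
  by rewrite exprn_ile1.
Qed.

Lemma riemS_pow_powR (q : R) : 0 < q ->
  riemS phi (fun t => t `^ q) N @[N --> \oo] --> a * m%:R / (m%:R + q).
Proof.
move=> q0; have m1 : 1 <= m%:R :> R by rewrite ler1n.
have mq : 1 < m%:R + q by lra.
have mq0 : m%:R + q != 0 by rewrite gt_eqF//; lra.
have := riemS_pow (within_powR q0); congr (_ --> _).
pose F r := a * m%:R / (m%:R + q) * apow (m%:R + q) r.
transitivity (F 1 - F 0); last first.
  by rewrite /F apow0// apow_pos// powR1 mulr0 mulr1 subr0.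
have ck : {within `[0, 1], continuous (fun r : R => a * (m%:R * r ^+ m.-1))}.
  by apply: continuous_subspaceT => x; apply: cvgMr; apply: cvgMr; exact: exprn_continuous.
have cF : {within `[0, 1], continuous F}.
  by apply: continuous_subspaceT => x; apply: cvgMr; apply: apow_continuous; lra.
have dF x : 0 < x < 1 -> isd x F (x `^ q * (a * (m%:R * x ^+ m.-1))).
  move=> /andP[x0 x1]; apply: isd_eq (isdZ _ (isd_apow_pos _ x0)) _.
  rewrite (_ : m%:R + q - 1 = m.-1%:R + q); last by rewrite -[m in LHS](prednK m0) -natr1; lra.
  by rewrite gt0_powRD// powR_mulrn ?ltW//; field.
by apply: (FTC_isd ler01 _ cF dF) => x; apply: cvgM; [exact: within_powR|exact: ck].
Qed.

(** Right-end sampling is what makes a partial sum up to the (j+1)-st grid point a rescaled copy of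
    the whole sum on a grid of j+1 steps. *)
Definition rsum (y : R -> R) (N : nat) : R :=
  \sum_(0 <= j < N) (phi (grid N j.+1) - phi (grid N j)) * y (grid N j.+1).

Lemma rsum_cvg (y : R -> R) (l : R) : {within `[0, 1], continuous y} ->
  riemS phi y N @[N --> \oo] --> l -> rsum y N @[N --> \oo] --> l.
Proof.
move=> cy cl; rewrite -[l]addr0.
have -> : rsum y = fun N => riemS phi y N +
   \sum_(0 <= j < N) (y (grid N j.+1) - y (grid N j)) * (phi (grid N j.+1) - phi (grid N j)).
  apply/funext => N; rewrite /rsum /riemS -big_split/=; apply: eq_bigr => j _; ring.
apply: cvgD => //; apply/cvgrPdist_le => e e0.
have e1 : 0 < e / (a + 1) by rewrite divr_gt0// ltr_wpDl.
have [d d0 hd] := within_unif_cont cy e1.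
near=> N; have N0 : (0 < N)%N by near: N; exact: nbhs_infty_gt.
have Nd : N%:R^-1 <= d by near: N; exact: near_invn_le.
rewrite sub0r normrN.
have h j : (j < N)%N -> `|y (grid N j.+1) - y (grid N j)| <= e / (a + 1).
  move=> jN; apply: hd; rewrite ?grid_mem ?(ltnW jN)//.
  by rewrite gridS ger0_norm.
apply: le_trans (sum_dphi_le phi_pow_nd N0 h) _.
rewrite phi_pow0 subr0 expr1n mulr1 mulrAC ler_pdivrMr ?ltr_wpDl//; nra.
Unshelve. all: by end_near. Qed.

Lemma rsum_le (y : R -> R) N : (0 < N)%N -> (forall t, t \in `[0, 1] -> 0 <= y t <= 1) ->
  0 <= rsum y N <= a.
Proof.
move=> N0 hy; rewrite /rsum; apply/andP; split.
  rewrite big_nat; apply: sumr_ge0 => j /= jN; rewrite mulr_ge0 ?(dphi_ge0 phi_pow_nd)//.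
  by case/andP: (hy (grid N j.+1) (grid_mem N0 jN)).
have h j : (j < N)%N -> `|y (grid N j.+1)| <= 1.
  by move=> jN; case/andP: (hy (grid N j.+1) (grid_mem N0 jN)) => ? ?; rewrite ger0_norm.
have := sum_dphi_le phi_pow_nd N0 h; rewrite phi_pow0 subr0 expr1n mulr1 mul1r.
apply: le_trans; apply: le_trans (ler_norm _).
by rewrite le_eqVlt; apply/orP; left; apply/eqP; apply: eq_bigr => j _; rewrite mulrC.
Qed.

Lemma sum_sym_half (F : nat -> nat -> R) N : (forall i j, F i j = F j i) ->
  (forall i, F i i = 0) ->
  \sum_(0 <= i < N) \sum_(0 <= j < N) F i j = 2 * \sum_(0 <= j < N) \sum_(0 <= i < j.+1) F i j.
Proof.
move=> FC F0; elim: N => [|N IH]; first by rewrite !big_nil mulr0.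
rewrite big_nat_recr//= (eq_bigr (fun i => \sum_(0 <= j < N) F i j + F i N)); last first.
  by move=> i _; rewrite big_nat_recr.
rewrite big_split/= IH [in RHS]big_nat_recr//= [X in 2 * (_ + X)]big_nat_recr//= F0.
rewrite [X in _ + _ + X]big_nat_recr//= F0.
rewrite [X in _ + (X + _)](eq_bigr (fun i => F i N)) => [|i _]; last by rewrite FC.
rewrite (eq_bigr (fun j => \sum_(0 <= i < j) F i j)) => [|i _]; last by rewrite big_nat_recr//= F0 addr0.
ring.
Qed.

Section kernel.
Variable (p : R).
Hypothesis p0 : 0 < p.
Variable (L : R).
Hypothesis hL : rsum (fun t => (1 - t) `^ p) N @[N --> \oo] --> L.
Local Notation RJ := (rsum (fun t : R => (1 - t) `^ p)).

(* Self-similarity: [phi] and the kernel are homogeneous. *)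
Lemma rsum_scale N j : (j < N)%N ->
  \sum_(0 <= i < j.+1) (phi (grid N i.+1) - phi (grid N i)) * (grid N j.+1 - grid N i.+1) `^ p =
  grid N j.+1 `^ (m%:R + p) * RJ j.+1.
Proof.
move=> jN; have N0 : 0 < N%:R :> R by rewrite ltr0n; case: N jN.
have g0 : 0 < grid N j.+1 :> R by rewrite divr_gt0.
rewrite gt0_powRD//.
rewrite powR_mulrn ?ltW// /rsum mulr_sumr big_nat [RHS]big_nat.
apply: eq_bigr => i /= ij.
have E k : grid N k = grid N j.+1 * grid j.+1 k :> R by rewrite /grid; field; rewrite ?gt_eqF// ltr0n.
have h : 0 <= 1 - grid j.+1 i.+1 :> R by rewrite subr_ge0 grid_le1.
have -> : grid N j.+1 - grid N i.+1 = grid N j.+1 * (1 - grid j.+1 i.+1) :> R by rewrite (E i.+1); ring.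
rewrite powRM ?(ltW g0)//.
rewrite (E i.+1) (E i) !exprMn; ring.
Qed.

(** By symmetry only i <= j matters, and scaling turns the inner sum into t^(m+p) RJ_{j+1} with t =
    (j+1)/N. Here RJ_{j+1} is close to L for large j only, but the remaining indices j < K carry the
    phi-mass phi(K/N), which tends to 0. *)
Lemma double_sum_cvg :
  \sum_(0 <= i < N) \sum_(0 <= j < N) (phi (grid N i.+1) - phi (grid N i)) *
    (phi (grid N j.+1) - phi (grid N j)) * `|grid N i.+1 - grid N j.+1| `^ p @[N --> \oo] -->
  2 * (L * (a * m%:R / (m%:R + (m%:R + p)))).
Proof.
have m1 : 1 <= m%:R :> R by rewrite ler1n.
have mp : 0 < m%:R + p by rewrite ltr_wpDl.
pose z (t : R) := t `^ (m%:R + p).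
have cz : rsum z N @[N --> \oo] --> a * m%:R / (m%:R + (m%:R + p)).
  by apply: rsum_cvg; [exact: within_powR|exact: riemS_pow_powR].
have pow01 q : 0 <= q -> forall t : R, t \in `[0, 1] -> 0 <= t `^ q <= 1.
  move=> q0 t; rewrite in_itv/= powR_ge0 => /andP[t0 t1] /=.
  by have := @ge0_ler_powR R q q0 t 1; rewrite powR1; apply; rewrite ?nnegrE.
have z01 : forall t, t \in `[0, 1] -> 0 <= z t <= 1 by apply: pow01; exact: ltW.
pose S N := \sum_(0 <= j < N) (phi (grid N j.+1) - phi (grid N j)) * (z (grid N j.+1) * RJ j.+1).
have E N : \sum_(0 <= i < N) \sum_(0 <= j < N) (phi (grid N i.+1) - phi (grid N i)) *
    (phi (grid N j.+1) - phi (grid N j)) * `|grid N i.+1 - grid N j.+1| `^ p = 2 * S N.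
  rewrite sum_sym_half; last 2 first.
  - by move=> i j; rewrite distrC; ring.
  - by move=> i; rewrite subrr normr0 powR0 ?mulr0// gt_eqF.
  congr (2 * _); rewrite /S big_nat [RHS]big_nat; apply: eq_bigr => j /= jN.
  rewrite -rsum_scale// mulr_sumr big_nat [RHS]big_nat; apply: eq_bigr => i /= ij.
  rewrite distrC ger0_norm; first by ring.
  by rewrite subr_ge0 grid_le.
under eq_fun do rewrite E.
apply: cvgMr.
rewrite -[X in _ --> X]addr0.
have -> : S = fun N => L * rsum z N +
   \sum_(0 <= j < N) (z (grid N j.+1) * (RJ j.+1 - L)) * (phi (grid N j.+1) - phi (grid N j)).
  apply/funext => N; rewrite /S /rsum mulr_sumr -big_split/=; apply: eq_bigr => j _; ring.
apply: cvgD; first exact: cvgMr.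
have r01 : forall t : R, t \in `[0, 1] -> 0 <= (1 - t) `^ p <= 1.
  move=> t; rewrite in_itv/= => /andP[t0 t1]; apply: pow01; first exact: ltW.
  by rewrite in_itv/=; apply/andP; split; lra.
have RL j : `|RJ j.+1 - L| <= a + `|L|.
  have /andP[h1 h2] := rsum_le (ltn0Sn j) r01.
  by apply: le_trans (ler_normB _ _) _; rewrite lerD2r ger0_norm.
apply/cvgrPdist_le => e e0.
have e1 : 0 < e / (a + 1) / 2 by rewrite !divr_gt0// ltr_wpDl.
have [K _ hK] : \forall j \near \oo, `|L - RJ j| <= e / (a + 1) / 2.
  by move/cvgrPdist_le: hL => /(_ _ e1).
have C0 : 0 < (a + `|L|) * a + 1 by rewrite ltr_wpDl ?mulr_ge0 ?addr_ge0.
(* The initial block has mass at most a K/N and terms at most a + |L|; once 1/N is below this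
   threshold its contribution is at most e/2. *)
have e2 : 0 < e / 2 / ((a + `|L|) * a + 1) / (K%:R + 1) by rewrite !divr_gt0// ltr_wpDl.
near=> N; have N0 : (0 < N)%N by near: N; exact: nbhs_infty_gt.
have NK : (K <= N)%N by near: N; exact: nbhs_infty_ge.
have Nd : N%:R^-1 <= e / 2 / ((a + `|L|) * a + 1) / (K%:R + 1) by near: N; exact: near_invn_le.
rewrite sub0r normrN; apply: le_trans (ler_norm_sum _ _ _) _.
pose b j := phi (grid N j.+1) - phi (grid N j).
apply: (@le_trans _ _ (\sum_(0 <= j < N) (e / (a + 1) / 2 * b j + (a + `|L|) * ((j < K)%N%:R * b j)))).
  rewrite big_nat [leRHS]big_nat; apply: ler_sum => j /= jN.
  have b0 : 0 <= b j := dphi_ge0 phi_pow_nd jN.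
  rewrite normrM (ger0_norm b0) -/(b j) mulrA -mulrDl ler_wpM2r// normrM.
  have /andP[z0 z1] := z01 (grid N j.+1) (grid_mem N0 jN).
  rewrite ger0_norm//; apply: (@le_trans _ _ `|RJ j.+1 - L|); first by rewrite ler_piMl.
  case: ltnP => jK; first by rewrite mulr1 (le_trans (RL j))// lerDr ltW.
  by rewrite mulr0 addr0 distrC; apply: hK => /=; rewrite ltnW.
rewrite big_split/= -!mulr_sumr /b telescope_sumr// gridN// grid0 phi_pow0 subr0 expr1n mulr1.
have -> : \sum_(0 <= i < N) (i < K)%N%:R * (phi (grid N i.+1) - phi (grid N i)) = phi (grid N K).
  have -> : phi (grid N K) = \sum_(0 <= j < K) (phi (grid N j.+1) - phi (grid N j)).
    by rewrite (telescope_sumr (fun j => phi (grid N j)))// grid0 phi_pow0 subr0.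
  rewrite (big_nat_widen _ _ _ _ _ NK) [RHS]big_mkcond; apply: eq_bigr => j _ /=.
  by case: (_ < _)%N; rewrite ?mul1r ?mul0r.
have gK : phi (grid N K) <= a * (K%:R * N%:R^-1).
  rewrite ler_wpM2l// -/(grid N K); have g0 := grid_ge0 N K : 0 <= _ :> R.
  have g1 := grid_le1 NK : _ <= 1 :> R.
  by rewrite -(prednK m0) exprS ler_piMr// exprn_ile1.
have h1 : e / (a + 1) / 2 * a <= e / 2.
  have a1 : 0 < a + 1 by rewrite ltr_wpDl.
  rewrite (_ : _ * a = e / 2 * (a / (a + 1))); last by field; rewrite gt_eqF.
  by rewrite ler_piMr ?ler_pdivrMr// ?divr_ge0 ?ltW// mul1r; lra.
have h2 : (a + `|L|) * phi (grid N K) <= e / 2.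
  have aL : 0 <= a + `|L| by rewrite addr_ge0.
  apply: (@le_trans _ _ ((a + `|L|) * (a * (K%:R * N%:R^-1)))); first by rewrite ler_wpM2l.
  apply: (@le_trans _ _ (((a + `|L|) * a + 1) * ((K%:R + 1) * N%:R^-1))).
    rewrite mulrA ler_pM ?mulr_ge0//; first by lra.
    by rewrite ler_wpM2r//; lra.
  have := C0; have := Nd; set C := _ + 1; set x := _ / (K%:R + 1) => Nx Cp.
  have K0 : 0 < K%:R + 1 :> R by rewrite ltr_wpDl.
  apply: (@le_trans _ _ (C * ((K%:R + 1) * x))).
    by rewrite ler_wpM2l ?(ltW Cp)// ler_wpM2l// ltW.
  by rewrite /x [(K%:R + 1) * _]mulrC divfK ?gt_eqF// mulrC divfK ?gt_eqF.
lra.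
Unshelve. all: by end_near. Qed.

End kernel.

End power_weight.

(** * Norm of the class of a power and its covariance with B_1 *)

Section power_vector.
Context {R : realType} (H : R) (hH : 2^-1 < H < 1).
Context (V : completeNormedModType R) (ip : {dot V for idfun}) (ind : R -> V).
Hypothesis hV : step_completion H ip ind.
Variables (a : R) (m : nat).
Hypotheses (a0 : 0 <= a) (m0 : (0 < m)%N).
Local Notation phi := (fun t : R => a * t ^+ m).
Local Notation p := (2 * H).
Variables (v : V) (L : R).
Hypothesis hv : riem ind phi N @[N --> \oo] --> v.
Hypothesis hL : riemS phi (fun t => (1 - t) `^ p) N @[N --> \oo] --> L.
Local Notation b N j := (phi (grid N j.+1) - phi (grid N j)).

Let p0 : 0 < p. Proof. by have /andP[h _] := p_bounds hH; rewrite (lt_trans ltr01). Qed.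
Let ipE h : ip h h = `|h| ^+ 2. Proof. exact: stepE hV h. Qed.
Let phi0 := phi_pow0 a m0.

Let sum_b N : (0 < N)%N -> \sum_(0 <= j < N) b N j = a.
Proof.
by move=> N0; rewrite telescope_sumr// gridN// grid0 phi0 subr0 expr1n mulr1.
Qed.

(** Moving the differences from [ind] to phi leaves only the vectors ind 1 - ind t, whose inner
    products are explicit combinations of powers. *)
Lemma riem_abel N : (0 < N)%N ->
  riem ind phi N = \sum_(0 <= j < N) b N j *: (ind 1 - ind (grid N j.+1)).
Proof.
move=> N0; under [RHS]eq_bigr do rewrite scalerBr.
rewrite sumrB -scaler_suml sum_b//.
have -> : a *: ind 1 = \sum_(0 <= j < N) (phi (grid N j.+1) *: ind (grid N j.+1) -
    phi (grid N j) *: ind (grid N j)).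
  rewrite (telescope_sumr (fun j => phi (grid N j) *: ind (grid N j)))//.
  by rewrite gridN// grid0 phi0 scale0r subr0 expr1n mulr1.
rewrite -sumrB; apply: eq_bigr => j _.
by rewrite scalerBr scalerBl opprB [RHS]addrC addrA subrK.
Qed.

Let cov1 N j : (j < N)%N -> ip (ind 1 - ind (grid N j.+1)) (ind 1) =
  2^-1 * (1 - grid N j.+1 `^ p + (1 - grid N j.+1) `^ p).
Proof.
move=> jN; have N0 : (0 < N)%N by case: N jN.
rewrite ipBl !(step_ip hV) ?grid_mem ?bound_itvE// fbm_cov11// /fbm_cov powR1.
by rewrite [`|1 - _|]ger0_norm ?subr_ge0 ?grid_le1//; field.
Qed.

Let covij N i j : (i < N)%N -> (j < N)%N ->
  ip (ind 1 - ind (grid N i.+1)) (ind 1 - ind (grid N j.+1)) =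
  2^-1 * ((1 - grid N i.+1) `^ p + (1 - grid N j.+1) `^ p - `|grid N i.+1 - grid N j.+1| `^ p).
Proof.
move=> iN jN; have N0 : (0 < N)%N by case: N jN {iN}.
rewrite ipBl !ipBr !(step_ip hV) ?grid_mem ?bound_itvE// fbm_cov11// /fbm_cov powR1.
rewrite [`|1 - _|]ger0_norm ?subr_ge0 ?grid_le1//.
rewrite [`|_ - 1|]distrC [`|1 - _|]ger0_norm ?subr_ge0 ?grid_le1// [`|grid N j.+1 - _|]distrC.
by field.
Qed.

Let c1 : rsum a m (fun t => (1 - t) `^ p) N @[N --> \oo] --> L.
Proof. by apply: rsum_cvg => //; exact: within_powR_rev. Qed.

Lemma power_vector_cov : ip v (ind 1) = 2^-1 * (a + L - a * m%:R / (m%:R + p)).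
Proof.
have c2 : rsum a m (fun t => t `^ p) N @[N --> \oo] --> a * m%:R / (m%:R + p).
  by apply: rsum_cvg => //; [exact: within_powR|exact: riemS_pow_powR].
have c3 := @ip_cvgl _ _ ip ipE _ _ (ind 1) hv.
apply: (cvg_unique _ c3) => //.
apply: (@cvg_trans _ (2^-1 * (a + rsum a m (fun t => (1 - t) `^ p) N -
    rsum a m (fun t => t `^ p) N) @[N --> \oo])); last first.
  by apply: cvgMr; apply: cvgB => //; apply: cvgD => //; exact: cvg_cst.
apply: near_eq_cvg; near=> N; have N0 : (0 < N)%N by near: N; exact: nbhs_infty_gt.
rewrite riem_abel// ip_suml -{1}(sum_b N0) /rsum -big_split -sumrB mulr_sumr /=.
rewrite big_nat [RHS]big_nat; apply: eq_bigr => j /= jN.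
by rewrite ipZl cov1//; ring.
Unshelve. all: by end_near. Qed.

(** Of the three parts of [covij], the first two depend on one variable each and together give a L;
    the third is half of the double sum. *)
Lemma power_vector_norm : `|v| ^+ 2 = a * L - L * (a * m%:R / (m%:R + (m%:R + p))).
Proof.
have c2 := double_sum_cvg a0 m0 p0 c1.
have c3 : `|riem ind phi N| ^+ 2 @[N --> \oo] --> `|v| ^+ 2.
  by under eq_fun do rewrite expr2; rewrite expr2; apply: cvgM; exact: cvg_norm.
apply: (cvg_unique _ c3) => //.
have -> : a * L - L * (a * m%:R / (m%:R + (m%:R + p))) =
  a * L - 2^-1 * (2 * (L * (a * m%:R / (m%:R + (m%:R + p))))) by rewrite mulKf.
apply: (@cvg_trans _ (a * rsum a m (fun t => (1 - t) `^ p) N -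
    2^-1 * (\sum_(0 <= i < N) \sum_(0 <= j < N) b N i * b N j * `|grid N i.+1 - grid N j.+1| `^ p)
    @[N --> \oo])); last by apply: cvgB; exact: cvgMr.
apply: near_eq_cvg; near=> N; have N0 : (0 < N)%N by near: N; exact: nbhs_infty_gt.
rewrite riem_abel// -ipE ip_suml.
transitivity (\sum_(0 <= i < N) \sum_(0 <= j < N) (2^-1 * (b N i * (1 - grid N i.+1) `^ p * b N j) +
   2^-1 * (b N i * (b N j * (1 - grid N j.+1) `^ p)) -
   2^-1 * (b N i * b N j * `|grid N i.+1 - grid N j.+1| `^ p))); last first.
  rewrite [LHS]big_nat [RHS]big_nat; apply: eq_bigr => i /= iN.
  rewrite ip_sumr [LHS]big_nat [RHS]big_nat; apply: eq_bigr => j /= jN.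
  by rewrite ipZl ipZr covij//; ring.
rewrite /rsum; set A := \sum_(0 <= j < N) _ * (1 - _) `^ p.
transitivity (\sum_(0 <= i < N) (2^-1 * a * (b N i * (1 - grid N i.+1) `^ p) + 2^-1 * A * b N i -
    2^-1 * \sum_(0 <= j < N) b N i * b N j * `|grid N i.+1 - grid N j.+1| `^ p)).
  by rewrite sumrB big_split/= -!mulr_sumr sum_b// -/A; field.
apply: eq_bigr => i _; rewrite sumrB big_split/= -!mulr_sumr sum_b// -/A; ring.
Unshelve. all: by end_near. Qed.

End power_vector.

(** * The Beta integral and the Gamma function *)

Section gamma_limit.
Context {R : realType}.
Local Notation isd x f df := (is_derive (x : R) (1 : R) f df).
Local Notation mu := (@lebesgue_measure R).

Lemma bernoulli_ineq (x : R) n : 0 <= x <= 1 -> 1 - n%:R * x <= (1 - x) ^+ n.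
Proof.
move=> /andP[x0 x1]; elim: n => [|n IH]; first by rewrite mul0r subr0 expr0.
rewrite exprS; apply: (@le_trans _ _ ((1 - x) * (1 - n%:R * x))); last first.
  by rewrite ler_wpM2l// subr_ge0.
have n0 : 0 <= n%:R :> R by [].
rewrite -natr1; nra.
Qed.

(** With y = x/m, the upper bound is the m-th power of 1 - y <= e^(-y). For the lower one, 1 + y <=
    e^y gives 1 - y >= e^(-y)(1 - y^2), and Bernoulli's inequality bounds (1 - y^2)^m below by 1 -
    x^2/m. *)
Lemma expR_pow_bounds (m : nat) (x : R) : (0 < m)%N -> 0 <= x -> x <= m%:R ->
  expR (- x) * (1 - x ^+ 2 / m%:R) <= (1 - x / m%:R) ^+ m <= expR (- x).
Proof.
move=> m0 x0 xm; have mp : 0 < m%:R :> R by rewrite ltr0n.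
have y0 : 0 <= x / m%:R by rewrite divr_ge0.
have y1 : x / m%:R <= 1 by rewrite ler_pdivrMr// mul1r.
have E : expR (- x) = expR (- (x / m%:R)) ^+ m.
  by rewrite -expRM_natl; congr expR; field; rewrite gt_eqF.
apply/andP; split; last first.
  by rewrite E lerXn2r ?nnegrE ?subr_ge0 ?expR_ge0// expR_ge1Dx.
apply: (@le_trans _ _ (expR (- x) * (1 - (x / m%:R) ^+ 2) ^+ m)).
  rewrite ler_wpM2l ?expR_ge0//; apply: le_trans (bernoulli_ineq _ _); last first.
    by rewrite sqr_ge0/= expr_le1.
  by rewrite le_eqVlt; apply/orP; left; apply/eqP; field; rewrite gt_eqF.
rewrite E -exprMn lerXn2r ?nnegrE ?subr_ge0//.
  by rewrite mulr_ge0 ?expR_ge0// subr_ge0 expr_le1.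
have -> : 1 - (x / m%:R) ^+ 2 = (1 - x / m%:R) * (1 + x / m%:R) by ring.
rewrite mulrCA ler_piMr ?subr_ge0//.
apply: (@le_trans _ _ (expR (- (x / m%:R)) * expR (x / m%:R))).
  by rewrite ler_wpM2l ?expR_ge0// expR_ge1Dx.
by rewrite mulrC expRxMexpNx_1.
Qed.

Variables (p : R).
Hypothesis p12 : 1 < p < 2.
Local Notation g := (fun x : R => x `^ (p - 1) * expR (- x)).
Local Notation kap := (fun x : R => 216 * expR (- (x / 2))).

Let p1 : 0 < p - 1. Proof. by case/andP: p12 => ? _; rewrite subr_gt0. Qed.
Let p2 : p - 1 < 1. Proof. by case/andP: p12 => _ ?; lra. Qed.

Lemma powR_le1D (x : R) : 0 <= x -> x `^ (p - 1) <= 1 + x.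
Proof.
move=> x0; case: (lerP x 1) => [x1|x1].
  apply: (@le_trans _ _ 1); last by rewrite lerDl.
  by have := @ge0_ler_powR R (p - 1) (ltW p1) x 1; rewrite powR1; apply; rewrite ?nnegrE.
apply: (@le_trans _ _ x); last by rewrite lerDr.
by rewrite -[leRHS]powRr1//; apply: ler_powR; exact: ltW.
Qed.

(** From (1 + x/6)^3 <= e^(x/2): 216 = 6^3 turns the cube into (6 + x)^3, which dominates (1 + x)(1
    + x^2). The factor 1 + x^2 lets [kap] dominate both g and the error x^2 g; its integral 432 is
    the constant in [Gamma_gam]. *)
Lemma kernel_exp_le (x : R) : 0 <= x -> g x * (1 + x ^+ 2) <= kap x.
Proof.
move=> x0; have e6 : (1 + x / 6) ^+ 3 <= expR (x / 2).
  rewrite (_ : x / 2 = 3 * (x / 6)); last by field.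
  by rewrite expRM_natl lerXn2r ?nnegrE ?expR_ge0 ?expR_ge1Dx// addr_ge0// divr_ge0.
have h1 := powR_le1D x0; have h0 := powR_ge0 x (p - 1).
have -> : - (x / 2) = x / 2 - x by field.
rewrite expRD [leLHS]mulrAC [leRHS]mulrA ler_wpM2r ?expR_ge0//.
rewrite [leRHS]mulrC; apply: (@le_trans _ _ ((1 + x) * (1 + x ^+ 2))).
  by rewrite ler_wpM2r// addr_ge0// sqr_ge0.
apply: (@le_trans _ _ ((1 + x / 6) ^+ 3 * 216)); last by rewrite ler_wpM2r.
rewrite -subr_ge0 (_ : _ - _ = 215 + 107 * x + 17 * x ^+ 2); last by field.
by rewrite !addr_ge0// ?mulr_ge0// sqr_ge0.
Qed.

Lemma integral_kap : (\int[mu]_(x in `[0%R, +oo[) (kap x)%:E = 432%:E)%E.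
Proof.
pose F (x : R) : R := - 432 * expR (- (x / 2)).
have ce : continuous (fun x : R => expR (- (x / 2))).
  move=> x; apply: (@continuous_comp _ _ _ (fun x : R => - (x / 2)) expR); last exact: continuous_expR.
  by apply: cvgN; apply: cvgMl; exact: cvg_id.
have dF x : isd x F (kap x).
  apply: isd_eq (isdZ _ (isd_comp (is_derive_expR _) (isdN (isdM (isd_id x) (isd_cst x 2^-1))))) _.
  by field.
rewrite (@ge0_continuous_FTC2y _ kap F 0 0).
- by rewrite /F mul0r oppr0 expR0 mulr1 -EFinB opprK add0r.
- by move=> x _; rewrite mulr_ge0 ?expR_ge0.
- by apply: continuous_subspaceT => x; apply: cvgMr; exact: ce.
- rewrite -[X in _ --> X](mulr0 (- 432)); apply: cvgMr.
  apply: (@cvg_comp _ _ _ (fun x : R => x / 2) (fun x => expR (- x)) _ (pinfty_nbhs R)); last exact: cvgr_expR.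
  by apply: gt0_cvgMly => //; exact: cvg_id.
- by move=> x _; exact: isd_derivable (dF x).
- by apply: cvg_at_right_filter; apply: cvgMr; exact: ce.
- by move=> x _; exact: isd_derive1 (dF x).
Qed.

(** The Beta integral B(m + 1, p). *)
Definition gam (m : nat) : R := \int[mu]_(r in `[0, 1]) (r ^+ m * (1 - r) `^ (p - 1)).

Let hm (m : nat) (x : R) : R := (1 - x / m%:R) ^+ m * x `^ (p - 1).

Let within_gam m : {within `[0, 1], continuous (fun r : R => r ^+ m * (1 - r) `^ (p - 1))}.
Proof.
move=> x; apply: cvgM; last exact: within_powR_rev.
have c : {within `[0, 1], continuous (fun r : R => r ^+ m)}.
  by apply: continuous_subspaceT => {}x; exact: exprn_continuous.
exact: c.
Qed.

Lemma beta_gam m : (0 < m)%N ->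
  \int[mu]_(r in `[0, 1]) ((1 - r) `^ p * (m%:R * r ^+ m.-1)) = p * gam m.
Proof.
move=> m0; have /andP[pp _] := p12; have {}pp : 0 < p by rewrite (lt_trans ltr01).
have c1 : {within `[0, 1], continuous (fun r : R => m%:R * r ^+ m.-1)}.
  by apply: continuous_subspaceT => x; apply: cvgMr; exact: exprn_continuous.
have c2 : {within `[0, 1], continuous (fun r : R => (1 - r) `^ p * (m%:R * r ^+ m.-1))}.
  by move=> x; apply: cvgM; [exact: within_powR_rev|exact: c1].
have c3 : {within `[0, 1], continuous (fun r : R => p * (r ^+ m * (1 - r) `^ (p - 1)))}.
  by move=> x; apply: cvgMr; exact: within_gam.
pose F (r : R) : R := r ^+ m * apow p (1 - r).
have cr (r : R) : {for r, continuous (fun r : R => apow p (1 - r))}.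
  apply: (@continuous_comp _ _ _ (fun x : R => 1 - x) (apow p)); last exact: apow_continuous.
  by apply: cvgB; [exact: cvg_cst|exact: cvg_id].
have cF : {within `[0, 1], continuous F}.
  by apply: continuous_subspaceT => x; apply: cvgM; [exact: exprn_continuous|exact: cr].
have dF x : 0 < x < 1 -> isd x F ((1 - x) `^ p * (m%:R * x ^+ m.-1) - p * (x ^+ m * (1 - x) `^ (p - 1))).
  move=> /andP[x0 x1]; have x10 : 0 < 1 - x by rewrite subr_gt0.
  have h1 := @isd_comp _ x (fun r => 1 - r) (apow p) _ _ (isd_apow_pos p x10) (isdB (isd_cst x 1) (isd_id x)).
  apply: isd_eq (isdM (isdX m (isd_id x)) h1) _.
  by rewrite apow_pos ?ltW//; ring.
have : \int[mu]_(x in `[0, 1]) ((1 - x) `^ p * (m%:R * x ^+ m.-1) - p * (x ^+ m * (1 - x) `^ (p - 1))) = F 1 - F 0.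
  by apply: (FTC_isd ler01 _ cF dF) => x; apply: cvgB; [exact: c2|exact: c3].
rewrite /F subrr apow0 ?gt_eqF// mulr0 expr0n gtn_eqF// mul0r subrr.
rewrite RintegralB//; [|exact: within_itgb|exact: within_itgb].
rewrite RintegralZl//; last exact: within_itgb.
by move/eqP; rewrite subr_eq0 => /eqP.
Qed.

(** The substitution r = 1 - x/m, which decreases and therefore exchanges the ends of
    integration. *)
Lemma gam_scale m : (0 < m)%N ->
  m%:R `^ p * gam m = \int[mu]_(x in `[0, m%:R]) hm m x.
Proof.
move=> m0; have mp : 0 < m%:R :> R by rewrite ltr0n.
pose F (x : R) : R := 1 - x / m%:R.
have dF x : isd x F (- m%:R^-1).
  by apply: isd_eq (isdB (isd_cst x 1) (isdM (isd_id x) (isd_cst x m%:R^-1))) _; ring.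
have dF1 : derive1 F = cst (- m%:R^-1) by apply/funext => x; exact: isd_derive1 (dF x).
have cF x : {for x, continuous F} := isd_continuous (dF x).
have F0 : F 0 = 1 by rewrite /F mul0r subr0.
have Fm : F m%:R = 0 by rewrite /F divff ?subrr// gt_eqF.
have F1 x : 1 - F x = x / m%:R by rewrite /F; ring.
have := @integration_by_substitution_decreasing R F (fun r : R => r ^+ m * (1 - r) `^ (p - 1)) 0 m%:R (ltW mp).
rewrite dF1 F0 Fm => /(_ _ _ _ _ _ (@within_gam m)) h.
have {}h : (\int[mu]_(r in `[0%R, 1%R]) (r ^+ m * (1 - r) `^ (p - 1))%:E =
   \int[mu]_(x in `[0%R, m%:R]) (F x ^+ m * (1 - F x) `^ (p - 1) * m%:R^-1)%:E)%E.
  rewrite h.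
  - by apply: eq_integral => x _ /=; congr EFin; rewrite /= opprK.
  - by move=> x y _ _ xy; rewrite /F ltrD2l ltrN2 ltr_pM2r// invr_gt0.
  - by move=> x _; exact: cvg_cst.
  - exact: is_cvg_cst.
  - exact: is_cvg_cst.
  - split; first by move=> x _; exact: isd_derivable (dF x).
    + by apply: cvg_at_right_filter; exact: cF.
    + by apply: cvg_at_left_filter; exact: cF.
have c : {within `[0, m%:R], continuous (fun x : R => F x ^+ m * (1 - F x) `^ (p - 1) * m%:R^-1)}.
  apply: (@subspace_eq_continuous _ _ _ (fun x => F x ^+ m * apow (p - 1) (1 - F x) * m%:R^-1)).
    move=> x /set_mem/=; rewrite in_itv/= => /andP[x0 xm].
    by rewrite /from_subspace F1 apow_pos// divr_ge0.
  apply: continuous_subspaceT => x; apply: cvgMl; apply: cvgM.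
    by apply: (@continuous_comp _ _ _ F (fun y => y ^+ m)); [exact: cF|exact: exprn_continuous].
  apply: (@continuous_comp _ _ _ (fun x => 1 - F x) (apow (p - 1))); last exact: apow_continuous.
  by apply: cvgB; [exact: cvg_cst|exact: cF].
have -> : gam m = \int[mu]_(x in `[0, m%:R]) (F x ^+ m * (1 - F x) `^ (p - 1) * m%:R^-1).
  by rewrite /gam /Rintegral; congr fine.
rewrite -RintegralZl//; last by apply: continuous_compact_integrable => //; exact: segment_compact.
apply: eq_Rintegral => x; rewrite inE/= in_itv/= => /andP[x0 xm].
rewrite F1 /hm /F powRM ?invr_ge0//.
have -> : m%:R `^ p = m%:R `^ (p - 1) * m%:R by rewrite -[X in _ * X]powRr1 ?ltW// -gt0_powRD// subrK.
have E : m%:R `^ (p - 1) * m%:R^-1 `^ (p - 1) = 1.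
  by rewrite -powRM ?invr_ge0 ?ltW// divff ?gt_eqF// powR1.
transitivity ((m%:R `^ (p - 1) * m%:R^-1 `^ (p - 1)) * (m%:R * m%:R^-1) *
  ((1 - x / m%:R) ^+ m * x `^ (p - 1))); first by ring.
by rewrite E divff ?gt_eqF// !mul1r.
Qed.
Let kap_itg : mu.-integrable `[0, +oo[ (EFin \o kap).
Proof.
have mk : measurable_fun (setT : set (measurableTypeR R)) kap.
  apply: continuous_measurable_fun => x; apply: cvgMr.
  apply: (@continuous_comp _ _ _ (fun x : R => - (x / 2)) expR); last exact: continuous_expR.
  by apply: cvgN; apply: cvgMl; exact: cvg_id.
apply/integrableP; split; first by apply/measurable_EFinP; exact: measurable_funS mk.
apply: (@le_lt_trans _ _ 432%:E); last exact: ltry.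
rewrite -integral_kap le_eqVlt; apply/orP; left; apply/eqP; apply: eq_integral => x _ /=.
by rewrite ger0_norm// mulr_ge0 ?expR_ge0.
Qed.

Let measurable_g : measurable_fun (setT : set (measurableTypeR R)) g.
Proof.
apply: measurable_funM; first exact: measurable_powR.
apply: continuous_measurable_fun => x.
apply: (@continuous_comp _ _ _ (fun x : R => - x) expR); last exact: continuous_expR.
by apply: cvgN; exact: cvg_id.
Qed.

Let measurable_hm m : measurable_fun (setT : set (measurableTypeR R)) (hm m).
Proof.
apply: measurable_funM; last exact: measurable_powR.
apply: continuous_measurable_fun => x.
apply: (@continuous_comp _ _ _ (fun x : R => 1 - x / m%:R) (fun y => y ^+ m)); last exact: exprn_continuous.
by apply: cvgB; [exact: cvg_cst|apply: cvgMl; exact: cvg_id].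
Qed.

Let g_ge0 x : 0 <= g x. Proof. by rewrite mulr_ge0 ?powR_ge0 ?expR_ge0. Qed.

Let g_le x : 0 <= x -> g x <= kap x.
Proof.
move=> x0; apply: le_trans (kernel_exp_le x0).
by rewrite ler_peMr// lerDl sqr_ge0.
Qed.

Let g_itg : mu.-integrable `[0, +oo[ (EFin \o g).
Proof.
apply: le_integrable kap_itg => //.
  by apply/measurable_EFinP; exact: measurable_funS measurable_g.
move=> x /=; rewrite in_itv/= andbT => x0.
by rewrite lee_fin !ger0_norm ?g_le// (le_trans _ (g_le x0)).
Qed.

Let hp m := hm m \_ `[0, m%:R].

(** For x <= m this is [expR_pow_bounds]. For x > m the truncated function is 0 and m <= 1 + x^2, so
    g itself is at most (1 + x^2) g / m. *)
Let hp_bounds m x : (0 < m)%N -> 0 <= x -> 0 <= hp m x /\ 0 <= g x - hp m x <= m%:R^-1 * kap x.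
Proof.
move=> m0 x0; have mp : 0 < m%:R :> R by rewrite ltr0n.
have hk := kernel_exp_le x0; have q0 := powR_ge0 x (p - 1).
rewrite /hp patchE mem_setE in_itv/= x0 /=; case: (lerP x m%:R) => xm.
  have /andP[h1 h2] := expR_pow_bounds m0 x0 xm.
  have hm0 : 0 <= hm m x.
    by rewrite mulr_ge0// exprn_ge0// subr_ge0 ler_pdivrMr// mul1r.
  split => //; rewrite /hm mulrC -mulrBl mulr_ge0 ?subr_ge0//=.
  apply: (@le_trans _ _ (m%:R^-1 * (g x * (1 + x ^+ 2)))); last by rewrite ler_wpM2l ?invr_ge0.
  rewrite mulrC; apply: (@le_trans _ _ (x `^ (p - 1) * (expR (- x) * (x ^+ 2 / m%:R)))).
    by rewrite ler_wpM2l//; move: h1; rewrite mulrBr mulr1; lra.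
  rewrite -subr_ge0 (_ : _ - _ = m%:R^-1 * g x); first by rewrite mulr_ge0 ?invr_ge0.
  by field; rewrite gt_eqF.
split => //; rewrite subr0 g_ge0/=; apply: (@le_trans _ _ (m%:R^-1 * (g x * (1 + x ^+ 2)))).
  rewrite [leRHS]mulrC ler_pdivlMr// ler_wpM2l//.
  have m1 : 1 <= m%:R :> R by rewrite ler1n.
  nra.
by rewrite ler_wpM2l ?invr_ge0.
Qed.

Let hp_itg m : (0 < m)%N -> mu.-integrable `[0, +oo[ (EFin \o hp m).
Proof.
move=> m0; apply: le_integrable g_itg => //.
  apply/measurable_EFinP; apply: (measurable_funS measurableT) => //.
  apply/(measurable_restrict _ _ _) => //.
  by apply: measurable_funS (measurable_hm m).
move=> x /=; rewrite in_itv/= andbT => x0; have [h1 /andP[h2 _]] := hp_bounds m0 x0.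
by rewrite lee_fin !ger0_norm// -subr_ge0.
Qed.

Lemma Gamma_gam m : (0 < m)%N -> 0 <= Gamma p - m%:R `^ p * gam m <= 432 / m%:R.
Proof.
move=> m0; have -> : Gamma p = \int[mu]_(x in `[0, +oo[) g x.
  by apply: Rintegral_itv_obnd_cbnd; apply: integrableS g_itg => //; move=> x /=; rewrite !in_itv/= !andbT; exact: ltW.
have -> : m%:R `^ p * gam m = \int[mu]_(x in `[0, +oo[) hp m x.
  rewrite gam_scale// -Rintegral_mkcondr; congr Rintegral; apply/esym/setIidr => x /=.
  by rewrite !in_itv/= => /andP[->].
have ih := hp_itg m0; rewrite -RintegralB//.
apply/andP; split.
  apply: Rintegral_ge0 => x /=; rewrite in_itv/= andbT => x0.
  by have [_ /andP[]] := hp_bounds m0 x0.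
apply: (@le_trans _ _ (\int[mu]_(x in `[0, +oo[) (m%:R^-1 * kap x))); last first.
  by rewrite (RintegralZl _ _ kap_itg)// {1}/Rintegral integral_kap mulrC.
apply: le_Rintegral => //.
- exact: (integrableB _ g_itg ih).
- exact: (integrableZl _ _ kap_itg).
- move=> x /=; rewrite in_itv/= andbT => x0.
  by have [_ /andP[]] := hp_bounds m0 x0.
Qed.

(** By [Gamma_gam] with m = 1 the value is at least B(2, p), which is at least the integral of r(1 -
    r) because p - 1 < 1. *)
Lemma Gamma_gt0 : 0 < Gamma p.
Proof.
have := Gamma_gam (ltn0Sn 0); rewrite powR1 mul1r => /andP[h _].
have -> : Gamma p = (Gamma p - gam 1) + gam 1 by rewrite subrK.
rewrite ltr_wpDl//.
have c : continuous (fun r : R => r - r ^+ 2).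
  by move=> x; apply: cvgB; [exact: cvg_id|exact: exprn_continuous].
apply: (@lt_le_trans _ _ (\int[mu]_(r in `[0, 1]) (r - r ^+ 2))).
  have dF (x : R) : isd x (fun r => 2^-1 * r ^+ 2 - 3^-1 * r ^+ 3) (x - x ^+ 2).
    by apply: isd_eq (isdB (isdZ _ (isdX 2 (isd_id x))) (isdZ _ (isdX 3 (isd_id x)))) _; field.
  have -> : \int[mu]_(r in `[0, 1]) (r - r ^+ 2) = 2^-1 - 3^-1.
    have := FTC_isd ler01 (continuous_subspaceT c)
      (continuous_subspaceT (fun x => isd_continuous (dF x))) (fun x _ => dF x).
    by move=> ->; ring.
  lra.
apply: le_Rintegral => //.
- by apply: within_itgb; exact: continuous_subspaceT.
- by apply: within_itgb; exact: within_gam.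
- move=> r; rewrite /= in_itv/= => /andP[r0 r1].
  rewrite expr2 -[X in X - _]mulr1 -mulrBr expr1 ler_wpM2l//.
  have [->|r1'] := eqVneq r 1; first by rewrite subrr powR_ge0.
  by apply: ger1_powR; [rewrite subr_gt0 lt_neqAle r1' r1/=; lra|exact: ltW].
Qed.


End gamma_limit.

(** * Orders of magnitude in n *)

Section asymptotics.
Context {R : realType} (H : R) (hH : 2^-1 < H < 1).
Local Notation p := (2 * H).

Let p12 : 1 < p < 2. Proof. exact: p_bounds hH. Qed.
Let H0 : 0 < H. Proof. by have /andP[h _] := hH; rewrite (lt_trans _ h)// invr_gt0. Qed.
Let p0 : 0 < p. Proof. by rewrite mulr_gt0. Qed.

Lemma cvg_invn : (n%:R^-1 : R) @[n --> \oo] --> 0.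
Proof.
apply/cvgrPdist_le => e e0; near=> n.
rewrite sub0r normrN ger0_norm ?invr_ge0//; near: n; exact: near_invn_le.
Unshelve. all: by end_near. Qed.

Lemma cvg_powRNn (q : R) : 0 < q -> (n%:R `^ (- q) : R) @[n --> \oo] --> 0.
Proof.
move=> q0; apply: (@cvg_trans _ (apow q n%:R^-1 @[n --> \oo])); last first.
  by apply: (@cvg_comp _ _ _ (fun n : nat => n%:R^-1 : R) (apow q) _ _ _ cvg_invn); exact: apow_cvg0.
apply: near_eq_cvg; near=> n.
have n0 : 0 < n%:R :> R by rewrite ltr0n; near: n; exact: nbhs_infty_gt.
rewrite apow_pos ?invr_ge0 ?ltW//; apply: (@mulfI _ (n%:R `^ q)); first by rewrite gt_eqF// powR_gt0.
by rewrite -gt0_powRD// subrr powRr0 -powRM ?invr_ge0 ?ltW// divff ?gt_eqF// powR1.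
Unshelve. all: by end_near. Qed.

(* With phi t = n^H t^n and v its class: [rho n] is the covariance of B_1 and W v,
   [sig2 n] is the variance of W v, and [tail n] is the integral of (1 - t)^(2H)
   with respect to phi, which bounds the remainder of Z_n in L^1. *)
Definition weight (n : nat) : R := n%:R `^ H.
Definition rate (n : nat) : R := n%:R `^ (H - 1).
Definition tail (n : nat) : R := weight n * (p * gam p n).
Definition sig2 (n : nat) : R :=
  weight n * tail n - tail n * (weight n * n%:R / (n%:R + (n%:R + p))).
Definition rho (n : nat) : R := 2^-1 * (weight n + tail n - weight n * n%:R / (n%:R + p)).

Let g (n : nat) : R := n%:R `^ p * gam p n.
Let e (n : nat) : R := n%:R `^ (- (p - 1)).

Let g_cvg : g n @[n --> \oo] --> Gamma p.
Proof.
apply/subr_cvg0.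
apply: (@squeeze_cvgr _ _ _ _ (fun n => - (432 * n%:R^-1)) (cst 0)).
- near=> n; have n0 : (0 < n)%N by near: n; exact: nbhs_infty_gt.
  have /andP[h1 h2] := Gamma_gam p12 n0.
  by rewrite /g /cst; apply/andP; split; lra.
- rewrite -[X in _ --> X]oppr0 -[X in _ --> - X](mulr0 432); apply: cvgN; apply: cvgMr; exact: cvg_invn.
- exact: cvg_cst.
Unshelve. all: by end_near. Qed.

Let weightE n : (0 < n)%N -> weight n = rate n * n%:R.
Proof.
move=> n0; have n0' : 0 < n%:R :> R by rewrite ltr0n.
by rewrite /weight /rate -[X in _ * X]powRr1 ?ltW// -gt0_powRD// subrK.
Qed.

Let tailE n : (0 < n)%N -> tail n = rate n * (e n * (p * g n)).
Proof.
move=> n0; have n0' : 0 < n%:R :> R by rewrite ltr0n.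
transitivity (rate n * e n * n%:R `^ p * (p * gam p n)); last by rewrite /g; ring.
rewrite /tail /rate /e -!gt0_powRD//; congr (_ `^ _ * _); ring.
Qed.

Lemma rate_gt0 n : (0 < n)%N -> 0 < rate n.
Proof. by move=> n0; rewrite powR_gt0// ltr0n. Qed.

Lemma rate_cvg : rate n @[n --> \oo] --> 0.
Proof.
have -> : rate = fun n : nat => n%:R `^ (- (1 - H)) by apply/funext => n; rewrite opprB.
by apply: cvg_powRNn; have /andP[] := hH; rewrite subr_gt0.
Qed.

Lemma invn_rate_cvg : n%:R^-1 / rate n @[n --> \oo] --> 0.
Proof.
apply: cvg_trans (cvg_powRNn H0); apply: near_eq_cvg; near=> n.
have n0 : (0 < n)%N by near: n; exact: nbhs_infty_gt.
have n0' : 0 < n%:R :> R by rewrite ltr0n.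
rewrite -invfM [n%:R * _]mulrC -weightE// powRN//.
Unshelve. all: by end_near. Qed.

Lemma tail_cvg : tail n / rate n @[n --> \oo] --> 0.
Proof.
apply: (@cvg_trans _ (e n * (p * g n) @[n --> \oo])).
  apply: near_eq_cvg; near=> n; have n0 : (0 < n)%N by near: n; exact: nbhs_infty_gt.
  by rewrite tailE// [RHS]mulrAC divff ?mul1r// gt_eqF// rate_gt0.
have <- : 0 * (p * Gamma p) = 0 by rewrite mul0r.
apply: cvgM; last exact: cvgMr.
by apply: cvg_powRNn; have /andP[] := p12; rewrite subr_gt0.
Unshelve. all: by end_near. Qed.

(** The leading terms of [rho] nearly cancel: 1 - n/(n + 2H) is 2H/(n + 2H), so half of it times n^H
    is equivalent to H n^(H-1), and the tail is of smaller order. *)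
Lemma rho_cvg : rho n / rate n @[n --> \oo] --> H.
Proof.
apply: (@cvg_trans _ (2^-1 * (p * (1 + p * n%:R^-1)^-1 + tail n / rate n) @[n --> \oo])).
  apply: near_eq_cvg; near=> n; have n0 : (0 < n)%N by near: n; exact: nbhs_infty_gt.
  have n0' : 0 < n%:R :> R by rewrite ltr0n.
  rewrite /rho; have := weightE n0; have := rate_gt0 n0; move: (tail n) (weight n) (rate n) => t a h h0 ->.
  field; rewrite !gt_eqF//= ltr_wpDl// ltW.
suff : (2^-1 * (p * (1 + p * n%:R^-1)^-1 + tail n / rate n) @[n --> \oo]) -->
    2^-1 * (p * (1 + p * 0)^-1 + 0).
  by congr (_ --> _); field.
apply: cvgMr; apply: cvgD; last exact: tail_cvg.
apply: cvgMr; apply: cvgV; first by rewrite mulr0 addr0 oner_neq0.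
by apply: cvgD; [exact: cvg_cst|apply: cvgMr; exact: cvg_invn].
Unshelve. all: by end_near. Qed.

(** The variance factors as p g(n) q with q = (n + p)/(2n + p). Both g(n) - Gamma(p) and q - 1/2 are
    O(1/n), and p/2 = H. *)
Lemma sig2_le n : (0 < n)%N -> `|sig2 n - H * Gamma p| <= p * (432 + Gamma p) * n%:R^-1.
Proof.
move=> n0; have n0' : 0 < n%:R :> R by rewrite ltr0n.
have n1 : 1 <= n%:R :> R by rewrite ler1n.
have /andP[g1 g2] := Gamma_gam p12 n0; have G0 := Gamma_gt0 p12.
have E : sig2 n = p * g n * ((n%:R + p) / (n%:R + (n%:R + p))).
  have -> : g n = weight n * weight n * gam p n.
    by rewrite /g /weight -gt0_powRD//; congr (_ `^ _ * _); ring.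
  by rewrite /sig2 /tail; field; rewrite gt_eqF// !addr_gt0.
set q := (n%:R + p) / _ in E.
have nn : 0 < n%:R + (n%:R + p) by rewrite !addr_gt0.
have q1 : 0 <= q <= 1.
  rewrite /q; apply/andP; split; first by rewrite divr_ge0 ?addr_ge0 ?ltW.
  by rewrite ler_pdivrMr// mul1r lerDr ltW.
have q2 : 0 <= q - 2^-1 <= n%:R^-1.
  have -> : q - 2^-1 = 2^-1 * p * (n%:R + (n%:R + p))^-1 by rewrite /q; field; rewrite gt_eqF.
  apply/andP; split; first by rewrite !mulr_ge0 ?invr_ge0 ?ltW.
  rewrite -[leRHS]mul1r; apply: ler_pM; rewrite ?mulr_ge0 ?invr_ge0 ?(ltW nn) ?(ltW p0) ?(ltW H0)//.
    by have /andP[_ ?] := p12; lra.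
  by rewrite lef_pV2 ?posrE// lerDl addr_ge0// ltW.
have -> : sig2 n - H * Gamma p = p * ((g n - Gamma p) * q + Gamma p * (q - 2^-1)).
  by rewrite E; field.
clearbody q; rewrite normrM (ger0_norm (ltW p0)) -[leRHS]mulrA ler_pM2l// [leRHS]mulrDl.
apply: le_trans (ler_normD _ _) _; rewrite !normrM; apply: lerD.
  case/andP: q1 => q0 q1; rewrite distrC (ger0_norm g1) (ger0_norm q0).
  by rewrite -[leRHS]mulr1 ler_pM.
by case/andP: q2 => q0 q2; rewrite (ger0_norm q0) (ger0_norm (ltW G0)) ler_pM2l.
Qed.

End asymptotics.

(** * Products of independent standard normal variables *)

Section independent_pairs.
Context {d} {T : measurableType d} {R : realType} (P : probability T R).
Local Notation N01 := (normal_prob (0 : R) 1).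

Definition indep (X Y : T -> R) : Prop := independent_of P setT (fun _ : unit => X) Y.

Lemma independent_of_indep (I : Type) (D : set I) (X : I -> T -> R) (Y : T -> R) i :
  D i -> independent_of P D X Y -> indep (X i) Y.
Proof.
move=> Di h A C mA hC; apply: h => //; move: hC; apply: sub_sigma_algebra2.
by move=> _ [_ [B [_ mB ->]]]; exists i, B.
Qed.

Variables (X Y : T -> R).
Hypotheses (mX : measurable_fun setT X) (mY : measurable_fun setT Y).
Hypothesis lawY : forall A, measurable A -> P (Y @^-1` A) = N01 A.
Hypothesis indXY : indep X Y.
Variable psi : R -> R -> R.
Hypothesis mpsi : measurable_fun setT
  (fun z : measurableTypeR R * measurableTypeR R => psi z.1 z.2).
Hypothesis ipsi : itg P (fun w => psi (X w) (Y w)).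

Lemma pair_integral : itg P (fun w => Ex N01 (psi (X w))) /\
  Ex P (fun w => psi (X w) (Y w)) = Ex P (fun w => Ex N01 (psi (X w))).
Proof.
have mXs : measurable_fun setT (fun z : g_sigma_algebraType (sigma_gen setT (fun _ : unit => X)) *
    measurableTypeR R => X z.1).
  have h := @measurable_sigma_gen _ T R unit setT (fun=> X) tt I.
  exact: (measurableT_comp h).
apply: (@independent_integral _ _ _ P unit setT (fun=> X) Y 0 1 _ mY lawY indXY
  (fun z => psi (X z.1) z.2)) => //.
apply: (measurableT_comp (f := fun z : measurableTypeR R * measurableTypeR R => psi z.1 z.2)
   (g := fun z : g_sigma_algebraType (sigma_gen setT (fun _ : unit => X)) * measurableTypeR R =>
     (X z.1 : measurableTypeR R, z.2))) => //.
by apply: measurable_fun_pair => //; exact: mXs.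
Qed.

Hypothesis lawX : forall A, measurable A -> P (X @^-1` A) = N01 A.
Hypothesis psi0 : forall x y, 0 <= psi x y.

Lemma pair_law : Ex P (fun w => psi (X w) (Y w)) = Ex N01 (fun x => Ex N01 (psi x)).
Proof.
have [_ ->] := pair_integral.
pose F := fubini_F N01 (fun z : measurableTypeR R * measurableTypeR R => (psi z.1 z.2)%:E).
have mF : measurable_fun setT F.
  by apply: measurable_fun_fubini_tonelli_F => [|z]; [exact/measurable_EFinP|rewrite lee_fin].
have mG : measurable_fun setT (fun x : R => (Ex N01 (psi x))%:E).
  by apply/measurable_EFinP; apply: (measurableT_comp (fine_measurable measurableT) mF).
rewrite {1}/Rintegral [in RHS]/Rintegral; congr fine.
apply: (law_ge0 mX lawX (g := fun x => (Ex N01 (psi x))%:E)) => // x.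
by rewrite lee_fin Ex_ge0.
Qed.

End independent_pairs.

Section normal_symmetry.
Context {d} {T : measurableType d} {R : realType} (P : probability T R).
Local Notation N01 := (normal_prob (0 : R) 1).

Lemma gaussian_standard (X : T -> R) : measurable_fun setT X -> gaussian P X ->
  Ex P X = 0 -> Ex P (fun w => X w ^+ 2) = 1 ->
  forall A, measurable A -> P (X @^-1` A) = N01 A.
Proof.
move=> mX gX X0 X1; have [[s [s0 s2 law]]|[h _]] := gaussian_centered mX gX X0; last first.
  by move: (@oner_neq0 R); rewrite -X1 h eqxx.
(* [gaussian] only requires s to be nonzero, so the negative root occurs as well; the density
   depends on s^2 alone. *)
have : s = 1 \/ s = -1.
  move: s2; rewrite X1 => /eqP; rewrite sqrf_eq1 => /orP[/eqP->|/eqP->]; [by left|by right].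
case=> sE; rewrite {}sE in law; first exact: law.
move=> A mA; rewrite (law A mA) /normal_prob; apply: eq_integral => x _; congr EFin.
by rewrite /normal_pdf oppr_eq0 /normal_peak /normal_fun sqrrN.
Qed.

End normal_symmetry.

(** * Mean value and Taylor bounds *)

Section taylor_bounds.
Context {R : realType}.
Local Notation isd x f df := (is_derive (x : R) (1 : R) f df).

Lemma mean_value (f f1 : R -> R) : (forall x, isd x f (f1 x)) ->
  forall x y, exists2 z, `|z - x| <= `|y - x| & f y - f x = f1 z * (y - x).
Proof.
move=> df x y; have cf : continuous f by move=> z; exact: isd_continuous (df z).
have [xy|yx] := leP x y.
  have [z] := MVT_segment xy (fun z _ => df z) (continuous_subspaceT cf).
  rewrite in_itv/= => /andP[xz zy] ->; exists z => //.
  by rewrite !ger0_norm ?subr_ge0// lerD2r.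
have [z] := MVT_segment (ltW yx) (fun z _ => df z) (continuous_subspaceT cf).
rewrite in_itv/= => /andP[yz zx] E; exists z.
  by rewrite !ler0_norm ?subr_le0 ?(ltW yx)// lerN2 lerD2r.
by rewrite -opprB E -mulrN opprB.
Qed.

Lemma derive_lipschitz (f f1 : R -> R) (M : R) : (forall x, isd x f (f1 x)) ->
  (forall x, `|f1 x| <= M) -> forall x y, `|f y - f x| <= M * `|y - x|.
Proof.
move=> df hM x y; have [z _ ->] := mean_value df x y.
by rewrite normrM ler_wpM2r.
Qed.

Lemma taylor1 (f f1 f2 : R -> R) (M : R) : (forall x, isd x f (f1 x)) ->
  (forall x, isd x f1 (f2 x)) -> (forall x, `|f2 x| <= M) ->
  forall x h, `|f (x + h) - f x - h * f1 x| <= M * h ^+ 2.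
Proof.
move=> df df1 hM x h; have [z + ->] := mean_value df x (x + h).
rewrite addrAC subrr add0r => zx; have -> : f1 z * h - h * f1 x = (f1 z - f1 x) * h by ring.
rewrite normrM -[h ^+ 2]real_normK ?num_real// expr2 mulrA ler_wpM2r//.
apply: le_trans (derive_lipschitz df1 hM _ _) _; rewrite ler_wpM2l//.
by apply: le_trans (hM 0).
Qed.

End taylor_bounds.

(** * Expectations involving a product of two independent standard normals *)

Section gaussian_product.
Context {d} {T : measurableType d} {R : realType} (P : probability T R).
Local Notation isd x f df := (is_derive (x : R) (1 : R) f df).
Local Notation N01 := (normal_prob (0 : R) 1).
Variables b eta zeta : T -> R.
Hypotheses (lb : Lall P b) (le : Lall P eta) (lz : Lall P zeta).
Hypothesis law_b : forall A, measurable A -> P (b @^-1` A) = N01 A.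
Hypothesis law_e : forall A, measurable A -> P (eta @^-1` A) = N01 A.
Hypothesis law_Ne : forall A, measurable A -> P ((fun w => - eta w) @^-1` A) = N01 A.
Hypothesis law_z : forall A, measurable A -> P (zeta @^-1` A) = N01 A.
Hypotheses (b1 : Ex P (fun w => b w ^+ 2) = 1) (e1 : Ex P (fun w => eta w ^+ 2) = 1).
Hypotheses (ibe : indep P b eta) (ieb : indep P eta b) (ibz : indep P b zeta).

Let mb : measurable_fun setT b := lb.1.
Let me : measurable_fun setT eta := le.1.
Let mz : measurable_fun setT zeta := lz.1.

Let mpsi (k h a : R -> R) (s : R) : measurable_fun setT k -> measurable_fun setT h ->
  measurable_fun setT a ->
  measurable_fun setT (fun z : measurableTypeR R * measurableTypeR R => k z.1 * h (s * a z.1 * z.2)).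
Proof.
move=> mk mh ma; apply: measurable_funM.
  exact: (measurableT_comp mk measurable_fst).
apply: (measurableT_comp mh); apply: measurable_funM; last exact: measurable_snd.
apply: measurable_funM; first exact: measurable_cst.
exact: (measurableT_comp ma measurable_fst).
Qed.

(** The symmetry of N(0, 1) is read off from [eta] and its opposite, which have the same law. *)
Lemma normal_even (g : R -> R) : measurable_fun setT g -> pg g ->
  Ex N01 (fun y => g (- y)) = Ex N01 g.
Proof.
move=> mg pgg; have o := oner_neq0 R.
have mNe : measurable_fun setT (fun w => - eta w) by exact: measurable_funN.
rewrite -(law_Ex mNe law_Ne mg (itg_normal_pg _ o mg pgg)).
have mgN : measurable_fun setT (fun y : R => g (- y)).
  apply: (measurableT_comp mg); exact: oppr_measurable.
apply/esym; apply: (law_Ex me law_e mgN); apply: itg_normal_pg => //.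
have := pg_affine (-1) 0 pgg; congr pg; apply/funext => y.
by rewrite mulN1r addr0.
Qed.

(** Given b, both sides average over N(0, 1), and by symmetry the sign of b does not affect the
    average. This trades the pair (|b|, zeta) of the statement for the pair (b, eta) of the
    decomposition. *)
Lemma Ex_abs_product (k h : R -> R) (s : R) : measurable_fun setT k -> measurable_fun setT h ->
  pg h -> itg P (fun w => k (b w) * h (s * `|b w| * zeta w)) ->
  itg P (fun w => k (b w) * h (s * b w * eta w)) ->
  Ex P (fun w => k (b w) * h (s * `|b w| * zeta w)) = Ex P (fun w => k (b w) * h (s * b w * eta w)).
Proof.
move=> mk mh ph i1 i2.
have [_ ->] := pair_integral (psi := fun x y => k x * h (s * `|x| * y)) mb mz law_z ibz
  (mpsi s mk mh (@normr_measurable R setT)) i1.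
have [_ ->] := pair_integral (psi := fun x y => k x * h (s * x * y)) mb me law_e ibe
  (mpsi s mk mh (@measurable_id _ _ setT)) i2.
apply: eqEx => w; have [b0|b0] := leP 0 (b w); [by rewrite ger0_norm|rewrite ltr0_norm//].
pose g y := k (b w) * h (s * b w * y).
have mg : measurable_fun setT g.
  apply: measurable_funM; first exact: measurable_cst.
  apply: (measurableT_comp mh); apply: measurable_funM; first exact: measurable_cst.
  exact: measurable_id.
have pgg : pg g.
  apply: pg_mul; first exact: (pg_bounded (M := `|k (b w)|)).
  have := pg_affine (s * b w) 0 ph; congr pg; apply/funext => y; by rewrite addr0.
rewrite -(normal_even mg pgg); apply: eqEx => y; rewrite /g; congr (_ * h _); ring.
Qed.

Section smooth.
Variables (f f1 f2 f3 : R -> R) (M : R).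
Hypothesis df : forall x, isd x f (f1 x).
Hypothesis df1 : forall x, isd x f1 (f2 x).
Hypothesis df2 : forall x, isd x f2 (f3 x).
Hypothesis cf3 : continuous f3.
Hypotheses (M1 : forall x, `|f1 x| <= M) (M2 : forall x, `|f2 x| <= M) (M3 : forall x, `|f3 x| <= M).

Let M0 : 0 <= M := le_trans (normr_ge0 _) (M1 0).
Let cf : continuous f. Proof. by move=> x; exact: isd_continuous (df x). Qed.
Let cf1 : continuous f1. Proof. by move=> x; exact: isd_continuous (df1 x). Qed.
Let cf2 : continuous f2. Proof. by move=> x; exact: isd_continuous (df2 x). Qed.
Let mf := continuous_measurable_fun cf.
Let mf1 := continuous_measurable_fun cf1.
Let mf3 := continuous_measurable_fun cf3.

Lemma lipschitz_itg (U : T -> R) : itg P U -> itg P (fun w => f (U w)).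
Proof.
move=> iU; have iN := itg_norm iU.
apply: (itg_le (Y := fun w => `|f 0| + M * `|U w|)).
- by apply: (measurableT_comp mf); exact: itg_meas iU.
- by apply: itgD; [exact: itg_cst|exact: itgZ].
- move=> w; have := derive_lipschitz df M1 0 (U w); rewrite subr0 => h.
  by rewrite -[f (U w)](subrK (f 0)) addrC (le_trans (ler_normD _ _))// lerD2l.
Qed.

Lemma pg_lipschitz : pg f.
Proof.
exists (`|f 0| + M), 1%N => x; rewrite expr1.
have := derive_lipschitz df M1 0 x; rewrite subr0 => h.
rewrite -[f x](subrK (f 0)); apply: le_trans (ler_normD _ _) _.
have := mulr_ge0 (normr_ge0 (f 0)) (normr_ge0 x); have := M0; lra.
Qed.

Lemma bounded_mul_itg (g : R -> R) (U V : T -> R) : measurable_fun setT g -> (forall x, `|g x| <= M) ->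
  itg P U -> measurable_fun setT V -> itg P (fun w => U w * g (V w)).
Proof.
move=> mg gM iU mV; apply: (itg_le (Y := fun w => M * `|U w|)).
- apply: measurable_funM; [exact: itg_meas iU|exact: (measurableT_comp mg)].
- by apply: itgZ; exact: itg_norm.
- by move=> w; rewrite normrM mulrC ler_wpM2r.
Qed.

Let mprod (s : R) (X Y : T -> R) : measurable_fun setT X -> measurable_fun setT Y ->
  measurable_fun setT (fun w => s * X w * Y w).
Proof. by move=> mX mY; apply: measurable_funM => //; exact: measurable_funM. Qed.

Let iprod (s : R) (X Y : T -> R) : Lall P X -> Lall P Y -> itg P (fun w => s * X w * Y w).
Proof.
move=> lX lY; apply: Lall_itg; apply: Lall_mul => //; apply: Lall_mul => //; exact: Lall_cst.
Qed.

Lemma Ex_f_product (s : R) :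
  Ex P (fun w => f (s * `|b w| * zeta w)) = Ex P (fun w => f (s * b w * eta w)).
Proof.
have i1 : itg P (fun w => f (s * `|b w| * zeta w)).
  by apply: lipschitz_itg; apply: iprod => //; exact: Lall_norm.
have i2 : itg P (fun w => f (s * b w * eta w)) by apply: lipschitz_itg; exact: iprod.
have E (U : T -> R) : (fun w => cst 1 (b w) * U w) = U by apply/funext => w; rewrite mul1r.
by have := @Ex_abs_product (cst 1) f s (measurable_cst _) mf pg_lipschitz; rewrite !E; exact.
Qed.

Lemma Ex_f3_product (s : R) :
  Ex P (fun w => b w ^+ 2 * f3 (s * `|b w| * zeta w)) = Ex P (fun w => b w ^+ 2 * f3 (s * b w * eta w)).
Proof.
have ib := Lall_itg (Lall_exp 2 lb).
have mk : measurable_fun setT (fun x : R => x ^+ 2) by exact: measurable_funX.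
apply: (@Ex_abs_product (fun x => x ^+ 2) f3 s mk mf3 (pg_bounded M3)).
- by apply: bounded_mul_itg => //; apply: mprod => //; exact: measurableT_comp.
- by apply: bounded_mul_itg => //; exact: mprod.
Qed.

(* The law of (b, eta) is invariant under exchange of its two entries. *)
Lemma Ex_f3_swap (s : R) : Ex P (fun w => eta w ^+ 2 * f3 (s * eta w * b w)) =
  Ex P (fun w => b w ^+ 2 * f3 (s * b w * eta w)).
Proof.
(* The shift by the bound M gives the nonnegativity that [pair_law] requires; it adds M to the
   expectation since the second moments are 1. *)
pose psi x y := x ^+ 2 * (f3 (s * x * y) + M).
have psi0 x y : 0 <= psi x y.
  by rewrite mulr_ge0 ?sqr_ge0//; have := M3 (s * x * y); rewrite ler_norml => /andP[]; lra.
have mk : measurable_fun setT (fun x : R => x ^+ 2) by exact: measurable_funX.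
have mg : measurable_fun setT (fun x => f3 x + M) by apply: measurable_funD => //; exact: measurable_cst.
have mp := mpsi s mk mg (@measurable_id _ _ setT).
have h X Y : Lall P X -> Lall P Y -> Ex P (fun w => X w ^+ 2) = 1 ->
   itg P (fun w => psi (X w) (Y w)) /\
   Ex P (fun w => X w ^+ 2 * f3 (s * X w * Y w)) = Ex P (fun w => psi (X w) (Y w)) - M.
  move=> lX lY X1; have iX := Lall_itg (Lall_exp 2 lX).
  have i1 : itg P (fun w => X w ^+ 2 * f3 (s * X w * Y w)).
    by apply: bounded_mul_itg => //; apply: mprod; [exact: lX.1|exact: lY.1].
  have E : (fun w => psi (X w) (Y w)) = (fun w => X w ^+ 2 * f3 (s * X w * Y w) + M * X w ^+ 2).
    by apply/funext => w; rewrite /psi; ring.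
  rewrite E; split; first by apply: itgD => //; exact: itgZ.
  by rewrite ExD ?ExZ ?X1 ?mulr1 ?addrK//; exact: itgZ.
have [i1 ->] := h _ _ le lb e1; have [i2 ->] := h _ _ lb le b1.
by rewrite (pair_law me mb law_b ieb mp i1 law_e psi0) (pair_law mb me law_e ibe mp i2 law_b psi0).
Qed.

(** y^2 - 1 is the second Hermite polynomial, so two applications of Stein's identity move two
    derivatives onto y -> f1(t y). *)
Lemma hermite_ibp (t : R) : Ex N01 (fun y => (y ^+ 2 - 1) * f1 (t * y)) = t ^+ 2 * Ex N01 (fun y => f3 (t * y)).
Proof.
have o := oner_neq0 R.
have comp (g : R -> R) : continuous g -> continuous (fun y : R => g (t * y)).
  move=> cg y; apply: (@continuous_comp _ _ _ (fun y : R => t * y) g); last exact: cg.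
  by apply: cvgMr; exact: cvg_id.
have dcomp (g g' : R -> R) x : (forall x, isd x g (g' x)) -> isd x (fun y => g (t * y)) (t * g' (t * x)).
  by move=> dg; apply: isd_eq (isd_comp (dg (t * x)) (isdZ t (isd_id x))) _; rewrite mulr1 mulrC.
have pgc (g : R -> R) : (forall x, `|g x| <= M) -> pg (fun y => g (t * y)).
  by move=> h; exact: (pg_bounded (M := M)).
have pgt : pg (fun _ : R => t) by exact: (pg_bounded (M := `|t|)).
have cid : continuous (fun y : R => y) by move=> y; exact: cvg_id.
have ce : continuous (fun y : R => t * f3 (t * y)) by move=> y; apply: cvgMr; exact: comp.
have itgc (g : R -> R) : continuous g -> pg g -> itg N01 g.
  by move=> cg pgg; apply: itg_normal_pg => //; exact: continuous_measurable_fun.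
have E1 : Ex N01 (fun y => y * f2 (t * y)) = t * Ex N01 (fun y => f3 (t * y)).
  have := @normal_ibp R 0 1 o _ _ (fun x => dcomp f2 f3 x df2) ce (pgc _ M2) (pg_mul pgt (pgc _ M3)).
  under eqEx do rewrite subr0; move=> ->; rewrite expr1n mul1r ExZ//.
  by apply: itgc; [exact: comp|exact: pgc].
pose F (y : R) := y * f1 (t * y); pose F' (y : R) := f1 (t * y) + t * (y * f2 (t * y)).
have dF x : isd x F (F' x).
  by apply: isd_eq (isdM (isd_id x) (dcomp f1 f2 x df1)) _; rewrite /F'; ring.
have c12 : continuous (fun y : R => y * f2 (t * y)).
  by move=> y; apply: cvgM; [exact: cvg_id|exact: comp].
have cF' : continuous F' by move=> y; apply: cvgD; [exact: comp|apply: cvgMr; exact: c12].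
have pg2 : pg (fun y : R => y * f2 (t * y)) by exact: pg_mul pg_id (pgc _ M2).
have pF : pg F by exact: pg_mul pg_id (pgc _ M1).
have pF' : pg F' by exact: pg_add (pgc _ M1) (pg_mul pgt pg2).
have := @normal_ibp R 0 1 o _ _ dF cF' pF pF'; under eqEx do rewrite subr0.
have i1 := itgc _ (comp _ cf1) (pgc _ M1); have i2 := itgc _ c12 pg2.
rewrite expr1n mul1r ExD ?ExZ//; last exact: itgZ.
rewrite E1 => h.
have i3 : itg N01 (fun y => y * F y).
  apply: itgc; last exact: pg_mul pg_id pF.
  by move=> y; apply: cvgM; [exact: cvg_id|apply: cvgM; [exact: cvg_id|exact: comp]].
transitivity (Ex N01 (fun y => y * F y - f1 (t * y))).
  by apply: eqEx => y; rewrite /F; ring.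
by rewrite ExB// h; ring.
Qed.

(** Given eta, [hermite_ibp] applies in b with t = s eta and produces the factor s^2 eta^2;
    [Ex_f3_swap] then turns eta^2 into b^2. *)
Lemma Ex_f1_product (s : R) : Ex P (fun w => (b w ^+ 2 - 1) * f1 (s * b w * eta w)) =
  s ^+ 2 * Ex P (fun w => b w ^+ 2 * f3 (s * `|b w| * zeta w)).
Proof.
rewrite Ex_f3_product -Ex_f3_swap.
have mid : measurable_fun setT (fun x : R => x) by exact: measurable_id.
have m1 : measurable_fun setT (fun z : measurableTypeR R * measurableTypeR R =>
    (z.2 ^+ 2 - 1) * f1 (s * z.1 * z.2)).
  have := mpsi s (@measurable_cst _ _ R R setT 1) mf1 mid.
  under eq_fun do rewrite mul1r.
  move=> h; apply: measurable_funM => //; apply: measurable_funB; last exact: measurable_cst.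
  by apply: measurable_funX; exact: measurable_snd.
have ib : itg P (fun w => b w ^+ 2 - 1) by apply: itgB; [exact: Lall_itg (Lall_exp 2 lb)|exact: itg_cst].
have i1 : itg P (fun w => (b w ^+ 2 - 1) * f1 (s * eta w * b w)).
  by apply: bounded_mul_itg => //; exact: mprod.
have [_ E1] := pair_integral (psi := fun x y => (y ^+ 2 - 1) * f1 (s * x * y)) me mb law_b ieb m1 i1.
have mk : measurable_fun setT (fun x : R => x ^+ 2) by exact: measurable_funX.
have ie := Lall_itg (Lall_exp 2 le).
have i2 : itg P (fun w => eta w ^+ 2 * f3 (s * eta w * b w)) by apply: bounded_mul_itg => //; exact: mprod.
have [i3 ->] := pair_integral (psi := fun x y => x ^+ 2 * f3 (s * x * y)) me mb law_b ieb
  (mpsi s mk mf3 mid) i2.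
transitivity (Ex P (fun w => (b w ^+ 2 - 1) * f1 (s * eta w * b w))).
  by apply: eqEx => w; rewrite mulrAC.
rewrite E1 -ExZ//; apply: eqEx => w; rewrite hermite_ibp exprMn -mulrA; congr (_ * _).
rewrite ExZ//; apply: itg_normal_pg; [exact: oner_neq0| |exact: (pg_bounded (M := M))].
by apply: (measurableT_comp mf3); apply: measurable_funM => //; exact: measurable_cst.
Qed.

(** A first-order Taylor expansion in rho (b^2 - 1) and the Lipschitz bound in [Rm]. The factor 2 is
    E(b^2 - 1)^2 = 3 - 2 + 1. *)
Lemma expansion_le (s rho : R) (Rm : T -> R) : itg P Rm ->
  `|Ex P (fun w => f (s * b w * eta w + rho * (b w ^+ 2 - 1) + Rm w)) -
    Ex P (fun w => f (s * `|b w| * zeta w)) -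
    rho * (s ^+ 2 * Ex P (fun w => b w ^+ 2 * f3 (s * `|b w| * zeta w)))| <=
  M * (Ex P (fun w => `|Rm w|) + 2 * rho ^+ 2).
Proof.
move=> iR; rewrite Ex_f_product -Ex_f1_product.
have lq : Lall P (fun w => b w ^+ 2 - 1) by apply: Lall_add; [exact: Lall_exp|exact: Lall_cst].
have iq := Lall_itg lq; have iqq := Lall_itg (Lall_exp 2 lq).
pose x w := s * b w * eta w; pose h w := rho * (b w ^+ 2 - 1).
have ix : itg P x by exact: iprod.
have ih : itg P h by exact: itgZ.
have i1 : itg P (fun w => f (x w + h w + Rm w)) by apply: lipschitz_itg; apply: itgD => //; exact: itgD.
have i2 := lipschitz_itg ix.
have i3 : itg P (fun w => (b w ^+ 2 - 1) * f1 (x w)) by apply: bounded_mul_itg => //; exact: mprod.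
have i4 := itg_norm iR.
have q2 : Ex P (fun w => (b w ^+ 2 - 1) ^+ 2) = 2.
  have gb : gaussian P b by left; exists 0, 1; split => //; exact: oner_neq0.
  have b0 : Ex P b = 0.
    have o := oner_neq0 R.
    have := law_Ex mb law_b (@measurable_id _ _ setT) (itg_normal_pg _ o (@measurable_id _ _ setT) pg_id).
    by move=> ->; exact: normal_mean.
  have ib2 := Lall_itg (Lall_exp 2 lb); have ib4 := Lall_itg (Lall_exp 4 lb).
  have := gaussian_moment4 mb gb b0; rewrite b1 expr1n mulr1 => E4.
  transitivity (Ex P (fun w => b w ^+ 4 - 2 * b w ^+ 2 + 1)); first by apply: eqEx => w; ring.
  rewrite ExD ?ExB ?ExZ ?Ex_cst ?E4 ?b1//; [by ring|exact: itgZ| |exact: itg_cst].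
  by apply: itgB => //; exact: itgZ.
rewrite -ExZ// -!ExB//; last 2 first.
- exact: itgB.
- exact: itgZ.
have i5 : itg P (fun w => f (x w + h w + Rm w) - f (x w) - rho * ((b w ^+ 2 - 1) * f1 (x w))).
  by apply: itgB; [exact: itgB|exact: itgZ].
apply: le_trans (Ex_norm i5) _.
have i6 : itg P (fun w => `|Rm w| + rho ^+ 2 * (b w ^+ 2 - 1) ^+ 2) by apply: itgD => //; exact: itgZ.
apply: (@le_trans _ _ (Ex P (fun w => M * (`|Rm w| + rho ^+ 2 * (b w ^+ 2 - 1) ^+ 2)))).
  apply: Ex_le; [exact: itg_norm|exact: itgZ|move=> w].
  have t1 := taylor1 df df1 M2 (x w) (h w).
  have t2 := derive_lipschitz df M1 (x w + h w) (x w + h w + Rm w).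
  rewrite (_ : x w + h w + Rm w - (x w + h w) = Rm w) in t2; last by ring.
  have -> : f (x w + h w + Rm w) - f (x w) - rho * ((b w ^+ 2 - 1) * f1 (x w)) =
    (f (x w + h w + Rm w) - f (x w + h w)) + (f (x w + h w) - f (x w) - h w * f1 (x w)).
    by rewrite /h; ring.
  apply: le_trans (ler_normD _ _) _; rewrite mulrDr; apply: lerD => //.
  by rewrite -exprMn.
rewrite ExZ// ExD//; last exact: itgZ.
by rewrite ExZ// q2 [rho ^+ 2 * 2]mulrC.
Qed.

Lemma Ex_f_lipschitz (s c : R) :
  `|Ex P (fun w => f (s * `|b w| * zeta w)) - Ex P (fun w => f (c * `|b w| * zeta w))| <=
  M * Ex P (fun w => `|b w * zeta w|) * `|s - c|.
Proof.
have lN := Lall_norm lb.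
have i1 := lipschitz_itg (iprod s lN lz); have i2 := lipschitz_itg (iprod c lN lz).
have i3 := itg_norm (Lall_itg (Lall_mul lb lz)).
rewrite -ExB//; apply: le_trans (Ex_norm (itgB i1 i2)) _.
rewrite mulrAC -ExZ//; apply: Ex_le; [by apply: itg_norm; exact: itgB|exact: itgZ|move=> w].
apply: le_trans (derive_lipschitz df M1 _ _) _; rewrite -[leRHS]mulrA ler_wpM2l//.
by rewrite -!mulrA -mulrBl !normrM normr_id mulrA.
Qed.

Lemma Ex_f3_cvg (s_ : nat -> R) (c : R) : s_ n @[n --> \oo] --> c ->
  Ex P (fun w => b w ^+ 2 * f3 (s_ n * `|b w| * zeta w)) @[n --> \oo] -->
  Ex P (fun w => b w ^+ 2 * f3 (c * `|b w| * zeta w)).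
Proof.
move=> sc; have ib := Lall_itg (Lall_exp 2 lb).
have mN : measurable_fun setT (fun w => `|b w|) by exact: measurableT_comp.
suff [_ [_ h]] : measurable_fun setT (fun w => b w ^+ 2 * f3 (c * `|b w| * zeta w)) /\
   itg P (fun w => b w ^+ 2 * f3 (c * `|b w| * zeta w)) /\
   Ex P (fun w => b w ^+ 2 * f3 (s_ n * `|b w| * zeta w)) @[n --> \oo] -->
   Ex P (fun w => b w ^+ 2 * f3 (c * `|b w| * zeta w)) by [].
apply: (dct (G := fun w => M * b w ^+ 2)).
- move=> n; apply: itg_meas; apply: bounded_mul_itg => //; exact: mprod.
- exact: itgZ.
- by move=> n w; rewrite normrM (ger0_norm (sqr_ge0 _)) mulrC ler_wpM2r ?sqr_ge0.
- move=> w; apply: cvgMr.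
  have c1 : s_ n * `|b w| * zeta w @[n --> \oo] --> c * `|b w| * zeta w by apply: cvgMl; exact: cvgMl.
  by apply: (@cvg_comp _ _ _ _ f3 _ _ _ c1); exact: cf3.
Qed.

End smooth.
End gaussian_product.

(** * The expansion *)

Section skorohod_power.
Context {d} {T : measurableType d} {R : realType} (P : probability T R).
Context (H : R) (hH : 2^-1 < H < 1).
Context (V : completeNormedModType R) (ip : {dot V for idfun}) (ind : R -> V).
Hypothesis hV : step_completion H ip ind.
Context (W : V -> {RV P >-> R}).
Hypothesis hW : isonormal ip W.
Context (B : R -> {RV P >-> R}).
Hypothesis hB : fbm H B.
Hypothesis hWB : forall t, t \in `[0, 1] -> W (ind t) = B t :> (T -> R).
Local Notation isd x f df := (is_derive (x : R) (1 : R) f df).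
Local Notation N01 := (normal_prob (0 : R) 1).
Local Notation b := (fun w => W (ind 1) w).
Local Notation Wf := (fun h w => W h w).
Local Notation phi n := (fun t : R => weight H n * t ^+ n).
Local Notation uB n := (fun w => class H ind (fun t => n%:R `^ H * t ^+ n * B t w)).

Let ipE h : ip h h = `|h| ^+ 2. Proof. exact: stepE hV h. Qed.

Let cB w : {within `[0, 1], continuous (fun t => B t w)}. Proof. by case: hB. Qed.

Let cW w : {within `[0, 1], continuous (fun t => W (ind t) w)}.
Proof.
have c : {within `[0, 1], continuous (fun t => B t w)} by exact: cB.
by apply: subspace_eq_continuous c => t /set_mem t01; rewrite /from_subspace hWB.
Qed.

Let weight_ge0 n : 0 <= weight H n. Proof. exact: powR_ge0. Qed.

Let phi_c n : {within `[0, 1], continuous (phi n)}.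
Proof. by apply: continuous_subspaceT; exact: phi_pow_continuous. Qed.

(** Continuity of the paths lets [class_riem] act outcome by outcome, so the discretised integrands
    converge everywhere and not only in L^2. *)
Let hu n w : uN ind W (phi n) N w @[N --> \oo] --> uB n w.
Proof.
have cy : {within `[0, 1], continuous (fun t => weight H n * t ^+ n * B t w)}.
  by move=> x; apply: cvgM; [exact: phi_c|exact: cB].
apply: cvg_trans (class_riem hH hV cy); apply: near_eq_cvg; near=> N.
have N0 : (0 < N)%N by near: N; exact: nbhs_infty_gt.
rewrite /uN /riem big_nat [RHS]big_nat; apply: eq_bigr => j /= jN.
by rewrite hWB// grid_mem// ltnW.
Unshelve. all: by end_near. Qed.

Lemma Ex_divergence n (f : R -> R) : (0 < n)%N -> measurable_fun setT f ->
  Ex P (fun w => f (divergence ip W (uB n) w)) = Ex P (fun w => f (Zlim ind W (phi n) w)).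
Proof.
move=> n0 mf.
have nd := @phi_pow_nd _ _ n (weight_ge0 n).
have p0 := phi_pow0 (weight H n) n0.
have ae := divergence_ae hH hV hW cW nd (@phi_c n) p0 (@hu n).
have iZ := is_divergence_Zlim hH hV hW cW nd (@phi_c n) p0 (@hu n).
have [_ [/L2_Lfun [mZ _] _] _] := iZ.
have [_ [/L2_Lfun [mD _] _] _] : is_divergence ip W (uB n) (divergence ip W (uB n)).
  by apply: xgetPex; exists (Zlim ind W (phi n)); exact: iZ.
rewrite /Rintegral; congr fine; apply: ae_eq_integral => //.
- by apply/measurable_EFinP; exact: (measurableT_comp mf).
- by apply/measurable_EFinP; exact: (measurableT_comp mf).
- by apply: filterS ae => w E _; rewrite E.
Qed.

Section one_step.
Variables (n : nat) (n0 : (0 < n)%N).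
Hypothesis q0 : 0 < sig2 H n - rho H n ^+ 2.

(** The conditional standard deviation of W v given b, since b has variance 1. *)
Definition sd : R := Num.sqrt (sig2 H n - rho H n ^+ 2).

Let s0 : 0 < sd. Proof. by rewrite sqrtr_gt0. Qed.
Let s2 : sd ^+ 2 = sig2 H n - rho H n ^+ 2. Proof. by rewrite sqr_sqrtr// ltW. Qed.

Variable v : V.
Hypothesis hv : riem ind (phi n) N @[N --> \oo] --> v.

Lemma weight_tail : riemS (phi n) (fun t => (1 - t) `^ (2 * H)) N @[N --> \oo] --> tail H n.
Proof.
have p0 : 0 < 2 * H by have /andP[h _] := p_bounds hH; rewrite (lt_trans ltr01).
have := @riemS_pow _ _ n (weight_ge0 n) _ (within_powR_rev p0).
have E : \int[@lebesgue_measure R]_(r in `[0, 1]) ((1 - r) `^ (2 * H) * (weight H n * (n%:R * r ^+ n.-1))) = tail H n.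
  have i : (@lebesgue_measure R).-integrable `[0, 1]
      (EFin \o (fun r => (1 - r) `^ (2 * H) * (n%:R * r ^+ n.-1))).
    apply: within_itgb => x; apply: cvgM; first exact: within_powR_rev.
    have c : {within `[0, 1], continuous (fun r : R => n%:R * r ^+ n.-1)}.
      by apply: continuous_subspaceT => {}x; apply: cvgMr; exact: exprn_continuous.
    exact: c.
  transitivity (\int[@lebesgue_measure R]_(r in `[0, 1])
      (weight H n * ((1 - r) `^ (2 * H) * (n%:R * r ^+ n.-1)))).
    by apply: eq_Rintegral => r _; rewrite mulrCA.
  by rewrite (RintegralZl _ _ i)// (beta_gam (p_bounds hH) n0).
by rewrite E.
Qed.

Lemma ip_v_ind1 : ip v (ind 1) = rho H n.
Proof. exact: (power_vector_cov hH hV (weight_ge0 n) n0 hv weight_tail). Qed.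

Lemma norm_v : `|v| ^+ 2 = sig2 H n.
Proof. exact: (power_vector_norm hH hV (weight_ge0 n) n0 hv weight_tail). Qed.

Let n1 : `|ind 1| ^+ 2 = 1.
Proof. by rewrite (ind_var hH hV) ?bound_itvE// powR1. Qed.

(** The normalised residual of W v after projection on b, kept as a list of coefficients so that its
    joint Gaussianity with b is an instance of [lincomb_gaussian]. *)
Let seta : seq (R * V) := [:: (sd^-1, v); (- (rho H n / sd), ind 1)].
Let eta : T -> R := lincomb Wf seta.

Let etaE w : sd * eta w = W v w - rho H n * b w.
Proof. by rewrite /eta /lincomb !big_cons big_nil /=; field; rewrite gt_eqF. Qed.

Let ip_eta : ip (ind 1) (lin_vec seta) = 0.
Proof.
rewrite /lin_vec !big_cons big_nil /= addr0 ipDr !ipZr (ipC ip (ind 1)) ip_v_ind1 ipE n1.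
by ring.
Qed.

Let var_eta : `|lin_vec seta| ^+ 2 = 1.
Proof.
have -> : lin_vec seta = sd^-1 *: (v - rho H n *: ind 1).
  by rewrite /lin_vec !big_cons big_nil /= addr0 scalerBr scalerA scaleNr mulrC.
rewrite -ipE ipZl ipZr ipBl !ipBr !ipZl !ipZr (ipC ip (ind 1)) ip_v_ind1 !ipE norm_v n1.
have -> : sig2 H n - rho H n * rho H n - (rho H n * rho H n - rho H n * (rho H n * 1)) = sd ^+ 2.
  by rewrite s2; ring.
by field; rewrite gt_eqF.
Qed.

Let law_lincomb s : `|lin_vec s| ^+ 2 = 1 ->
  forall A, measurable A -> P (lincomb Wf s @^-1` A) = N01 A.
Proof.
move=> E; apply: gaussian_standard.
- exact: lincomb_meas.
- exact: (lincomb_gaussian hW).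
- exact: (lincomb_mean hW).
- by rewrite (lincomb_var ipE hW) E.
Qed.

Let lincomb_pair (k : R) (s : seq (R * V)) :
  (fun w => k * b w + lincomb Wf s w) = lincomb Wf ((k, ind 1) :: s).
Proof. by apply/funext => w; rewrite /lincomb big_cons. Qed.

Let lincombZ (k : R) (s : seq (R * V)) w :
  k * lincomb Wf s w = lincomb Wf [seq (k * p.1, p.2) | p <- s] w.
Proof.
by rewrite /lincomb big_map mulr_sumr; apply: eq_bigr => p _ /=; rewrite mulrA.
Qed.

Let lincomb_unit (X : T -> R) (s : seq (R * unit)) w :
  lincomb (fun _ : unit => X) s w = (\sum_(p <- s) p.1) * X w.
Proof. by rewrite /lincomb mulr_suml. Qed.

Let gaussian_pair (k l : R) : gaussian P (fun w => k * b w + l * eta w).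
Proof.
have -> : (fun w => k * b w + l * eta w) = lincomb Wf ((k, ind 1) :: [seq (l * p.1, p.2) | p <- seta]).
  by rewrite -lincomb_pair; apply/funext => w; rewrite -lincombZ.
exact: (lincomb_gaussian hW).
Qed.

Let mb : measurable_fun setT b := W_meas W (ind 1).
Let me : measurable_fun setT eta := lincomb_meas W seta.
Let b0 : Ex P b = 0 := W_mean hW (ind 1).
Let eta0 : Ex P eta = 0 := lincomb_mean hW seta.
Let lb : Lall P b := W_Lall hW (ind 1).
Let le : Lall P eta := lincomb_Lall hW seta.

Let cov0 : Ex P (fun w => b w * eta w) = 0.
Proof.
have := lincomb_cov hW [:: (1, ind 1)] seta.
rewrite /lin_vec big_seq1 scale1r -/(lin_vec seta) ip_eta => <-.
by apply: eqEx => w; rewrite [in RHS]/lincomb big_seq1 mul1r.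
Qed.

Let ind_b_eta : indep P b eta.
Proof.
apply: gaussian_independent => //.
- move=> s mu _; have := gaussian_pair (\sum_(p <- s) p.1) mu; congr gaussian.
  by apply/funext => w; rewrite lincomb_unit.
Qed.

Let ind_eta_b : indep P eta b.
Proof.
apply: gaussian_independent => //.
- move=> s mu _; have := gaussian_pair mu (\sum_(p <- s) p.1); congr gaussian.
  by apply/funext => w; rewrite lincomb_unit addrC.
- by move=> _ _; rewrite -[RHS]cov0; apply: eqEx => w; rewrite mulrC.
Qed.

Variable zeta : {RV P >-> R}.
Hypothesis zeta_normal : forall A, measurable A -> P (zeta @^-1` A) = N01 A.
Hypothesis zeta_indep : independent_of P `[0%R, 1%R]%classic B zeta.

Let ind_b_zeta : indep P b zeta.
Proof.
have h1 : (`[0%R, 1%R]%classic : set R) 1 by rewrite /= bound_itvE.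
have := independent_of_indep h1 zeta_indep.
by rewrite -hWB// bound_itvE.
Qed.

Let lz : Lall P zeta.
Proof.
apply: gaussian_Lall; first exact: measurable_funPT.
by left; exists 0, 1; split => //; exact: oner_neq0.
Qed.

Variables (f f1 f2 f3 : R -> R) (M : R).
Hypothesis df : forall x, isd x f (f1 x).
Hypothesis df1 : forall x, isd x f1 (f2 x).
Hypothesis df2 : forall x, isd x f2 (f3 x).
Hypothesis cf3 : continuous f3.
Hypotheses (M1 : forall x, `|f1 x| <= M) (M2 : forall x, `|f2 x| <= M) (M3 : forall x, `|f3 x| <= M).

Lemma Ex_divergence_expansion :
  `|Ex P (fun w => f (divergence ip W (uB n) w)) -
    Ex P (fun w => f (sd * `|b w| * zeta w)) -
    rho H n * (sd ^+ 2 * Ex P (fun w => b w ^+ 2 * f3 (sd * `|b w| * zeta w)))| <=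
  M * (tail H n + 2 * rho H n ^+ 2).
Proof.
have nd := @phi_pow_nd _ _ n (weight_ge0 n).
have p0 := phi_pow0 (weight H n) n0.
have mf : measurable_fun setT f.
  by apply: continuous_measurable_fun => x; exact: isd_continuous (df x).
have iR := Rem_itg hH hV hW cW nd (@phi_c n) p0 v.
have hR := Rem_le hH hV hW cW nd (@phi_c n) p0 hv weight_tail.
have M0 : 0 <= M := le_trans (normr_ge0 _) (M1 0).
have law_b A : measurable A -> P (b @^-1` A) = N01 A.
  have := @law_lincomb [:: (1, ind 1)]; rewrite lincomb1; apply.
  by rewrite /lin_vec big_seq1 scale1r.
have law_Ne A : measurable A -> P ((fun w => - eta w) @^-1` A) = N01 A.
  have -> : (fun w => - eta w) = lincomb Wf [seq (-1 * p.1, p.2) | p <- seta].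
    by apply/funext => w; rewrite -lincombZ mulN1r.
  apply: law_lincomb; transitivity (`|lin_vec seta| ^+ 2) => //; rewrite -[in RHS]normrN; congr (`|_| ^+ 2).
  by rewrite /lin_vec big_map -sumrN; apply: eq_bigr => p _; rewrite /= mulN1r scaleNr.
have b1 : Ex P (fun w => b w ^+ 2) = 1 by rewrite (W_var ipE hW) n1.
have e1 : Ex P (fun w => eta w ^+ 2) = 1 by rewrite (lincomb_var ipE hW).
rewrite Ex_divergence//.
have -> : Ex P (fun w => f (Zlim ind W (phi n) w)) =
  Ex P (fun w => f (sd * b w * eta w + rho H n * (b w ^+ 2 - 1) + Rem ip ind W (phi n) v w)).
  apply: eqEx => w; congr f; rewrite /Rem (ipC ip (ind 1)) ip_v_ind1 mulrAC etaE.
  by ring.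
apply: le_trans (expansion_le lb le lz law_b (law_lincomb var_eta) law_Ne zeta_normal b1 e1
  ind_b_eta ind_eta_b ind_b_zeta df df1 df2 cf3 M1 M2 M3 sd (rho H n) iR) _.
by rewrite ler_wpM2l// lerD2r.
Qed.

End one_step.

End skorohod_power.

(** * Passage to the limit in the expansion *)

Section limit.
Context {d} {T : measurableType d} {R : realType} (P : probability T R).
Context (H : R) (hH : 2^-1 < H < 1).
Context (V : completeNormedModType R) (ip : {dot V for idfun}) (ind : R -> V).
Hypothesis hV : step_completion H ip ind.
Context (W : V -> {RV P >-> R}).
Hypothesis hW : isonormal ip W.
Context (B : R -> {RV P >-> R}).
Hypothesis hB : fbm H B.
Hypothesis hWB : forall t, t \in `[0, 1] -> W (ind t) = B t :> (T -> R).
Local Notation isd x f df := (is_derive (x : R) (1 : R) f df).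
Local Notation b := (fun w => W (ind 1) w).
Local Notation uB n := (fun w => class H ind (fun t => n%:R `^ H * t ^+ n * B t w)).
Variable zeta : {RV P >-> R}.
Hypothesis zeta_normal : forall A, measurable A -> P (zeta @^-1` A) = normal_prob 0 1 A.
Hypothesis zeta_indep : independent_of P `[0%R, 1%R]%classic B zeta.
Variables (f f1 f2 f3 : R -> R) (M : R).
Hypothesis df : forall x, isd x f (f1 x).
Hypothesis df1 : forall x, isd x f1 (f2 x).
Hypothesis df2 : forall x, isd x f2 (f3 x).
Hypothesis cf3 : continuous f3.
Hypotheses (M1 : forall x, `|f1 x| <= M) (M2 : forall x, `|f2 x| <= M) (M3 : forall x, `|f3 x| <= M).

Let c : R := Num.sqrt (H * Gamma (2 * H)).
Let q (n : nat) : R := sig2 H n - rho H n ^+ 2.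
Let A0 (s : R) : R := Ex P (fun w => f (s * `|b w| * zeta w)).
Let A1 (s : R) : R := Ex P (fun w => b w ^+ 2 * f3 (s * `|b w| * zeta w)).
Let r (n : nat) : R := rho H n / rate H n.

Let HG0 : 0 < H * Gamma (2 * H).
Proof.
rewrite mulr_gt0 ?(Gamma_gt0 (p_bounds hH))//.
by have /andP[h _] := hH; rewrite (lt_trans _ h)// invr_gt0.
Qed.

Let c0 : 0 < c. Proof. by rewrite sqrtr_gt0. Qed.
Let c2 : c ^+ 2 = H * Gamma (2 * H). Proof. by rewrite sqr_sqrtr// ltW. Qed.

Let rhoE n : (0 < n)%N -> rho H n = r n * rate H n.
Proof. by move=> n0; rewrite /r divfK// gt_eqF// rate_gt0. Qed.

Let r_cvg : r n @[n --> \oo] --> H. Proof. exact: rho_cvg. Qed.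

Let rho_cvg0 : rho H n @[n --> \oo] --> 0.
Proof.
rewrite -(mulr0 H); apply: (@cvg_trans _ (r n * rate H n @[n --> \oo])); last first.
  by apply: cvgM => //; exact: rate_cvg.
apply: near_eq_cvg; near=> n; rewrite rhoE//; near: n; exact: nbhs_infty_gt.
Unshelve. all: by end_near. Qed.

Let C : R := 2 * H * (432 + Gamma (2 * H)).

Let q_le n : (0 < n)%N -> `|q n - c ^+ 2| <= C * n%:R^-1 + rho H n ^+ 2.
Proof.
move=> n0; rewrite c2 /q addrAC; apply: le_trans (ler_normB _ _) _.
by rewrite [`|_ ^+ 2|]ger0_norm ?sqr_ge0// lerD2r sig2_le.
Qed.

Let q_cvg : q n @[n --> \oo] --> c ^+ 2.
Proof.
apply/subr_cvg0; apply: norm_cvg0.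
apply: (@squeeze_cvgr _ _ _ _ (cst 0) (fun n => C * n%:R^-1 + rho H n * rho H n)).
- near=> n; rewrite normr_ge0/= -expr2; apply: q_le; near: n; exact: nbhs_infty_gt.
- exact: cvg_cst.
- have <- : C * 0 + 0 * 0 = 0 :> R by rewrite !mulr0 addr0.
  by apply: cvgD; [apply: cvgMr; exact: cvg_invn|exact: cvgM].
Unshelve. all: by end_near. Qed.

Let sd_cvg : sd H n @[n --> \oo] --> c.
Proof.
have -> : c = Num.sqrt (c ^+ 2) by rewrite sqrtr_sqr ger0_norm// ltW.
by apply: (@cvg_comp _ _ _ q Num.sqrt _ _ _ q_cvg); exact: sqrt_continuous.
Qed.

Let K : R := Ex P (fun w => `|b w * zeta w|).

(** The error divided by the rate, in three parts: the remainder of the expansion, the replacement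
    of [sd] by c in the main term, and the convergence of the coefficient of the correction. *)
Let bound (n : nat) : R := M * (tail H n / rate H n + 2 * (r n * rho H n)) +
  M * K / c * (C * (n%:R^-1 / rate H n) + r n * rho H n) +
  `|r n * (q n * A1 (sd H n)) - H * (c ^+ 2 * A1 c)|.

Let lb : Lall P b := W_Lall hW (ind 1).
Let lz : Lall P zeta.
Proof.
apply: gaussian_Lall; first exact: measurable_funPT.
by left; exists 0, 1; split => //; exact: oner_neq0.
Qed.

Let bound_cvg : bound n @[n --> \oo] --> 0.
Proof.
have A1c : A1 (sd H n) @[n --> \oo] --> A1 c.
  exact: (Ex_f3_cvg lb lz cf3 M3 sd_cvg).
have rr : r n * rho H n @[n --> \oo] --> 0 by rewrite -(mulr0 H); exact: cvgM.
have <- : M * (0 + 2 * 0) + M * K / c * (C * 0 + 0) + `|H * (c ^+ 2 * A1 c) - H * (c ^+ 2 * A1 c)| = 0.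
  by rewrite subrr normr0 !mulr0 !addr0 !mulr0 addr0.
apply: cvgD; first apply: cvgD.
- by apply: cvgMr; apply: cvgD; [exact: tail_cvg|exact: cvgMr].
- by apply: cvgMr; apply: cvgD => //; apply: cvgMr; exact: invn_rate_cvg.
- apply: cvg_norm; apply: cvgB; last exact: cvg_cst.
  by apply: cvgM => //; exact: cvgM.
Qed.

Lemma Ex_divergence_limit (eps : R) : 0 < eps -> \forall n \near \oo,
  `|Ex P (fun w => f (divergence ip W (uB n) w)) -
    (A0 c + rate H n * (H * (c ^+ 2 * A1 c)))| <= eps * rate H n.
Proof.
move=> e0; near=> n; have n0 : (0 < n)%N by near: n; exact: nbhs_infty_gt.
have h0 := rate_gt0 H n0.
have q0 : 0 < q n.
  near: n; apply: (cvgr_gt (c ^+ 2)); first exact: q_cvg.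
  by rewrite exprn_gt0.
have be : bound n <= eps.
  near: n; apply: (cvgr_le 0); first exact: bound_cvg.
  exact: e0.
have pc : {within `[0, 1], continuous (fun t : R => weight H n * t ^+ n)}.
  by apply: continuous_subspaceT; exact: phi_pow_continuous.
have ipE h : ip h h = `|h| ^+ 2 by exact: stepE hV h.
have ip_ind s t := step_ip hV (s := s) (t := t).
have /cvg_ex[v hv] := riem_cvg hH ipE ip_ind pc.
have M0 : 0 <= M := le_trans (normr_ge0 _) (M1 0).
have K0 : 0 <= K by apply: Ex_ge0.
have h1 := Ex_divergence_expansion hH hV hW hB hWB n0 q0 hv zeta_normal zeta_indep
  df df1 df2 cf3 M1 M2 M3.
have h2 : `|A0 (sd H n) - A0 c| <= M * K * `|sd H n - c|.
  exact: (Ex_f_lipschitz lb lz df M1 (sd H n) c).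
have s2 : sd H n ^+ 2 = q n by rewrite sqr_sqrtr// ltW.
(* From sd^2 - c^2 = (sd - c)(sd + c) with sd + c >= c > 0: the variance estimate passes to the
   standard deviation at the cost of a factor 1/c. *)
have h3 : `|sd H n - c| <= (C * n%:R^-1 + rho H n ^+ 2) / c.
  rewrite ler_pdivlMr//; apply: le_trans (q_le n0); rewrite -s2 subr_sqr normrM.
  rewrite ler_wpM2l// ger0_norm ?addr_ge0 ?sqrtr_ge0//.
  by rewrite lerDr sqrtr_ge0.
apply: (@le_trans _ _ (bound n * rate H n)); last by rewrite ler_wpM2r// ltW.
pose X := Ex P (fun w => f (divergence ip W (uB n) w)).
have -> : X - (A0 c + rate H n * (H * (c ^+ 2 * A1 c))) =
  (X - A0 (sd H n) - rho H n * (sd H n ^+ 2 * A1 (sd H n))) + (A0 (sd H n) - A0 c) +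
  rate H n * (r n * (q n * A1 (sd H n)) - H * (c ^+ 2 * A1 c)).
  by rewrite s2 rhoE//; ring.
rewrite /bound [leRHS]mulrDl [X in _ <= X + _]mulrDl; apply: le_trans (ler_normD _ _) _; apply: lerD; last first.
  by rewrite normrM mulrC (ger0_norm (ltW h0)).
apply: le_trans (ler_normD _ _) _; apply: lerD.
  apply: le_trans h1 _; rewrite le_eqVlt; apply/orP; left; apply/eqP.
  by rewrite /r; field; rewrite gt_eqF.
apply: le_trans h2 _; apply: (@le_trans _ _ (M * K * ((C * n%:R^-1 + rho H n ^+ 2) / c))).
  by rewrite ler_wpM2l// mulr_ge0.
rewrite le_eqVlt; apply/orP; left; apply/eqP.
by rewrite /r; field; rewrite !gt_eqF// ltr0n.
Unshelve. all: by end_near. Qed.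

End limit.

Theorem mainTheorem7 (R : realType) (H : R) (d : measure_display)
  (T : measurableType d) (P : probability T R)
  (B : R -> {RV P >-> R}) (zeta : {RV P >-> R})
  (V : completeNormedModType R) (ip : {dot V for idfun}) (ind : R -> V)
  (W : V -> {RV P >-> R})
  (hH : 2^-1 < H < 1)
  (hB : fbm H B)
  (hV : step_completion H ip ind)
  (hW : isonormal ip W)
  (hWB : forall t, t \in `[0, 1] -> W (ind t) = B t :> (T -> R))
  (zeta_normal :
     forall A, measurable A -> P (zeta @^-1` A) = normal_prob 0 1 A)
  (zeta_indep : independent_of P `[0%R, 1%R]%classic B zeta)
  (f : R -> R) (hf : Cb3 f) :
  let u (n : nat) (w : T) : V :=
    class H ind (fun t => n%:R `^ H * t ^+ n * B t w) in
  let Z (n : nat) : T -> R := divergence ip W (u n) in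
  let c : R := Num.sqrt (H * Gamma (2 * H)) in
  let S (w : T) : R := c * `|B 1 w| * zeta w in
  (fun n : nat => fine 'E_P[(fun w => f (Z n w))%R]%E) =
  (fun n : nat => fine 'E_P[(fun w => f (S w))%R]%E +
     n%:R `^ (H - 1) *
     fine 'E_P[(fun w => c ^+ 2 * H * B 1 w ^+ 2 * derive1n 3 f (S w))%R]%E)
  +o_\oo (fun n : nat => n%:R `^ (H - 1) : R).
Proof.
move=> u Z c S.
have [hd hc hb] := hf.
have [m1 b1] := hb 1%N isT; have [m2 b2] := hb 2%N isT; have [m3 b3] := hb 3%N isT.
pose M := `|m1| + `|m2| + `|m3|.
have M1 x : `|derive1n 1 f x| <= M.
  by apply: le_trans (b1 x) (le_trans (ler_norm _) _); rewrite /M -addrA lerDl addr_ge0.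
have M2 x : `|derive1n 2 f x| <= M.
  by apply: le_trans (b2 x) (le_trans (ler_norm _) _); rewrite /M addrAC lerDr addr_ge0.
have M3 x : `|derive1n 3 f x| <= M.
  by apply: le_trans (b3 x) (le_trans (ler_norm _) _); rewrite /M lerDr addr_ge0.
have df k : (k < 3)%N -> forall x, is_derive (x : R) (1 : R) (derive1n k f) (derive1n k.+1 f x).
  by move=> k3 x; apply: derivable_isd; exact: hd.
have B1 : B 1 = W (ind 1) :> (T -> R) by rewrite hWB// bound_itvE.
have E1 : fine 'E_P[(fun w => f (S w))%R] = Ex P (fun w => f (c * `|W (ind 1) w| * zeta w)).
  by rewrite unlock; apply: eqEx => w; rewrite /S B1.
have E3 : fine 'E_P[(fun w => c ^+ 2 * H * B 1 w ^+ 2 * derive1n 3 f (S w))%R] =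
    H * (c ^+ 2 * Ex P (fun w => W (ind 1) w ^+ 2 * derive1n 3 f (c * `|W (ind 1) w| * zeta w))).
  rewrite unlock mulrA [H * _]mulrC -ExZ; last first.
    have lb := W_Lall hW (ind 1).
    apply: (bounded_mul_itg (continuous_measurable_fun (hc 3%N isT)) M3).
      exact: Lall_itg (Lall_exp 2 lb).
    apply: measurable_funM; last exact: measurable_funPT.
    by apply: measurable_funM => //; apply: measurableT_comp => //; exact: W_meas.
  by apply: eqEx => w; rewrite /S B1 mulrA.
have EZ n : fine 'E_P[(fun w => f (Z n w))%R] = Ex P (fun w => f (Z n w)) by rewrite unlock.
apply/eqaddoP => eps eps0.
have := Ex_divergence_limit hH hV hW hB hWB zeta_normal zeta_indep
  (df 0%N isT) (df 1%N isT) (df 2%N isT) (hc 3%N isT) M1 M2 M3 eps0.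
apply: filterS => n hn.
rewrite -[X in eps * X]ger0_norm ?powR_ge0// in hn.
apply: le_trans hn; rewrite le_eqVlt; apply/orP; left; apply/eqP; congr (`|_|).
by rewrite -EZ -E1 -E3.
Qed.
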